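(* Let $\mathfrak{c}$ be a big chamber of the cone $C(\Phi^+)$ and let $\lambda\in\mathfrak{c}\cap Q^+$. Then $$c(\lambda,r^+(\eta))=\sum_{p}\chi_{\mathfrak{c}}\Big(\mathrm{Tres}\big(e^{-\lambda(p-z)}\eta(p-z)\big)\Big),$$ where the sum runs over the classes $p\in V_{\mathbb{C}}$ modulo $2\pi i Q^\vee$ such that $t_p$ is a residual point, and the total residue is taken of the function $z\mapsto e^{-\lambda(p-z)}\eta(p-z)$ near $z=0$.
   Context: Let $\Phi$ be an irreducible (reduced) root system spanning a real vector space $V^*$ of dimension $r$ (the rank), with positive roots $\Phi^+$, simple roots $\Delta$, coroots $\Phi^\vee\subset V$, coroot lattice $Q^\vee=\mathbb{Z}\Phi^\vee$, weight lattice $P=\{\lambda\in V^*:\langle\lambda,\alpha^\vee\rangle\in\mathbb{Z}\ \forall\alpha\}$, and $Q^+=\sum_{\alpha\in\Delta}\mathbb{Z}_{\ge0}\alpha$. Let $V_{\mathbb{C}}=V\otimes\mathbb{C}$ and fix a real number $q>1$. Define, for $z\in V_{\mathbb{C}}$, $\eta(z)=\prod_{\alpha\in\Phi^+}\frac{(1-e^{\alpha(z)})^2}{(1-q^{-1}e^{\alpha(z)})(1-qe^{\alpha(z)})}$. Let $r^+(\eta)$ be the formal series obtained by expanding each factor $\frac1{1-ue^{\alpha}}$ as $\sum_{k\ge0}u^ke^{k\alpha}$ and multiplying out; write $r^+(\eta)=\sum_{\mu}c_\mu e^{\mu}$ and $c(\mu,r^+(\eta)):=c_\mu$. Residual points: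 $t\in\mathrm{Hom}(P,\mathbb{C}^* )$ is residual if $\#\{\alpha\in\Phi:t(\alpha)=1\}-\#\{\alpha\in\Phi:t(\alpha)=q\}\ge r$. For $p\in V_{\mathbb{C}}$, $t_p\in\mathrm{Hom}(P,\mathbb{C}^* )$ is $t_p(\mu)=e^{\mu(p)}$; it depends only on $p$ mod $2\pi iQ^\vee$. Total residue: for $\alpha\in\Phi^+$ let $H_\alpha=\{z\in V_{\mathbb{C}}:\alpha(z)=0\}$; let $R_H$ be the rational functions on $V_{\mathbb{C}}$ with poles on $\bigcup H_\alpha$, and $S_H\subset R_H$ the span of $f_\sigma=1/\prod_{\alpha\in\sigma}\alpha(z)$ for $\sigma\subset\Phi^+$ a basis of $V^*$. Then $R_H=(\sum_{v\in V_{\mathbb{C}}}\partial_vR_H)\oplus S_H$, and $\mathrm{Tres}:R_H\to S_H$ is the projection. For a formal germ $P(z)/\prod_{i=1}^k\beta_i(z)$ with $P$ a formal power series and $\beta_i\in\Phi^+$, set $\mathrm{Tres}=\mathrm{Tres}(P_{k-r}/\prod\beta_i)$ with $P_{k-r}$ the homogeneous part of degree $k-r$. Chambers: $C(S)=\sum_{\alpha\in S}\mathbb{R}_{\ge0}\alpha$. A vector of $C(\Phi^+)$ is singular if it lies in a cone generated by fewer than $r$ elements of $\Phi^+$; the big chambers are the connected components of the set of non-singular vectors of $C(\Phi^+)$ (these are open). For a big chamber $\mathfrak{c}$, $\chi_{\mathfrak{c}}$ is the linear functional on $S_H$ with $\chi_{\mathfrak{c}}(f_\sigma)=\mathrm{vol}(\mathrm{Box}(\sigma))$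 if $\mathfrak{c}\subset C(\sigma)$ and $0$ otherwise, where $\mathrm{Box}(\sigma)$ is the parallelepiped spanned by $\sigma$ and $\mathrm{vol}$ is normalized so that the parallelepiped spanned by the fundamental weights (a $\mathbb{Z}$-basis of $P$) has volume $1$.
   Formalization: Two conventions are corrected, as the printed formula fails for A1: t is residual when #{α: t(α)=q} − #{α: t(α)=1} ≥ r (printed sign reversed), and χ_c(f_σ) = 1/vol(Box(σ)) instead of vol(Box(σ)) when c ⊂ C(σ). *)

(* Defs.v *)
From HB Require Import structures.
From mathcomp Require Import all_boot all_order all_algebra finmap.
From mathcomp Require Import generic_quotient fraction complex.
From mathcomp Require Import all_classical all_reals all_analysis.
From mathcomp Require Import -(notations) mpoly.

Set Implicit Arguments.
Unset Strict Implicit.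
Unset Printing Implicit Defensive.

Import Order.TTheory GRing.Theory Num.Theory.
Import numFieldNormedType.Exports.

Local Open Scope classical_set_scope.
Local Open Scope fset_scope.
Local Open Scope complex_scope.
Local Open Scope ring_scope.

(* V^* is identified with row vectors, V and V_C with real and complex column
   vectors; no inner product is used. *)

Section Pairings.
Variables (R : realType) (r : nat).

Definition pairing (mu : 'rV[R]_r) (v : 'cV[R]_r) : R := (mu *m v) 0 0.

Definition evalC (mu : 'rV[R]_r) (z : 'cV[R[i]]_r) : R[i] :=
  (map_mx (real_complex R) mu *m z) 0 0.

Definition cexp (w : R[i]) : R[i] :=
  (expR (complex.Re w) * cos (complex.Im w))
    +i* (expR (complex.Re w) * sin (complex.Im w)).

Definition cabs (w : R[i]) : R := complex.Re `|w|.

End Pairings.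

Section RootSystems.
Variables (R : realType) (r : nat).
Implicit Types (Phi Delta : {fset 'rV[R]_r}) (cor : 'rV[R]_r -> 'cV[R]_r).

(* [cor a] is the coroot of [a]; its values outside [Phi] are irrelevant. *)
Record irreducible_root_system Phi cor : Prop := IrreducibleRootSystem {
  roots_neq0 : 0 \notin Phi;
  roots_span : <<Phi>>%VS = fullv;
  coroot2 : forall a, a \in Phi -> pairing a (cor a) = 2;
  roots_refl : forall a b, a \in Phi -> b \in Phi ->
    b - pairing b (cor a) *: a \in Phi;
  roots_int : forall a b, a \in Phi -> b \in Phi ->
    pairing b (cor a) \is a Num.int;
  roots_reduced : forall a (c : R), a \in Phi -> c *: a \in Phi ->
    c = 1 \/ c = -1;
  roots_nonempty : Phi != fset0;
  roots_irreducible : forall A B : {fset 'rV[R]_r},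
    A `|` B = Phi -> [disjoint A & B]%fset ->
    (forall a b, a \in A -> b \in B -> pairing a (cor b) = 0) ->
    A = fset0 \/ B = fset0 }.

Definition Qplus Delta : set 'rV[R]_r :=
  [set mu | exists n : 'rV[R]_r -> nat, mu = \sum_(a <- Delta) a *+ n a]%classic.

Record root_base Phi Delta : Prop := RootBase {
  base_sub : Delta `<=` Phi;
  base_basis : basis_of fullv Delta;
  base_sign : forall a, a \in Phi -> Qplus Delta a \/ Qplus Delta (- a) }.

Definition posroots Phi Delta : {fset 'rV[R]_r} :=
  [fset a in Phi | `[< Qplus Delta a >]].

Definition weight_lattice Phi cor : set 'rV[R]_r :=
  [set mu | forall a, a \in Phi -> pairing mu (cor a) \is a Num.int]%classic.

Definition coroot_lattice Phi cor : set 'cV[R]_r :=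
  [set v | exists n : 'rV[R]_r -> int, v = \sum_(a <- Phi) cor a *~ n a]%classic.

(* The rows are the fundamental weights: the basis of V^* dual to the simple
   coroots. *)
Definition fund_weights Delta cor : 'M[R]_r :=
  invmx (\matrix_(i < r, j < r) cor (enum_fset Delta)`_j i 0).

(* Coordinate volume of the parallelepiped spanned by the rows of the matrix
   of [s], divided by the one of the parallelepiped of fundamental weights. *)
Definition vol_box Delta cor (s : {fset 'rV[R]_r}) : R :=
  `|\det (\matrix_(i < r, j < r) (enum_fset s)`_i 0 j)|
    / `|\det (fund_weights Delta cor)|.

End RootSystems.

Section Points.
Variables (R : realType) (r : nat).
Implicit Types (Phi : {fset 'rV[R]_r}) (cor : 'rV[R]_r -> 'cV[R]_r).

(* Homomorphisms from P to the units of C; values outside the weight lattice are irrelevant. *)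
Definition torus_point Phi cor (t : 'rV[R]_r -> R[i]) : Prop :=
  (forall mu, weight_lattice Phi cor mu -> t mu != 0) /\
  (forall mu nu, weight_lattice Phi cor mu -> weight_lattice Phi cor nu ->
     t (mu + nu) = t mu * t nu).

(* The poles of eta at [t] are counted by the roots with t(a) = q and its
   zeros by those with t(a) = 1: residual means that the pole order exceeds
   the order of vanishing by at least the rank. *)
Definition residual Phi cor (q : R) (t : 'rV[R]_r -> R[i]) : Prop :=
  torus_point Phi cor t /\
  (r%:Z <= #|` [fset a in Phi | t a == q%:C]|%:Z
           - #|` [fset a in Phi | t a == 1%:C]|%:Z).

Definition tpoint (p : 'cV[R[i]]_r) : 'rV[R]_r -> R[i] :=
  fun mu => cexp (evalC mu p).

Definition class_mod Phi cor (p : 'cV[R[i]]_r) : set 'cV[R[i]]_r :=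
  [set p' | exists2 v, coroot_lattice Phi cor v &
     p' = p + (0 +i* (2 * pi)) *: map_mx (real_complex R) v]%classic.

Definition residual_classes Phi cor (q : R) : set (set 'cV[R[i]]_r) :=
  [set K | exists2 p, residual Phi cor q (tpoint p) & K = class_mod Phi cor p]
  %classic.

Definition eta_fun (Phip : {fset 'rV[R]_r}) (q : R) (z : 'cV[R[i]]_r) : R[i] :=
  \prod_(a <- Phip)
    ((1 - cexp (evalC a z)) ^+ 2 /
     ((1 - q^-1%:C * cexp (evalC a z)) * (1 - q%:C * cexp (evalC a z)))).

End Points.

(* Formal series sum_mu (f mu) e^mu; all the series below are supported in
   Q^+, so that the sum in [fsmul] has finite support. *)
Section FormalSeries.
Variables (R : realType) (r : nat).
Implicit Types (f g : 'rV[R]_r -> R).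

Definition fsexp (nu : 'rV[R]_r) : 'rV[R]_r -> R := fun mu => (mu == nu)%:R.

Definition fsmul f g : 'rV[R]_r -> R :=
  fun mu => \sum_(nu \in [set: 'rV[R]_r]%classic) f nu * g (mu - nu).

(* sum_k u^k e^(k a), for [a] nonzero *)
Definition fsgeom (u : R) (a : 'rV[R]_r) : 'rV[R]_r -> R :=
  fun mu => \sum_(k \in [set k : nat | mu = a *+ k]%classic) u ^+ k.

Definition rplus_eta (Phip : {fset 'rV[R]_r}) (q : R) : 'rV[R]_r -> R :=
  \big[fsmul/fsexp 0]_(a <- Phip)
    fsmul (fsmul (fsexp 0 \- fsexp a) (fsexp 0 \- fsexp a))
          (fsmul (fsgeom q^-1 a) (fsgeom q a)).

End FormalSeries.

Section Chambers.
Variables (R : realType) (r : nat).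
Implicit Types (S Phip : {fset 'rV[R]_r}).

Definition cone S : set 'rV[R]_r :=
  [set x | exists2 c : 'rV[R]_r -> R,
     forall a, 0 <= c a & x = \sum_(a <- S) c a *: a]%classic.

Definition singular Phip (x : 'rV[R]_r) : Prop :=
  exists S, [/\ S `<=` Phip, (#|` S| < r)%N & cone S x].

Definition nonsingular Phip : set 'rV[R]_r :=
  [set x | cone Phip x /\ ~ singular Phip x]%classic.

Definition big_chamber Phip (c : set 'rV[R]_r) : Prop :=
  exists2 x, nonsingular Phip x & c = connected_component (nonsingular Phip) x.

End Chambers.

(* Polynomial and rational functions on V_C, in the coordinates of V_C. *)
Notation polyVC R r := (mpoly r R[i]) (only parsing).
Notation ratVC R r := {fraction (mpoly r R[i])} (only parsing).

Section TotalResidue.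
Variables (R : realType) (r : nat).
Implicit Types (Phip : {fset 'rV[R]_r}) (f s : ratVC R r).

Definition linform (a : 'rV[R]_r) : polyVC R r :=
  \sum_(i < r) (a 0 i)%:C *: mpolyX _ (mnm1 i).

Definition ratfrac (n : polyVC R r) (d : polyVC R r) : ratVC R r :=
  tofrac n / tofrac d.

Definition pderiv (v : 'cV[R[i]]_r) (p : polyVC R r) : polyVC R r :=
  \sum_(i < r) v i 0 *: mderiv i p.

(* The quotient rule applied to a fraction representing [f]. *)
Definition fderiv (v : 'cV[R[i]]_r) f : ratVC R r :=
  let n := (repr f).1 in let d := (repr f).2 in
  ratfrac (pderiv v n * d - n * pderiv v d) (d ^+ 2).

Definition RH Phip : set (ratVC R r) :=
  [set f | exists (p : polyVC R r) (b : seq 'rV[R]_r),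
     {subset b <= Phip} /\ f = ratfrac p (\prod_(a <- b) linform a)]%classic.

Definition dRH Phip : set (ratVC R r) :=
  [set f | exists vg : seq ('cV[R[i]]_r * ratVC R r),
     (forall x, x \in vg -> RH Phip x.2) /\
     f = \sum_(x <- vg) fderiv x.1 x.2]%classic.

Definition fsigma (s : {fset 'rV[R]_r}) : ratVC R r :=
  ratfrac 1 (\prod_(a <- s) linform a).

Definition scal (c : R[i]) f : ratVC R r := tofrac (mpolyC r c) * f.

Definition SH Phip : set (ratVC R r) :=
  [set f | exists c : {fset 'rV[R]_r} -> R[i],
     f = \sum_(s <- fpowerset Phip | basis_of fullv s) scal (c s) (fsigma s)]
  %classic.

(* The projection R_H = dRH (+) S_H -> S_H. *)
Definition Tres Phip f : ratVC R r :=
  xget 0 [set s | SH Phip s /\ dRH Phip (f - s)]%classic.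

(* [P m] is the homogeneous part of degree [m] of a power series P such that
   F = P / prod_(a <- b) a  near 0, away from the hyperplanes a = 0. *)
Definition germ_at0 Phip (F : 'cV[R[i]]_r -> R[i])
    (P : nat -> polyVC R r) (b : seq 'rV[R]_r) : Prop :=
  [/\ forall m, P m \is ishomog1 m mdeg,
      {subset b <= Phip} &
      exists2 e : R, 0 < e & forall z : 'cV[R[i]]_r,
        (forall i, cabs (z i 0) < e) ->
        (forall a, a \in Phip -> evalC a z != 0) ->
        (fun M : nat =>
           cabs (\sum_(m < M) meval (fun i => z i 0) (P m)
                  - F z * \prod_(a <- b) evalC a z)) @ \oo --> (0 : R)].

(* Total residue at 0 of a function; the value does not depend on how its germ
   is written as P / prod b. *)
Definition Tres_germ Phip (F : 'cV[R[i]]_r -> R[i]) : ratVC R r :=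
  xget 0 [set s | exists (P : nat -> polyVC R r) (b : seq 'rV[R]_r),
    germ_at0 Phip F P b /\
    s = Tres Phip (ratfrac (if (r <= size b)%N then P (size b - r)%N else 0)
                        (\prod_(a <- b) linform a))]%classic.

(* The linear functional chi_c on S_H; its values outside S_H are irrelevant.
   The volume of Box(s) enters through its inverse: for a basis s of roots the
   lattice Z s has index vol(Box(s)) in P, so f_s contributes once for each of
   vol(Box(s)) classes of points. *)
Definition chamber_functional Phip (vol : {fset 'rV[R]_r} -> R)
    (c : set 'rV[R]_r) (h : ratVC R r -> R[i]) : Prop :=
  (forall (k : R[i]) f g, SH Phip f -> SH Phip g ->
     h (scal k f + g) = k * h f + h g) /\
  (forall s : {fset 'rV[R]_r}, s `<=` Phip -> basis_of fullv s ->
     h (fsigma s) = if `[< (c `<=` cone s)%classic >] then (vol s)^-1%:C else 0).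

Definition chi Phip (vol : {fset 'rV[R]_r} -> R) (c : set 'rV[R]_r) :
    ratVC R r -> R[i] :=
  xget (fun=> 0) [set h | chamber_functional Phip vol c h]%classic.

End TotalResidue.

(* Main.v *)
(** Expand [e^(-lambda) eta] by partial fractions into combinations of
    [e^(mu - lambda) / prod_d (1 - u_d e^(gamma_d))], where each [gamma_d] is a
    positive multiple of a positive root, [u_d > 0], and [mu] lies in the root
    lattice and in the zonotope of the [gamma_d].  The identity "coefficient =
    sum of residues" is linear, and for such a term it reduces to fewer
    directions: an integer relation between the [gamma_d], made of signs after
    replacing the blocks [(gamma, u)] by multiples [(n gamma, u ^ n)], is
    followed step by step, each step using
      [1 / (1 - X) - X / (1 - X) = 1],
    in an order that keeps every exponent inside its zonotope.  When the
    directions are independent, both sides are products of one-variable terms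
    and the sum over the points of the finite quotient of lattices is a
    character sum.  There the residue of [e^(nu y) / (1 - e^(-y))^m] at 0 is the
    coefficient of [X^nu] in [1 / (1 - X)^m] exactly because [nu > -m], which
    holds since [mu] lies in the zonotope and [lambda] is nonsingular.

    That [chi] is defined and kills derivatives follows from writing it as a
    combination of iterated residues along the bases of roots without broken
    circuit.  Points which are not residual contribute nothing because there
    the zeros of [eta] outweigh the excess of poles over the rank. *)
Require Import Defs.
From HB Require Import structures.
From mathcomp Require Import all_boot all_order all_algebra finmap.
From mathcomp Require Import generic_quotient fraction complex.
From mathcomp Require Import all_classical all_reals all_analysis.
From mathcomp Require Import -(notations) mpoly.
From mathcomp Require Import perm.
From mathcomp Require Import ring lra zify.

Set Implicit Arguments.
Unset Strict Implicit.
Unset Printing Implicit Defensive.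

Import Order.TTheory GRing.Theory Num.Theory.
Import numFieldNormedType.Exports.

Local Open Scope classical_set_scope.
Local Open Scope complex_scope.
Local Open Scope ring_scope.

(** * Root systems and coroots *)

(** Without the zonotope condition the reduction would be false: as a function of [nu] the residue
    of [e^(nu y) / (1 - e^(-y))^m] is a polynomial, nonzero at [nu = -m], where the coefficient is
    0. As [lambda] may lie close to a wall, a partial fraction decomposition with uncontrolled
    numerators would leave the range where both agree. Terms are carried as pairs (coefficient,
    function); the pairs whose coefficient is the sum of the residues of the function form a linear
    subspace containing every instance of the one-step relation, so only the terms that end the
    reduction need a computation. Going around a circuit multiplies a term by a product of the [u_d]
    and their inverses. If this factor is not 1, the term can be solved for; if it is 1, one spare
    copy of a block is added and the term where that copy is dropped is solved for instead. For
    independent directions the number of poles is a lattice index, the product of the multiples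
    times the volume of the box; it cancels the inverse volume in [chi] and the Jacobians of the
    rescaled variables. The finiteness of the support of the residues is part of what is carried
    along. *)

Section LinearIndependence.
Variables (K : fieldType) (vT : vectType K).

Lemma free_sum_eq0 (X : seq vT) (c : vT -> K) : free X ->
  \sum_(x <- X) c x *: x = 0 -> {in X, forall x, c x = 0}.
Proof.
move=> fX; rewrite (big_nth 0) big_mkord => S0 x /(nthP 0) [i iX <-].
by have /freeP /(_ (fun j => c X`_j) S0 (Ordinal iX)) : free (in_tuple X) by [].
Qed.

Lemma free_sum_inj (X : seq vT) (c c' : vT -> K) : free X ->
  \sum_(x <- X) c x *: x = \sum_(x <- X) c' x *: x -> {in X, c =1 c'}.
Proof.
move=> fX /eqP; rewrite -subr_eq0 -sumrB => /eqP E x xX; apply/eqP; rewrite -subr_eq0.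
apply/eqP; apply: (@free_sum_eq0 X (fun x => c x - c' x)) => //.
by rewrite -[RHS]E; apply: eq_bigr => y _; rewrite scalerBl.
Qed.

End LinearIndependence.

Section PairingTheory.
Variables (R : realType) (r : nat).
Implicit Types (mu : 'rV[R]_r) (v : 'cV[R]_r).

Lemma pairingDl mu mu' v : pairing (mu + mu') v = pairing mu v + pairing mu' v.
Proof. by rewrite /pairing mulmxDl mxE. Qed.
Lemma pairingZl k mu v : pairing (k *: mu) v = k * pairing mu v.
Proof. by rewrite /pairing -scalemxAl mxE. Qed.
Lemma pairingNl mu v : pairing (- mu) v = - pairing mu v.
Proof. by rewrite -scaleN1r pairingZl mulN1r. Qed.
Lemma pairing0l v : pairing 0 v = 0.
Proof. by rewrite /pairing mul0mx mxE. Qed.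
Lemma pairingDr mu v v' : pairing mu (v + v') = pairing mu v + pairing mu v'.
Proof. by rewrite /pairing mulmxDr mxE. Qed.
Lemma pairingZr k mu v : pairing mu (k *: v) = k * pairing mu v.
Proof. by rewrite /pairing -scalemxAr mxE. Qed.
Lemma pairingNr mu v : pairing mu (- v) = - pairing mu v.
Proof. by rewrite -scaleN1r pairingZr mulN1r. Qed.
Lemma pairing0r mu : pairing mu 0 = 0.
Proof. by rewrite /pairing mulmx0 mxE. Qed.
Lemma pairing_suml (I : Type) (s : seq I) (P : pred I) (F : I -> 'rV[R]_r) v :
  pairing (\sum_(i <- s | P i) F i) v = \sum_(i <- s | P i) pairing (F i) v.
Proof. by rewrite /pairing mulmx_suml summxE. Qed.
Lemma pairing_sumr (I : Type) (s : seq I) (P : pred I) (F : I -> 'cV[R]_r) mu :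
  pairing mu (\sum_(i <- s | P i) F i) = \sum_(i <- s | P i) pairing mu (F i).
Proof. by rewrite /pairing mulmx_sumr summxE. Qed.

Lemma pairing_eq0 (X : seq 'rV[R]_r) v : <<X>>%VS = fullv ->
  {in X, forall x, pairing x v = 0} -> v = 0.
Proof.
move=> sX X0; have all0 mu : pairing mu v = 0.
  have: mu \in <<X>>%VS by rewrite sX memvf.
  rewrite -[X]/(tval (in_tuple X)) => /coord_span ->.
  rewrite pairing_suml big1 // => i _; rewrite pairingZl X0 ?mulr0 //.
  by rewrite mem_nth.
apply/colP => i; have := all0 (delta_mx 0 i); rewrite /pairing -rowE !mxE //.
Qed.

End PairingTheory.

Section RootSystemTheory.
Variables (R : realType) (r : nat).
Variables (Phi Delta : {fset 'rV[R]_r}) (cor : 'rV[R]_r -> 'cV[R]_r).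
Hypotheses (rootsP : irreducible_root_system Phi cor) (baseP : root_base Phi Delta).

(** The axioms supply no inner product. This canonical form on V is invariant because reflections
    permute [Phi], and positive definite because the roots span; the properties of [cor] beyond its
    axioms are derived from it. *)
Definition coroot_form (v w : 'cV[R]_r) : R := \sum_(g <- Phi) pairing g v * pairing g w.
Local Notation B := coroot_form.

Lemma rootN a : a \in Phi -> - a \in Phi.
Proof.
move=> aP; have := roots_refl rootsP aP aP; rewrite (coroot2 rootsP aP).
by rewrite scaler_nat mulr2n opprD addrA subrr add0r.
Qed.

Lemma root_neq0 a : a \in Phi -> a != 0.
Proof. by move=> aP; apply: contraTneq aP => ->; apply: roots_neq0 rootsP. Qed.

Lemma reflection_scalar (x : R) : x + (x - x * 2) = 0.
Proof. by ring. Qed.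

Lemma reflK a : a \in Phi -> involutive (fun g => g - pairing g (cor a) *: a).
Proof.
move=> aP g; rewrite pairingDl pairingNl pairingZl (coroot2 rootsP aP).
rewrite -addrA -opprD -scalerDl; set x := pairing _ _.
by rewrite reflection_scalar scale0r subr0.
Qed.

Lemma coroot_form_refl a v w : a \in Phi ->
  B (v - pairing a v *: cor a) (w - pairing a w *: cor a) = B v w.
Proof.
move=> aP; pose s g := g - pairing g (cor a) *: a.
have E g u : pairing g (u - pairing a u *: cor a) = pairing (s g) u.
  by rewrite pairingDr pairingNr pairingZr pairingDl pairingNl pairingZl mulrC.
rewrite /B (eq_bigr (fun g => pairing (s g) v * pairing (s g) w)); last first.
  by move=> g _; rewrite !E.
rewrite -(big_map s xpredT (fun g => pairing g v * pairing g w)).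
apply: perm_big; apply: uniq_perm => [||x].
- by rewrite map_inj_uniq ?fset_uniq //; apply: inv_inj; apply: reflK.
- exact: fset_uniq.
apply/mapP/idP => [[g gP ->]|xP]; first exact: roots_refl rootsP _ _ aP gP.
by exists (s x); [apply: roots_refl rootsP _ _ aP xP|rewrite /s reflK].
Qed.

Lemma coroot_form_sym v w : B v w = B w v.
Proof. by apply: eq_bigr => g _; rewrite mulrC. Qed.
Lemma coroot_formDr v w w' : B v (w + w') = B v w + B v w'.
Proof. by rewrite -big_split; apply: eq_bigr => g _; rewrite pairingDr mulrDr. Qed.
Lemma coroot_formZr k v w : B v (k *: w) = k * B v w.
Proof. by rewrite mulr_sumr; apply: eq_bigr => g _; rewrite pairingZr mulrCA. Qed.
Lemma coroot_formDl v w w' : B (w + w') v = B w v + B w' v.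
Proof. by rewrite !(coroot_form_sym _ v) coroot_formDr. Qed.
Lemma coroot_formZl k v w : B (k *: w) v = k * B w v.
Proof. by rewrite !(coroot_form_sym _ v) coroot_formZr. Qed.

Lemma coroot_form_ge0 v : 0 <= B v v.
Proof. by apply: sumr_ge0 => g _; rewrite -expr2 sqr_ge0. Qed.

Lemma coroot_form_eq0 v : B v v = 0 -> v = 0.
Proof.
move=> /eqP; rewrite psumr_eq0 => [/allP H|g _]; last by rewrite -expr2 sqr_ge0.
apply: (pairing_eq0 (roots_span rootsP)) => g gP.
by apply/eqP; have := H g gP; rewrite -expr2 sqrf_eq0.
Qed.

Lemma coroot_form_gt0 v : v != 0 -> 0 < B v v.
Proof.
by move=> v0; rewrite lt0r coroot_form_ge0 andbT; apply: contra_neqN v0 => /eqP /coroot_form_eq0.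
Qed.

Lemma coroot_neq0 a : a \in Phi -> cor a != 0.
Proof.
move=> aP; apply/eqP => c0; have := coroot2 rootsP aP; rewrite c0 pairing0r => /eqP.
by rewrite eq_sym pnatr_eq0.
Qed.

(** The reflection in [a] is an isometry that negates [cor a]; expanding the invariance gives the
    identity, so [cor a] represents a multiple of the root [a]. *)
Lemma coroot_formE a v : a \in Phi -> 2 * B v (cor a) = pairing a v * B (cor a) (cor a).
Proof.
move=> aP; have := coroot_form_refl v (cor a) aP; rewrite (coroot2 rootsP aP).
have -> : cor a - 2 *: cor a = - 1 *: cor a.
  by rewrite scaleN1r scaler_nat mulr2n opprD addrA subrr add0r.
rewrite coroot_formZr coroot_formDl -scaleNr coroot_formZl => E.
by rewrite mulrDl mul1r -{1}E; ring.
Qed.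

Lemma coroot_form_inj v v' : (forall w, B w v = B w v') -> v = v'.
Proof.
move=> E; apply/eqP; rewrite -subr_eq0; apply/eqP/coroot_form_eq0.
by rewrite coroot_formDr -scaleN1r coroot_formZr E mulN1r subrr.
Qed.

(** By [coroot_formE] the coroot represents [b] up to a factor, hence so does any competitor [w],
    and the value 2 on [b] fixes the factor. *)
Lemma coroot_unique b w k : b \in Phi ->
  (forall v, B v w * k = pairing b v) -> pairing b w = 2 -> w = cor b.
Proof.
move=> bP E b2; set c := B (cor b) (cor b).
have c0 : c != 0 by apply/lt0r_neq0/coroot_form_gt0/coroot_neq0.
have E' : k *: w = (2 / c) *: cor b.
  apply: coroot_form_inj => v; rewrite !coroot_formZr mulrC E.
  by rewrite mulrAC coroot_formE // mulfK.
have kE : k = 2 / c.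
  have := congr1 (pairing b) E'; rewrite !pairingZr b2 (coroot2 rootsP bP).
  by apply: mulIf; rewrite pnatr_eq0.
have k0 : k != 0 by rewrite kE mulf_neq0 ?invr_eq0 ?pnatr_eq0.
by apply: (scalerI k0); rewrite E' kE.
Qed.

Lemma coroot_refl a b : a \in Phi -> b \in Phi ->
  cor (b - pairing b (cor a) *: a) = cor b - pairing a (cor b) *: cor a.
Proof.
move=> aP bP; apply/esym.
apply: (@coroot_unique _ _ (2 / B (cor b) (cor b))).
- exact: roots_refl rootsP _ _ aP bP.
- move=> v; have c0 : B (cor b) (cor b) != 0.
    by apply/lt0r_neq0/coroot_form_gt0/coroot_neq0.
  have := coroot_form_refl (v - pairing a v *: cor a) (cor b) aP.
  have -> : v - pairing a v *: cor a -
    pairing a (v - pairing a v *: cor a) *: cor a = v.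
    rewrite pairingDr pairingNr pairingZr (coroot2 rootsP aP).
    rewrite -addrA -opprD -scalerDl; set x := pairing _ _.
    by rewrite reflection_scalar scale0r subr0.
  move=> ->; rewrite mulrA (mulrC _ 2) coroot_formE // mulfK //.
  by rewrite pairingDr pairingNr pairingZr pairingDl pairingNl pairingZl mulrC.
- rewrite !(pairingDl, pairingDr, pairingNl, pairingNr, pairingZl, pairingZr).
  rewrite (coroot2 rootsP aP) (coroot2 rootsP bP); ring.
Qed.

Lemma corootN a : a \in Phi -> cor (- a) = - cor a.
Proof.
move=> aP; have := coroot_refl aP aP; rewrite (coroot2 rootsP aP) !scaler_nat !mulr2n.
by rewrite !opprD !addrA !subrr !add0r.
Qed.

Lemma pairing_coroot_gt0 a b : a \in Phi -> b \in Phi ->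
  0 < pairing a (cor b) -> 0 < pairing b (cor a).
Proof.
move=> aP bP ab0.
have ca := coroot_form_gt0 (coroot_neq0 aP); have cb := coroot_form_gt0 (coroot_neq0 bP).
rewrite -(pmulr_lgt0 _ cb) -coroot_formE // coroot_form_sym coroot_formE //.
by rewrite mulr_gt0.
Qed.

Lemma base_free : free Delta.
Proof. exact: basis_free (base_basis baseP). Qed.

Lemma base_root a : a \in Delta -> a \in Phi.
Proof. by move=> aD; apply: (fsubsetP (base_sub baseP)). Qed.

Lemma base_sum_inj (c c' : 'rV[R]_r -> R) :
  \sum_(a <- Delta) c a *: a = \sum_(a <- Delta) c' a *: a -> {in Delta, c =1 c'}.
Proof. exact: free_sum_inj base_free. Qed.

Lemma size_base : size Delta = r.
Proof.
have /andP[/eqP sD] := base_basis baseP; rewrite /free sD => /eqP <-.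
by rewrite dimvf /dim /= mul1n.
Qed.

Definition simple_coroot_span (v : 'cV[R]_r) : Prop :=
  exists n : 'rV[R]_r -> int, v = \sum_(a <- Delta) cor a *~ n a.

Lemma simple_coroot_spanD v w :
  simple_coroot_span v -> simple_coroot_span w -> simple_coroot_span (v + w).
Proof.
move=> [n ->] [m ->]; exists (fun a => n a + m a); rewrite -big_split /=.
by apply: eq_bigr => a _; rewrite mulrzDr.
Qed.

Lemma simple_coroot_spanMz v (k : int) :
  simple_coroot_span v -> simple_coroot_span (v *~ k).
Proof.
move=> [n ->]; exists (fun a => n a * k); rewrite mulrz_suml.
by apply: eq_bigr => a _; rewrite mulrzA.
Qed.

Lemma simple_coroot_span_base a : a \in Delta -> simple_coroot_span (cor a).
Proof.
move=> aD; exists (fun b => (b == a)%:Z); rewrite (big_fsetD1 a) //= eqxx.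
rewrite big_seq big1 ?addr0 ?mulr1z // => b.
by rewrite in_fsetD1 => /andP[/negbTE -> _]; rewrite mulr0z.
Qed.

(** Induction on the height of [b]. Reflecting in a suitable simple root lowers the height and
    changes the coroot by an integral multiple of a simple coroot; the descent ends at the simple
    roots because the system is reduced. *)
Lemma coroot_pos_span (n : 'rV[R]_r -> nat) b : b \in Phi ->
  b = \sum_(a <- Delta) a *+ n a -> simple_coroot_span (cor b).
Proof.
move: {2}(\sum_(a <- Delta) n a)%N (leqnn (\sum_(a <- Delta) n a)%N) => k.
elim: k n b => [|k IH] n b nk bP bE.
  case/eqP: (root_neq0 bP); rewrite bE big_seq big1 // => a aD.
  by move: nk; rewrite leqn0 sum_nat_seq_eq0 => /allP /(_ _ aD) /eqP ->.
(* The value of [b] on its own coroot is 2, so some term of its expansion over the simple roots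
   contributes positively. *)
have [a aD]: exists2 a, a \in Delta & (0 < n a)%N && (0 < pairing a (cor b)).
  apply: contrapT => H; have := coroot2 rootsP bP.
  rewrite {1}bE pairing_suml big_seq => E.
  suff: \sum_(i <- Delta | i \in Delta) pairing (i *+ n i) (cor b) <= 0.
    by rewrite E lern0.
  apply: sumr_le0 => a aD; rewrite -scaler_nat pairingZl.
  have [na|na] := posnP (n a); first by rewrite na mul0r.
  rewrite pmulr_rle0 ?ltr0n // leNgt; apply/negP => ab.
  by apply: H; exists a; rewrite ?na.
move=> /andP[na ab].
have aP := base_root aD; have ba := pairing_coroot_gt0 aP bP ab.
have sP := roots_refl rootsP aP bP.
have bE' : b = \sum_(x <- Delta) (n x)%:R *: x.
  by rewrite {1}bE; apply: eq_bigr => x _; rewrite scaler_nat.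
have [[a' [a'D a'a na']]|noa'] := pselect (exists a', [/\ a' \in Delta, a' != a & (0 < n a')%N]).
- pose m := pairing b (cor a).
  have mZ : m \is a Num.int by apply: roots_int rootsP _ _ aP bP.
  have sE : b - m *: a = \sum_(x <- Delta) ((n x)%:R - m * (x == a)%:R) *: x.
    rewrite (eq_bigr (fun x => (n x)%:R *: x - (m * (x == a)%:R) *: x)); last first.
      by move=> x _; rewrite scalerBl.
    rewrite sumrB -bE'; congr (_ - _).
    rewrite (big_fsetD1 a) //= eqxx mulr1 big_seq big1 ?addr0 // => x.
    by rewrite in_fsetD1 => /andP[/negbTE -> _]; rewrite mulr0 scale0r.
  case: (base_sign baseP sP) => -[n' n'E].
    have n'P : {in Delta, forall x, (n x)%:R - m * (x == a)%:R = (n' x)%:R :> R}.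
      apply: base_sum_inj; rewrite -sE n'E; apply: eq_bigr => x _.
      by rewrite scaler_nat.
    have := IH n' _ _ sP n'E.
    rewrite coroot_refl // => IH'.
    have -> : cor b = (cor b - pairing a (cor b) *: cor a) + pairing a (cor b) *: cor a.
      by rewrite subrK.
    apply: simple_coroot_spanD.
      apply: IH'; rewrite -ltnS; apply: leq_trans nk.
      rewrite (big_fsetD1 a) //= [X in (_ < X)%N](big_fsetD1 a) //=.
      rewrite [in X in (X < _)%N]big_seq [X in (_ < _ + X)%N]big_seq.
      rewrite -addSn; apply: leq_add.
        rewrite -(ltr_nat R) -n'P // eqxx mulr1 ltrBlDr ltrDl //.
      apply: leq_sum => x; rewrite in_fsetD1 => /andP[/negbTE xa xD].
      by rewrite -(ler_nat R) -n'P // xa mulr0 subr0.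
    have /Num.Theory.intrP [j ->] : pairing a (cor b) \is a Num.int by apply: roots_int rootsP _ _ bP aP.
    by rewrite scaler_int; apply/simple_coroot_spanMz/simple_coroot_span_base.
  (* The reflected root cannot be negative: its coefficient at [a'] is that of [b], which is
     positive. *)
  have : {in Delta, forall x, - ((n x)%:R - m * (x == a)%:R) = (n' x)%:R :> R}.
    apply: base_sum_inj; rewrite (eq_bigr (fun x => - (((n x)%:R - m * (x == a)%:R) *: x))).
      by rewrite sumrN -sE n'E; apply: eq_bigr => x _; rewrite scaler_nat.
    by move=> x _; rewrite scaleNr.
  move=> /(_ _ a'D); rewrite (negbTE a'a) mulr0 subr0 => /eqP.
  by rewrite eq_sym -subr_eq0 opprK -natrD pnatr_eq0 addn_eq0 andbC -leqn0 leqNgt na'.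
have {}bE : b = (n a)%:R *: a.
  rewrite bE' (big_fsetD1 a) //= big_seq big1 ?addr0 // => x.
  rewrite in_fsetD1 => /andP[xa xD]; apply/eqP; rewrite scaler_eq0 pnatr_eq0 -leqn0 leqNgt.
  by apply/orP; left; apply/negP => nx; apply: noa'; exists x; split.
have := roots_reduced rootsP aP; move=> /(_ (n a)%:R); rewrite -bE => /(_ bP) [n1|n1].
  by rewrite bE n1 scale1r; apply: simple_coroot_span_base.
by have := ler0n R (n a); rewrite n1 lerNr oppr0 ler10.
Qed.

Lemma coroot_simple_span b : b \in Phi -> simple_coroot_span (cor b).
Proof.
move=> bP; case: (base_sign baseP bP) => -[n nE]; first exact: coroot_pos_span nE.
rewrite -[b]opprK (corootN (rootN bP)) -mulrN1z; apply: simple_coroot_spanMz.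
exact: coroot_pos_span (rootN bP) nE.
Qed.

Lemma coroot_latticeE v : coroot_lattice Phi cor v <-> simple_coroot_span v.
Proof.
split=> [[n ->]|[n ->]].
  rewrite big_seq; elim/big_ind: _ => [|x y|a aP].
  - by exists (fun=> 0); rewrite big1 // => a _; rewrite mulr0z.
  - exact: simple_coroot_spanD.
  - exact/simple_coroot_spanMz/coroot_simple_span.
exists (fun a => if a \in Delta then n a else 0).
rewrite [RHS](bigID [in Delta]) /= [X in _ = _ + X]big1 ?addr0 => [|a /negbTE -> //].
rewrite -[RHS]big_filter [RHS](eq_big_seq (fun a => cor a *~ n a)); last first.
  by move=> a; rewrite mem_filter => /andP[->].
apply: perm_big; apply: uniq_perm; rewrite ?filter_uniq ?fset_uniq // => a.
rewrite mem_filter; case: (boolP (a \in Delta)) => //= aD.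
by rewrite base_root.
Qed.

Lemma pairing_coroot_int a v : a \in Phi -> coroot_lattice Phi cor v ->
  pairing a v \is a Num.int.
Proof.
move=> aP [n ->]; rewrite pairing_sumr big_seq rpred_sum // => b bP.
by rewrite -scaler_int pairingZr rpredM ?intr_int ?(roots_int rootsP).
Qed.

Definition coroot_matrix : 'M[R]_r := \matrix_(i < r, j < r) cor (enum_fset Delta)`_j i 0.

Lemma mul_coroot_matrix mu j : (mu *m coroot_matrix) 0 j = pairing mu (cor (enum_fset Delta)`_j).
Proof. by rewrite /pairing !mxE; apply: eq_bigr => i _; rewrite mxE. Qed.

(** The Gram matrix [G] of the invariant form is invertible, so [u] is the form against some [w]; by
    [coroot_formE] its vanishing on the coroots says that every root kills [w], whence [w = 0]. *)
Lemma coroots_separate u : {in Phi, forall a, pairing u (cor a) = 0} -> u = 0.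
Proof.
pose G : 'M[R]_r := \sum_(g <- Phi) g^T *m g.
have GE v w : pairing (v^T *m G) w = B v w.
  rewrite /G mulmx_sumr pairing_suml; apply: eq_bigr => g _.
  rewrite /pairing mulmxA -mulmxA mxE big_ord1; congr (_ * _).
  by rewrite -trmx_mul mxE.
have Gu : G \in unitmx.
  rewrite -row_free_unit -kermx_eq0; apply/eqP/row_matrixP => i; rewrite row0.
  apply: trmx_inj; rewrite trmx0; apply: coroot_form_eq0.
  by rewrite -GE trmxK -row_mul mulmx_ker row0 pairing0l.
move=> u0; pose w := (u *m invmx G)^T.
have uE : u = w^T *m G by rewrite trmxK mulmxKV.
suff w0 : w = 0 by rewrite uE w0 trmx0 mul0mx.
apply: (pairing_eq0 (roots_span rootsP)) => a aP.
have ca : B (cor a) (cor a) != 0 by apply/lt0r_neq0/coroot_form_gt0/coroot_neq0.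
apply: (mulIf ca); rewrite -coroot_formE // -GE -uE u0 //.
by rewrite mulr0 mul0r.
Qed.

Lemma coroot_matrix_unit : coroot_matrix \in unitmx.
Proof.
rewrite -row_free_unit -kermx_eq0; apply/eqP/row_matrixP => i; rewrite row0.
set u := row i _; apply: coroots_separate => a aP.
have [n ->] := coroot_simple_span aP; rewrite pairing_sumr big_seq big1 // => b bD.
rewrite -scaler_int pairingZr; have /(nthP 0) [j jr <-] := bD.
have {}jr : (j < r)%N by rewrite -size_base.
rewrite -(mul_coroot_matrix u (Ordinal jr)) /u -row_mul mulmx_ker row0 mxE mulr0 //.
Qed.

Lemma coroot_latticeP v : coroot_lattice Phi cor v <->
  exists x : 'cV[int]_r, v = coroot_matrix *m map_mx intr x.
Proof.
rewrite coroot_latticeE; split=> [[n ->]|[x ->]].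
  exists (\col_j n (enum_fset Delta)`_j).
  rewrite (big_nth 0) size_base big_mkord; apply/colP => i; rewrite summxE mxE.
  by apply: eq_bigr => j _; rewrite -[cor _ *~ _]scaler_int !mxE mulrC.
exists (fun a => if insub (index a Delta) is Some j then x j 0 else 0).
rewrite (big_nth 0) size_base big_mkord; apply/colP => i; rewrite summxE mxE.
apply: eq_bigr => j _; rewrite index_uniq ?fset_uniq ?size_base // valK.
by rewrite -[cor _ *~ _]scaler_int !mxE mulrC.
Qed.

Lemma posroots_sub a : a \in posroots Phi Delta -> a \in Phi.
Proof. by rewrite !inE => /andP[]. Qed.

Lemma posrootsP a : a \in posroots Phi Delta <-> a \in Phi /\ Qplus Delta a.
Proof. by rewrite !inE /=; split=> [/andP[-> /asboolP]|[-> ?]] //; apply/asboolP. Qed.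

(** A linear functional that is at least 1 on the nonzero elements of Q+. It grades the formal
    series, which makes their sums finite, and it shows that the positive roots lie in an open
    half-space. *)
Definition height (x : 'rV[R]_r) : R :=
  \sum_(i < size Delta) coord (in_tuple Delta) i x.

Lemma heightD x y : height (x + y) = height x + height y.
Proof. by rewrite -big_split; apply: eq_bigr => i _; rewrite linearD. Qed.

Lemma heightZ k x : height (k *: x) = k * height x.
Proof. by rewrite mulr_sumr; apply: eq_bigr => i _; rewrite linearZ. Qed.

Lemma height_base a : a \in Delta -> height a = 1.
Proof.
move=> /(nthP 0) [j jr <-]; rewrite /height (bigD1 (Ordinal jr)) //=.
rewrite (coord_free (Ordinal jr) (Ordinal jr)) ?base_free // eqxx big1 ?addr0 // => i ij.
have := @coord_free _ _ _ (in_tuple Delta) (Ordinal jr) i base_free.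
by rewrite /= => ->; rewrite eq_sym (negbTE ij).
Qed.

Lemma height_sum (n : 'rV[R]_r -> nat) :
  height (\sum_(a <- Delta) a *+ n a) = (\sum_(a <- Delta) n a)%:R.
Proof.
have h0 : height 0 = 0 by rewrite -[0](scale0r 0) heightZ mul0r.
rewrite (big_morph _ heightD h0) natr_sum big_seq [RHS]big_seq.
by apply: eq_bigr => a aD; rewrite -scaler_nat heightZ height_base ?mulr1.
Qed.

Lemma height_ge1 x : Qplus Delta x -> x != 0 -> 1 <= height x.
Proof.
move=> [n ->]; rewrite height_sum ler1n lt0n; apply: contra_neqN.
rewrite sum_nat_seq_eq0 => /allP n0; rewrite big_seq big1 // => a /n0 /eqP ->.
by rewrite mulr0n.
Qed.

Lemma Qplus_opp x : Qplus Delta x -> Qplus Delta (- x) -> x = 0.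
Proof.
move=> Qx Qx'; apply/eqP; apply: contrapT => /negP x0.
have := lerD (height_ge1 Qx x0) (height_ge1 Qx' _); rewrite oppr_eq0 => /(_ x0).
by rewrite -heightD subrr -[0](scale0r 0) heightZ mul0r -(natrD _ 1 1) lern0.
Qed.

Lemma pairing_coroot_Qplus_int x v : Qplus Delta x -> coroot_lattice Phi cor v ->
  pairing x v \is a Num.int.
Proof.
move=> [n ->] vQ; rewrite pairing_suml big_seq rpred_sum // => a aD.
by rewrite -scaler_nat pairingZl rpredM ?natr_int ?pairing_coroot_int ?base_root.
Qed.

Lemma posroots_span : <<posroots Phi Delta>>%VS = fullv.
Proof.
apply/eqP; rewrite eqEsubv subvf /= -(roots_span rootsP).
apply/span_subvP => a aP; case: (base_sign baseP aP) => Qa.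
  by apply: memv_span; apply/posrootsP.
by rewrite -[a]opprK memvN memv_span //; apply/posrootsP; split; rewrite ?rootN.
Qed.

End RootSystemTheory.

(** * Rational functions and derivations *)

Section FieldDerivation.
Variables (F : fieldType) (del : F -> F).
Hypothesis delM : forall f g, del (f * g) = del f * g + f * del g.

Lemma derivation1 : del 1 = 0.
Proof.
have /eqP := delM 1 1; rewrite !mulr1 mul1r -subr_eq0 opprD addrA subrr add0r oppr_eq0.
by move=> /eqP.
Qed.

Lemma derivationV f : f != 0 -> del f^-1 = - del f / f ^+ 2.
Proof.
move=> f0; have := derivation1; rewrite -[X in del X](mulfV f0) delM => /eqP.
rewrite addr_eq0 => /eqP E.
have -> : del f^-1 = (f * del f^-1) / f by rewrite mulrAC divff ?mul1r.
by rewrite -[f * _]opprK -E; field.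
Qed.

Lemma derivationXz f (k : int) : f != 0 -> del (f ^ k) = k%:~R * f ^ (k - 1) * del f.
Proof.
move=> f0.
have nat_case (j : nat) : del (f ^+ j) * f = j%:R * f ^+ j * del f.
  elim: j => [|j IH]; first by rewrite expr0 derivation1 !mul0r.
  rewrite exprS delM mulrDl -(mulrA f) IH -natr1 [j%:R + 1]addrC mulrDl.
  by ring.
have key (e : F) : e != 0 -> del e * f = k%:~R * e * del f -> e = f ^ k ->
    del (f ^ k) = k%:~R * f ^ (k - 1) * del f.
  move=> e0 E ek; rewrite -ek; apply: (mulIf f0); rewrite E ek.
  have -> : f ^ (k - 1) = f ^ k / f by rewrite expfzDr // exprN1.
  by field.
case: (intP k) key => [|j|j] key.
- by rewrite expr0z derivation1 !mul0r.
- by apply: (key (f ^+ j.+1)); rewrite ?expf_neq0 ?nat_case.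
- apply: (key (f ^- j.+1)); rewrite ?invr_eq0 ?expf_neq0 ?derivationV ?expf_neq0 //.
  have F0 : f ^+ j.+1 != 0 by rewrite expf_neq0.
  have := nat_case j.+1; set f1 := f ^+ j.+1 in F0 *; set df1 := del f1 => E.
  have -> : - df1 / f1 ^+ 2 * f = - (df1 * f) / f1 ^+ 2 by field.
  by rewrite E rmorphN /=; field.
Qed.

End FieldDerivation.

Section FractionDerivation.
Variables (D : idomainType) (del : D -> D).
Hypotheses (delD : {morph del : p q / p + q})
  (delM : forall p q, del (p * q) = del p * q + p * del q).
Local Notation K := {fraction D}.
Implicit Types (f g : K) (p n d : D).

Lemma fraction_repr f : (repr f).2 != 0 /\ f = tofrac (repr f).1 / tofrac (repr f).2.
Proof.
have d0 : (repr f).2 != 0 by apply: denom_ratioP.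
split=> //; have td0 : tofrac (repr f).2 != 0 by rewrite tofrac_eq0.
apply: (canRL (mulfK td0)); rewrite -[f in f * _]reprK; move: (repr f) d0 {td0} => x d0.
rewrite !piE; apply/eqmodP => /=; rewrite /FracField.mulf /=.
rewrite FracField.equivfE !numden_Ratio ?mulf_neq0 ?denom_ratioP ?oner_eq0 //=.
by rewrite !mulr1 mulrC.
Qed.

Definition quot n d : K := tofrac n / tofrac d.

Definition del_frac f : K :=
  let n := (repr f).1 in let d := (repr f).2 in
  quot (del n * d - n * del d) (d ^+ 2).

Lemma quot_eq n d n' d' : d != 0 -> d' != 0 ->
  (quot n d == quot n' d') = (n * d' == n' * d).
Proof.
move=> d0 d0'; rewrite /quot eqr_div ?tofrac_eq0 //.
by rewrite -!rmorphM tofrac_eq.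
Qed.

(** The derivation is computed on the representative chosen by [repr]; differentiating the cross
    relation [n * d' = n' * d] shows that any other fraction gives the same value. *)
Lemma del_fracE n d : d != 0 ->
  del_frac (quot n d) = quot (del n * d - n * del d) (d ^+ 2).
Proof.
move=> d0; rewrite /del_frac.
have [] := fraction_repr (quot n d); move: (repr _) => -[[n' d'] /= _] d0' E.
have {}E : n * d' = n' * d by apply/eqP; rewrite -quot_eq // {1}E.
apply/eqP; rewrite quot_eq ?expf_neq0 //.
have := congr1 del E; rewrite !delM => E'.
rewrite -subr_eq0.
have -> : (del n' * d' - n' * del d') * d ^+ 2 - (del n * d - n * del d) * d' ^+ 2 =
  d * d' * (del n' * d + n' * del d - (del n * d' + n * del d'))
  + (n * d' - n' * d) * (d * del d' + d' * del d) by ring.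
by rewrite E' E !subrr mulr0 mul0r addr0.
Qed.

Lemma quotP f : exists n d, d != 0 /\ f = quot n d.
Proof. by have [d0 fE] := fraction_repr f; exists (repr f).1, (repr f).2. Qed.

Lemma quotM n d n' d' : quot n d * quot n' d' = quot (n * n') (d * d').
Proof. by rewrite /quot !rmorphM /= mulf_div. Qed.

Lemma quotD n d n' d' : d != 0 -> d' != 0 ->
  quot n d + quot n' d' = quot (n * d' + n' * d) (d * d').
Proof. by move=> d0 d0'; rewrite /quot addf_div ?tofrac_eq0 // rmorphD !rmorphM. Qed.

Lemma del_fracM f g : del_frac (f * g) = del_frac f * g + f * del_frac g.
Proof.
have [n [d [d0 ->]]] := quotP f; have [n' [d' [d0' ->]]] := quotP g.
have dd0 : d * d' != 0 by rewrite mulf_neq0.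
have d20 : d ^+ 2 != 0 by rewrite expf_neq0.
have d20' : d' ^+ 2 != 0 by rewrite expf_neq0.
rewrite quotM !del_fracE // !quotM quotD ?mulf_neq0 //.
apply/eqP; rewrite quot_eq ?mulf_neq0 ?expf_neq0 //.
by apply/eqP; rewrite !delM; ring.
Qed.

Lemma del_frac_tofrac p : del_frac (tofrac p) = tofrac (del p).
Proof.
have E q : tofrac q = quot q 1 by rewrite /quot rmorph1 divr1.
have d1 : del 1 = 0.
  have /eqP := delM 1 1; rewrite !mulr1 mul1r -subr_eq0 opprD addrA subrr add0r oppr_eq0.
  by move=> /eqP.
by rewrite !E del_fracE ?oner_neq0 // d1 mulr1 mulr0 subr0 expr1n.
Qed.

End FractionDerivation.

Section Fractions.
Variables (R : realType) (r : nat).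
Local Notation A := (mpoly r R[i]).
Local Notation K := {fraction (mpoly r R[i])}.
Implicit Types (f g : K) (v : 'cV[R[i]]_r) (p n d : A).

Lemma pderivM v p q : pderiv v (p * q) = pderiv v p * q + p * pderiv v q.
Proof.
rewrite /pderiv mulr_suml mulr_sumr -big_split; apply: eq_bigr => i _ /=.
by rewrite mderivM scalerDr scalerAl scalerAr.
Qed.

Lemma pderivC v c : pderiv v (mpolyC r c) = 0.
Proof. by rewrite /pderiv big1 // => i _; rewrite mderivC scaler0. Qed.

Lemma pderiv1 v : pderiv v 1 = 0.
Proof. exact: (pderivC v 1). Qed.

Lemma fderiv_del v : fderiv v = @del_frac A (pderiv v).
Proof. reflexivity. Qed.

Lemma fderivM v f g : fderiv v (f * g) = fderiv v f * g + f * fderiv v g.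
Proof. by rewrite fderiv_del; apply: del_fracM; apply: pderivM. Qed.

Lemma fderiv_tofrac v p : fderiv v (tofrac p) = tofrac (pderiv v p).
Proof. by rewrite fderiv_del; apply: del_frac_tofrac; apply: pderivM. Qed.

Lemma fderivXz v f (k : int) : f != 0 ->
  fderiv v (f ^ k) = k%:~R * f ^ (k - 1) * fderiv v f.
Proof. exact: (@derivationXz K (fderiv v) (@fderivM v)). Qed.

Lemma fderivE v n d : d != 0 ->
  fderiv v (ratfrac n d) = ratfrac (pderiv v n * d - n * pderiv v d) (d ^+ 2).
Proof. by rewrite fderiv_del; apply: del_fracE; apply: pderivM. Qed.

Lemma ratfrac_eq n d n' d' : d != 0 -> d' != 0 ->
  (ratfrac n d == ratfrac n' d') = (n * d' == n' * d).
Proof. exact: quot_eq. Qed.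

Lemma ratfracM n d n' d' : ratfrac n d * ratfrac n' d' = ratfrac (n * n') (d * d').
Proof. exact: quotM. Qed.

Lemma ratfracD n d n' d' : d != 0 -> d' != 0 ->
  ratfrac n d + ratfrac n' d' = ratfrac (n * d' + n' * d) (d * d').
Proof. exact: quotD. Qed.

Lemma tofracE p : tofrac p = ratfrac p 1.
Proof. by rewrite /ratfrac rmorph1 divr1. Qed.

Lemma scalM (c : R[i]) f g : scal c (f * g) = scal c f * g.
Proof. by rewrite /scal mulrA. Qed.

Lemma scalD (c : R[i]) f g : scal c (f + g) = scal c f + scal c g.
Proof. by rewrite /scal mulrDr. Qed.

Lemma scal_scal (c c' : R[i]) f : scal c (scal c' f) = scal (c * c') f.
Proof. by rewrite /scal mulrA -rmorphM /= mpolyCM. Qed.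

Lemma scal1 f : scal 1 f = f.
Proof. by rewrite /scal mpolyC1 rmorph1 mul1r. Qed.

Lemma scal0 f : scal 0 f = 0.
Proof. by rewrite /scal mpolyC0 rmorph0 mul0r. Qed.

Lemma scalDl (c c' : R[i]) f : scal (c + c') f = scal c f + scal c' f.
Proof. by rewrite /scal mpolyCD rmorphD mulrDl. Qed.

Lemma scalN1 f : scal (-1) f = - f.
Proof. by rewrite /scal mpolyCN mpolyC1 rmorphN1 mulN1r. Qed.

Lemma scal_sum (I : Type) (s : seq I) (P : pred I) c (F : I -> K) :
  scal c (\sum_(i <- s | P i) F i) = \sum_(i <- s | P i) scal c (F i).
Proof. by rewrite /scal mulr_sumr. Qed.

Lemma fderiv_scal v c f : fderiv v (scal c f) = scal c (fderiv v f).
Proof. by rewrite /scal fderivM fderiv_tofrac pderivC rmorph0 mul0r add0r. Qed.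

Lemma meval_linform (a : 'rV[R]_r) (z : 'cV[R[i]]_r) :
  meval (fun i => z i 0) (linform a) = evalC a z.
Proof.
rewrite /linform /evalC mxE rmorph_sum; apply: eq_bigr => i _ /=.
by rewrite mevalZ mevalXU mxE.
Qed.

Lemma linform_eq0 (a : 'rV[R]_r) : (linform a == 0) = (a == 0).
Proof.
apply/eqP/eqP => [E|->]; last by rewrite /linform big1 // => i _; rewrite mxE scale0r.
apply/rowP => j; rewrite mxE.
have /(congr1 (@complex.Re R)) := meval_linform a (\col_i (i == j)%:R).
rewrite E meval0 /evalC mxE (bigD1 j) //= !mxE eqxx mulr1 big1 => [|i ij].
  by rewrite addr0 /= => ->.
by rewrite !mxE (negbTE ij) mulr0.
Qed.

Lemma pderiv_linform v a : pderiv v (linform a) = mpolyC r (evalC a v).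
Proof.
rewrite /linform /pderiv /evalC mxE rmorph_sum /=; apply: eq_bigr => i _.
rewrite (raddf_sum (@mderiv r R[i] i)) (bigD1 i) //= big1 => [|j ji].
  rewrite mderivZ mderivX mnm1E eqxx.
  have -> : (mnm_sub (mnm1 i) (mnm1 i)) = mnm0 by apply/mnmP => k; rewrite mnmBE subnn mnm0E.
  rewrite mpolyX0 scale1r addr0 !mxE.
  by rewrite alg_mpolyC mulrC mpolyCM mul_mpolyC.
by rewrite mderivZ mderivX mnm1E (negbTE ji) scale0r scaler0.
Qed.

Section RHclosure.
Variable Phip : {fset 'rV[R]_r}.
Hypothesis Phip0 : 0 \notin Phip.

Lemma linform_prod_neq0 (b : seq 'rV[R]_r) : {subset b <= Phip} ->
  \prod_(a <- b) linform a != 0.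
Proof.
move=> bP; rewrite prodf_seq_neq0; apply/allP => a /bP aP; rewrite linform_eq0.
by apply: contraNneq Phip0 => <-.
Qed.

Lemma RH_tofrac p : RH Phip (tofrac p).
Proof. by exists p, [::]; split=> //; rewrite big_nil tofracE. Qed.

Lemma RHM f g : RH Phip f -> RH Phip g -> RH Phip (f * g).
Proof.
move=> [p [b [bP ->]]] [p' [b' [bP' ->]]]; exists (p * p'), (b ++ b').
by rewrite ratfracM big_cat; split=> // a; rewrite mem_cat => /orP[/bP|/bP'].
Qed.

Lemma RHD f g : RH Phip f -> RH Phip g -> RH Phip (f + g).
Proof.
move=> [p [b [bP ->]]] [p' [b' [bP' ->]]].
rewrite ratfracD ?linform_prod_neq0 // -big_cat; eexists _, (b ++ b'); split=> // a.
by rewrite mem_cat => /orP[/bP|/bP'].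
Qed.

Lemma RH_scal c f : RH Phip f -> RH Phip (scal c f).
Proof. by move=> fR; apply: RHM => //; apply: RH_tofrac. Qed.

Lemma RH_linformXz a (k : int) : a \in Phip -> RH Phip (tofrac (linform a) ^ k).
Proof.
move=> aP; case: k => j; first by rewrite -exprnP -rmorphXn; apply: RH_tofrac.
rewrite NegzE -exprnN; exists 1, (nseq j.+1 a); split.
  by move=> x; rewrite mem_nseq => /andP[_ /eqP->].
by rewrite /ratfrac big_nseq rmorph1 div1r iter_mulr_1 rmorphXn.
Qed.

Lemma dRH0 : dRH Phip 0.
Proof. by exists [::]; split=> //; rewrite big_nil. Qed.

Lemma dRHD f g : dRH Phip f -> dRH Phip g -> dRH Phip (f + g).
Proof.
move=> [s [sP ->]] [s' [sP' ->]]; exists (s ++ s'); rewrite big_cat; split=> // x.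
by rewrite mem_cat => /orP[/sP|/sP'].
Qed.

Lemma dRH_fderiv v g : RH Phip g -> dRH Phip (fderiv v g).
Proof.
move=> gR; exists [:: (v, g)]; rewrite big_seq1; split=> // x.
by rewrite inE => /eqP ->.
Qed.

Lemma dRH_scal c f : dRH Phip f -> dRH Phip (scal c f).
Proof.
move=> [s [sP ->]]; exists [seq (x.1, scal c x.2) | x <- s]; split.
  by move=> _ /mapP [x xs ->]; apply: RH_scal; apply: sP.
by rewrite big_map scal_sum; apply: eq_bigr => x _; rewrite fderiv_scal.
Qed.

Lemma dRHB f g : dRH Phip f -> dRH Phip g -> dRH Phip (f - g).
Proof. by move=> df dg; apply: dRHD => //; rewrite -scalN1; apply: dRH_scal. Qed.

Lemma SH0 : SH Phip 0.
Proof. by exists (fun=> 0); rewrite big1 // => s _; rewrite scal0. Qed.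

Lemma SHD f g : SH Phip f -> SH Phip g -> SH Phip (f + g).
Proof.
move=> [c ->] [c' ->]; exists (fun s => c s + c' s).
by rewrite -big_split; apply: eq_bigr => s _; rewrite scalDl.
Qed.

Lemma SH_scal k f : SH Phip f -> SH Phip (scal k f).
Proof.
move=> [c ->]; exists (fun s => k * c s).
by rewrite scal_sum; apply: eq_bigr => s _; rewrite scal_scal.
Qed.

Lemma SHB f g : SH Phip f -> SH Phip g -> SH Phip (f - g).
Proof. by move=> df dg; apply: SHD => //; rewrite -scalN1; apply: SH_scal. Qed.

Lemma SH_fsigma (s : {fset 'rV[R]_r}) : (s `<=` Phip)%fset -> basis_of fullv s ->
  SH Phip (fsigma s).
Proof.
move=> sP sb; exists (fun t => (t == s)%:R).
rewrite big_mkcond (big_fsetD1 s) ?fpowersetE //= sb eqxx scal1 big_seq big1 ?addr0 // => t.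
by rewrite in_fsetD1 => /andP[/negbTE -> _]; rewrite scal0 if_same.
Qed.

End RHclosure.
End Fractions.

(** * Iterated residues *)

Section LaurentModule.
Variables (C : fieldType) (r : nat).
Local Notation A := (mpoly r C).
Local Notation G := ('rV[int]_r).
Implicit Types (P Q : A) (m g : G -> C) (k : G) (i j l : 'I_r).

Definition lincomb (phi : multinom r -> C) P : C :=
  \sum_(e <- msupp P) mcoeff e P * phi e.

Lemma lincombE phi P (s : seq (multinom r)) : uniq s -> {subset msupp P <= s} ->
  lincomb phi P = \sum_(e <- s) mcoeff e P * phi e.
Proof.
move=> us sub; rewrite (bigID [in msupp P]) /= [X in _ = _ + X]big1 ?addr0; last first.
  by move=> e; rewrite -mcoeff_eq0 => /eqP ->; rewrite mul0r.
rewrite -[RHS]big_filter; apply: perm_big; apply: uniq_perm.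
- exact: msupp_uniq.
- by rewrite filter_uniq.
by move=> e; rewrite mem_filter; case: (boolP (e \in msupp P)) => // /sub ->.
Qed.

Lemma lincombD phi : {morph lincomb phi : P Q / P + Q}.
Proof.
move=> P Q; pose s := undup (msupp P ++ msupp Q ++ msupp (P + Q)).
have us : uniq s by apply: undup_uniq.
rewrite !(@lincombE _ _ s) // => [|e|e|e]; rewrite ?mem_undup ?mem_cat.
- by rewrite -big_split; apply: eq_bigr => e _; rewrite mcoeffD mulrDl.
- by move=> ->; rewrite !orbT.
- by move=> ->.
- by move=> ->; rewrite !orbT.
Qed.

Lemma lincomb0 phi : lincomb phi 0 = 0.
Proof. by rewrite /lincomb msupp0 big_nil. Qed.

Lemma lincombZ phi c P : lincomb phi (c *: P) = c * lincomb phi P.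
Proof.
have [->|c0] := eqVneq c 0; first by rewrite scale0r mul0r lincomb0.
rewrite (@lincombE _ (c *: P) (msupp P)) ?msupp_uniq // => [|e].
  by rewrite /lincomb mulr_sumr; apply: eq_bigr => e _; rewrite mcoeffZ mulrA.
by rewrite (perm_mem (msuppZ _ c0)).
Qed.

Lemma lincombX phi e : lincomb phi (mpolyX C e) = phi e.
Proof. by rewrite /lincomb msuppX big_seq1 mcoeffX eqxx mul1r. Qed.

Lemma lincomb_sum phi (I : Type) (s : seq I) (p : pred I) (F : I -> A) :
  lincomb phi (\sum_(x <- s | p x) F x) = \sum_(x <- s | p x) lincomb phi (F x).
Proof. exact: (big_morph _ (lincombD phi) (lincomb0 phi)). Qed.

Lemma lincombM phi P Q :
  lincomb phi (P * Q) = lincomb (fun e => lincomb (fun e' => phi (mnm_add e e')) Q) P.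
Proof.
rewrite mpolyME lincomb_sum big_allpairs_dep /=; apply: eq_bigr => e _.
rewrite /lincomb mulr_sumr; apply: eq_bigr => e' _ /=.
by rewrite -/(lincomb phi _) lincombZ lincombX mulrA.
Qed.

Lemma lincomb_mderiv phi P i :
  lincomb phi (mderiv i P) = lincomb (fun e => (e i)%:R * phi (mnm_sub e (mnm1 i))) P.
Proof.
rewrite {1}[P]mpolyE (raddf_sum (@mderiv r C i)) lincomb_sum; apply: eq_bigr => e _.
by rewrite /= mderivZ mderivX !lincombZ lincombX.
Qed.

Lemma lincomb_comb phi phi' c P :
  lincomb (fun e => c * phi e + phi' e) P = c * lincomb phi P + lincomb phi' P.
Proof.
rewrite /lincomb mulr_sumr -big_split; apply: eq_bigr => e _ /=.
by rewrite mulrDr mulrCA.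
Qed.

Definition mnm_row (e : multinom r) : G := \row_i (e i)%:Z.
Definition unit_row i : G := \row_l (i == l)%:Z.

Lemma mnm_row1 i : mnm_row (mnm1 i) = unit_row i.
Proof. by apply/rowP => l; rewrite !mxE mnm1E. Qed.

Lemma mnm_rowD e e' : mnm_row (mnm_add e e') = mnm_row e + mnm_row e'.
Proof. by apply/rowP => l; rewrite !mxE mnmDE PoszD. Qed.

(* [m] stands for the Laurent series [sum_k m(k) y^k], on which polynomials act
   by multiplication and [laurent_deriv i] by the derivative in [y_i]. *)
Definition poly_act P m : G -> C := fun k => lincomb (fun e => m (k - mnm_row e)) P.

Lemma poly_actM P Q m : poly_act (P * Q) m = poly_act P (poly_act Q m).
Proof.
apply/funext => k; rewrite /poly_act lincombM; congr (lincomb _ P).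
apply/funext => e; congr (lincomb _ Q); apply/funext => e'.
by rewrite mnm_rowD opprD addrA.
Qed.

Lemma poly_actD P Q m k : poly_act (P + Q) m k = poly_act P m k + poly_act Q m k.
Proof. exact: lincombD. Qed.

Lemma poly_actZ c P m k : poly_act (c *: P) m k = c * poly_act P m k.
Proof. exact: lincombZ. Qed.

Lemma poly_act_comb P c m m' :
  poly_act P (fun k => c * m k + m' k) = (fun k => c * poly_act P m k + poly_act P m' k).
Proof. by apply/funext => k; exact: lincomb_comb. Qed.

Lemma poly_act1 m : poly_act 1 m = m.
Proof.
apply/funext => k; rewrite /poly_act -[1]mpolyX0 lincombX; congr m.
by apply/rowP => l; rewrite !mxE mnm0E subr0.
Qed.

Lemma poly_actC c m k : poly_act (mpolyC r c) m k = c * m k.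
Proof. by rewrite -alg_mpolyC poly_actZ poly_act1. Qed.

Definition laurent_deriv i m : G -> C := fun k => (k 0 i + 1)%:~R * m (k + unit_row i).

Lemma laurent_deriv_act i P m k :
  laurent_deriv i (poly_act P m) k =
  poly_act (mderiv i P) m k + poly_act P (laurent_deriv i m) k.
Proof.
rewrite /laurent_deriv /poly_act lincomb_mderiv.
rewrite /lincomb mulr_sumr -big_split; apply: eq_bigr => e _ /=.
have -> : k - mnm_row e + unit_row i = k + unit_row i - mnm_row e by rewrite addrAC.
have [e0|e0] := posnP (e i).
  by rewrite e0 mul0r mulr0 add0r !mxE e0 subr0 mulrCA.
have -> : k - mnm_row (mnm_sub e (mnm1 i)) = k + unit_row i - mnm_row e.
  apply/rowP => l; rewrite !mxE mnmBE mnm1E.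
  case: eqP => [<-|_] /=; last by rewrite subn0 addr0.
  by rewrite -subzn //=; ring.
by rewrite -mulrDr -mulrDl mulrCA !mxE; congr (_ * (_ * _)); rewrite !(rmorphD, rmorphN, rmorph1) /=; ring.
Qed.

(* Weights increase with the index, so expanding a linear form around its first
   nonzero coordinate makes all other monomials of the quotient heavier. *)
Definition weight k : int := \sum_(i < r) i%:Z * k 0 i.

Lemma weightD : {morph weight : k k' / k + k'}.
Proof. by move=> k k'; rewrite -big_split; apply: eq_bigr => i _; rewrite mxE mulrDr. Qed.

Lemma weightN k : weight (- k) = - weight k.
Proof. by rewrite -sumrN; apply: eq_bigr => i _; rewrite mxE mulrN. Qed.

Lemma weight_unit i : weight (unit_row i) = i%:Z.
Proof.
rewrite /weight (bigD1 i) //= !mxE eqxx mulr1 big1 ?addr0 // => l li.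
by rewrite !mxE eq_sym (negbTE li) mulr0.
Qed.

Lemma weight_mnm_ge0 e : 0 <= weight (mnm_row e).
Proof. by apply: sumr_ge0 => i _; rewrite mxE mulr_ge0. Qed.

(** Among the Laurent series with weights bounded below, division by a nonzero linear form has
    exactly one result; this class makes the expansion of a rational function well defined. *)
Definition bounded m := exists N : int, forall k, weight k < N -> m k = 0.

Lemma bounded_comb c m m' : bounded m -> bounded m' -> bounded (fun k => c * m k + m' k).
Proof.
move=> [N mN] [N' mN']; exists (Num.min N N') => k; rewrite lt_min => /andP[kN kN'].
by rewrite mN // mN' // mulr0 addr0.
Qed.

Lemma bounded_act P m : bounded m -> bounded (poly_act P m).
Proof.
move=> [N mN]; exists N => k kN; rewrite /poly_act /lincomb big1 // => e _.
rewrite mN ?mulr0 // weightD weightN; apply: le_lt_trans kN.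
by rewrite lerBlDr lerDl weight_mnm_ge0.
Qed.

Lemma bounded_deriv i m : bounded m -> bounded (laurent_deriv i m).
Proof.
move=> [N mN]; exists (N - i%:Z) => k kN; rewrite /laurent_deriv mN ?mulr0 //.
by rewrite weightD weight_unit -ltrBrDr.
Qed.

Definition delta0 : G -> C := fun k => (k == 0)%:R.

Lemma bounded_delta0 : bounded delta0.
Proof.
exists 0 => k; rewrite /delta0; case: eqP => // ->.
by rewrite /weight big1 // => i _; rewrite mxE mulr0.
Qed.

Section LinearForm.
Variables (c : 'I_r -> C) (j : 'I_r).
Hypotheses (cj : c j != 0) (clt : forall i, (i < j)%N -> c i = 0).

Definition lform : A := \sum_(i < r) c i *: mpolyX C (mnm1 i).

Lemma lform_act m k : poly_act lform m k = \sum_(i < r) c i * m (k - unit_row i).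
Proof.
rewrite /poly_act lincomb_sum; apply: eq_bigr => i _.
by rewrite lincombZ lincombX mnm_row1.
Qed.

Lemma lform_actE m k : poly_act lform m (k + unit_row j) =
  c j * m k + \sum_(i < r | (j < i)%N) c i * m (k + unit_row j - unit_row i).
Proof.
rewrite lform_act (bigD1 j) //= addrK; congr (_ + _).
rewrite (bigID (fun i : 'I_r => (j < i)%N)) /= [X in _ + X]big1 ?addr0.
  by apply: eq_bigl => i; case: ltngtP => // ji; rewrite ?andbT ?andbF // -?val_eqE ?gt_eqF.
move=> i /andP[ij]; rewrite -leqNgt leq_eqVlt => /orP[/eqP/val_inj iE|/clt ->].
  by rewrite iE eqxx in ij.
by rewrite mul0r.
Qed.

Lemma weight_shift k i : (j < i)%N -> weight (k + unit_row j - unit_row i) < weight k.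
Proof. by move=> ji; rewrite !(weightD, weightN, weight_unit); lia. Qed.

(** The coefficient of the product at [k + unit_row j] is [c j * m k] plus values of [m] at smaller
    weights, so [m] vanishes by induction on the weight, starting from its bound. *)
Lemma lform_act_inj m : bounded m -> poly_act lform m = (fun=> 0) -> m = (fun=> 0).
Proof.
move=> [N mN] m0; apply/funext => k.
have: forall n k, weight k < N + n%:Z -> m k = 0.
  elim=> [|n IH] {}k; first by rewrite addr0; apply: mN.
  move=> kn; apply: (mulfI cj); rewrite mulr0.
  have := lform_actE m k; rewrite m0 big1 ?addr0 // => i ji.
  by rewrite IH ?mulr0 //; have := weight_shift k ji; move: kn; lia.
by move/(_ (absz (weight k - N)).+1); apply; lia.
Qed.

(** The recursion that divides by the linear form, with fuel [n]. The recursive calls lower the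
    weight and [g] vanishes at small weights, so the value at [k] no longer depends on [n] once [n]
    is large. *)
Fixpoint inv_approx g (n : nat) : G -> C :=
  if n is n'.+1 then fun k =>
    (g (k + unit_row j) -
      \sum_(i < r | (j < i)%N) c i * inv_approx g n' (k + unit_row j - unit_row i)) / c j
  else fun=> 0.

Lemma inv_approxS g n k : inv_approx g n.+1 k = (g (k + unit_row j) -
    \sum_(i < r | (j < i)%N) c i * inv_approx g n (k + unit_row j - unit_row i)) / c j.
Proof. by []. Qed.

Lemma inv_approx0 g N n k : (forall k, weight k < N -> g k = 0) ->
  weight k < N - j%:Z -> inv_approx g n k = 0.
Proof.
move=> gN; elim: n k => [//|n IH] k kN /=.
rewrite gN ?weightD ?weight_unit -?ltrBrDr // sub0r big1 ?oppr0 ?mul0r // => i ji.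
by rewrite IH ?mulr0 //; apply: lt_trans kN; apply: weight_shift.
Qed.

Lemma inv_approx_stable g N n k : (forall k, weight k < N -> g k = 0) ->
  weight k < N - j%:Z + n%:Z -> inv_approx g n.+1 k = inv_approx g n k.
Proof.
move=> gN; elim: n k => [|n IH] k kN.
  by rewrite addr0 in kN; rewrite !(inv_approx0 _ gN kN).
rewrite inv_approxS [RHS]inv_approxS; congr ((_ - _) / _); apply: eq_bigr => i ji; congr (_ * _).
by apply: IH; have := weight_shift k ji; move: kN; lia.
Qed.

(** The last clause follows the degree in the variable [l]: a form that starts at [l] lowers it by
    one, and a form that starts later or lies on another axis does not raise it. It serves to show
    that certain iterated residues vanish. *)
Lemma lform_act_surj g : bounded g -> exists m, [/\ bounded m, poly_act lform m = g &
  forall l (d : int), (l <= j)%N \/ (l != j /\ forall i, i != j -> c i = 0) ->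
    (forall k, g k != 0 -> k 0 l <= d) ->
    forall k, m k != 0 -> k 0 l <= d - (l == j)%:Z].
Proof.
move=> [N gN]; pose n k := (absz (weight k - (N - j%:Z))%R).+1.
pose m k := inv_approx g (n k) k.
have mE k n' : weight k < N - j%:Z + n'%:Z -> inv_approx g n' k = m k.
  move=> kn.
  have st a : weight k < N - j%:Z + a%:Z -> forall b, inv_approx g (b + a) k = inv_approx g a k.
    move=> ka; elim=> [//|b <-]; apply: (inv_approx_stable gN); apply: lt_le_trans ka _.
    by rewrite lerD2l lez_nat leq_addl.
  have kn' : weight k < N - j%:Z + (n k)%:Z by rewrite /n; lia.
  by rewrite -(st _ kn (n k)) addnC (st _ kn' n').
have mrec k : m k = (g (k + unit_row j) -
    \sum_(i < r | (j < i)%N) c i * m (k + unit_row j - unit_row i)) / c j.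
  rewrite -(mE k (n k).+1) ?inv_approxS.
    congr ((_ - _) / _); apply: eq_bigr => i ji; congr (_ * _); apply: mE.
    by have := weight_shift k ji; rewrite /n; lia.
  by rewrite /n; lia.
exists m; split.
- by exists (N - j%:Z) => k kN; rewrite -(mE k 0%N) ?addr0.
- apply/funext => k; rewrite -[k in LHS](subrK (unit_row j)) lform_actE mrec subrK.
  by rewrite mulrCA divff // mulr1 subrK.
move=> l d lj gd k; apply: contra_neqT; rewrite -ltNge => kd.
rewrite /m; move: (n k) => n0; elim: n0 k kd => [//|n' IH] k kd /=.
have -> : g (k + unit_row j) = 0.
  apply/eqP/negPn/negP => /gd; rewrite leNgt !mxE => /negP; apply.
  by move: kd; rewrite ltrBlDr (eq_sym l j).
rewrite sub0r big1 ?oppr0 ?mul0r // => i ji; rewrite /=.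
case: lj => [lj|[_ ci]]; last by rewrite ci ?mul0r // -val_eqE gt_eqF.
rewrite IH ?mulr0 // !mxE; apply: lt_le_trans kd _.
have -> : (i == l) = false by apply/negP => /eqP il; move: ji; rewrite il ltnNge lj.
by rewrite subr0 lerDl.
Qed.

End LinearForm.
End LaurentModule.

Section LinearSubstitution.
Variables (C : fieldType) (r : nat) (B : 'M[C]_r).
Local Notation A := (mpoly r C).

Definition lin_subst (P : A) : A :=
  comp_mpoly [tuple lform (fun i => B l i) | l < r] P.

Lemma lin_substD : {morph lin_subst : P Q / P + Q}.
Proof. by move=> P Q; rewrite /lin_subst comp_mpolyD. Qed.

Lemma lin_substM : {morph lin_subst : P Q / P * Q}.
Proof. by move=> P Q; rewrite /lin_subst rmorphM. Qed.

Lemma lin_subst0 : lin_subst 0 = 0.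
Proof. by rewrite /lin_subst comp_mpoly0. Qed.

Lemma lin_subst1 : lin_subst 1 = 1.
Proof. by rewrite /lin_subst comp_mpoly1. Qed.

Lemma lin_substC c : lin_subst (mpolyC r c) = mpolyC r c.
Proof. by rewrite /lin_subst comp_mpolyC. Qed.

Lemma lin_substZ c P : lin_subst (c *: P) = c *: lin_subst P.
Proof. by rewrite /lin_subst comp_mpolyZ. Qed.

Lemma lin_substX l : lin_subst (mpolyX C (mnm1 l)) = lform (fun i => B l i).
Proof. by rewrite /lin_subst comp_mpolyXU -tnth_nth tnth_mktuple. Qed.

Lemma lin_subst_sum (I : Type) (s : seq I) (p : pred I) (F : I -> A) :
  lin_subst (\sum_(x <- s | p x) F x) = \sum_(x <- s | p x) lin_subst (F x).
Proof. exact: (big_morph _ lin_substD lin_subst0). Qed.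

Lemma lin_subst_lform (a : 'rV[C]_r) :
  lin_subst (lform (fun l => a 0 l)) = lform (fun i => (a *m B) 0 i).
Proof.
rewrite {1}/lform lin_subst_sum.
under eq_bigr => l _ do rewrite lin_substZ lin_substX /lform scaler_sumr.
rewrite exchange_big; apply: eq_bigr => i _ /=; rewrite mxE scaler_suml.
by apply: eq_bigr => l _; rewrite scalerA.
Qed.

Lemma mderiv_lform i (c : 'I_r -> C) : mderiv i (lform c) = mpolyC r (c i).
Proof.
rewrite /lform (raddf_sum (@mderiv r C i)) (bigD1 i) //= big1 => [|l li].
  rewrite mderivZ mderivX mnm1E eqxx.
  have -> : (mnm_sub (mnm1 i) (mnm1 i)) = mnm0 by apply/mnmP => k; rewrite mnmBE subnn mnm0E.
  by rewrite mpolyX0 scale1r addr0 alg_mpolyC.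
by rewrite mderivZ mderivX mnm1E (negbTE li) scale0r scaler0.
Qed.

Definition dir_deriv (w : 'cV[C]_r) (P : A) : A := \sum_(i < r) w i 0 *: mderiv i P.

Lemma dir_derivD w : {morph dir_deriv w : P Q / P + Q}.
Proof.
by move=> P Q; rewrite -big_split; apply: eq_bigr => i _; rewrite mderivD scalerDr.
Qed.

Lemma dir_derivM w P Q : dir_deriv w (P * Q) = dir_deriv w P * Q + P * dir_deriv w Q.
Proof.
rewrite /dir_deriv mulr_suml mulr_sumr -big_split; apply: eq_bigr => i _ /=.
by rewrite mderivM scalerDr scalerAl scalerAr.
Qed.

Lemma dir_derivC w c : dir_deriv w (mpolyC r c) = 0.
Proof. by rewrite /dir_deriv big1 // => i _; rewrite mderivC scaler0. Qed.

Lemma mpoly_alg_ind (p : A -> Prop) :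
  (forall c, p (mpolyC r c)) -> (forall l, p (mpolyX C (mnm1 l))) ->
  (forall P Q, p P -> p Q -> p (P + Q)) -> (forall P Q, p P -> p Q -> p (P * Q)) ->
  forall P, p P.
Proof.
move=> pC pX pD pM P; rewrite [P]mpolyE; elim/big_rec: _ => [|e Q _ pQ].
  by rewrite -mpolyC0.
apply: (pD) => //; rewrite -mul_mpolyC; apply: (pM) => //; rewrite mpolyXE_id.
elim/big_rec: _ => [|l Q' _ pQ']; first by rewrite -mpolyC1.
apply: (pM) => //; elim: (e l) => [|n IH]; first by rewrite expr0 -mpolyC1.
by rewrite exprS; apply: (pM).
Qed.

Lemma lin_subst_deriv (w : 'cV[C]_r) P :
  lin_subst (dir_deriv (B *m w) P) = dir_deriv w (lin_subst P).
Proof.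
elim/mpoly_alg_ind: P => [c|l|P Q IP IQ|P Q IP IQ].
- by rewrite lin_substC !dir_derivC lin_subst0.
- rewrite lin_substX.
  have -> : mpolyX C (mnm1 l) = lform (fun i => (i == l)%:R).
    rewrite /lform (bigD1 l) //= eqxx scale1r big1 ?addr0 // => i /negbTE ->.
    by rewrite scale0r.
  rewrite /dir_deriv lin_subst_sum.
  under eq_bigr => i _ do rewrite mderiv_lform lin_substZ lin_substC.
  under [RHS]eq_bigr => i _ do rewrite mderiv_lform.
  rewrite (bigD1 l) //= eqxx big1 ?addr0 => [|i /negbTE ->]; last by rewrite mpolyC0 scaler0.
  rewrite mxE scaler_suml; apply: eq_bigr => i _.
  by rewrite -!mul_mpolyC mpolyC1 mulr1 -mpolyCM mulrC.
- by rewrite dir_derivD !lin_substD dir_derivD IP IQ.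
- by rewrite dir_derivM !(lin_substD, lin_substM) dir_derivM IP IQ.
Qed.

End LinearSubstitution.

(** * Laurent expansion of rational functions along a basis *)

Section LaurentExpansion.
Variables (R : realType) (r : nat) (Phip : {fset 'rV[R]_r}) (S : 'M[R]_r).
Hypotheses (Phip0 : 0 \notin Phip) (Su : S \in unitmx).
Local Notation C := R[i].
Local Notation A := (mpoly r C).
Local Notation K := {fraction (mpoly r R[i])}.
Local Notation G := ('rV[int]_r).
Local Notation toC := (map_mx (real_complex R)).
Implicit Types (P Q : A) (m : G -> C) (k : G) (a : 'rV[R]_r) (f g : K).

Lemma real_complex_eq0 (x : R) : (x%:C == 0 :> C) = (x == 0).
Proof. by rewrite eq_complex /= eqxx andbT. Qed.

Definition linform_prod (b : seq 'rV[R]_r) : A := \prod_(a <- b) linform a.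

Lemma linform_prod_cat b b' : linform_prod (b ++ b') = linform_prod b * linform_prod b'.
Proof. exact: big_cat. Qed.

Lemma linform_prod_cons a b : linform_prod (a :: b) = linform a * linform_prod b.
Proof. exact: big_cons. Qed.

Lemma linform_prod_nil : linform_prod [::] = 1.
Proof. exact: big_nil. Qed.

Lemma linform_prod_nz b : {subset b <= Phip} -> linform_prod b != 0.
Proof. exact: (linform_prod_neq0 Phip0). Qed.

Definition coordmx a : 'rV[R]_r := a *m invmx S.

Definition expand_act P m : G -> C := poly_act (lin_subst (toC (invmx S)) P) m.

Lemma expand_actM P Q m : expand_act (P * Q) m = expand_act P (expand_act Q m).
Proof. by rewrite /expand_act lin_substM poly_actM. Qed.

Lemma expand_act_swap P Q m :
  expand_act P (expand_act Q m) = expand_act Q (expand_act P m).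
Proof. by rewrite -!expand_actM mulrC. Qed.

Lemma expand_act1 m : expand_act 1 m = m.
Proof. by rewrite /expand_act lin_subst1 poly_act1. Qed.

Lemma expand_actD P Q m k : expand_act (P + Q) m k = expand_act P m k + expand_act Q m k.
Proof. by rewrite /expand_act lin_substD poly_actD. Qed.

Lemma expand_actC c m : expand_act (mpolyC r c) m = (fun k => c * m k).
Proof. by apply/funext => k; rewrite /expand_act lin_substC poly_actC. Qed.

Lemma expand_actN P m k : expand_act (- P) m k = - expand_act P m k.
Proof.
have -> : - P = mpolyC r (-1) * P by rewrite mpolyCN mpolyC1 mulN1r.
by rewrite expand_actM expand_actC mulN1r.
Qed.

Lemma expand_act_comb P c m m' :
  expand_act P (fun k => c * m k + m' k) =
  (fun k => c * expand_act P m k + expand_act P m' k).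
Proof. exact: poly_act_comb. Qed.

Lemma expand_act0 P : expand_act P (fun=> 0) = (fun=> 0).
Proof.
apply/funext => k; rewrite /expand_act /poly_act /lincomb.
by apply: big1 => e _; exact: mulr0.
Qed.

Lemma bounded_expand_act P m : bounded m -> bounded (expand_act P m).
Proof. exact: bounded_act. Qed.

Lemma lin_subst_linform a :
  lin_subst (toC (invmx S)) (linform a) = lform (fun i => (coordmx a 0 i)%:C).
Proof.
have -> : linform a = lform (fun l => toC a 0 l).
  by apply: eq_bigr => l _; rewrite mxE.
rewrite lin_subst_lform -map_mxM; congr lform; apply/funext => i; by rewrite mxE.
Qed.

Definition expand_deriv (v : 'cV[C]_r) m : G -> C :=
  fun k => \sum_(i < r) (toC S *m v) i 0 * laurent_deriv i m k.

Lemma expand_deriv_act v P m k : expand_deriv v (expand_act P m) k =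
  expand_act (pderiv v P) m k + expand_act P (expand_deriv v m) k.
Proof.
rewrite /expand_deriv /expand_act.
under eq_bigr => i _ do rewrite laurent_deriv_act mulrDr.
rewrite big_split /=; congr (_ + _).
  have -> : pderiv v P = dir_deriv (toC (invmx S) *m (toC S *m v)) P.
    by rewrite mulmxA -map_mxM mulVmx // map_mx1 mul1mx.
  rewrite lin_subst_deriv /dir_deriv /poly_act lincomb_sum.
  by apply: eq_bigr => i _; rewrite lincombZ.
rewrite /poly_act /lincomb; under eq_bigr => i _ do rewrite mulr_sumr.
rewrite exchange_big; apply: eq_bigr => e _ /=.
by rewrite mulr_sumr; apply: eq_bigr => i _; rewrite mulrCA.
Qed.

Lemma bounded_expand_deriv v m : bounded m -> bounded (expand_deriv v m).
Proof.
move=> mb; have all_b s : bounded (fun k => \sum_(i <- s) (toC S *m v) i 0 * laurent_deriv i m k).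
  elim: s => [|i s IH]; first by exists 0 => k _; rewrite big_nil.
  rewrite (_ : (fun k => _) = (fun k => (toC S *m v) i 0 * laurent_deriv i m k +
      \sum_(i <- s) (toC S *m v) i 0 * laurent_deriv i m k)).
    by apply: bounded_comb => //; apply: bounded_deriv.
  by apply/funext => k; rewrite big_cons.
exact: (all_b (index_enum 'I_r)).
Qed.

Definition lead_ge (l : 'I_r) a := [forall i : 'I_r, (i < l)%N ==> (coordmx a 0 i == 0)].
Definition lead_eq (l : 'I_r) a := lead_ge l a && (coordmx a 0 l != 0).
Definition on_axis (j : 'I_r) a := [forall i : 'I_r, (i != j) ==> (coordmx a 0 i == 0)].

Lemma lead_exists a : a \in Phip -> exists l, lead_eq l a.
Proof.
move=> aP; have [i ai]: exists i : 'I_r, coordmx a 0 i != 0.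
  apply: contrapT => H; move: Phip0; rewrite -(_ : a = 0) ?aP //.
  rewrite -[a](mulmxKV Su) -/(coordmx a) (_ : coordmx a = 0) ?mul0mx //.
  by apply/rowP => i; rewrite [RHS]mxE; apply: contrapT => /eqP ai; apply: H; exists i.
case: (@arg_minnP _ i (fun i : 'I_r => coordmx a 0 i != 0) (fun i => nat_of_ord i) ai) => l al lmin.
exists l; rewrite /lead_eq al andbT; apply/forallP => i'; apply/implyP => il.
by apply: contraTT il => /lmin; rewrite -leqNgt.
Qed.

Lemma expand_linform_inj a m : a \in Phip -> bounded m ->
  expand_act (linform a) m = (fun=> 0) -> m = (fun=> 0).
Proof.
move=> /lead_exists [l /andP[/forallP lg ll]] mb.
rewrite /expand_act lin_subst_linform; apply: (@lform_act_inj _ _ _ l) mb.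
  by rewrite real_complex_eq0.
by move=> i il; have /implyP /(_ il) /eqP -> := lg i.
Qed.

Lemma expand_linform_surj a (g : G -> C) : a \in Phip -> bounded g ->
  exists m, [/\ bounded m, expand_act (linform a) m = g &
  forall l (d : int), lead_ge l a \/ (exists2 j : 'I_r, (j < l)%N & on_axis j a) ->
    (forall k, g k != 0 -> k 0 l <= d) ->
    forall k, m k != 0 -> k 0 l <= d - (lead_eq l a)%:Z].
Proof.
move=> /lead_exists [j aj] gb; have /andP[/forallP jg jj] := aj.
have [||m [mb mE ms]] := @lform_act_surj C r (fun i => (coordmx a 0 i)%:C) j _ _ g gb.
- by rewrite real_complex_eq0.
- by move=> i il; have /implyP /(_ il) /eqP -> := jg i.
exists m; split=> //; first by rewrite /expand_act lin_subst_linform.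
have leadE l : lead_eq l a = (l == j).
  apply/idP/eqP => [/andP[/forallP lg ll]|-> //].
  case: (ltngtP l j) => [h|h|/ord_inj //].
    by have := jg l; rewrite h (negbTE ll).
  by have := lg j; rewrite h (negbTE jj).
move=> l d la gd k mk; rewrite leadE; apply: ms gd _ mk.
case: la => [/forallP lg|[i il /forallP ia]].
  left; rewrite leqNgt; apply/negP => h.
  by have := lg j; rewrite h (negbTE jj).
have ij : j = i.
  by apply/eqP/negPn/negP => ji; have := ia j; rewrite ji (negbTE jj).
right; rewrite ij; split; first by rewrite -val_eqE gtn_eqF.
by move=> i' i'i; have /implyP /(_ i'i) /eqP -> := ia i'.
Qed.

Lemma expand_prod_inj b m : {subset b <= Phip} -> bounded m ->
  expand_act (linform_prod b) m = (fun=> 0) -> m = (fun=> 0).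
Proof.
elim: b m => [|a b IH] m bP mb; first by rewrite linform_prod_nil expand_act1.
rewrite linform_prod_cons mulrC expand_actM => E.
apply: (@expand_linform_inj a) => //; first by rewrite bP ?mem_head.
apply: IH => //; first by move=> x xb; rewrite bP // inE xb orbT.
exact: bounded_expand_act.
Qed.

Lemma expand_prod_surj b (g : G -> C) : {subset b <= Phip} -> bounded g ->
  exists m, [/\ bounded m, expand_act (linform_prod b) m = g &
  forall l (d : int),
    (forall a, a \in b -> lead_ge l a \/ (exists2 j : 'I_r, (j < l)%N & on_axis j a)) ->
    (forall k, g k != 0 -> k 0 l <= d) ->
    forall k, m k != 0 -> k 0 l <= d - (count (lead_eq l) b)%:Z].
Proof.
elim: b g => [|a b IH] g bP gb.
  exists g; rewrite linform_prod_nil expand_act1; split=> // l d _ gd k /gd.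
  by rewrite subr0.
have aP : a \in Phip by rewrite bP ?mem_head.
have [m [mb mE ms]] := expand_linform_surj aP gb.
have {}bP : {subset b <= Phip} by move=> x xb; rewrite bP // inE xb orbT.
have [m' [mb' mE' ms']] := IH m bP mb.
exists m'; rewrite linform_prod_cons expand_actM mE'; split=> // l d lb gd k mk.
rewrite /= PoszD opprD addrA; apply: ms' mk => [x xb|].
  by apply: lb; rewrite inE xb orbT.
by apply: ms => //; apply: lb; rewrite mem_head.
Qed.

(** The expansion is characterised by an equation instead of being constructed, so a candidate for a
    sum or a derivative has only to satisfy the cleared equation; injectivity of the action of the
    denominators gives uniqueness. *)
Definition expansion_of f m := exists P b, [/\ {subset b <= Phip},
  f = ratfrac P (linform_prod b), bounded m &
  expand_act (linform_prod b) m = expand_act P (@delta0 C r)].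

Lemma expansion_exists f : RH Phip f -> exists m, expansion_of f m.
Proof.
move=> [P [b [bP fE]]].
have [m [mb mE _]] := expand_prod_surj bP (bounded_expand_act P (@bounded_delta0 C r)).
by exists m, P, b; split; [exact: bP|exact: fE|exact: mb|exact: mE].
Qed.

Lemma expand_act_sub P m m' :
  expand_act P (fun k => -1 * m k + m' k) = (fun k => - expand_act P m k + expand_act P m' k).
Proof. by rewrite expand_act_comb; apply/funext => k; rewrite mulN1r. Qed.

Lemma expansion_unique f m m' : expansion_of f m -> expansion_of f m' -> m = m'.
Proof.
move=> [P [b [bP -> mb mE]]] [Q [b' [bP' E mb' mE']]].
have {}E : P * linform_prod b' = Q * linform_prod b.
  have := ratfrac_eq P Q (linform_prod_nz bP) (linform_prod_nz bP').
  by rewrite E eqxx => /esym/eqP.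
suff d0 : (fun k => -1 * m k + m' k) = (fun=> 0).
  apply/funext => k; have := congr1 (fun h => h k) d0.
  by rewrite mulN1r addrC => /eqP; rewrite subr_eq0 => /eqP.
apply: (@expand_prod_inj (b ++ b')).
- by move=> x; rewrite mem_cat => /orP[/bP|/bP'].
- exact: bounded_comb.
rewrite linform_prod_cat expand_act_sub; apply/funext => k.
rewrite {1}[linform_prod b * _]mulrC !expand_actM mE mE' -!expand_actM.
by rewrite [linform_prod b' * P]mulrC [linform_prod b * Q]mulrC E addrC subrr.
Qed.

Lemma expansion_comb c f g m m' : expansion_of f m -> expansion_of g m' ->
  expansion_of (scal c f + g) (fun k => c * m k + m' k).
Proof.
move=> [P [b [bP -> mb mE]]] [Q [b' [bP' -> mb' mE']]].
have d0 := linform_prod_nz bP; have d0' := linform_prod_nz bP'.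
set d := linform_prod b in d0 mE *; set d' := linform_prod b' in d0' mE' *.
exists (mpolyC r c * P * d' + Q * d), (b ++ b'); split.
- by move=> x; rewrite mem_cat => /orP[/bP|/bP'].
- rewrite linform_prod_cat /scal tofracE ratfracM mul1r; exact: ratfracD d0 d0'.
- exact: bounded_comb.
rewrite linform_prod_cat expand_act_comb; apply/funext => k.
rewrite -/d -/d' expand_actD.
have -> : expand_act (d * d') m = expand_act d' (expand_act P (@delta0 C r)).
  by rewrite expand_actM expand_act_swap mE.
have -> : expand_act (d * d') m' = expand_act d (expand_act Q (@delta0 C r)).
  by rewrite expand_actM mE'.
have -> : expand_act (mpolyC r c * P * d') (@delta0 C r) k =
    c * expand_act d' (expand_act P (@delta0 C r)) k.
  by rewrite -mulrA expand_actM expand_actC expand_actM expand_act_swap.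
have -> : expand_act (Q * d) (@delta0 C r) = expand_act d (expand_act Q (@delta0 C r)).
  by rewrite mulrC expand_actM.
by [].
Qed.

Lemma expand_deriv_delta0 v : expand_deriv v (@delta0 C r) = (fun=> 0).
Proof.
apply/funext => k; rewrite /expand_deriv big1 // => i _; rewrite /laurent_deriv /delta0.
case: eqP => [/rowP /(_ i)|_]; last by rewrite !mulr0.
by rewrite !mxE eqxx => ->; rewrite mul0r mulr0.
Qed.

(** Leibniz applied to [d m = P] gives [d] times the derivative of [m]; a further factor [d]
    replaces [d m] by [P] in the remaining term and produces the quotient rule. *)
Lemma expansion_deriv v f m : expansion_of f m -> expansion_of (fderiv v f) (expand_deriv v m).
Proof.
move=> [P [b [bP -> mb mE]]]; set d := linform_prod b in mE *.
have d0 : d != 0 := linform_prod_nz bP.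
exists (pderiv v P * d - P * pderiv v d), (b ++ b); split.
- by move=> x; rewrite mem_cat orbb => /bP.
- by rewrite (fderivE _ _ d0) linform_prod_cat expr2.
- exact: bounded_expand_deriv.
have E k : expand_act d (expand_deriv v m) k =
    expand_act (pderiv v P) (@delta0 C r) k + -1 * expand_act (pderiv v d) m k.
  have := expand_deriv_act v d m k; rewrite mE expand_deriv_act expand_deriv_delta0.
  have -> : expand_act P (fun=> 0) k = 0.
    by rewrite expand_act0.
  by rewrite addr0 => ->; rewrite mulN1r addrAC subrr add0r.
rewrite linform_prod_cat expand_actM -/d (_ : expand_act d (expand_deriv v m) =
    (fun k => -1 * expand_act (pderiv v d) m k + expand_act (pderiv v P) (@delta0 C r) k)); last first.
  by apply/funext => k; rewrite E addrC.
have E1 : expand_act d (expand_act (pderiv v P) (@delta0 C r)) =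
    expand_act (pderiv v P * d) (@delta0 C r).
  by rewrite expand_act_swap expand_actM.
have E2 : expand_act d (expand_act (pderiv v d) m) =
    expand_act (P * pderiv v d) (@delta0 C r).
  by rewrite expand_act_swap mE expand_act_swap expand_actM.
rewrite expand_act_comb E1 E2; apply/funext => k.
by rewrite expand_actD expand_actN mulN1r [RHS]addrC.
Qed.

(* Coefficient of [1 / (y_1 ... y_r)] in the coordinates given by the rows of
   [S]; derivatives have none. *)
Definition iterated_residue f : C := xget (fun=> 0) (expansion_of f) (const_mx (-1)).

Lemma iterated_residueE f m : expansion_of f m -> iterated_residue f = m (const_mx (-1)).
Proof.
move=> fm; rewrite /iterated_residue; case: xgetP => [m' _ fm'|/(_ m) //].
by rewrite (expansion_unique fm' fm).
Qed.

Lemma iterated_residue_comb c f g : RH Phip f -> RH Phip g ->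
  iterated_residue (scal c f + g) = c * iterated_residue f + iterated_residue g.
Proof.
move=> /expansion_exists [m fm] /expansion_exists [m' gm'].
by rewrite (iterated_residueE (expansion_comb c fm gm')) (iterated_residueE fm) (iterated_residueE gm').
Qed.

Lemma iterated_residue_deriv v f : RH Phip f -> iterated_residue (fderiv v f) = 0.
Proof.
move=> /expansion_exists [m fm]; rewrite (iterated_residueE (expansion_deriv v fm)).
rewrite /expand_deriv big1 // => i _; rewrite /laurent_deriv !mxE addNr.
by rewrite mul0r mulr0.
Qed.

Lemma iterated_residue_axes b : {subset b <= Phip} -> perm_eq b [seq row i S | i <- enum 'I_r] ->
  iterated_residue (ratfrac 1 (linform_prod b)) = 1.
Proof.
move=> bP bE; rewrite (@iterated_residueE _ (fun k => (k == const_mx (-1))%:R)) ?eqxx //.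
exists 1, b; split=> //.
  exists (- \sum_(i < r) i%:Z) => k; case: eqP => // ->.
  by rewrite /weight -sumrN (eq_bigr (fun i : 'I_r => - i%:Z)) ?ltxx // => i _; rewrite mxE mulrN1.
rewrite expand_act1 /linform_prod (perm_big _ bE) big_map big_enum /=.
rewrite /expand_act (big_morph _ (@lin_substM C r _) (@lin_subst1 C r _)).
have -> : \prod_(i < r) lin_subst (toC (invmx S)) (linform (row i S)) =
    mpolyX C (Multinom [tuple 1%N | i < r]).
  rewrite mpolyXE_id; apply: eq_bigr => i _; rewrite mnmE expr1 lin_subst_linform.
  rewrite /lform (bigD1 i) //= big1 => [|l li].
    by rewrite /coordmx -row_mul mulmxV // row1 !mxE !eqxx addr0 scale1r.
  by rewrite /coordmx -row_mul mulmxV // row1 !mxE eqxx (negbTE li) scale0r.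
apply/funext => k; rewrite /poly_act lincombX /delta0; congr (_%:R); congr nat_of_bool.
rewrite subr_eq -[RHS](inj_eq (addIr (const_mx (-1)))) add0r; apply/eqP/eqP => [->|E].
  by apply/rowP => l; rewrite !mxE mnmE; ring.
by apply/rowP => l; have /rowP/(_ l) := E; rewrite !mxE mnmE => E'; apply: (addIr (-1)); rewrite E' -addrA.
Qed.

(** Each form starting at [l] lowers the degree in the variable [l] by one and the others do not
    raise it. With two such forms every exponent of that variable is at most -2, and the exponent -1
    does not occur. *)
Lemma iterated_residue_eq0 b l : {subset b <= Phip} ->
  (forall a, a \in b -> lead_ge l a \/ (exists2 j : 'I_r, (j < l)%N & on_axis j a)) ->
  (1 < count (lead_eq l) b)%N ->
  iterated_residue (ratfrac 1 (linform_prod b)) = 0.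
Proof.
move=> bP lb cb; have [m [mb mE ms]] := expand_prod_surj bP (@bounded_delta0 C r).
rewrite (@iterated_residueE _ m); last by exists 1, b; rewrite expand_act1.
apply/eqP/negPn/negP => /(ms _ 0 lb) H.
have: -1 <= 0 - (count (lead_eq l) b)%:Z :> int.
  move: H; rewrite mxE; apply => k; rewrite /delta0.
  by case: (k =P 0) => [-> _|_]; rewrite ?mxE // eqxx.
by move: cb; lia.
Qed.

End LaurentExpansion.

(** * The functional of a chamber *)

Section ExchangeSigns.
Variables (R : realFieldType) (T : eqType) (s : seq T) (l c : T -> R).

Lemma seq_argmin (P : pred T) (f : T -> R) : has P s ->
  exists g, [/\ g \in s, P g & forall h, h \in s -> P h -> f g <= f h].
Proof.
elim: s => [//|x t IH] /=; case: (boolP (has P t)) => [/IH [g [gt Pg gm]] _|nt]; last first.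
  rewrite orbF => Px; exists x; split; rewrite ?mem_head // => h.
  rewrite inE => /orP[/eqP -> //|ht Ph]; case/negP: nt; apply/hasP; by exists h.
case: (boolP (P x && (f x <= f g))) => [/andP[Px xg]|nx].
  exists x; split; rewrite ?mem_head // => h.
  rewrite inE => /orP[/eqP -> //|ht Ph]; exact: le_trans xg (gm h ht Ph).
exists g; split; rewrite ?inE ?gt ?orbT // => h.
rewrite inE => /orP[/eqP -> Px|]; last exact: gm.
by move: nx; rewrite Px /= -ltNge => /ltW.
Qed.

Definition exchange_ok g := (0 <= l g / c g) && all (fun h => 0 <= l h - l g / c g * c h) s.

Hypotheses (us : uniq s) (cpos : has (fun g => 0 < c g) s).
Hypothesis strict : forall g, g \in s -> c g != 0 -> exchange_ok g ->
  0 < l g / c g /\ forall h, h \in s -> h != g -> 0 < l h - l g / c g * c h.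

(** If [c g] and [c h] have the same sign, the two strict inequalities order the ratios [l g / c g]
    and [l h / c h] in opposite ways. *)
Lemma exchange_sign_unique g h : g \in s -> h \in s -> exchange_ok g -> exchange_ok h ->
  0 < c g * c h -> g = h.
Proof.
move=> gs hs gA hA gh; apply/eqP; apply: contraTT isT => nE.
have cg : c g != 0 by apply: contraTneq gh => ->; rewrite mul0r ltxx.
have ch : c h != 0 by apply: contraTneq gh => ->; rewrite mulr0 ltxx.
have [_ /(_ h hs)] := strict gs cg gA; rewrite eq_sym nE => /(_ isT) H1.
have [_ /(_ g gs nE) H2] := strict hs ch hA.
have E1 : l h - l g / c g * c h = (l h / c h - l g / c g) * c h by field; rewrite ?cg ?ch.
have E2 : l g - l h / c h * c g = - (l h / c h - l g / c g) * c g by field; rewrite ?cg ?ch.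
rewrite E1 in H1; rewrite E2 in H2.
have := mulr_gt0 H1 H2; rewrite mulrACA mulrN -expr2 mulNr oppr_gt0 (mulrC (c h)).
by rewrite ltNge mulr_ge0 ?sqr_ge0 // ltW.
Qed.

(* [l] are the coordinates of a vector [x] and [c] those of a vector [b];
   [exchange_ok g] says that [x] lies in the cone where [b] replaces [g]. *)
Lemma exchange_sign_sum :
  (all (fun g => 0 <= l g) s)%:R =
  \sum_(g <- s | c g != 0) Num.sg (c g) * (exchange_ok g)%:R :> R.
Proof.
have posE : \sum_(g <- s | 0 < c g) (exchange_ok g)%:R =
    (has (fun g => (0 < c g) && exchange_ok g) s)%:R :> R.
  case: (boolP (has _ s)) => [/hasP [g gs /andP[cg gA]]|/hasPn nA].
    rewrite big_mkcond (bigD1_seq g) //= cg gA big_seq_cond big1 ?addr0 // => h /andP[hs hg].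
    case: ifP => // ch; case: (boolP (exchange_ok h)) => // hA; case/eqP: hg.
    by apply: exchange_sign_unique => //; rewrite mulr_gt0.
  rewrite big_seq_cond big1 // => g /andP[gs cg].
  by have := nA g gs; rewrite cg /= => /negbTE ->.
have negE : \sum_(g <- s | c g < 0) (exchange_ok g)%:R =
    (has (fun g => (c g < 0) && exchange_ok g) s)%:R :> R.
  case: (boolP (has _ s)) => [/hasP [g gs /andP[cg gA]]|/hasPn nA].
    rewrite big_mkcond (bigD1_seq g) //= cg gA big_seq_cond big1 ?addr0 // => h /andP[hs hg].
    case: ifP => // ch; case: (boolP (exchange_ok h)) => // hA; case/eqP: hg.
    by apply: exchange_sign_unique => //; rewrite nmulr_rgt0.
  rewrite big_seq_cond big1 // => g /andP[gs cg].
  by have := nA g gs; rewrite cg /= => /negbTE ->.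
have -> : \sum_(g <- s | c g != 0) Num.sg (c g) * (exchange_ok g)%:R =
    \sum_(g <- s | 0 < c g) (exchange_ok g)%:R - \sum_(g <- s | c g < 0) (exchange_ok g)%:R :> R.
  rewrite (bigID (fun g => 0 < c g)) /= -sumrN; congr (_ + _).
    rewrite (eq_bigl (fun g => 0 < c g)).
      by apply: eq_bigr => g cg; rewrite gtr0_sg // mul1r.
    by move=> g; case: ltgtP.
  rewrite (eq_bigl (fun g => c g < 0)).
    by apply: eq_bigr => g cg; rewrite ltr0_sg // mulN1r.
  by move=> g; case: ltgtP.
rewrite posE negE.
(* On the ray [x - t b] with [t >= 0] the cone cuts out an interval, bounded since some [c g] is
   positive. Admissible exchanges with [c g > 0] are its end and those with [c g < 0] its beginning;
   they cancel unless the interval starts at [t = 0], that is, unless [x] is in the cone. The ratio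
   at [gp] is the only possible end. *)
have [gp [gps cgp gpm]] := seq_argmin (fun g => l g / c g) cpos.
have okp t : 0 <= t -> (forall h, h \in s -> 0 <= l h - t * c h) -> exchange_ok gp.
  move=> t0 tA; have tp : t <= l gp / c gp.
    by have := tA gp gps; rewrite subr_ge0 -ler_pdivlMr.
  apply/andP; split; first exact: le_trans tp.
  apply/allP => h hs; rewrite subr_ge0; have [ch|ch] := ltP 0 (c h).
    by rewrite -ler_pdivlMr // gpm.
  by have := tA h hs; rewrite subr_ge0; apply: le_trans; rewrite ler_wnM2r.
have sgn : all (fun g => 0 <= l g) s -> exchange_ok gp.
  by move=> /allP l0; apply: (okp 0) => // h hs; rewrite mul0r subr0 l0.
have negok g : g \in s -> c g < 0 -> exchange_ok g -> exchange_ok gp.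
  by move=> gs cg /andP[g0 /allP gA]; apply: (okp (l g / c g)).
case: (boolP (exchange_ok gp)) => [gpA|gpA]; last first.
  have -> : all (fun g => 0 <= l g) s = false by apply/negbTE; apply: contra gpA.
  have -> : has (fun g => (0 < c g) && exchange_ok g) s = false.
    apply/negbTE; apply: contra gpA => /hasP [g gs /andP[cg /andP[g0 /allP gA]]].
    exact: (okp (l g / c g)).
  have -> : has (fun g => (c g < 0) && exchange_ok g) s = false.
    by apply/negbTE; apply: contra gpA => /hasP [g gs /andP[cg gA]]; apply: negok gA.
  by rewrite subrr.
have -> : has (fun g => (0 < c g) && exchange_ok g) s by apply/hasP; exists gp; rewrite ?cgp.
have [gp0 _] := strict gps (lt0r_neq0 cgp) gpA.
case: (boolP (has (fun g => (c g < 0) && exchange_ok g) s)) => [/hasP [g gs /andP[cg gA]]|/hasPn nA].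
  rewrite subrr; have [g0 _] := strict gs (ltr0_neq0 cg) gA.
  have -> // : all (fun g => 0 <= l g) s = false.
  apply/negbTE/allPn; exists g => //; rewrite -ltNge.
  by move: g0; rewrite ltr_ndivlMr // mul0r.
rewrite subr0; have -> // : all (fun g => 0 <= l g) s.
apply: contrapT => /negP /allPn [h hs]; rewrite -ltNge => lh.
have ch : c h < 0.
  have /andP[_ /allP /(_ h hs)] := gpA; rewrite subr_ge0 => H.
  have := le_lt_trans H lh; rewrite pmulr_rlt0 //.
have cneg : has (fun g => c g < 0) s by apply/hasP; exists h.
have [gm [gms cgm gmm]] := seq_argmin (fun g => - (l g / c g)) cneg.
case/negP: (nA gm gms); rewrite cgm /=.
have gmh : l h / c h <= l gm / c gm by have := gmm h hs ch; rewrite lerN2.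
have gm0 : 0 < l gm / c gm by apply: lt_le_trans gmh; rewrite ltr_ndivlMr // mul0r.
have gmp : l gm / c gm <= l gp / c gp.
  have /andP[_ /allP /(_ gm gms)] := gpA; rewrite subr_ge0.
  by rewrite -ler_ndivrMr.
apply/andP; split; first exact: ltW.
apply/allP => x xs; rewrite subr_ge0; have [cx|cx] := ltP (c x) 0.
  by rewrite -ler_ndivrMr //; have := gmm x xs cx; rewrite lerN2.
have /andP[_ /allP /(_ x xs)] := gpA; rewrite subr_ge0; apply: le_trans.
by rewrite ler_wpM2r.
Qed.

End ExchangeSigns.

Section RowDeterminants.
Variables (R : realType) (r : nat).
Implicit Types (s t : seq 'rV[R]_r).

Definition seq_mx s : 'M[R]_r := \matrix_(i < r, j < r) s`_i 0 j.

Lemma row_seq_mx s i : row i (seq_mx s) = s`_i.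
Proof. by apply/rowP => j; rewrite !mxE. Qed.

Lemma mul_seq_mx s (x : 'rV[R]_r) : x *m seq_mx s = \sum_(i < r) x 0 i *: s`_i.
Proof. by rewrite mulmx_sum_row; apply: eq_bigr => i _; rewrite row_seq_mx. Qed.

Lemma normr_det_perm s t : size s = r -> perm_eq s t ->
  `|\det (seq_mx s)| = `|\det (seq_mx t)|.
Proof.
move=> sr st; have tr : size t = r by rewrite -(perm_size st).
have [p pE] : exists p : {perm 'I_r}, forall i : 'I_r, s`_i = t`_(p i).
  have: perm_eq s (tcast tr (in_tuple t)) by rewrite val_tcast.
  move=> /tuple_permP [p ->]; exists p => i.
  by rewrite -tnth_nth tnth_mktuple (tnth_nth 0) val_tcast.
have -> : seq_mx s = row_perm p (seq_mx t).
  by apply/matrixP => i j; rewrite !mxE pE.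
by rewrite row_permE det_mulmx det_perm normrM normrX normrN1 expr1n mul1r.
Qed.

Lemma det_replace_row s (i : 'I_r) (c : 'rV[R]_r) : size s = r ->
  \det (seq_mx (set_nth 0 s i (c *m seq_mx s))) = c 0 i * \det (seq_mx s).
Proof.
move=> sr; set b := c *m _; rewrite (expand_det_row _ i).
have : (b *m \adj (seq_mx s)) 0 i = c 0 i * \det (seq_mx s).
  by rewrite /b -mulmxA mul_mx_adj -scalemx1 -scalemxAr mulmx1 mxE mulrC.
move=> <-; rewrite mxE; apply: eq_bigr => j _; rewrite [\adj _ _ _]mxE; congr (_ * _).
  by rewrite [LHS]mxE nth_set_nth /= eqxx.
rewrite /cofactor; congr (_ * determinant _); apply/matrixP => k k'; rewrite !mxE nth_set_nth /=.
by rewrite -[lift i k == i :> nat]/(lift i k == i) eq_sym (negbTE (neq_lift _ _)).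
Qed.

Lemma basis_seq_mx s : basis_of fullv s -> size s = r /\ seq_mx s \in unitmx.
Proof.
move=> sb; have sr : size s = r.
  have /andP[/eqP sD] := sb; rewrite /free sD => /eqP <-.
  by rewrite dimvf /dim /= mul1n.
split=> //; rewrite -row_free_unit -kermx_eq0; apply/eqP/row_matrixP => i; rewrite row0.
set u := row i _; have u0 : u *m seq_mx s = 0 by rewrite /u -row_mul mulmx_ker row0.
have fs : free (in_tuple s) by apply: basis_free sb.
have: \sum_(j < size s) u 0 (cast_ord sr j) *: (in_tuple s)`_j = 0.
  transitivity (u *m seq_mx s); last exact: u0.
  rewrite mul_seq_mx [RHS](reindex (cast_ord sr)) //=.
  by exists (cast_ord (esym sr)) => x _; [rewrite cast_ordK|rewrite cast_ordKV].
have /freeP H := fs; move=> /H {}H; apply/rowP => j; rewrite [RHS]mxE.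
by rewrite -(H (cast_ord (esym sr) j)) cast_ordKV.
Qed.

Lemma seq_mx_basis s : size s = r -> seq_mx s \in unitmx -> basis_of fullv s.
Proof.
move=> sr su; rewrite basisEfree subvf dimvf /dim /= mul1n sr leqnn !andbT.
rewrite -[s]/(tval (in_tuple s)); apply/freeP => k k0 i.
pose u : 'rV[R]_r := \row_j k (cast_ord (esym sr) j).
have u0 : u *m seq_mx s = 0.
  transitivity (\sum_i k i *: (in_tuple s)`_i); last exact: k0.
  rewrite mul_seq_mx (reindex (cast_ord sr)) /=; last first.
    by exists (cast_ord (esym sr)) => x _; [rewrite cast_ordK|rewrite cast_ordKV].
  by apply: eq_bigr => j _; rewrite mxE cast_ordK.
have : u = 0 by rewrite -(mulmxK su u) u0 mul0mx.
by move=> /rowP /(_ (cast_ord sr i)); rewrite !mxE cast_ordK.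
Qed.

End RowDeterminants.

Section Linform.
Variables (R : realType) (r : nat).
Local Notation K := {fraction (mpoly r R[i])}.

Lemma linformD (a b : 'rV[R]_r) : linform (a + b) = linform a + linform b.
Proof.
rewrite /linform -big_split; apply: eq_bigr => i _ /=.
by rewrite mxE rmorphD scalerDl.
Qed.

Lemma linformZ k (a : 'rV[R]_r) : linform (k *: a) = k%:C *: linform a.
Proof.
rewrite /linform scaler_sumr; apply: eq_bigr => i _ /=.
by rewrite mxE rmorphM scalerA.
Qed.

Lemma linform_sum (I : Type) (s : seq I) (c : I -> R) (F : I -> 'rV[R]_r) :
  linform (\sum_(i <- s) c i *: F i) = \sum_(i <- s) (c i)%:C *: linform (F i).
Proof.
have l0 : linform (0 : 'rV[R]_r) = 0 by apply/eqP; rewrite linform_eq0.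
by rewrite (big_morph _ linformD l0); apply: eq_bigr => i _; rewrite linformZ.
Qed.

Lemma tofracZ c (p : mpoly r R[i]) : tofrac (c *: p) = scal c (tofrac p) :> K.
Proof. by rewrite -mul_mpolyC rmorphM. Qed.

End Linform.

Lemma offset_in_range (l k n : nat) : (k < n - l)%N -> (l <= l + k < n)%N.
Proof. by lia. Qed.

Lemma offset_in_range_lt (l k n : nat) : (k.+1 < n - l)%N -> (l < l + k.+1 < n)%N.
Proof. by lia. Qed.

(** * Bases without broken circuit and their dual residues *)

Section ChamberFunctional.
Variables (R : realType) (r : nat) (Phip Delta : {fset 'rV[R]_r}).
Variables (cor : 'rV[R]_r -> 'cV[R]_r) (height : 'rV[R]_r -> R) (lambda : 'rV[R]_r).
Hypotheses (Phip0 : 0 \notin Phip).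
Hypotheses (heightD : {morph height : x y / x + y})
  (heightZ : forall k x, height (k *: x) = k * height x)
  (height_pos : {in Phip, forall a, 0 < height a}).
Hypothesis lambda_ns : ~ singular Phip lambda.
Hypothesis fund_unit : fund_weights Delta cor \in unitmx.
Local Notation C := R[i].
Local Notation K := {fraction (mpoly r R[i])}.
Implicit Types (s t : {fset 'rV[R]_r}) (a b g : 'rV[R]_r).

Lemma cone_basisE s (l : 'rV[R]_r -> R) : free s -> lambda = \sum_(g <- s) l g *: g ->
  cone s lambda <-> all (fun g => 0 <= l g) s.
Proof.
move=> fs lE; split=> [[c c0 cE]|/allP l0].
  by apply/allP => g gs; rewrite (free_sum_inj fs (etrans (esym lE) cE)).
exists (fun g => if g \in s then l g else 0) => [g|]; first by case: ifP => // /l0.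
by rewrite lE big_seq [RHS]big_seq; apply: eq_bigr => g ->.
Qed.

(** A zero coordinate would put [lambda] in the cone of the other [r - 1] roots and make it
    singular. *)
Lemma cone_strict s (l : 'rV[R]_r -> R) : (s `<=` Phip)%fset -> basis_of fullv s ->
  lambda = \sum_(g <- s) l g *: g -> all (fun g => 0 <= l g) s -> {in s, forall g, 0 < l g}.
Proof.
move=> sP sb lE /allP l0 g gs; rewrite lt0r l0 // andbT; apply/eqP => lg.
have [sr _] := basis_seq_mx sb.
apply: lambda_ns; exists (s `\ g)%fset; split.
- by apply: fsubset_trans sP; apply: fsubD1set.
- by have E := cardfsD1 g s; rewrite gs sr add1n in E; exact: eq_leq (esym E).
exists (fun h => if h \in s then l h else 0) => [h|]; first by case: ifP => // /l0.
rewrite lE (big_fsetD1 g) //= lg scale0r add0r big_seq [RHS]big_seq.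
by apply: eq_bigr => h; rewrite in_fsetD1 => /andP[_ ->].
Qed.

Definition cone_weight s : R := if `[< cone s lambda >] then (vol_box Delta cor s)^-1 else 0.

Lemma basis_coords s x : basis_of fullv s ->
  exists l : 'rV[R]_r -> R, x = \sum_(g <- s) l g *: g.
Proof.
move=> sb; exists (fun g => if insub (index g s) is Some i then coord (in_tuple s) i x else 0).
rewrite {1}(coord_basis (X := in_tuple s) sb (memvf x)) (big_nth 0) big_mkord.
by apply: eq_bigr => i _; rewrite index_uniq ?fset_uniq // valK.
Qed.

Section Exchange.
Variables (t : {fset 'rV[R]_r}) (b : 'rV[R]_r) (c : 'rV[R]_r -> R).
Hypotheses (tP : (t `<=` Phip)%fset) (tb : basis_of fullv t) (bP : b \in Phip)
  (bt : b \notin t) (bE : b = \sum_(g <- t) c g *: g).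

Definition exchange g : {fset 'rV[R]_r} := (b |` (t `\ g))%fset.

Lemma exchange_sub g : (exchange g `<=` Phip)%fset.
Proof.
apply/fsubsetP => x; rewrite in_fset1U => /orP[/eqP -> //|].
by rewrite in_fsetD1 => /andP[_ /(fsubsetP tP)].
Qed.

Lemma b_notin_D1 g : b \notin (t `\ g)%fset.
Proof. by rewrite in_fsetD1 negb_and bt orbT. Qed.

Lemma exchange_perm g : g \in t ->
  perm_eq (exchange g) (set_nth 0 t (index g t) b).
Proof.
move=> gt; rewrite set_nthE index_mem gt.
rewrite perm_sym -cat1s perm_catCA cat1s -remE perm_sym; apply: uniq_perm.
- exact: fset_uniq.
- rewrite /= rem_uniq ?fset_uniq // andbT mem_rem_uniq ?fset_uniq //.
  by rewrite inE negb_and bt orbT.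
move=> x; rewrite in_fset1U in_fsetD1 inE; congr (_ || _).
by rewrite mem_rem_uniq ?fset_uniq // inE.
Qed.

Lemma normr_det_exchange g : g \in t ->
  `|\det (seq_mx (exchange g))| = `|c g| * `|\det (seq_mx t)|.
Proof.
move=> gt; have [tr tu] := basis_seq_mx tb.
have gi : (index g t < #|` t|)%N by rewrite index_mem.
rewrite tr in gi.
have := det_replace_row (Ordinal gi) (\row_(j < r) c t`_j) tr.
have -> : (\row_(j < r) c t`_j) *m seq_mx t = b.
  rewrite mul_seq_mx bE (big_nth 0) tr big_mkord; apply: eq_bigr => j _.
  by rewrite mxE.
rewrite mxE /= nth_index // -normrM => <-.
rewrite (normr_det_perm _ (exchange_perm gt)) // (perm_size (exchange_perm gt)).
by rewrite size_set_nth -[RHS]tr; apply/maxn_idPr; rewrite index_mem.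
Qed.

Lemma exchange_basis g : g \in t -> c g != 0 -> basis_of fullv (exchange g).
Proof.
move=> gt cg; have [tr tu] := basis_seq_mx tb.
have sE : size (exchange g) = r.
  rewrite (perm_size (exchange_perm gt)) size_set_nth -[RHS]tr.
  by apply/maxn_idPr; rewrite index_mem.
apply: seq_mx_basis sE _.
rewrite unitmxE unitfE -normr_eq0 normr_det_exchange // mulf_neq0 ?normr_eq0 //.
by rewrite -unitfE -unitmxE.
Qed.

Lemma exchange_coords (l : 'rV[R]_r -> R) g : g \in t -> c g != 0 ->
  lambda = \sum_(h <- t) l h *: h ->
  lambda = \sum_(h <- exchange g)
    (if h == b then l g / c g else l h - l g / c g * c h) *: h.
Proof.
move=> gt cg lE; rewrite big_fsetU1 ?b_notin_D1 //= eqxx.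
have -> : \sum_(h <- (t `\ g)%fset) (if h == b then l g / c g else l h - l g / c g * c h) *: h =
    \sum_(h <- (t `\ g)%fset) (l h - l g / c g * c h) *: h.
  apply: eq_big_seq => h ht; case: eqP => // hb.
  by move: ht; rewrite hb (negbTE (b_notin_D1 g)).
have -> : \sum_(h <- (t `\ g)%fset) (l h - l g / c g * c h) *: h =
    \sum_(h <- t) (l h - l g / c g * c h) *: h.
  by rewrite [RHS](big_fsetD1 g) //= divfK // subrr scale0r add0r.
rewrite {1}bE scaler_sumr -big_split /= lE; apply: eq_bigr => h _.
by rewrite scalerA -scalerDl addrC subrK.
Qed.

Lemma exchange_cone (l : 'rV[R]_r -> R) g : g \in t -> c g != 0 ->
  lambda = \sum_(h <- t) l h *: h ->
  cone (exchange g) lambda <-> exchange_ok t l c g.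
Proof.
move=> gt cg lE; have fE := basis_free (exchange_basis gt cg).
rewrite (cone_basisE fE (exchange_coords gt cg lE)) /exchange_ok; split.
  move=> /allP H; have := H b; rewrite fset1U1 eqxx => -> //=.
  apply/allP => h ht; have [->|hg] := eqVneq h g; first by rewrite divfK // subrr.
  have := H h; rewrite in_fset1U in_fsetD1 hg ht orbT => /(_ isT).
  by case: eqP => // hb; move: bt; rewrite -hb ht.
move=> /andP[g0 /allP H]; apply/allP => h; rewrite in_fset1U in_fsetD1.
by case: eqP => //= _ /andP[_ /H].
Qed.

(** This is the relation that [fsigma_exchange] imposes on any functional of the [fsigma]. An
    exchange multiplies the volume by [|c g|], so [c g] times the new weight is a sign over the old
    volume and the claim becomes [exchange_sign_sum]. *)
Lemma cone_weight_exchange :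
  cone_weight t = \sum_(g <- t | c g != 0) c g * cone_weight (exchange g).
Proof.
have [l lE] := basis_coords lambda tb; have [tr tu] := basis_seq_mx tb.
pose W := `|\det (fund_weights Delta cor)|.
have W0 : W != 0 by rewrite normr_eq0 -unitfE -unitmxE.
have d0 : `|\det (seq_mx t)| != 0 by rewrite normr_eq0 -unitfE -unitmxE.
have weightE s : cone_weight s = (`[< cone s lambda >])%:R * (W / `|\det (seq_mx s)|).
  by rewrite /cone_weight /vol_box invf_div; case: asboolP => _; rewrite ?mul1r ?mul0r.
have cE g : g \in t -> c g != 0 -> c g * cone_weight (exchange g) =
    (Num.sg (c g) * (exchange_ok t l c g)%:R) * (W / `|\det (seq_mx t)|).
  move=> gt cg; rewrite weightE normr_det_exchange //.
  have -> : `[< cone (exchange g) lambda >] = exchange_ok t l c g.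
    by apply/asboolP/idP => /(exchange_cone gt cg lE).
  rewrite {1}[c g]numEsg; field; rewrite d0 normr_eq0 //.
rewrite big_seq_cond (eq_bigr (fun g =>
  (Num.sg (c g) * (exchange_ok t l c g)%:R) * (W / `|\det (seq_mx t)|))); last first.
  by move=> g /andP[gt cg]; apply: cE.
rewrite -mulr_suml -big_seq_cond -exchange_sign_sum ?fset_uniq //.
- rewrite weightE; congr (_%:R * _); congr nat_of_bool.
  by apply/asboolP/idP => /(cone_basisE (basis_free tb) lE).
(* Some coefficient of [b] is positive, since otherwise its height would be at most 0. *)
- apply: contrapT => /negP /hasPn cn; have := height_pos bP; rewrite bE.
  have h0 : height 0 = 0 by rewrite -[0](scale0r 0) heightZ mul0r.
  rewrite (big_morph _ heightD h0) ltNge big_seq sumr_le0 // => g gt.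
  rewrite heightZ mulr_le0_ge0 //; first by rewrite leNgt cn.
  by apply/ltW/height_pos/(fsubsetP tP).
move=> g gt cg gok.
have gA : all (fun h => 0 <= if h == b then l g / c g else l h - l g / c g * c h) (exchange g).
  apply/(cone_basisE (basis_free (exchange_basis gt cg)) (exchange_coords gt cg lE)).
  exact/(exchange_cone gt cg lE).
have H := cone_strict (exchange_sub g) (exchange_basis gt cg) (exchange_coords gt cg lE) gA.
split; first by have := H b; rewrite fset1U1 eqxx => /(_ isT).
move=> h ht hg; have := H h; rewrite in_fset1U in_fsetD1 hg ht orbT => /(_ isT).
by case: eqP => // hb; move: bt; rewrite -hb ht.
Qed.

Lemma fsigma_exchange :
  fsigma t = \sum_(g <- t | c g != 0) scal ((c g)%:C) (fsigma (exchange g)).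
Proof.
have lin0 a : a \in Phip -> tofrac (linform a) != 0 :> K.
  by move=> aP; rewrite tofrac_eq0 linform_eq0; apply: contraNneq Phip0 => <-.
have fE s : fsigma s = (\prod_(a <- s) tofrac (linform a))^-1.
  by rewrite /fsigma /ratfrac rmorph1 div1r rmorph_prod.
have lbE : tofrac (linform b) = \sum_(g <- t) scal (c g)%:C (tofrac (linform g)) :> K.
  by rewrite bE linform_sum rmorph_sum; apply: eq_bigr => g _; exact: tofracZ.
have step (F : fieldType) (x y z w : F) : x != 0 -> y != 0 -> z = x * y -> z^-1 * (w * x) = w * y^-1.
  by move=> x0 y0 ->; field; rewrite ?x0 ?y0.
have b0 := lin0 b bP.
(* Multiply and divide by the form of [b], then expand the numerator over [t]: each summand cancels
   one factor of the denominator. *)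
rewrite -[LHS](mulfK b0) {1}lbE mulr_sumr mulr_suml.
rewrite (bigID (fun g => c g != 0)) /= [X in _ + X]big1 ?addr0; last first.
  by move=> g; rewrite negbK => /eqP ->; rewrite scal0 mulr0 mul0r.
rewrite big_seq_cond [RHS]big_seq_cond; apply: eq_bigr => g /andP[gt _].
rewrite !fE big_fsetU1 ?b_notin_D1 //= (big_fsetD1 g) //= /scal -mulrA.
set p := \prod_(_ <- _) _.
have p0 : p != 0.
  rewrite prodf_seq_neq0; apply/allP => x; rewrite in_fsetD1 => /andP[_ /(fsubsetP tP) xP].
  exact: lin0.
by rewrite invfM mulrA -invfM (step _ _ _ _ _ (lin0 _ (fsubsetP tP _ gt)) p0 erefl) invfM mulrCA mulrC mulrA.
Qed.

End Exchange.

Definition rank a := index a Phip.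

(** For the order given by [rank]: the basis contains no circuit deprived of its least element, here
    [b]. *)
Definition no_broken_circuit s := basis_of fullv s &&
  all (fun b => b \notin <<[seq g <- s | (rank b < rank g)%N]>>%VS) Phip.

Definition ordered s : seq 'rV[R]_r := [seq a <- Phip | a \in s].

Lemma ordered_perm s : (s `<=` Phip)%fset -> perm_eq (ordered s) s.
Proof.
move=> sP; apply: uniq_perm; rewrite ?filter_uniq ?fset_uniq // => x.
by rewrite mem_filter; case: (boolP (x \in s)) => //= /(fsubsetP sP) ->.
Qed.

Lemma rank_inj a b : a \in Phip -> rank a = rank b -> a = b.
Proof.
move=> aP ab; have bP : b \in Phip by rewrite -index_mem -[index _ _]/(rank b) -ab index_mem.
by rewrite -(nth_index 0 aP) -[index a _]/(rank a) ab nth_index.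
Qed.

Lemma ordered_lt s i j : (i < j < size (ordered s))%N ->
  (rank (ordered s)`_i < rank (ordered s)`_j)%N.
Proof.
move=> /andP[ij js]; pose e a b := (rank a < rank b)%N.
have etr : transitive e by move=> y x z; apply: ltn_trans.
have so : sorted e (ordered s).
  apply: sorted_filter => //; apply/(sortedP 0) => k kP.
  by rewrite /e /rank !index_uniq ?fset_uniq // ltnW.
by apply: (sorted_ltn_nth etr 0 so) => //; rewrite inE // (ltn_trans ij).
Qed.

Lemma nth_ex (X : seq 'rV[R]_r) x : x \in X -> exists2 i, (i < size X)%N & X`_i = x.
Proof. by move/(nthP 0). Qed.

Lemma span_coords (X : seq 'rV[R]_r) x : uniq X -> x \in <<X>>%VS ->
  exists l : 'rV[R]_r -> R, x = \sum_(g <- X) l g *: g.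
Proof.
move=> uX xX.
exists (fun g => if insub (index g X) is Some i then coord (in_tuple X) i x else 0).
have xX' : x \in <<in_tuple X>>%VS by [].
rewrite {1}(coord_span xX') (big_nth 0) big_mkord.
by apply: eq_bigr => i _; rewrite index_uniq // valK.
Qed.

Section NbcResidue.
Variables s t : {fset 'rV[R]_r}.
Hypotheses (sP : (s `<=` Phip)%fset) (tP : (t `<=` Phip)%fset).
Hypotheses (snbc : no_broken_circuit s) (tnbc : no_broken_circuit t).

Let sb : basis_of fullv s. Proof. by case/andP: snbc. Qed.
Let tb : basis_of fullv t. Proof. by case/andP: tnbc. Qed.

Lemma ordered_basis u : (u `<=` Phip)%fset -> basis_of fullv u -> basis_of fullv (ordered u).
Proof. by move=> uP; rewrite (perm_basis _ (ordered_perm uP)). Qed.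

Lemma ordered_mx_unit : seq_mx (ordered s) \in unitmx.
Proof. by have [] := basis_seq_mx (ordered_basis sP sb). Qed.

Lemma size_ordered u : (u `<=` Phip)%fset -> basis_of fullv u -> size (ordered u) = r.
Proof. by move=> uP ub; have [] := basis_seq_mx (ordered_basis uP ub). Qed.

Lemma nbc_residue_diag :
  iterated_residue Phip (seq_mx (ordered s)) (fsigma s) = 1.
Proof.
rewrite /fsigma; apply: iterated_residue_axes => //.
- exact: ordered_mx_unit.
- by move=> x /(fsubsetP sP).
- rewrite perm_sym; apply: perm_trans (ordered_perm sP).
  suff -> : [seq row i (seq_mx (ordered s)) | i <- enum 'I_r] = ordered s by [].
  apply: (@eq_from_nth _ 0) => [|i]; rewrite size_map size_enum_ord ?size_ordered // => ir.
  rewrite (nth_map (Ordinal ir)) ?size_enum_ord // row_seq_mx.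
  by rewrite (nth_enum_ord (Ordinal ir) ir).
Qed.

(** Otherwise the tails of [s] and [t] from [l] on span the same space, by dimension. The smaller of
    the two elements at position [l] then lies in the span of strictly later elements of the other
    basis, which is a broken circuit there. *)
Lemma drop_span_neq l : (l < r)%N -> (forall i, (i < l)%N -> (ordered s)`_i = (ordered t)`_i) ->
  (ordered s)`_l != (ordered t)`_l ->
  exists2 i, (l <= i < r)%N & (ordered t)`_i \notin <<drop l (ordered s)>>%VS.
Proof.
move=> lr _ neq; apply: contrapT => H.
have sr := size_ordered sP sb; have tr := size_ordered tP tb.
have sub : (<<drop l (ordered t)>> <= <<drop l (ordered s)>>)%VS.
  apply/span_subvP => x xd; have [k kl kE] := nth_ex xd.
  move: kl kE; rewrite size_drop nth_drop tr => il <-.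
  apply: contrapT => /negP nx; apply: H; exists (l + k)%N => //.
  exact: offset_in_range.
have fr u : (u `<=` Phip)%fset -> basis_of fullv u -> \dim <<drop l (ordered u)>>%VS = (r - l)%N.
  move=> uP ub; have /basis_free := ordered_basis uP ub.
  rewrite -{1}(cat_take_drop l (ordered u)) => /catr_free /eqP ->.
  by rewrite size_drop size_ordered.
have E : <<drop l (ordered t)>>%VS = <<drop l (ordered s)>>%VS.
  by apply/eqP; rewrite eqEdim sub (fr t tP tb) (fr s sP sb) leqnn.
have mem_drop u : size (ordered u) = r -> (ordered u)`_l \in drop l (ordered u).
  by move=> ur; rewrite (drop_nth 0) ?ur // mem_head.
have inP u : size (ordered u) = r -> (ordered u)`_l \in Phip.
  by move=> ur; have := mem_nth 0 (s := ordered u) (n := l); rewrite ur => /(_ lr); rewrite mem_filter => /andP[].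
have key u u' : size (ordered u) = r -> size (ordered u') = r -> no_broken_circuit u ->
    <<drop l (ordered u')>>%VS = <<drop l (ordered u)>>%VS ->
    (rank (ordered u')`_l < rank (ordered u)`_l)%N -> False.
  move=> ur ur' /andP[_ /allP /(_ _ (inP _ ur')) /negP nb] E' lt; apply: nb.
  have := memv_span (mem_drop _ ur'); rewrite E'; apply/subvP/sub_span => x xd; have [k kl kE] := nth_ex xd.
  move: kl kE; rewrite size_drop nth_drop ur => il <-; rewrite mem_filter; apply/andP; split.
    case: k il => [|k] il; first by rewrite addn0.
    apply: (ltn_trans lt); apply: ordered_lt; rewrite ur.
    exact: offset_in_range_lt.
  have : (ordered u)`_(l + k) \in ordered u by rewrite mem_nth // ur; have /andP[] := offset_in_range il.
  by rewrite mem_filter => /andP[].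
case: (ltngtP (rank (ordered s)`_l) (rank (ordered t)`_l)) => [lt|lt|/rank_inj eq].
- exact: key tr sr tnbc (esym E) lt.
- exact: key sr tr snbc E lt.
- by case/eqP: neq; apply: eq; apply: inP.
Qed.

(** Let [l0] be the first place where the ordered bases differ. Some tail element of [t] has a
    nonzero coordinate before [l0]; let [l] be the least such coordinate. Then two forms of [t]
    start at [l], that element and the common element at position [l], and [iterated_residue_eq0]
    applies. *)
Lemma nbc_residue_neq : s != t ->
  iterated_residue Phip (seq_mx (ordered s)) (fsigma t) = 0.
Proof.
move=> st; have sr := size_ordered sP sb; have tr := size_ordered tP tb.
pose S := seq_mx (ordered s); have Su : S \in unitmx := ordered_mx_unit.
have [l0 [l0r l0lt l0neq]] : exists l, [/\ (l < r)%N,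
    forall i, (i < l)%N -> (ordered s)`_i = (ordered t)`_i & (ordered s)`_l != (ordered t)`_l].
  have ex : exists l, (ordered s)`_l != (ordered t)`_l.
    apply: contrapT => H; case/eqP: st; apply/fsetP => x.
    rewrite -(perm_mem (ordered_perm sP)) -(perm_mem (ordered_perm tP)).
    suff -> : ordered s = ordered t by [].
    apply: (@eq_from_nth _ 0); first by rewrite sr tr.
    by move=> i _; apply/eqP; apply: contrapT => /negP n; apply: H; exists i.
  case: (ex_minnP ex) => l ln lmin; exists l; split=> // [|i il].
    by rewrite ltnNge; apply: contra ln => rl; rewrite !nth_default ?sr ?tr.
  by apply/eqP; apply: contraTT il => /lmin; rewrite -leqNgt.
have [i1 /andP[li1 i1r] i1n] := drop_span_neq l0r l0lt l0neq.
have Sset : forall i : 'I_r, (ordered s)`_i = row i S by move=> i; rewrite row_seq_mx.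
have axis (j : 'I_r) : on_axis S j (ordered s)`_j.
  apply/forallP => k; apply/implyP => kj.
  by rewrite Sset /coordmx -row_mul mulmxV // row1 !mxE eqxx (negbTE kj).
have axis1 (j : 'I_r) : coordmx S (ordered s)`_j 0 j != 0.
  by rewrite Sset /coordmx -row_mul mulmxV // row1 !mxE !eqxx oner_neq0.
(* Coordinates that occur in some element of the tail of [t]; minimality of [l] below makes no tail
   element start before [l], while the common elements lie on axes. *)
pose bad (l : 'I_r) := [exists i : 'I_r, (l0 <= i)%N && (coordmx S (ordered t)`_i 0 l != 0)].
have [j0 j0l bj0] : exists2 j, (nat_of_ord j < l0)%N & bad j.
  apply: contrapT => H; case/negP: i1n.
  rewrite -[(ordered t)`_i1](mulmxKV Su) -/(coordmx S _) mul_seq_mx.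
  apply: memv_suml => j _; have [jl|jl] := ltnP j l0.
    have -> : coordmx S (ordered t)`_i1 0 j = 0; last by rewrite scale0r mem0v.
    apply/eqP; apply: contrapT => /negP n; apply: H; exists j => //.
    by apply/existsP; exists (Ordinal i1r); rewrite /= li1.
  apply/memvZ/memv_span; have -> : (ordered s)`_j = (drop l0 (ordered s))`_(j - l0).
    by rewrite nth_drop subnKC.
  by rewrite mem_nth // size_drop sr ltn_sub2r.
case: (@arg_minnP _ j0 bad (fun i => nat_of_ord i) bj0) => l bl lmin.
have ll0 : (l < l0)%N := leq_ltn_trans (lmin _ bj0) j0l.
have tE : forall a, a \in t -> exists2 i : 'I_r, a = (ordered t)`_i & true.
  move=> a; rewrite -(perm_mem (ordered_perm tP)) => ao.
  have [k kr <-] := nth_ex ao; move: kr; rewrite tr => ir.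
  by exists (Ordinal ir).
have late (i : 'I_r) : (l0 <= i)%N -> lead_ge S l (ordered t)`_i.
  move=> li; apply/forallP => k; apply/implyP => kl; apply: contraTT kl => n.
  rewrite -leqNgt; apply: lmin; apply/existsP; exists i; by rewrite li.
rewrite /fsigma; apply: (@iterated_residue_eq0 _ _ _ _ _ _ _ l) => //.
- by move=> x /(fsubsetP tP).
- move=> a /tE [i -> _]; have [il|il] := ltnP i l0; last by left; apply: late.
  rewrite -l0lt //; have [il'|il'] := ltnP i l; first by right; exists i; rewrite ?axis.
  left; apply/forallP => k; apply/implyP => kl; have /forallP/(_ k)/implyP := axis i.
  by apply; rewrite -val_eqE neq_ltn (leq_trans kl).
have /existsP [i2 /andP[li2 i2n]] := bl.
pose x := (ordered t)`_l; pose y := (ordered t)`_i2.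
have xt : x \in t by rewrite -(perm_mem (ordered_perm tP)) mem_nth ?tr.
have yt : y \in t by rewrite -(perm_mem (ordered_perm tP)) mem_nth ?tr.
have xy : x != y.
  by rewrite nth_uniq ?tr ?filter_uniq ?fset_uniq // neq_ltn (leq_trans ll0).
have xl : lead_eq S l x.
  rewrite /x -l0lt // /lead_eq axis1 andbT; apply/forallP => k; apply/implyP => kl.
  by have /forallP/(_ k)/implyP := axis l; apply; rewrite -val_eqE neq_ltn kl.
have yl : lead_eq S l y by rewrite /lead_eq late.
rewrite -size_filter; apply: (@uniq_leq_size _ [:: x; y]).
  by rewrite /= inE xy.
by move=> z; rewrite !inE mem_filter => /orP[] /eqP ->; rewrite ?xl ?yl.
Qed.

End NbcResidue.

(** The iterated residues are dual to the functions of the bases without broken circuit, so the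
    weights are the prescribed values there. The combination kills derivatives term by term. *)
Definition chamber_residue (f : K) : C :=
  \sum_(s <- fpowerset Phip | no_broken_circuit s)
    (cone_weight s)%:C * iterated_residue Phip (seq_mx (ordered s)) f.

Lemma nbc_unit s : (s `<=` Phip)%fset -> no_broken_circuit s ->
  seq_mx (ordered s) \in unitmx.
Proof. by move=> sP sn; apply: ordered_mx_unit. Qed.

Lemma chamber_residue_comb k (f g : K) : RH Phip f -> RH Phip g ->
  chamber_residue (scal k f + g) = k * chamber_residue f + chamber_residue g.
Proof.
move=> fR gR; rewrite /chamber_residue mulr_sumr -big_split /= big_seq_cond [RHS]big_seq_cond.
apply: eq_bigr => s /andP[]; rewrite fpowersetE => sP sn.
by rewrite iterated_residue_comb ?nbc_unit // mulrDr mulrCA.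
Qed.

Lemma chamber_residue_deriv v f : RH Phip f -> chamber_residue (fderiv v f) = 0.
Proof.
move=> fR; rewrite /chamber_residue big_seq_cond big1 // => s /andP[].
by rewrite fpowersetE => sP sn; rewrite iterated_residue_deriv ?nbc_unit // mulr0.
Qed.

Lemma RH_fsigma t : (t `<=` Phip)%fset -> RH Phip (fsigma t).
Proof. by move=> /fsubsetP tP; exists 1, t. Qed.

Lemma chamber_residue0 : chamber_residue 0 = 0.
Proof.
have R0 : RH Phip (0 : K) by rewrite -(rmorph0 (@FracField.tofrac _)); apply: RH_tofrac.
have := @chamber_residue_comb 1 0 0 R0 R0; rewrite scal1 addr0 mul1r => /eqP.
by rewrite -subr_eq0 opprD addrA subrr add0r oppr_eq0 => /eqP.
Qed.

Lemma RH_sum (I : eqType) (s : seq I) (p : pred I) (F : I -> K) :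
  (forall x, x \in s -> p x -> RH Phip (F x)) -> RH Phip (\sum_(x <- s | p x) F x).
Proof.
move=> FR; rewrite big_seq_cond; elim/big_ind: _ => [|x y|x /andP[]]; last exact: FR.
  by rewrite -(rmorph0 (@FracField.tofrac _)); apply: RH_tofrac.
exact: RHD.
Qed.

Lemma chamber_residue_sum (I : eqType) (s : seq I) (p : pred I) (k : I -> C) (F : I -> K) :
  (forall x, x \in s -> p x -> RH Phip (F x)) ->
  chamber_residue (\sum_(x <- s | p x) scal (k x) (F x)) =
  \sum_(x <- s | p x) k x * chamber_residue (F x).
Proof.
elim: s => [|a s IH] FR; first by rewrite !big_nil chamber_residue0.
have FR' : forall x, x \in s -> p x -> RH Phip (F x).
  by move=> x xs; apply: FR; rewrite inE xs orbT.
rewrite !big_cons; case: ifP => pa; last exact: IH.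
rewrite chamber_residue_comb ?IH //; first by apply: FR; rewrite ?mem_head.
by apply: RH_sum => x xs px; apply: RH_scal; apply: FR'.
Qed.

(** Induction on the sum of the ranks. If some [b] lies in the span of later elements of [t],
    exchanging it for one of them lowers the sum, and both sides obey the same exchange relation;
    otherwise duality gives the value. *)
Lemma chamber_residue_fsigma t : (t `<=` Phip)%fset -> basis_of fullv t ->
  chamber_residue (fsigma t) = (cone_weight t)%:C.
Proof.
move: {2}(\sum_(g <- t) rank g).+1 (ltnSn (\sum_(g <- t) rank g)) => n.
elim: n t => [//|n IH] t tn tP tb.
case: (boolP (no_broken_circuit t)) => [tnbc|].
  rewrite /chamber_residue big_mkcond (big_fsetD1 t) ?fpowersetE //= tnbc.
  rewrite nbc_residue_diag // mulr1 big_seq_cond big1 ?addr0 // => s.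
  rewrite in_fsetD1 fpowersetE andbT => /andP[st sP]; case: ifP => // sn.
  by rewrite nbc_residue_neq // mulr0.
rewrite /no_broken_circuit tb /= => /allPn [b bP]; rewrite negbK => bspan.
have [|l lE] := span_coords _ bspan; first by rewrite filter_uniq ?fset_uniq.
(* Coefficients are set to 0 on the elements not later than [b], so only exchanges that lower the
   sum of ranks occur. *)
pose c g := if (rank b < rank g)%N then l g else 0.
have bE : b = \sum_(g <- t) c g *: g.
  rewrite {1}lE big_filter big_mkcond; apply: eq_bigr => g _; rewrite /c.
  by case: ifP => //; rewrite scale0r.
have bt : b \notin t.
  apply/negP => bt; have bE' : b = \sum_(g <- t) (g == b)%:R *: g.
    rewrite (big_fsetD1 b) //= eqxx scale1r big_seq big1 ?addr0 // => g.
    by rewrite in_fsetD1 => /andP[/negbTE -> _]; rewrite scale0r.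
  have := free_sum_inj (basis_free tb) (etrans (esym bE) bE') bt.
  by rewrite /c ltnn eqxx => /eqP; rewrite eq_sym oner_eq0.
rewrite (fsigma_exchange tP bP bt bE) chamber_residue_sum; last first.
  by move=> g _ _; apply/RH_fsigma/exchange_sub.
rewrite (cone_weight_exchange tP tb bP bt bE) rmorph_sum /=.
rewrite big_seq_cond [RHS]big_seq_cond; apply: eq_bigr => g /andP[gt cg].
rewrite rmorphM IH //; last 2 first.
- exact: exchange_sub.
- exact: exchange_basis bE _ gt cg.
have bg : (rank b < rank g)%N by move: cg; rewrite /c; case: ifP => //; rewrite eqxx.
rewrite big_fsetU1 ?b_notin_D1 //= -ltnS; apply: leq_ltn_trans tn => /=.
by rewrite (big_fsetD1 g gt) /= ltn_add2r.
Qed.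

End ChamberFunctional.

Section ChiTheory.
Variables (R : realType) (r : nat) (Phip Delta : {fset 'rV[R]_r}).
Variables (cor : 'rV[R]_r -> 'cV[R]_r) (height : 'rV[R]_r -> R) (lambda : 'rV[R]_r).
Variable chamber : set 'rV[R]_r.
Hypotheses (Phip0 : 0 \notin Phip).
Hypotheses (heightD : {morph height : x y / x + y})
  (heightZ : forall k x, height (k *: x) = k * height x)
  (height_pos : {in Phip, forall a, 0 < height a}).
Hypothesis lambda_ns : ~ singular Phip lambda.
Hypothesis fund_unit : fund_weights Delta cor \in unitmx.
Hypothesis chamber_cone : forall s : {fset 'rV[R]_r}, (s `<=` Phip)%fset ->
  basis_of fullv s -> (chamber `<=` cone s)%classic <-> cone s lambda.
Local Notation C := R[i].
Local Notation K := {fraction (mpoly r R[i])}.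
Local Notation vol := (vol_box Delta cor).

Lemma SH_RH (f : K) : SH Phip f -> RH Phip f.
Proof.
move=> [c ->]; apply: RH_sum => // s; rewrite fpowersetE => sP _.
by apply: RH_scal; apply: RH_fsigma.
Qed.

Lemma chi_functional : chamber_functional Phip vol chamber (chi Phip vol chamber).
Proof.
rewrite /chi; case: xgetP => [h _ //|/(_ (chamber_residue Phip Delta cor lambda)) []].
split=> [k f g /SH_RH fR /SH_RH gR|s sP sb]; first exact: chamber_residue_comb.
rewrite (chamber_residue_fsigma Phip0 heightD heightZ height_pos lambda_ns fund_unit sP sb).
rewrite /cone_weight; case: asboolP => [sl|sl]; case: asboolP => // sl'.
- by case: sl'; apply/chamber_cone.
- by case: sl; apply/chamber_cone.
Qed.

Local Notation chi_c := (chi Phip vol chamber).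

Lemma chi_fsigma s : (s `<=` Phip)%fset -> basis_of fullv s ->
  chi_c (fsigma s) = if `[< cone s lambda >] then (vol s)^-1%:C else 0.
Proof.
move=> sP sb; have [_ ->] // := chi_functional.
by case: asboolP => [/chamber_cone H|sl]; case: asboolP => // sl'; [case: sl'; apply: H|case: sl; apply/chamber_cone].
Qed.

Lemma chi_comb k f g : SH Phip f -> SH Phip g -> chi_c (scal k f + g) = k * chi_c f + chi_c g.
Proof. by move=> fS gS; have [-> //] := chi_functional. Qed.

Lemma chi0 : chi_c 0 = 0.
Proof.
have := @chi_comb 1 0 0 (@SH0 R r Phip) (@SH0 R r Phip); rewrite scal1 addr0 mul1r => /eqP.
by rewrite -subr_eq0 opprD addrA subrr add0r oppr_eq0 => /eqP.
Qed.

Lemma chi_residue f : SH Phip f -> chi_c f = chamber_residue Phip Delta cor lambda f.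
Proof.
move=> [c ->]; have Sum (I : eqType) (s : seq I) (p : pred I) (k : I -> C) (F : I -> K) :
    (forall x, x \in s -> p x -> SH Phip (F x)) ->
    chi_c (\sum_(x <- s | p x) scal (k x) (F x)) =
    \sum_(x <- s | p x) k x * chi_c (F x) /\ SH Phip (\sum_(x <- s | p x) scal (k x) (F x)).
  elim: s => [|a s IH] FS; first by rewrite !big_nil chi0; split=> //; apply: SH0.
  have [IH1 IH2] : chi_c (\sum_(x <- s | p x) scal (k x) (F x)) =
    \sum_(x <- s | p x) k x * chi_c (F x) /\ SH Phip (\sum_(x <- s | p x) scal (k x) (F x)).
    by apply: IH => x xs; apply: FS; rewrite inE xs orbT.
  rewrite !big_cons; case: ifP => pa //.
  have aS : SH Phip (F a) by apply: FS; rewrite ?mem_head.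
  by rewrite chi_comb // IH1; split=> //; apply: SHD => //; apply: SH_scal.
have fP s : s \in fpowerset Phip -> basis_of fullv s -> SH Phip (fsigma s).
  by rewrite fpowersetE => sP sb; apply: SH_fsigma.
have [-> _] := Sum _ _ _ c _ fP.
rewrite chamber_residue_sum //; last by move=> s sP sb; apply: SH_RH; apply: fP.
rewrite big_seq_cond [RHS]big_seq_cond; apply: eq_bigr => s /andP[].
rewrite fpowersetE => sP sb; congr (_ * _); rewrite chi_fsigma //.
rewrite (chamber_residue_fsigma Phip0 heightD heightZ height_pos lambda_ns fund_unit sP sb).
by rewrite /cone_weight; case: asboolP.
Qed.

(** This takes the place of the directness of the decomposition of R_H: [Tres] chooses a part in
    S_H, and two choices differ by an element of both spaces, on which [chi] vanishes. *)
Lemma chi_dRH f : SH Phip f -> dRH Phip f -> chi_c f = 0.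
Proof.
move=> fS [vg [vgR fE]]; rewrite chi_residue // fE => {fS f fE}.
suff [] : RH Phip (\sum_(x <- vg) fderiv x.1 x.2) /\
    chamber_residue Phip Delta cor lambda (\sum_(x <- vg) fderiv x.1 x.2) = 0 by [].
elim: vg vgR => [|x vg IH] vgR.
  rewrite big_nil chamber_residue0 //; split=> //.
  by rewrite -(rmorph0 (@FracField.tofrac _)); apply: RH_tofrac.
have [|sR s0] := IH; first by move=> y yv; apply: vgR; rewrite inE yv orbT.
have xR := vgR x (mem_head _ _).
have dR : RH Phip (fderiv x.1 x.2).
  have [p [b [bP ->]]] := xR; rewrite (fderivE _ _ (linform_prod_neq0 Phip0 bP)).
  eexists _, (b ++ b); split; first by move=> y; rewrite mem_cat orbb => /bP.
  by rewrite big_cat expr2.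
rewrite big_cons -[X in X + _]scal1; split.
  by apply: RHD => //; apply: RH_scal.
by rewrite chamber_residue_comb // s0 chamber_residue_deriv // mulr0 addr0.
Qed.

End ChiTheory.

(** * Chambers and simplicial cones *)

Section BigChambers.
Variables (R : realType) (r : nat) (Phip : {fset 'rV[R]_r}).

Lemma chamber_nonsingular (c : set 'rV[R]_r) : big_chamber Phip c ->
  (c `<=` nonsingular Phip)%classic.
Proof. by move=> [x xn ->]; apply: connected_component_sub. Qed.

Lemma continuous_coordinate (A : 'M[R]_r) (k : 'I_r) :
  continuous (fun x : 'rV[R]_r => (x *m A) 0 k).
Proof.
have -> : (fun x : 'rV[R]_r => (x *m A) 0 k) = (fun x => \sum_(j < r) x 0 j * A j k).
  by apply/funext => x; rewrite mxE.
have: forall s : seq 'I_r, continuous (fun x : 'rV[R]_r => \sum_(j <- s) x 0 j * A j k).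
  elim=> [|j s IH] x.
    rewrite (_ : (fun x : 'rV[R]_r => _) = (fun=> 0)); first exact: cst_continuous.
    by apply/funext => y; rewrite big_nil.
  rewrite (_ : (fun x : 'rV[R]_r => _) =
      (fun x => x 0 j * A j k + \sum_(j <- s) x 0 j * A j k)).
    by apply: cvgD (IH x); apply: cvgMl; apply: coord_continuous.
  by apply/funext => y; rewrite big_cons.
exact.
Qed.

Lemma cone_seq_mx (s : {fset 'rV[R]_r}) x : basis_of fullv s ->
  cone s x <-> forall k : 'I_r, 0 <= (x *m invmx (seq_mx s)) 0 k.
Proof.
move=> sb; have [sr su] := basis_seq_mx sb.
have xE : x = \sum_(k < r) (x *m invmx (seq_mx s)) 0 k *: s`_k.
  by rewrite -mul_seq_mx mulmxKV.
split=> [[c c0 cE] k|x0].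
  suff -> : x *m invmx (seq_mx s) = \row_k c s`_k by rewrite mxE.
  apply: (can_inj (mulmxK su)); rewrite mulmxKV // mul_seq_mx cE (big_nth 0) sr big_mkord.
  by apply: eq_bigr => l _; rewrite mxE.
exists (fun a => if insub (index a s) is Some k then (x *m invmx (seq_mx s)) 0 k else 0).
  by move=> a; case: insub.
rewrite (big_nth 0) sr big_mkord {1}xE; apply: eq_bigr => k _.
by rewrite index_uniq ?fset_uniq ?sr // valK.
Qed.

Lemma cone_interior (s : {fset 'rV[R]_r}) x : (s `<=` Phip)%fset -> basis_of fullv s ->
  ~ singular Phip x -> cone s x -> forall k : 'I_r, 0 < (x *m invmx (seq_mx s)) 0 k.
Proof.
move=> sP sb xn sx k; have [sr su] := basis_seq_mx sb.
have xE : x = \sum_(k < r) (x *m invmx (seq_mx s)) 0 k *: s`_k.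
  by rewrite -mul_seq_mx mulmxKV.
pose l g := if insub (index g s) is Some k then (x *m invmx (seq_mx s)) 0 k else 0.
have lk (j : 'I_r) : l s`_j = (x *m invmx (seq_mx s)) 0 j.
  by rewrite /l index_uniq ?fset_uniq ?sr // valK.
have lE : x = \sum_(g <- s) l g *: g.
  by rewrite (big_nth 0) sr big_mkord {1}xE; apply: eq_bigr => j _; rewrite lk.
rewrite -lk; have lA : all (fun g => 0 <= l g) s by apply/(cone_basisE (basis_free sb) lE).
by have := cone_strict xn sP sb lE lA; apply; rewrite mem_nth ?sr.
Qed.

(** A chamber avoids the facets of the cone, so it meets the closed cone in the same set as the open
    one. That set is open and closed in the chamber, which is connected. *)
Lemma chamber_in_cone (c : set 'rV[R]_r) lambda (s : {fset 'rV[R]_r}) :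
  big_chamber Phip c -> c lambda -> (s `<=` Phip)%fset -> basis_of fullv s ->
  (c `<=` cone s)%classic <-> cone s lambda.
Proof.
move=> cP cl sP sb; split=> [|sl]; first exact.
have cn := chamber_nonsingular cP.
have cc : connected c by case: cP => x xn ->; apply: component_connected.
pose f (k : 'I_r) (x : 'rV[R]_r) := (x *m invmx (seq_mx s)) 0 k.
pose U : set 'rV[R]_r := [set x | forall k, 0 < f k x]%classic.
have Uo : open U.
  have opn (l : seq 'I_r) : open [set x | forall k, k \in l -> 0 < f k x]%classic.
    elim: l => [|k l IH].
      rewrite (_ : [set x | _]%classic = setT); first exact: openT.
      by apply/seteqP; split=> x.
    rewrite (_ : [set x | _]%classic =
        ((f k @^-1` [set y | 0 < y]) `&` [set x | forall k, k \in l -> 0 < f k x])%classic).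
      apply: openI IH; apply: open_comp; last exact: open_gt.
      by move=> x _; apply: continuous_coordinate.
    apply/seteqP; split=> x.
      by move=> H; split=> [|k' k'l]; apply: H; rewrite inE ?eqxx // k'l orbT.
    by move=> [Hk Hl] k'; rewrite inE => /orP[/eqP -> //|/Hl].
  rewrite (_ : U = [set x | forall k, k \in enum 'I_r -> 0 < f k x]%classic) //.
  by apply/seteqP; split=> x H k => [_|]; apply: H; rewrite ?mem_enum.
have Cc : closed (cone s).
  have -> : cone s = (\bigcap_(k in [set: 'I_r]) (f k @^-1` [set y | 0 <= y]))%classic.
    apply/seteqP; split=> x; first by move=> /(cone_seq_mx x sb) H k _; apply: H.
    by move=> H; apply/(cone_seq_mx x sb) => k; apply: H.
  apply: closed_bigI => k _; apply: closed_comp; last exact: closed_ge.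
  by move=> x _; apply: continuous_coordinate.
have cU : (c `&` U = c `&` cone s)%classic.
  apply/seteqP; split=> x [cx xU]; split=> //.
    by apply/(cone_seq_mx x sb) => k; apply/ltW/xU.
  by move=> k; apply: cone_interior xU _ => //; have [] := cn x cx.
have E : (c `&` cone s)%classic = c.
  apply: cc.
  - by exists lambda.
  - by exists U => //; rewrite cU.
  - by exists (cone s).
by move=> x cx; have [] : (c `&` cone s)%classic x by rewrite E.
Qed.

End BigChambers.

(** * Complex power series *)

Section ComplexModulus.
Variable R : realType.
Local Notation C := R[i].
Implicit Types (w x y : C).

Lemma cabsE w : `|w| = (cabs w)%:C.
Proof. by rewrite /cabs; apply/esym/RRe_real/normr_real. Qed.

Lemma cabsM w x : cabs (w * x) = cabs w * cabs x.
Proof. by apply: (@complexI R); rewrite rmorphM /= -!cabsE normrM. Qed.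

Lemma cabsX w n : cabs (w ^+ n) = cabs w ^+ n.
Proof. by apply: (@complexI R); rewrite rmorphXn /= -!cabsE normrX. Qed.

Lemma cabs_ge0 w : 0 <= cabs w.
Proof. by rewrite -lecR -cabsE normr_ge0. Qed.

Lemma cabsD w x : cabs (w + x) <= cabs w + cabs x.
Proof. by rewrite -lecR rmorphD /= -!cabsE ler_normD. Qed.

Lemma cabsN w : cabs (- w) = cabs w.
Proof. by rewrite /cabs normrN. Qed.

Lemma cabsB w x : cabs (w - x) <= cabs w + cabs x.
Proof. by rewrite -(cabsN x) cabsD. Qed.

Lemma cabs_distC w x : cabs (w - x) = cabs (x - w).
Proof. by rewrite -cabsN opprB. Qed.

Lemma cabs0 : cabs (0 : C) = 0.
Proof. by rewrite /cabs normr0. Qed.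

Lemma cabs1 : cabs (1 : C) = 1.
Proof. by rewrite /cabs normr1. Qed.

Lemma cabs_eq0 w : (cabs w == 0) = (w == 0).
Proof. by rewrite -(inj_eq (@complexI R)) -cabsE normr_eq0. Qed.

Lemma cabs_gt0 w : (0 < cabs w) = (w != 0).
Proof. by rewrite lt0r cabs_ge0 andbT cabs_eq0. Qed.

Lemma cabsV w : cabs w^-1 = (cabs w)^-1.
Proof.
have [->|w0] := eqVneq w 0; first by rewrite invr0 cabs0 invr0.
apply: (mulfI (x := cabs w)); first by rewrite cabs_eq0.
by rewrite -cabsM !divff ?cabs_eq0 // cabs1.
Qed.

Lemma cabs_real (t : R) : cabs t%:C = `|t|.
Proof. by apply: (@complexI R); rewrite -cabsE normc_def /= expr0n addr0 sqrtr_sqr. Qed.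

Lemma cabs_nat n : cabs (n%:R : C) = n%:R.
Proof. by rewrite -(rmorph_nat (real_complex R)) cabs_real normr_nat. Qed.

Lemma cabs_sum (I : Type) (s : seq I) (p : pred I) (F : I -> C) :
  cabs (\sum_(i <- s | p i) F i) <= \sum_(i <- s | p i) cabs (F i).
Proof.
elim/big_ind2: _ => [|x a y b xa yb|//]; first by rewrite cabs0.
by apply: le_trans (cabsD _ _) _; rewrite lerD.
Qed.

Lemma cabs_le_ReIm w : cabs w <= `|complex.Re w| + `|complex.Im w|.
Proof.
case: w => a b /=; have -> : (a +i* b) = a%:C + 'i * b%:C :> C by simpc.
apply: le_trans (cabsD _ _) _; rewrite cabsM !cabs_real.
by rewrite {1}/cabs normc_def /= expr0n expr1n add0r sqrtr1 mul1r.
Qed.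

(** Convergence of complex sequences through the real modulus, the form in which [germ_at0] states
    it. *)
Definition cvgC (u : nat -> C) (l : C) := (fun n => cabs (u n - l)) @ \oo --> (0 : R).

Lemma cvgCP u l : cvgC u l <-> forall e : R, 0 < e -> exists N, forall n, (N <= n)%N -> cabs (u n - l) < e.
Proof.
split=> [/cvgrPdist_lt H e e0|H].
  have [N _ NP] := H e e0; exists N => n /NP /=.
  by rewrite sub0r normrN ger0_norm ?cabs_ge0.
apply/cvgrPdist_lt => e e0; have [N NP] := H e e0.
by exists N => // n /NP /=; rewrite sub0r normrN ger0_norm ?cabs_ge0.
Qed.

Lemma cvgC_ext u u' l : (forall n, u n = u' n) -> cvgC u l -> cvgC u' l.
Proof. by move=> /funext ->. Qed.

Lemma cvgCD u v l k : cvgC u l -> cvgC v k -> cvgC (fun n => u n + v n) (l + k).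
Proof.
move=> /cvgCP ul /cvgCP vk; apply/cvgCP => e e0.
have e2 : 0 < e / 2 by rewrite divr_gt0.
have [N NP] := ul _ e2; have [M MP] := vk _ e2; exists (maxn N M) => n.
rewrite geq_max => /andP[/NP h /MP h'].
have -> : u n + v n - (l + k) = (u n - l) + (v n - k) by ring.
by rewrite (splitr e); apply: le_lt_trans (cabsD _ _) _; apply: ltrD.
Qed.

Lemma cvgCZ c u l : cvgC u l -> cvgC (fun n => c * u n) (c * l).
Proof.
move=> /cvgCP ul; apply/cvgCP => e e0.
have c0 : 0 < cabs c + 1 by rewrite ltr_wpDl ?cabs_ge0.
have [N NP] := ul (e / (cabs c + 1)) (divr_gt0 e0 c0); exists N => n /NP.
rewrite -mulrBr cabsM ltr_pdivlMr // => h; apply: le_lt_trans h.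
by rewrite mulrC ler_wpM2l ?cabs_ge0 // lerDl.
Qed.

Lemma cvgC_bounded u l : cvgC u l -> exists B, forall n, cabs (u n) <= B.
Proof.
move=> /cvgCP /(_ 1 ltr01) [N NP].
exists (\sum_(n < N) cabs (u n) + (cabs l + 1)) => n; have [nN|nN] := ltnP n N.
  rewrite (bigD1 (Ordinal nN)) //= -addrA lerDl addr_ge0 ?addr_ge0 ?cabs_ge0 //.
  by apply: sumr_ge0 => *; apply: cabs_ge0.
rewrite ler_wpDl ?sumr_ge0 // => [*|]; first exact: cabs_ge0.
have -> : u n = l + (u n - l) by ring.
by apply: le_trans (cabsD _ _) _; rewrite lerD2l ltW ?NP.
Qed.

Lemma cvgCM u v l k : cvgC u l -> cvgC v k -> cvgC (fun n => u n * v n) (l * k).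
Proof.
move=> ul vk; have [B BP] := cvgC_bounded vk.
move: ul vk => /cvgCP ul /cvgCP vk; apply/cvgCP => e e0.
have B0 : 0 < B + 1 by rewrite ltr_wpDl // (le_trans (cabs_ge0 (v 0%N)) (BP _)).
have l0 : 0 < cabs l + 1 by rewrite ltr_wpDl ?cabs_ge0.
have e2 : 0 < e / 2 by rewrite divr_gt0.
have [N NP] := ul _ (divr_gt0 e2 B0); have [M MP] := vk _ (divr_gt0 e2 l0).
exists (maxn N M) => n; rewrite geq_max => /andP[/NP h /MP h'].
have -> : u n * v n - l * k = (u n - l) * v n + l * (v n - k) by ring.
rewrite (splitr e); apply: le_lt_trans (cabsD _ _) _; rewrite !cabsM; apply: ltrD.
  move: h; rewrite ltr_pdivlMr //; apply: le_lt_trans.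
  by rewrite ler_wpM2l ?cabs_ge0 // (le_trans (BP n)) // lerDl.
move: h'; rewrite ltr_pdivlMr // mulrC; apply: le_lt_trans.
by rewrite ler_wpM2r ?cabs_ge0 // lerDl.
Qed.

Lemma cvgC_const l : cvgC (fun=> l) l.
Proof. by apply/cvgCP => e e0; exists 0%N => n _; rewrite subrr cabs0. Qed.

Lemma cvgC_shift u l : cvgC u l -> cvgC (fun n => u n.+1) l.
Proof.
move=> /cvgCP H; apply/cvgCP => e /H [N NP]; exists N => n Nn.
by apply: NP; rewrite ltnW.
Qed.

Lemma cvgC_unshift u l : cvgC (fun n => u n.+1) l -> cvgC u l.
Proof.
by move=> /cvgCP H; apply/cvgCP => e /H [N NP]; exists N.+1 => -[//|n] Nn; apply: NP.
Qed.

Lemma cvgC_le u l (B : R) : cvgC u l -> (forall n, cabs (u n) <= B) -> cabs l <= B.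
Proof.
move=> /cvgCP H uB; rewrite leNgt; apply/negP => lB.
have [N /(_ N (leqnn _))] := H _ (etrans (subr_gt0 _ _) lB).
rewrite ltNge => /negP; apply; rewrite lerBlDr.
rewrite {1}(_ : l = - (u N - l) + u N); last by ring.
by apply: le_trans (cabsD _ _) _; rewrite cabsN lerD2l.
Qed.

Definition cvgS (a : nat -> C) (s : C) := cvgC (fun n => \sum_(k < n) a k) s.

Lemma cvgSD a b s t : cvgS a s -> cvgS b t -> cvgS (fun k => a k + b k) (s + t).
Proof.
by move=> sa sb; apply: cvgC_ext (cvgCD sa sb) => n; rewrite big_split.
Qed.

Lemma cvgSZ c a s : cvgS a s -> cvgS (fun k => c * a k) (c * s).
Proof. by move=> sa; apply: cvgC_ext (cvgCZ c sa) => n; rewrite mulr_sumr. Qed.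

Lemma geometric_sum_le (rho : R) n : 0 <= rho -> rho <= 2^-1 -> \sum_(k < n) rho ^+ k <= 2.
Proof.
move=> r0 r2; have : \sum_(k < n) rho ^+ k <= \sum_(k < n) (2^-1) ^+ k :> R.
  by apply: ler_sum => k _; apply: lerXn2r; rewrite ?nnegrE.
move/le_trans; apply.
suff -> : \sum_(k < n) (2^-1) ^+ k = 2 - 2 * (2^-1) ^+ n :> R.
  by rewrite gerBl mulr_ge0 // exprn_ge0.
elim: n => [|n IH]; first by rewrite big_ord0 expr0; ring.
by rewrite big_ord_recr /= IH exprS; field.
Qed.

Definition cauchy (a b : nat -> C) n := \sum_(k < n.+1) a k * b (n - k)%N.

(** The [n + 1] terms of the Cauchy product are absorbed into [2 ^ n]. *)
Lemma cauchy_bound a b (A B rho : R) : 0 <= A -> 0 <= B -> 0 <= rho ->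
  (forall k, cabs (a k) <= A * rho ^+ k) -> (forall k, cabs (b k) <= B * rho ^+ k) ->
  forall n, cabs (cauchy a b n) <= A * B * (2 * rho) ^+ n.
Proof.
move=> A0 B0 r0 aA bB n; apply: le_trans (cabs_sum _ _ _) _.
apply: (@le_trans _ _ (\sum_(k < n.+1) A * B * rho ^+ n)).
  apply: ler_sum => k _; rewrite cabsM.
  have -> : A * B * rho ^+ n = (A * rho ^+ k) * (B * rho ^+ (n - k)).
    by rewrite mulrACA -exprD subnKC // -ltnS.
  by apply: ler_pM; rewrite ?cabs_ge0.
rewrite sumr_const card_ord -[_ *+ n.+1]mulr_natl exprMn.
have -> : n.+1%:R * (A * B * rho ^+ n) = A * B * (n.+1%:R * rho ^+ n) by ring.
apply: ler_wpM2l.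
  by rewrite mulr_ge0.
by rewrite ler_wpM2r ?exprn_ge0 // -natrX ler_nat ltn_expl.
Qed.

Lemma null_geometric (B e : R) : 0 < e -> exists N, forall n, (N <= n)%N -> B * 2^-1 ^+ n < e.
Proof.
move=> e0; exists (Num.truncn (`|B| / e)).+1 => n Nn.
rewrite exprVn ltr_pdivrMr ?exprn_gt0 // mulrC -ltr_pdivrMr //.
apply: (@le_lt_trans _ _ (`|B| / e)); first by apply: ler_wpM2r; [rewrite invr_ge0 ltW|exact: ler_norm].
apply: lt_le_trans (truncnS_gt _) _; rewrite -natrX ler_nat.
by apply: leq_trans Nn _; apply: ltnW; apply: ltn_expl.
Qed.

Lemma sum_triangle (F : nat -> nat -> C) N :
  \sum_(n < N) \sum_(k < n.+1) F k (n - k)%N = \sum_(k < N) \sum_(j < N - k) F k j.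
Proof.
elim: N => [|N IH]; first by rewrite !big_ord0.
rewrite big_ord_recr /= IH [RHS]big_ord_recr /= subSnn big_ord1.
rewrite [in LHS]big_ord_recr /= subnn addrA; congr (_ + _).
rewrite -big_split; apply: eq_bigr => k _ /=.
by rewrite subSn ?(ltnW (ltn_ord k)) // big_ord_recr.
Qed.

(** The difference is a sum over a triangle of at most [n ^ 2] terms of size [rho ^ n]. Bounding
    each factor [n] by [2 ^ n] leaves [(4 rho) ^ n], which is at most [2 ^ (-n)] for [rho <= 1/8].
    Convergence of the two series is not assumed, so that [has_seriesV] can apply it to an
    inverse. *)
Lemma cauchy_cvg0 a b (A B rho : R) : 0 <= A -> 0 <= B -> 0 <= rho -> rho <= 8^-1 ->
  (forall k, cabs (a k) <= A * rho ^+ k) -> (forall k, cabs (b k) <= B * rho ^+ k) ->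
  cvgC (fun N => \sum_(n < N) cauchy a b n - (\sum_(k < N) a k) * (\sum_(k < N) b k)) 0.
Proof.
move=> A0 B0 r0 r8 aA bB.
apply/cvgCP => e e0; have [N NP] := null_geometric (A * B) e0.
exists N => n /NP; apply: le_lt_trans; rewrite subr0 cabs_distC.
have -> : (\sum_(k < n) a k) * (\sum_(k < n) b k) - \sum_(m < n) cauchy a b m =
    \sum_(k < n) a k * (\sum_(n - k <= j < n) b j).
  rewrite mulr_suml (sum_triangle (fun k j => a k * b j)) -sumrB; apply: eq_bigr => k _.
  rewrite -mulr_sumr -mulrBr; congr (_ * _).
  rewrite -(big_mkord xpredT b) -(big_mkord xpredT b).
  by rewrite (big_cat_nat (leq0n (n - k)) (leq_subr k n)) /= addrAC subrr add0r.
apply: le_trans (cabs_sum _ _ _) _.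
apply: (@le_trans _ _ (\sum_(k < n) A * B * n%:R * rho ^+ n)).
  apply: ler_sum => k _; rewrite cabsM.
  have -> : A * B * n%:R * rho ^+ n = (A * rho ^+ k) * (n%:R * (B * rho ^+ (n - k))).
    have E : rho ^+ n = rho ^+ k * rho ^+ (n - k) by rewrite -exprD subnKC // ltnW.
    by rewrite E; ring.
  apply: ler_pM; rewrite ?cabs_ge0 //.
  apply: le_trans (cabs_sum _ _ _) _.
  apply: (@le_trans _ _ (\sum_(n - k <= j < n) B * rho ^+ (n - k))).
    rewrite big_nat_cond [X in _ <= X]big_nat_cond; apply: ler_sum => j.
    rewrite andbT => /andP[nj _]; apply: le_trans (bB j) _; apply: ler_wpM2l => //.
    by apply: ler_wiXn2l => //; apply: le_trans r8 _; rewrite invf_le1 ?ler1n.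
  rewrite sumr_const_nat -[_ *+ (n - _)]mulr_natl ler_wpM2r //; first by rewrite mulr_ge0 ?exprn_ge0.
  by rewrite ler_nat leq_subr.
rewrite sumr_const card_ord -[_ *+ n]mulr_natl.
have -> : n%:R * (A * B * n%:R * rho ^+ n) = A * B * (n%:R * n%:R * rho ^+ n) by ring.
apply: ler_wpM2l; first by rewrite mulr_ge0.
apply: (@le_trans _ _ (4 ^+ n * rho ^+ n)).
  apply: ler_wpM2r; first by rewrite exprn_ge0.
  rewrite -natrM -natrX ler_nat -[4%N]/(2 * 2)%N expnMn.
  by apply: leq_mul; apply: ltnW; apply: ltn_expl.
rewrite -exprMn; apply: lerXn2r; rewrite ?nnegrE ?mulr_ge0 ?invr_ge0 //.
apply: (@le_trans _ _ (4 * 8^-1)); first by rewrite ler_wpM2l.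
by rewrite -[8]/(4 * 2)%:R natrM invfM mulrA divff ?mul1r // pnatr_eq0.
Qed.

Lemma cauchy_cvg a b s t (A B rho : R) : 0 <= A -> 0 <= B -> 0 <= rho -> rho <= 8^-1 ->
  (forall k, cabs (a k) <= A * rho ^+ k) -> (forall k, cabs (b k) <= B * rho ^+ k) ->
  cvgS a s -> cvgS b t -> cvgS (cauchy a b) (s * t).
Proof.
move=> A0 B0 r0 r8 aA bB sa sb.
have := cvgCD (cauchy_cvg0 A0 B0 r0 r8 aA bB) (cvgCM sa sb); rewrite add0r.
by apply: cvgC_ext => n; rewrite subrK.
Qed.

(** At the first nonzero coefficient [a k], the terms beyond it at the point [th * t] are bounded by
    [2 D th^(k+1)], with [D] a bound for the terms at [t]. Hence [|a k| t^k <= 2 D th] for all small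
    [th]. *)
Lemma power_series_eq0 (a : nat -> C) (e : R) : 0 < e ->
  (forall t : R, 0 < t -> t < e -> cvgS (fun k => a k * (t ^+ k)%:C) 0) ->
  forall k, a k = 0.
Proof.
move=> e0 H k0; apply: contrapT => /eqP ak0.
have [k ak kmin] := ex_minnP (ex_intro (fun k => a k != 0) k0 ak0).
have lt0 j : (j < k)%N -> a j = 0.
  by move=> jk; apply/eqP; apply: contraTT jk => /kmin; rewrite -leqNgt.
pose t := e / 2; have t0 : 0 < t by rewrite divr_gt0.
have te : t < e by rewrite ltr_pdivrMr // ltr_pMr // ltr1n.
have [B BP] := cvgC_bounded (H t t0 te).
have termB j : cabs (a j) * t ^+ j <= B + B.
  have -> : cabs (a j) * t ^+ j =
      cabs (\sum_(k < j.+1) a k * (t ^+ k)%:C - \sum_(k < j) a k * (t ^+ k)%:C).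
    rewrite big_ord_recr /= addrAC subrr add0r cabsM cabs_real ger0_norm //.
    by rewrite exprn_ge0 // ltW.
  by apply: le_trans (cabsB _ _) _; apply: lerD.
pose D := B + B; have D0 : 0 <= D by apply: le_trans (termB 0%N); rewrite mulr_ge0 ?cabs_ge0 ?exprn_ge0 // ltW.
have key (th : R) : 0 < th -> th <= 2^-1 -> cabs (a k) * t ^+ k <= D * th * 2.
  move=> th0 th2; have tht : th * t < e.
    apply: le_lt_trans te; rewrite ler_piMl ?(ltW t0) //.
    by apply: le_trans th2 _; rewrite invf_le1 ?ler1n.
  have C0 := H (th * t) (mulr_gt0 th0 t0) tht.
  have bound n : cabs (a k) * (th * t) ^+ k <=
      cabs (\sum_(j < k.+1 + n) a j * ((th * t) ^+ j)%:C) + D * th ^+ k.+1 * 2.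
    rewrite big_split_ord /= big_ord_recr /= big1 ?add0r; last first.
      by move=> j _; rewrite lt0 ?mul0r.
    set X := a k * _; set Y := \sum_(j < n) _.
    have -> : cabs (a k) * (th * t) ^+ k = cabs (X + Y - Y).
      by rewrite addrK cabsM cabs_real ger0_norm // exprn_ge0 // ltW // mulr_gt0.
    apply: le_trans (cabsB _ _) _; rewrite lerD2l.
    apply: le_trans (cabs_sum _ _ _) _.
    apply: (@le_trans _ _ (\sum_(j < n) D * th ^+ k.+1 * th ^+ j)).
      apply: ler_sum => j _; rewrite cabsM cabs_real ger0_norm; last first.
        by rewrite exprn_ge0 // ltW // mulr_gt0.
      rewrite exprMn -mulrA -exprD [X in _ * X]mulrC mulrA.
      by apply: ler_wpM2r (termB _); rewrite exprn_ge0 // ltW.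
    rewrite -mulr_sumr ler_wpM2l ?geometric_sum_le ?(ltW th0) //.
    by rewrite mulr_ge0 ?exprn_ge0 ?(ltW th0).
  have bound' : cabs (a k) * (th * t) ^+ k <= D * th ^+ k.+1 * 2.
    rewrite leNgt; apply/negP => lt.
    have /cvgCP /(_ _ (etrans (subr_gt0 _ _) lt)) [N NP] := C0.
    have := NP (k.+1 + N)%N (leq_addl _ _); rewrite subr0 ltrBrDr.
    by rewrite ltNge bound.
  have thk : 0 < th ^+ k by rewrite exprn_gt0.
  rewrite -(ler_pM2r thk); apply: le_trans (le_trans _ bound') _.
    have -> // : cabs (a k) * t ^+ k * th ^+ k = cabs (a k) * (th * t) ^+ k.
    by rewrite (exprMn k th t) -mulrA [t ^+ k * _]mulrC.
  by rewrite exprS mulrA -!mulrA [th ^+ k * 2]mulrC.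
have pos : 0 < cabs (a k) * t ^+ k by rewrite mulr_gt0 ?exprn_gt0 // cabs_gt0.
pose Q := cabs (a k) * t ^+ k.
(* Chosen so that [2 D th < Q]; the 1 added to [D] avoids a division by zero. *)
pose th := Num.min 2^-1 (Q / (4 * (D + 1))).
have D1 : 0 < 4 * (D + 1) by rewrite mulr_gt0 // ltr_wpDl.
have th0 : 0 < th by rewrite lt_min invr_gt0 ltr0n /= divr_gt0.
have th2 : th <= 2^-1 by rewrite /th ge_min lexx.
have := key th th0 th2; rewrite -/Q leNgt => /negP; apply.
have thQ : th * (4 * (D + 1)) <= Q by rewrite -ler_pdivlMr // ge_min lexx orbT.
apply: lt_le_trans thQ; nra.
Qed.

End ComplexModulus.

(** * Functions of one variable given by power series near 0 *)

Section PowerSeries.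
Variable R : realType.
Local Notation C := R[i].
Implicit Types (f g : C -> C) (a b : nat -> C).

Definition geometric_bound a (A rho : R) := forall k, cabs (a k) <= A * rho ^+ k.

(* Only the values near 0 but not at 0 matter. *)
Definition has_series f a := (exists A rho : R, [/\ 0 <= A, 0 < rho & geometric_bound a A rho]) /\
  exists2 e : R, 0 < e & forall y : C, y != 0 -> cabs y < e -> cvgS (fun k => a k * y ^+ k) (f y).

Lemma geometric_boundW a A rho rho' : 0 <= A -> 0 <= rho -> rho <= rho' ->
  geometric_bound a A rho -> geometric_bound a A rho'.
Proof.
move=> A0 r0 rr aA k; apply: le_trans (aA k) _; apply: ler_wpM2l => //.
by apply: lerXn2r => //; rewrite nnegrE // (le_trans r0).
Qed.

Lemma geometric_bound_eval a A rho (y : C) : geometric_bound a A rho ->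
  geometric_bound (fun k => a k * y ^+ k) A (rho * cabs y).
Proof.
move=> aA k; rewrite cabsM cabsX exprMn mulrA; apply: ler_wpM2r (aA k).
by rewrite exprn_ge0 ?cabs_ge0.
Qed.

Lemma cauchy_eval a b (y : C) n :
  cauchy (fun k => a k * y ^+ k) (fun k => b k * y ^+ k) n = cauchy a b n * y ^+ n.
Proof.
rewrite /cauchy mulr_suml; apply: eq_bigr => k _.
by rewrite mulrACA -exprD subnKC // -ltnS.
Qed.

Lemma has_series_ext f f' a : (exists2 e : R, 0 < e & forall y : C, y != 0 -> cabs y < e -> f y = f' y) ->
  has_series f a -> has_series f' a.
Proof.
move=> [d d0 E] [B [e e0 H]]; split=> //; exists (Num.min d e); first by rewrite lt_min d0.
by move=> y y0; rewrite lt_min => /andP[yd ye]; rewrite -E //; apply: H.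
Qed.

Lemma has_seriesM f g a b : has_series f a -> has_series g b ->
  has_series (fun y => f y * g y) (cauchy a b).
Proof.
move=> [[A [rho [A0 r0 aA]]] [e e0 fa]] [[B [rho' [B0 r0' bB]]] [e' e0' gb]].
pose s := Num.max rho rho'; have s0 : 0 < s by rewrite lt_max r0.
have aA' : geometric_bound a A s by apply: geometric_boundW aA; rewrite ?(ltW r0) // /s le_max lexx.
have bB' : geometric_bound b B s by apply: geometric_boundW bB; rewrite ?(ltW r0') // /s le_max lexx orbT.
split.
  exists (A * B), (2 * s); split; rewrite ?mulr_ge0 ?mulr_gt0 //.
  by apply: cauchy_bound => //; rewrite ltW.
exists (Num.min (Num.min e e') (8^-1 / s)).
  by rewrite !lt_min e0 e0' divr_gt0.
move=> y y0; rewrite !lt_min => /andP[/andP[ye ye'] ys].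
have sy : s * cabs y <= 8^-1 by rewrite mulrC -ler_pdivlMr // ltW.
have H := cauchy_cvg A0 B0 (mulr_ge0 (ltW s0) (cabs_ge0 y)) sy
  (geometric_bound_eval y aA') (geometric_bound_eval y bB') (fa y y0 ye) (gb y y0 ye').
by apply: cvgC_ext H => n; apply: eq_bigr => k _; rewrite cauchy_eval.
Qed.

Lemma has_seriesZ c f a : has_series f a -> has_series (fun y => c * f y) (fun k => c * a k).
Proof.
move=> [[A [rho [A0 r0 aA]]] [e e0 fa]]; split.
  exists (cabs c * A), rho; split; rewrite ?mulr_ge0 ?cabs_ge0 // => k.
  by rewrite cabsM -mulrA; apply: ler_wpM2l; rewrite ?cabs_ge0.
exists e => // y y0 ye; apply: cvgC_ext (cvgSZ c (fa y y0 ye)) => n.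
by apply: eq_bigr => k _; rewrite mulrA.
Qed.

Lemma has_series1 : has_series (fun=> 1) (fun k => (k == 0%N)%:R).
Proof.
split.
  exists 1, 1; split=> // -[|k]; rewrite ?expr0 ?expr1n mulr1 ?cabs1 ?lexx // cabs0.
  exact: ler01.
exists 1 => // y y0 _; apply/cvgCP => e e0; exists 1%N => -[//|n] _.
rewrite big_ord_recl /= expr0 mulr1 big1 => [|j _]; last by rewrite mul0r.
by rewrite addr0 subrr cabs0.
Qed.

Lemma has_seriesB1 f a : has_series f a ->
  has_series (fun y => 1 - f y) (fun k => (k == 0%N)%:R - a k).
Proof.
move=> fa; have [[A [rho [A0 r0 aA]]] [e e0 fS]] := has_seriesZ (-1) fa.
have [_ [e' e0' oS]] := has_series1; split.
  exists (1 + A), (1 + rho); split; rewrite ?addr_ge0 ?addr_gt0 // => k.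
  apply: le_trans (cabsB _ _) _; rewrite mulrDl; apply: lerD; last first.
    have := aA k; rewrite mulN1r cabsN => /le_trans; apply; apply: ler_wpM2l => //.
    by apply: lerXn2r; rewrite ?nnegrE ?addr_ge0 ?lerDr // ltW.
  rewrite mul1r; apply: (@le_trans _ _ 1).
    by case: (k == 0%N); rewrite ?cabs1 ?cabs0.
  by rewrite exprn_ege1 // lerDl ltW.
exists (Num.min e e'); first by rewrite lt_min e0.
move=> y y0; rewrite lt_min => /andP[ye ye'].
have := cvgSD (oS y y0 ye') (fS y y0 ye); rewrite mulN1r; apply: cvgC_ext => n.
by apply: eq_bigr => k _; rewrite mulrBl mulN1r mulNr.
Qed.

Lemma has_series_scale f a (t : C) : t != 0 -> has_series f a ->
  has_series (fun y => f (t * y)) (fun k => t ^+ k * a k).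
Proof.
move=> t0 [[A [rho [A0 r0 aA]]] [e e0 fa]]; split.
  exists A, (cabs t * rho); split; rewrite ?mulr_gt0 ?cabs_gt0 // => k.
  rewrite cabsM cabsX exprMn mulrCA; apply: ler_wpM2l (aA k).
  by rewrite exprn_ge0 ?cabs_ge0.
exists (e / cabs t); first by rewrite divr_gt0 ?cabs_gt0.
move=> y y0; rewrite ltr_pdivlMr ?cabs_gt0 // => ye.
have := fa (t * y); rewrite mulf_neq0 // cabsM mulrC => /(_ isT ye).
by apply: cvgC_ext => n; apply: eq_bigr => k _; rewrite exprMn; ring.
Qed.

Lemma has_series_shift f a : a 0%N = 0 -> has_series f a ->
  has_series (fun y => f y / y) (fun k => a k.+1).
Proof.
move=> a0 [[A [rho [A0 r0 aA]]] [e e0 fa]]; split.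
  exists (A * rho), rho; split; rewrite ?mulr_ge0 ?(ltW r0) // => k.
  by rewrite -mulrA -exprS.
exists e => // y y0 ye; have := cvgCZ y^-1 (cvgC_shift (fa y y0 ye)).
rewrite mulrC; apply: cvgC_ext => n.
rewrite big_ord_recl a0 mul0r add0r mulr_sumr; apply: eq_bigr => k _.
by rewrite lift0 exprS mulrCA; congr (_ * _); rewrite mulrA mulVf // mul1r.
Qed.

Lemma series_near0 f a : has_series f a -> exists M e : R, [/\ 0 <= M, 0 < e &
  forall y, y != 0 -> cabs y < e -> cabs (f y - a 0%N) <= M * cabs y].
Proof.
move=> [[A [rho [A0 r0 aA]]] [e e0 fa]].
exists (2 * A * rho), (Num.min e (2^-1 / rho)); split.
- by rewrite !mulr_ge0 // ltW.
- by rewrite lt_min e0 divr_gt0.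
move=> y y0; rewrite lt_min => /andP[ye yr].
have ry : rho * cabs y <= 2^-1 by rewrite mulrC -ler_pdivlMr // ltW.
have fy := fa y y0 ye.
have H : cvgC (fun n => \sum_(k < n) a k.+1 * y ^+ k.+1) (f y - a 0%N).
  have := cvgCD (cvgC_shift fy) (cvgC_const (- a 0%N)); apply: cvgC_ext => n.
  by rewrite big_ord_recl expr0 mulr1 addrAC subrr add0r.
apply: cvgC_le H _ => n; apply: le_trans (cabs_sum _ _ _) _.
apply: (@le_trans _ _ (\sum_(k < n) A * rho * cabs y * (rho * cabs y) ^+ k)).
  apply: ler_sum => k _; apply: le_trans (geometric_bound_eval y aA k.+1) _.
  by rewrite exprS !mulrA.
rewrite -mulr_sumr.
have -> : 2 * A * rho * cabs y = A * rho * cabs y * 2 by ring.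
apply: ler_wpM2l; first by rewrite !mulr_ge0 ?cabs_ge0 // ltW.
by apply: geometric_sum_le => //; rewrite mulr_ge0 ?cabs_ge0 // ltW.
Qed.

Lemma series_lower f a : has_series f a -> a 0%N != 0 -> exists2 e : R, 0 < e &
  forall y, y != 0 -> cabs y < e -> cabs (a 0%N) / 2 <= cabs (f y).
Proof.
move=> fa a0; have [M [e [M0 e0 H]]] := series_near0 fa.
have c0 : 0 < cabs (a 0%N) by rewrite cabs_gt0.
exists (Num.min e (cabs (a 0%N) / 2 / (M + 1))).
  by rewrite lt_min e0 !divr_gt0 // ltr_wpDl.
move=> y y0; rewrite lt_min => /andP[ye yM].
have M1 : 0 < M + 1 by rewrite ltr_wpDl.
rewrite ltr_pdivlMr // in yM.
have := H y y0 ye; have : cabs (a 0%N) <= cabs (f y) + cabs (f y - a 0%N).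
  by rewrite -{1}(subKr (f y) (a 0%N)); apply: cabsB.
have := cabs_ge0 y; nra.
Qed.

(** Course-of-values recursion: each coefficient of the inverse series needs all the earlier ones,
    which are kept in a list. *)
Fixpoint inv_seq_list a n : seq C :=
  if n is n'.+1 then
    let l := inv_seq_list a n' in
    rcons l (if n' == 0%N then (a 0%N)^-1
             else - (a 0%N)^-1 * \sum_(k < n') a k.+1 * nth 0 l (n' - k.+1))
  else [::].

Definition inv_seq a n := nth 0 (inv_seq_list a n.+1) n.

Lemma size_inv_seq_list a n : size (inv_seq_list a n) = n.
Proof. by elim: n => //= n IH; rewrite size_rcons IH. Qed.

Lemma inv_seq_listE a n k : (k < n)%N -> nth 0 (inv_seq_list a n) k = inv_seq a k.
Proof.
elim: n => // n IH; rewrite ltnS leq_eqVlt => /orP[/eqP -> //|kn].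
by rewrite -IH //= nth_rcons size_inv_seq_list kn.
Qed.

Lemma inv_seq0 a : inv_seq a 0%N = (a 0%N)^-1.
Proof. by []. Qed.

Lemma inv_seqS a n : inv_seq a n.+1 = - (a 0%N)^-1 * \sum_(k < n.+1) a k.+1 * inv_seq a (n - k)%N.
Proof.
rewrite {1}/inv_seq [inv_seq_list a n.+2]/= -/(inv_seq_list a n.+1) nth_rcons size_inv_seq_list ltnn eqxx.
congr (_ * _); apply: eq_bigr => k _; congr (_ * _); rewrite subSS.
by rewrite inv_seq_listE // ltnS leq_subr.
Qed.

Lemma cauchy_inv_seq a n : a 0%N != 0 -> cauchy a (inv_seq a) n = (n == 0%N)%:R.
Proof.
move=> a0; rewrite /cauchy; case: n => [|n].
  by rewrite big_ord1 inv_seq0 divff.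
rewrite big_ord_recl subn0 inv_seqS mulrA mulrN divff // mulN1r /=.
apply/eqP; rewrite addrC subr_eq0; apply/eqP; apply: eq_bigr => k _.
by rewrite /bump /= add1n subSS.
Qed.

Lemma inv_seq_bound a A rho : a 0%N != 0 -> 0 <= A -> 0 < rho -> geometric_bound a A rho ->
  exists B s : R, [/\ 0 <= B, 0 < s & geometric_bound (inv_seq a) B s].
Proof.
move=> a0 A0 r0 aA; have c0 : 0 < cabs (a 0%N) by rewrite cabs_gt0.
pose D := cabs (a 0%N)^-1; have D0 : 0 <= D by apply: cabs_ge0.
(* With this [s] one has [A D rho^(k+1) <= s^(k+1)], and the additional factor 2 absorbs the sum
   over [k] in the recursion. *)
pose s := rho * (1 + A * D); exists D, (2 * s).
have s0 : 0 < s by rewrite mulr_gt0 // ltr_pwDl // mulr_ge0.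
split=> //; first by rewrite mulr_gt0.
elim/ltn_ind.
case=> [|n] IH.
  by rewrite inv_seq0 -/D expr0 mulr1.
rewrite inv_seqS cabsM cabsN -/D; apply: ler_wpM2l => //.
apply: le_trans (cabs_sum _ _ _) _.
apply: (@le_trans _ _ (\sum_(k < n.+1) s ^+ k.+1 * (2 * s) ^+ (n - k))).
  apply: ler_sum => k _; rewrite cabsM.
  have H1 := aA k.+1; have H2 := IH (n - k)%N (leq_subr _ _ : (n - k < n.+1)%N).
  apply: le_trans (ler_pM (cabs_ge0 _) (cabs_ge0 _) H1 H2) _.
  rewrite mulrA; apply: ler_wpM2r; first by rewrite exprn_ge0 // mulr_ge0 // ltW.
  rewrite mulrAC; apply: (@le_trans _ _ ((1 + A * D) ^+ k.+1 * rho ^+ k.+1)).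
    apply: ler_wpM2r; first by rewrite exprn_ge0 // ltW.
    apply: (@le_trans _ _ (1 + A * D)); first by rewrite lerDr.
    by rewrite exprS ler_peMr // ?addr_ge0 ?mulr_ge0 // exprn_ege1 // lerDl mulr_ge0.
  by rewrite -exprMn mulrC.
apply: (@le_trans _ _ (\sum_(k < n.+1) s ^+ n.+1 * 2 ^+ (n - k))).
  apply: ler_sum => k _; rewrite (exprMn _ 2 s) mulrCA -exprD mulrC addSn subnKC //.
  by rewrite -ltnS.
rewrite -mulr_sumr (exprMn _ 2 s) mulrC; apply: ler_wpM2r; first by rewrite exprn_ge0 // ltW.
have -> : \sum_(k < n.+1) 2 ^+ (n - k) = 2 ^+ n.+1 - 1 :> R.
  elim: {IH} n => [|n IH]; first by rewrite big_ord1 subnn; ring.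
  by rewrite big_ord_recl subn0 IH; rewrite !exprS; ring.
by rewrite gerBl.
Qed.

(** Convergence of the inverse series is not known beforehand. The products of partial sums tend to
    1 by [cauchy_cvg0] and the partial sums of the inverse are bounded, so [f y] times them tends to
    1 as well. *)
Lemma has_seriesV f a : has_series f a -> a 0%N != 0 ->
  has_series (fun y => (f y)^-1) (inv_seq a).
Proof.
move=> fa a0; have [e1 e10 low] := series_lower fa a0.
have [[A [rho [A0 r0 aA]]] [e e0 fS]] := fa.
have [B [s [B0 s0 bB]]] := inv_seq_bound a0 A0 r0 aA.
split; first by exists B, s.
pose m := Num.max rho s; have m0 : 0 < m by rewrite lt_max r0.
have aA' : geometric_bound a A m by apply: geometric_boundW aA; rewrite ?(ltW r0) // /m le_max lexx.
have bB' : geometric_bound (inv_seq a) B m by apply: geometric_boundW bB; rewrite ?(ltW s0) // /m le_max lexx orbT.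
exists (Num.min (Num.min e e1) (8^-1 / m)).
  by rewrite !lt_min e0 e10 divr_gt0.
move=> y y0; rewrite !lt_min => /andP[/andP[ye ye1] ym].
have my : m * cabs y <= 8^-1 by rewrite mulrC -ler_pdivlMr // ltW.
have f0 : f y != 0.
  rewrite -cabs_gt0; apply: lt_le_trans (low y y0 ye1).
  by rewrite divr_gt0 // cabs_gt0.
pose SF N := \sum_(k < N) a k * y ^+ k; pose SD N := \sum_(k < N) inv_seq a k * y ^+ k.
have F_cvg : cvgC SF (f y) := fS y y0 ye.
have FD1 : cvgC (fun N => SF N * SD N) 1.
  have H := cauchy_cvg0 A0 B0 (mulr_ge0 (ltW m0) (cabs_ge0 y)) my
    (geometric_bound_eval y aA') (geometric_bound_eval y bB').
  apply: cvgC_unshift; have /(cvgCZ (-1)) := cvgC_shift H; rewrite mulr0 => H'.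
  have := cvgCD (cvgC_const 1) H'; rewrite addr0; apply: cvgC_ext => N.
  rewrite (eq_bigr (fun k : 'I_N.+1 => (k == 0%N :> nat)%:R * y ^+ k)) => [|k _]; last first.
    by rewrite cauchy_eval cauchy_inv_seq.
  rewrite big_ord_recl mul1r expr0 big1 => [|k _]; last by rewrite mul0r.
  rewrite /SF /SD; ring.
have Dbd N : cabs (SD N) <= B * 2.
  apply: le_trans (cabs_sum _ _ _) _.
  apply: (@le_trans _ _ (\sum_(k < N) B * (m * cabs y) ^+ k)).
    by apply: ler_sum => k _; apply: geometric_bound_eval.
  rewrite -mulr_sumr; apply: ler_wpM2l => //; apply: geometric_sum_le.
    by rewrite mulr_ge0 ?cabs_ge0 // ltW.
  by apply: le_trans my _; rewrite lef_pV2 ?posrE // ler_nat.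
have E0 : cvgC (fun N => (SF N - f y) * SD N) 0.
  apply/cvgCP => d d0; have B1 : 0 < B * 2 + 1 by rewrite ltr_wpDl // mulr_ge0.
  move/cvgCP: F_cvg => /(_ _ (divr_gt0 d0 B1)) [N NP]; exists N => n /NP.
  rewrite subr0 cabsM ltr_pdivlMr //; apply: le_lt_trans.
  by apply: ler_wpM2l; [apply: cabs_ge0 | apply: le_trans (Dbd n) _; rewrite lerDl].
have /(cvgCZ (f y)^-1) := cvgCD FD1 (cvgCZ (-1) E0).
rewrite mulr0 addr0 mulr1; apply: cvgC_ext => N.
rewrite -/(SD N); set x := SF N; set w := SD N.
have -> : x * w + -1 * ((x - f y) * w) = f y * w by ring.
by rewrite mulrA mulVf // mul1r.
Qed.

End PowerSeries.

(** * The complex exponential: addition law, kernel, power series *)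

Section ComplexExponential.
Variable R : realType.
Local Notation C := R[i].
Implicit Types (w x y : C).

Lemma cexpD x y : cexp (x + y) = cexp x * cexp y.
Proof.
case: x => a b; case: y => c d; rewrite /cexp /= expRD cosD sinD.
by apply/eqP; rewrite eq_complex /=; apply/andP; split; apply/eqP; ring.
Qed.

Lemma cexp0 : cexp (0 : C) = 1.
Proof. by rewrite /cexp /= expR0 cos0 sin0 mulr1 mulr0. Qed.

Lemma cexpNK w : cexp (- w) * cexp w = 1.
Proof. by rewrite -cexpD addNr cexp0. Qed.

Lemma cexp_neq0 w : cexp w != 0.
Proof.
apply/eqP => E; have := cexpNK w; rewrite E mulr0 => /eqP.
by rewrite eq_sym oner_eq0.
Qed.

Lemma cexpN w : cexp (- w) = (cexp w)^-1.
Proof. by apply: (mulIf (cexp_neq0 w)); rewrite cexpNK mulVf ?cexp_neq0. Qed.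

Lemma cexp_sum (I : Type) (s : seq I) (p : pred I) (F : I -> C) :
  cexp (\sum_(i <- s | p i) F i) = \prod_(i <- s | p i) cexp (F i).
Proof. exact: (big_morph _ cexpD cexp0). Qed.

Lemma cexp_natM n w : cexp (n%:R * w) = cexp w ^+ n.
Proof.
elim: n => [|n IH]; first by rewrite mul0r cexp0 expr0.
by rewrite mulrS mulrDl mul1r cexpD IH exprS.
Qed.

Lemma cexp_real (t : R) : cexp t%:C = (expR t)%:C.
Proof. by rewrite /cexp /= cos0 sin0 mulr1 mulr0. Qed.

Lemma cexp_polar w : cexp w = (expR (complex.Re w))%:C * cexp (0 +i* complex.Im w).
Proof.
rewrite -cexp_real -cexpD; congr cexp.
by apply/eqP; rewrite eq_complex /= addr0 add0r !eqxx.
Qed.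

Lemma cabs_cexp w : cabs (cexp w) = expR (complex.Re w).
Proof.
rewrite cexp_polar cabsM cabs_real ger0_norm ?expR_ge0 //.
rewrite [X in _ * X](_ : _ = 1) ?mulr1 //.
by rewrite /cabs normc_def /= expR0 !mul1r cos2Dsin2 sqrtr1.
Qed.

Lemma cexp_2pi_int (k : int) : cexp (0 +i* (2 * pi * k%:~R)) = 1 :> C.
Proof.
have nat_case (n : nat) : cexp (0 +i* (2 * pi * n%:R)) = 1 :> C.
  have -> : (0 +i* (2 * pi * n%:R)) = n%:R * (0 +i* (2 * pi)) :> C.
    rewrite -(rmorph_nat (real_complex R)).
    by apply/eqP; rewrite eq_complex /=; apply/andP; split; apply/eqP; ring.
  rewrite cexp_natM /cexp /= expR0 !mul1r mulr_natl cos2pi sin2pi.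
  by rewrite -[1 +i* 0]/(1 : C) expr1n.
case: (intP k) => [|n|n]; rewrite ?mulr0 ?cexp0 ?nat_case //.
have -> : (0 +i* (2 * pi * (- (n.+1)%:Z)%:~R)) = - (0 +i* (2 * pi * n.+1%:R)) :> C.
  by rewrite mulrNz mulrN; apply/eqP; rewrite eq_complex /= oppr0 !eqxx.
by rewrite cexpN nat_case invr1.
Qed.

(** After reducing the imaginary part to [b] in [0, 2 pi), [cos b = 1] forces [sin (b / 2) = 0],
    while the sine is positive strictly between 0 and pi. *)
Lemma cexp_eq1 w : cexp w = 1 <-> exists k : int, w = 0 +i* (2 * pi * k%:~R).
Proof.
split=> [w1|[k ->]]; last exact: cexp_2pi_int.
have pi0 : 0 < 2 * pi :> R by rewrite mulr_gt0 ?pi_gt0.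
have re0 : complex.Re w = 0.
  by apply: expR_inj; rewrite -cabs_cexp w1 cabs1 expR0.
pose k := Num.floor (complex.Im w / (2 * pi)).
pose b := complex.Im w - 2 * pi * k%:~R.
have b0 : 0 <= b by rewrite subr_ge0 mulrC -ler_pdivlMr ?floor_le_tmp ?ge_floor.
have b2 : b < 2 * pi.
  rewrite ltrBlDr -[X in X + _]mulr1 -mulrDr mulrC -ltr_pdivrMr // addrC.
  have := floorD1_gt (complex.Im w / (2 * pi)); rewrite intrD; apply.
exists k; suff bz : b = 0.
  apply/eqP; rewrite eq_complex re0 eqxx /=.
  by move/eqP: bz; rewrite subr_eq0.
have : cexp (0 +i* b) = 1.
  have wE : w = 0 +i* complex.Im w by rewrite -{1}re0; case: (w).
  have -> : 0 +i* b = 0 +i* complex.Im w - 0 +i* (2 * pi * k%:~R) by rewrite /b; simpc.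
  by rewrite -wE cexpD cexpN w1 cexp_2pi_int invr1 mulr1.
rewrite /cexp /= expR0 !mul1r => /eqP; rewrite eq_complex /= => /andP[/eqP c1 _].
have s0 : sin (b / 2) = 0.
  have := cos_mulr2n (b / 2); rewrite (_ : b / 2 *+ 2 = b) ?c1; last first.
    by rewrite -[b / 2 *+ 2]mulr_natr mulfVK // pnatr_eq0.
  rewrite cos2sin2 => H; apply/eqP; rewrite -sqrf_eq0; apply/eqP.
  move: H; set s := sin _ ^+ 2 => H; lra.
apply/eqP; apply: contraTT isT => bn0.
have : 0 < sin (b / 2).
  apply: sin_gt0_pi; apply/andP; split; first by rewrite divr_gt0 // lt0r bn0.
  by rewrite ltr_pdivrMr // mulrC.
by rewrite s0 ltxx.
Qed.

Lemma cvgC_complex (u v : nat -> R) (a b : R) : u @ \oo --> a -> v @ \oo --> b ->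
  cvgC (fun n => u n +i* v n) (a +i* b).
Proof.
move=> /cvgrPdist_lt ua /cvgrPdist_lt vb; apply/cvgCP => e e0.
have e2 : 0 < e / 2 by rewrite divr_gt0.
have [N _ NP] := ua _ e2; have [M _ MP] := vb _ e2; exists (maxn N M) => n.
rewrite geq_max => /andP[/NP /= h /MP /= h']; apply: le_lt_trans (cabs_le_ReIm _) _.
by rewrite (splitr e) /= distrC [X in _ + X < _]distrC ltrD.
Qed.

Lemma fact_neq0 n : n`!%:R != 0 :> C.
Proof. by rewrite pnatr_eq0 -lt0n fact_gt0. Qed.

Lemma cauchy_exp x y n :
  cauchy (fun k => x ^+ k / k`!%:R) (fun k => y ^+ k / k`!%:R) n = (x + y) ^+ n / n`!%:R.
Proof.
rewrite addrC exprDn mulr_suml; apply: eq_bigr => k _.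
have kn : (k <= n)%N by rewrite -ltnS.
rewrite -(bin_fact kn) natrM natrM -[_ *+ 'C(n, k)]mulr_natl.
have b0 : 'C(n, k)%:R != 0 :> C by rewrite pnatr_eq0 -lt0n bin_gt0.
have f1 := fact_neq0 k; have f2 := fact_neq0 (n - k).
by field; rewrite b0 f1 f2.
Qed.

Lemma real_complexXV (t : R) k : (t ^+ k / k`!%:R)%:C = t%:C ^+ k / k`!%:R.
Proof. by rewrite rmorphM /= rmorphXn /= fmorphV /= rmorph_nat. Qed.

Lemma cvgS_expR (a : R) : cvgS (fun k => a%:C ^+ k / k`!%:R) (cexp a%:C).
Proof.
rewrite cexp_real; have /(@cvgC_complex _ _ _ _) := is_cvg_series_exp_coeff a.
move=> /(_ (fun=> 0) 0 (cvg_cst _)); apply: cvgC_ext => n.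
rewrite /series /= big_mkord -[_ +i* 0]/(real_complex R _) rmorph_sum /=.
by apply: eq_bigr => k _; rewrite /exp_coeff /= real_complexXV.
Qed.

Lemma iXn (b : R) k : (0 +i* b) ^+ k / k`!%:R = cos_coeff b k +i* sin_coeff b k.
Proof.
have -> : 0 +i* b = 'i * b%:C by simpc.
rewrite exprMn -mulrA -real_complexXV.
have step (s : R) : 'i ^+ k = (if odd k then 0 +i* s else s%:C) ->
    'i ^+ k * (b ^+ k / k`!%:R)%:C =
      ((~~ odd k)%:R * s * (b ^+ k / k`!%:R)) +i* ((odd k)%:R * s * (b ^+ k / k`!%:R)).
  by move=> ->; case: (odd k); apply/eqP; rewrite eq_complex /=; apply/andP; split; apply/eqP; ring.
rewrite cos_coeffE sin_coeffE /=.
have i2 m : 'i ^+ (m.*2) = ((-1) ^+ m)%:C :> C.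
  by rewrite -mul2n exprM sqr_i rmorphXn /= rmorphN1.
have := odd_double_half k; case E : (odd k) => /= Ek.
  rewrite (step ((-1) ^+ k./2)); last first.
    by rewrite E -{1}Ek exprD expr1 i2; simpc.
  have -> : k.-1./2 = k./2 by rewrite -{1}Ek add1n /= doubleK.
  rewrite E /=; apply/eqP; rewrite eq_complex /=.
  by apply/andP; split; apply/eqP; ring.
rewrite (step ((-1) ^+ k./2)); last by rewrite E -{1}Ek add0n i2.
by rewrite E /=; apply/eqP; rewrite eq_complex /=; apply/andP; split; apply/eqP; ring.
Qed.

Lemma cvgS_cis (b : R) : cvgS (fun k => (0 +i* b) ^+ k / k`!%:R) (cexp (0 +i* b)).
Proof.
rewrite /cexp /= expR0 !mul1r.
have c := @is_cvg_series_cos_coeff R b; have s := @is_cvg_series_sin_coeff R b.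
have : cvgC (fun n => series (cos_coeff b) n +i* series (sin_coeff b) n) (cos b +i* sin b).
  by apply: cvgC_complex; [rewrite cos.unlock | rewrite sin.unlock].
apply: cvgC_ext => n; rewrite /series /= !big_mkord.
elim: n => [|n IH]; first by rewrite !big_ord0.
by rewrite !big_ord_recr /= -IH iXn; simpc.
Qed.

Lemma exp_term_le w k : cabs (w ^+ k / k`!%:R) <= 1 * cabs w ^+ k.
Proof.
rewrite cabsM cabsX cabsV cabs_nat mul1r ler_piMr ?exprn_ge0 ?cabs_ge0 //.
by rewrite invf_le1 ?ltr0n ?ler1n fact_gt0.
Qed.

Lemma cabs_Re w : `|complex.Re w| <= cabs w.
Proof. by case: w => a b; rewrite /cabs normc_def /= -sqrtr_sqr ler_wsqrtr // lerDl sqr_ge0. Qed.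

Lemma cabs_Im w : `|complex.Im w| <= cabs w.
Proof. by case: w => a b; rewrite /cabs normc_def /= -sqrtr_sqr ler_wsqrtr // lerDr sqr_ge0. Qed.

(** The series at the real part and at the imaginary part come from real analysis; their Cauchy
    product is the series at [y]. The radius 1/8 is the one of [cauchy_cvg], and any positive radius
    serves for a germ. *)
Lemma has_series_cexp : has_series (@cexp R) (fun k => k`!%:R^-1).
Proof.
split.
  exists 1, 1; split=> // k; rewrite expr1n mulr1 cabsV cabs_nat.
  by rewrite invf_le1 ?ltr0n ?ler1n fact_gt0.
exists 8^-1; first by rewrite invr_gt0.
move=> y _ y8; set a := complex.Re y; set b := complex.Im y.
have yE : y = a%:C + (0 +i* b) by rewrite /a /b; case: (y) => u v; simpc.
have ca : cabs a%:C <= cabs y by rewrite cabs_real cabs_Re.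
have cb : cabs (0 +i* b) <= cabs y.
  have -> : 0 +i* b = 'i * b%:C by simpc.
  rewrite cabsM cabs_real; apply: le_trans (cabs_Im y).
  by rewrite {1}/cabs normc_def /= expr0n expr1n add0r sqrtr1 mul1r.
have H := @cauchy_cvg R _ _ _ _ 1 1 (cabs y) ler01 ler01 (cabs_ge0 y) (ltW y8) _ _
  (cvgS_expR a) (cvgS_cis b).
rewrite [cexp y](_ : _ = cexp a%:C * cexp (0 +i* b)); last by rewrite -cexpD -yE.
apply: cvgC_ext (H _ _) => [n|k|k].
- by apply: eq_bigr => k _; rewrite cauchy_exp -yE mulrC.
- apply: le_trans (exp_term_le _ _) _; rewrite !mul1r.
  by apply: lerXn2r; rewrite ?nnegrE ?cabs_ge0.
- apply: le_trans (exp_term_le _ _) _; rewrite !mul1r.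
  by apply: lerXn2r; rewrite ?nnegrE ?cabs_ge0.
Qed.

End ComplexExponential.

Lemma digits_inj n (N : nat) (f g : 'I_n -> nat) :
  (forall i, f i < N)%N -> (forall i, g i < N)%N ->
  (\sum_(i < n) f i * N ^ i = \sum_(i < n) g i * N ^ i)%N -> f =1 g.
Proof.
elim: n f g => [|n IH] f g fN gN; first by move=> _ [].
have split_dig (h : 'I_n.+1 -> nat) :
    (\sum_(i < n.+1) h i * N ^ i = h ord0 + (\sum_(i < n) h (lift ord0 i) * N ^ i) * N)%N.
  rewrite big_ord_recl /= muln1 big_distrl /=; congr (_ + _)%N.
  by apply: eq_bigr => i _; rewrite /bump /= add1n expnSr mulnA.
rewrite !split_dig => E.
have N0 : (0 < N)%N by apply: leq_ltn_trans (fN ord0).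
have E0 : f ord0 = g ord0.
  by have := congr1 (modn^~ N) E; rewrite !(addnC (_ ord0)) !modnMDl !modn_small.
have Es : (\sum_(i < n) f (lift ord0 i) * N ^ i = \sum_(i < n) g (lift ord0 i) * N ^ i)%N.
  by apply/eqP; rewrite -(eqn_pmul2r N0) -(eqn_add2l (f ord0)) E E0.
have {}IH := IH _ _ (fun i => fN _) (fun i => gN _) Es.
by move=> i; case: (unliftP ord0 i) => [j ->|-> //]; apply: IH.
Qed.

(* Kronecker substitution [X_i := t ^ (N ^ i)] with N beyond the degree. *)
Lemma mpoly_vanish (K : numFieldType) n (p : mpoly n K) :
  (forall v, meval v p = 0) -> p = 0.
Proof.
move=> p0; pose N := (\max_(m <- msupp p) mdeg m).+1.
pose kap (m : multinom n) := (\sum_(i < n) m i * N ^ i)%N.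
have mN m : m \in msupp p -> forall i, (m i < N)%N.
  move=> mp i; rewrite ltnS; apply: (@leq_trans (mdeg m)); last exact: (leq_bigmax_seq (F := fun m => mdeg m) _ mp isT).
  by rewrite mdegE (bigD1 i) //= leq_addr.
pose Q : {poly K} := \sum_(m <- msupp p) (mcoeff m p)%:P * 'X^(kap m).
have Qev t : Q.[t] = 0.
  rewrite -(p0 (fun i => t ^+ (N ^ i))) mevalE horner_sum; apply: eq_bigr => m _.
  rewrite hornerM hornerC hornerXn; congr (_ * _).
  by rewrite /kap -prodrXr; apply: eq_bigr => i _; rewrite -exprM mulnC.
have Q0 : Q = 0.
  apply/eqP; apply: contraT => Qn0.
  have := @max_poly_roots K Q [seq i%:R | i <- iota 0 (size Q)] Qn0.
  rewrite size_map size_iota ltnn => H; apply/H.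
    by apply/allP => x _; rewrite /root Qev.
  rewrite map_inj_uniq ?iota_uniq // => i j /eqP.
  by rewrite eqr_nat => /eqP.
apply/mpolyP => m; rewrite mcoeff0; have [mp|] := boolP (m \in msupp p); last first.
  by rewrite mcoeff_msupp negbK => /eqP.
have := congr1 (fun q : {poly K} => q`_(kap m)) Q0; rewrite coef0 /Q coef_sum.
rewrite (bigD1_seq m) ?msupp_uniq //= coefCM coefXn eqxx mulr1 big_seq_cond big1 ?addr0 //.
move=> m' /andP[m'p m'm]; rewrite coefCM coefXn; case: eqP => [E|_]; last by rewrite mulr0.
case/eqP: m'm; apply/mnmP => i.
by have := digits_inj (mN _ m'p) (mN _ mp) (esym E) i.
Qed.

Lemma cross_terms (K : comNzRingType) (u u' w w' X1 Y1 X Y v : K) :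
  w' * X1 = X * v -> w * Y1 = Y * v ->
  w' * u' * X1 + - (w * u) * Y1 = (u' * X - u * Y) * v.
Proof. by move=> EX EY; rewrite mulrBl -!mulrA -EX -EY; ring. Qed.

(** * Germs in several variables and their denominators *)

Section Germs.
Variables (R : realType) (r : nat) (Phip : {fset 'rV[R]_r}).
Hypothesis Phip0 : 0 \notin Phip.
Local Notation C := R[i].
Implicit Types (z : 'cV[C]_r) (P : nat -> polyVC R r) (b : seq 'rV[R]_r) (F : 'cV[C]_r -> C).

Definition ev z (p : polyVC R r) : C := meval (fun i => z i 0) p.

Lemma evM z p p' : ev z (p * p') = ev z p * ev z p'. Proof. exact: mevalM. Qed.
Lemma evD z p p' : ev z (p + p') = ev z p + ev z p'. Proof. exact: mevalD. Qed.
Lemma ev0 z : ev z 0 = 0. Proof. exact: meval0. Qed.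
Lemma ev1 z : ev z 1 = 1. Proof. exact: meval1. Qed.
Lemma evZ z k p : ev z (k *: p) = k * ev z p. Proof. exact: mevalZ. Qed.
Lemma ev_linform z a : ev z (linform a) = evalC a z. Proof. exact: meval_linform. Qed.

Lemma evX z p n : ev z (p ^+ n) = ev z p ^+ n.
Proof. by elim: n => [|n IH]; rewrite ?expr0 ?ev1 // !exprS evM IH. Qed.

Lemma ev_sum z (I : Type) (s : seq I) (p : I -> polyVC R r) :
  ev z (\sum_(i <- s) p i) = \sum_(i <- s) ev z (p i).
Proof. by rewrite /ev rmorph_sum. Qed.

Lemma ev_prod_linform z b : ev z (\prod_(a <- b) linform a) = \prod_(a <- b) evalC a z.
Proof.
elim: b => [|a b IH]; first by rewrite !big_nil ev1.
by rewrite !big_cons evM IH ev_linform.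
Qed.

Lemma evalCZ (a : 'rV[R]_r) (t : C) z : evalC a (t *: z) = t * evalC a z.
Proof. by rewrite /evalC -scalemxAr mxE. Qed.

Lemma ev_homog z t d p : p \is ishomog1 d mdeg -> ev (t *: z) p = t ^+ d * ev z p.
Proof.
move=> /dhomogP hp; rewrite /ev !mevalE mulr_sumr big_seq [RHS]big_seq; apply: eq_bigr => m mp.
rewrite mulrCA; congr (_ * _); have <- : mdeg m = d := hp m mp.
rewrite mdegE -prodrXr -big_split /=.
by apply: eq_bigr => i _; rewrite mxE exprMn.
Qed.

Lemma homog_linform (a : 'rV[R]_r) : linform a \is ishomog1 1 mdeg.
Proof.
apply: rpred_sum => i _; apply: rpredZ; rewrite dhomogX; apply/eqP; exact: mdeg1.
Qed.

Lemma homog_cast d d' (p : polyVC R r) : d = d' -> p \is ishomog1 d mdeg -> p \is ishomog1 d' mdeg.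
Proof. by move=> ->. Qed.

Lemma homog_linformX (a : 'rV[R]_r) k : (linform a : polyVC R r) ^+ k \is ishomog1 k mdeg.
Proof. by apply: homog_cast (mul1n k) _; apply: dhomogMn; apply: homog_linform. Qed.

Lemma homog_prod_linform b : (\prod_(a <- b) linform a : polyVC R r) \is ishomog1 (size b) mdeg.
Proof.
elim: b => [|a b IH]; first by rewrite big_nil dhomog1.
rewrite big_cons; apply: homog_cast (add1n (size b)) _.
by apply: dhomogM => //; apply: homog_linform.
Qed.

Lemma cvgS_delay (a : nat -> C) s k : cvgS a s ->
  cvgS (fun m => if (m < k)%N then 0 else a (m - k)%N) s.
Proof.
elim: k => [|k IH] sa; first by apply: cvgC_ext sa => n; apply: eq_bigr => m _; rewrite subn0.
apply: cvgC_unshift; apply: cvgC_ext (IH sa) => n.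
by rewrite [RHS]big_ord_recl add0r; apply: eq_bigr => m _; rewrite lift0 ltnS subSS.
Qed.

Lemma exists_small (e : R) z : 0 < e -> exists2 d : R, 0 < d &
  forall t : R, 0 < t -> t < d -> forall i, cabs ((t%:C *: z) i 0) < e.
Proof.
move=> e0; pose K := \sum_i cabs (z i 0) + 1.
have K0 : 0 < K by rewrite ltr_wpDl // sumr_ge0 // => i _; apply: cabs_ge0.
exists (e / K); first by rewrite divr_gt0.
move=> t t0; rewrite ltr_pdivlMr // => tK i; rewrite mxE cabsM cabs_real ger0_norm ?ltW //.
apply: le_lt_trans tK; rewrite ler_pM2l // /K (bigD1 i) //= -addrA lerDl addr_ge0 //.
by apply: sumr_ge0 => j _; apply: cabs_ge0.
Qed.

(** Since [P m] is homogeneous of degree [m], restriction to the ray through a regular point turns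
    the germ into a power series in one real variable with coefficients [ev z (P m)]. *)
Lemma germ_line F P b z : germ_at0 Phip F P b ->
  (forall a, a \in Phip -> evalC a z != 0) ->
  exists2 d : R, 0 < d & forall t : R, 0 < t -> t < d ->
    cvgS (fun m => ev z (P m) * (t ^+ m)%:C)
      (F (t%:C *: z) * ((t ^+ size b)%:C * \prod_(a <- b) evalC a z)).
Proof.
move=> [hom bP [e e0 H]] zP; have [d d0 dP] := exists_small z e0; exists d => // t t0 td.
have tn0 : t%:C != 0 :> C by rewrite -cabs_gt0 cabs_real normr_gt0 gt_eqF.
have tzP a : a \in Phip -> evalC a (t%:C *: z) != 0 by move=> aP; rewrite evalCZ mulf_neq0 // zP.
have := H (t%:C *: z) (dP t t0 td) tzP.
rewrite -[\prod_(a <- b) _]ev_prod_linform (ev_homog _ _ (homog_prod_linform b)) ev_prod_linform.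
rewrite -rmorphXn => G; apply: cvgC_ext G => n; apply: eq_bigr => m _.
by rewrite -/(ev _ _) (ev_homog _ _ (hom m)) -rmorphXn mulrC.
Qed.

Definition germ_residue P b : ratVC R r :=
  ratfrac (if (r <= size b)%N then P (size b - r)%N else 0) (\prod_(a <- b) linform a).

(** Along the ray through each regular point, [P] times the product over [b'] and [P'] times the
    product over [b] have the same power series. Comparing their parts of degree
    [size b + size b' - r] gives the equality of fractions. *)
Lemma germ_residue_unique F P b P' b' : germ_at0 Phip F P b -> germ_at0 Phip F P' b' ->
  germ_residue P b = germ_residue P' b'.
Proof.
move=> G G'; have [_ bP _] := G; have [_ bP' _] := G'.
apply/eqP; rewrite /germ_residue ratfrac_eq ?(linform_prod_neq0 Phip0) // -subr_eq0; apply/eqP.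
set D := _ - _.
(* The factor vanishes at all points that are not regular, so the polynomial identity has to be
   checked at regular points only. *)
suff : \prod_(a <- Phip) linform a * D = 0.
  move/eqP; rewrite mulf_eq0 => /orP[E|/eqP //].
  by have := @linform_prod_neq0 R r Phip Phip0 Phip (fun=> id); rewrite E.
apply: mpoly_vanish => v; pose z : 'cV[C]_r := \col_i v i.
have -> : meval v (\prod_(a <- Phip) linform a * D) = ev z (\prod_(a <- Phip) linform a * D).
  by apply: meval_eq => i; rewrite mxE.
rewrite evM ev_prod_linform.
have [/hasP[a aP a0]|] := boolP (has (fun a => evalC a z == 0) Phip).
  by rewrite (big_rem a aP) /= (eqP a0) !mul0r.
move=> /hasPn zP; have [d d0 H] := germ_line G zP; have [d' d0' H'] := germ_line G' zP.
suff -> : ev z D = 0 by rewrite mulr0.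
set k := size b; set k' := size b'.
(* Coefficient of [t ^ m] in the difference of the two cleared series; the shifts by [k'] and [k]
   come from the homogeneity of the denominators. *)
pose c m := \prod_(a <- b') evalC a z * (if (m < k')%N then 0 else ev z (P (m - k')%N)) -
  \prod_(a <- b) evalC a z * (if (m < k)%N then 0 else ev z (P' (m - k)%N)).
have c0 : forall m, c m = 0.
  apply: (@power_series_eq0 R c (Num.min d d')); first by rewrite lt_min d0.
  move=> t t0; rewrite lt_min => /andP[td td'].
  have S := cvgSZ ((t ^+ k')%:C * \prod_(a <- b') evalC a z) (cvgS_delay k' (H t t0 td)).
  have S' := cvgSZ (- ((t ^+ k)%:C * \prod_(a <- b) evalC a z)) (cvgS_delay k (H' t t0 td')).
  have := cvgSD S S'; rewrite -/k -/k'.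
  set B := \prod_(a <- b) _; set B' := \prod_(a <- b') _.
  rewrite [X in cvgS _ X](_ : _ = 0); last by ring.
  apply: cvgC_ext => n; apply: eq_bigr => m _; rewrite /c -/B -/B'.
  have delayE K (Q : nat -> C) : (t ^+ K)%:C * (if (m < K)%N then 0 else Q (m - K)%N * (t ^+ (m - K))%:C) =
      (if (m < K)%N then 0 else Q (m - K)%N) * (t ^+ m)%:C.
    case: ltnP => mK; rewrite ?mulr0 ?mul0r // mulrCA -rmorphM /= -exprD subnKC //.
  have E1 := delayE k' (fun n => ev z (P n)); have E2 := delayE k (fun n => ev z (P' n)).
  exact: cross_terms E1 E2.
rewrite /D evD -mulN1r.
have evN p : ev z (-1 * p) = - ev z p by rewrite mulN1r /ev rmorphN.
rewrite evN !evM !ev_prod_linform.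
have [rkk|rkk] := leqP r (k + k'); last first.
  have r1 : (r <= k)%N = false by rewrite leqNgt (leq_ltn_trans _ rkk) ?leq_addr.
  have r2 : (r <= k')%N = false by rewrite leqNgt (leq_ltn_trans _ rkk) ?leq_addl.
  by rewrite r1 r2 ev0 !mul0r subrr.
have := c0 (k + k' - r)%N; rewrite /c.
have H1 : (k + k' - r < k')%N = (k < r)%N by lia.
have H2 : (k + k' - r < k)%N = (k' < r)%N by lia.
rewrite H1 H2 [(k <  r)%N]ltnNge [(k' < r)%N]ltnNge.
have K1 : (r <= k)%N -> (k + k' - r - k' = k - r)%N by lia.
have K2 : (r <= k')%N -> (k + k' - r - k = k' - r)%N by lia.
have E1 : ev z (if (r <= k)%N then P (k - r)%N else 0) =
    if ~~ (r <= k)%N then 0 else ev z (P (k + k' - r - k')%N).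
  by move: K1; case: (r <= k)%N => /= [->|_] //; rewrite ev0.
have E2 : ev z (if (r <= k')%N then P' (k' - r)%N else 0) =
    if ~~ (r <= k')%N then 0 else ev z (P' (k + k' - r - k)%N).
  by move: K2; case: (r <= k')%N => /= [->|_] //; rewrite ev0.
by rewrite E1 E2 mulrC [X in _ - X]mulrC.
Qed.

Section ProductGerm.
Variables (T : eqType) (a : T -> 'rV[R]_r) (f : T -> C -> C) (c : T -> nat -> C).

(** Homogeneous part of degree [m] of the product of the one-variable series [c x] evaluated at the
    linear forms [a x]. *)
Fixpoint prod_poly (l : seq T) (m : nat) : polyVC R r :=
  if l is x :: l' then \sum_(j < m.+1) c x j *: (linform (a x) ^+ j * prod_poly l' (m - j))
  else (m == 0%N)%:R.

Lemma homog_prod_poly l m : prod_poly l m \is ishomog1 m mdeg.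
Proof.
elim: l m => [|x l IH] m /=.
  case: m => [|m] /=; first exact: dhomog1.
  exact: dhomog0.
apply: rpred_sum => j _; apply: rpredZ; have jm : (j <= m)%N by rewrite -ltnS.
by apply: homog_cast (subnKC jm) _; apply: dhomogM (IH _); apply: homog_linformX.
Qed.

Lemma ev_prod_poly x l z m : ev z (prod_poly (x :: l) m) =
  cauchy (fun j => c x j * evalC (a x) z ^+ j) (fun n => ev z (prod_poly l n)) m.
Proof.
rewrite /= ev_sum; apply: eq_bigr => j _.
by rewrite evZ evM evX ev_linform mulrA.
Qed.

(** The constants must not depend on [z], which enters only through a common bound [d] of the values
    of the forms. The geometric bound is carried along since the next Cauchy product needs it. *)
Lemma prod_poly_cvg l : (forall x, x \in l -> has_series (f x) (c x)) ->
  exists A s e : R, [/\ 0 <= A, 0 < s, 0 < e & forall z (d : R), 0 <= d -> d < e ->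
    (forall x, x \in l -> evalC (a x) z != 0 /\ cabs (evalC (a x) z) <= d) ->
    (forall m, cabs (ev z (prod_poly l m)) <= A * (s * d) ^+ m) /\
    cvgS (fun m => ev z (prod_poly l m)) (\prod_(x <- l) f x (evalC (a x) z))].
Proof.
elim: l => [|x l IH] H.
  exists 1, 1, 1; split=> // z d d0 _ _; split.
    case=> [|m]; first by rewrite expr0 mulr1 ev1 cabs1.
    by rewrite ev0 cabs0 mulr_ge0 ?exprn_ge0 ?mulr_ge0.
  rewrite big_nil; apply: cvgC_unshift; apply: cvgC_ext (cvgC_const 1) => n.
  by rewrite big_ord_recl ev1 big1 ?addr0 // => i _; rewrite ev0.
have [|A [s [e [A0 s0 e0 IH']]]] := IH; first by move=> y yl; apply: H; rewrite inE yl orbT.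
have [[B [rho [B0 r0 cB]]] [e' e0' fS]] := H x (mem_head _ _).
pose S := Num.max s rho; have S0 : 0 < S by rewrite lt_max s0.
have sS : s <= S by rewrite /S le_max lexx.
have rS : rho <= S by rewrite /S le_max lexx orbT.
exists (B * A), (2 * S), (Num.min (Num.min e e') (8^-1 / S)); split.
- by rewrite mulr_ge0.
- by rewrite mulr_gt0.
- by rewrite !lt_min e0 e0' divr_gt0.
move=> z d d0; rewrite !lt_min => /andP[/andP[de de'] dS] zl.
have [xz xd] := zl x (mem_head _ _).
have [|bd cv] := IH' z d d0 de; first by move=> y yl; apply: zl; rewrite inE yl orbT.
have Sd : S * d <= 8^-1 by rewrite mulrC -ler_pdivlMr // ltW.
have Sd0 : 0 <= S * d by rewrite mulr_ge0 // ltW.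
have bd1 k : cabs (c x k * evalC (a x) z ^+ k) <= B * (S * d) ^+ k.
  apply: le_trans (geometric_bound_eval _ cB k) _; apply: ler_wpM2l => //.
  apply: lerXn2r; rewrite ?nnegrE ?mulr_ge0 ?cabs_ge0 ?(ltW r0) ?(ltW S0) //.
  by apply: ler_pM => //; [apply: ltW | apply: cabs_ge0].
have bd2 k : cabs (ev z (prod_poly l k)) <= A * (S * d) ^+ k.
  apply: le_trans (bd k) _; apply: ler_wpM2l => //.
  apply: lerXn2r; rewrite ?nnegrE ?mulr_ge0 ?(ltW s0) ?(ltW S0) //.
  by apply: ler_wpM2r.
split.
  by move=> m; rewrite ev_prod_poly -[2 * S * d]mulrA; apply: cauchy_bound.
rewrite big_cons.
have := cauchy_cvg B0 A0 Sd0 Sd bd1 bd2 (fS _ xz (le_lt_trans xd de')) cv.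
by apply: cvgC_ext => n; apply: eq_bigr => m _; rewrite ev_prod_poly.
Qed.

Lemma germ_prod l b F : (forall x, x \in l -> has_series (f x) (c x)) ->
  (forall x, x \in l -> a x \in Phip) -> {subset b <= Phip} ->
  (forall z, (forall a, a \in Phip -> evalC a z != 0) ->
     F z * \prod_(a <- b) evalC a z = \prod_(x <- l) f x (evalC (a x) z)) ->
  germ_at0 Phip F (prod_poly l) b.
Proof.
move=> H la bP FE; split=> //; first by move=> m; apply: homog_prod_poly.
have [A [s [e [A0 s0 e0 cv]]]] := prod_poly_cvg H.
pose K := \sum_(x <- l) \sum_i `|a x 0 i| + 1.
have K0 : 0 < K.
  by rewrite ltr_wpDl // sumr_ge0 // => x _; rewrite sumr_ge0.
exists (e / 2 / K); first by rewrite !divr_gt0.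
move=> z ze zP; rewrite FE //.
have h0 : 0 <= e / 2 by rewrite divr_ge0 // ltW.
have he : e / 2 < e by rewrite ltr_pdivrMr // ltr_pMr // ltr1n.
suff zl : forall x, x \in l -> evalC (a x) z != 0 /\ cabs (evalC (a x) z) <= e / 2.
  by have [] := cv z (e / 2) h0 he zl.
move=> x xl; split; first by rewrite zP // la.
rewrite /evalC mxE; apply: le_trans (cabs_sum _ _ _) _.
apply: (@le_trans _ _ (\sum_i `|a x 0 i| * (e / 2 / K))).
  by apply: ler_sum => i _; rewrite mxE cabsM cabs_real ler_wpM2l // ltW.
rewrite -mulr_suml; apply: (@le_trans _ _ (K * (e / 2 / K))); last first.
  by rewrite mulrC mulfVK // gt_eqF.
apply: ler_wpM2r; first by rewrite divr_ge0 // ltW.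
rewrite /K (big_rem x xl) /= -addrA lerDl addr_ge0 //.
by rewrite sumr_ge0 // => y _; rewrite sumr_ge0.
Qed.

Lemma prod_poly_low (o : T -> nat) l : (forall x k, x \in l -> (k < o x)%N -> c x k = 0) ->
  forall m, (m < \sum_(x <- l) o x)%N -> prod_poly l m = 0.
Proof.
elim: l => [|x l IH] H m; first by rewrite big_nil.
rewrite big_cons /= => mo; apply: big1 => j _.
have [jx|jx] := ltnP j (o x); first by rewrite H ?mem_head // scale0r.
rewrite IH ?mulr0 ?scaler0 // => [y k yl|]; first by apply: H; rewrite inE yl orbT.
have jm := ltn_ord j; move: mo jm jx; set n := (\sum_(_ <- _) _)%N; move: (nat_of_ord j) => j' /= *; lia.
Qed.

End ProductGerm.

End Germs.

(** * One-variable residues *)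

Section FormalSeriesRing.
Variable R : realType.
Local Notation C := R[i].
Implicit Types (a b c : nat -> C) (f g : C -> C).

Definition one_seq : nat -> C := fun k => (k == 0%N)%:R.
Definition X_seq : nat -> C := fun k => (k == 1%N)%:R.
Definition euler a : nat -> C := fun k => k%:R * a k.

(** Truncation to polynomials, through which commutativity and associativity of the Cauchy product
    are inherited from the polynomial ring. *)
Lemma cauchy_poly a b N n : (n < N)%N ->
  cauchy a b n = (\poly_(k < N) a k * \poly_(k < N) b k)`_n.
Proof.
move=> nN; rewrite coefM; apply: eq_bigr => k _; rewrite !coef_poly.
have kn : (k <= n)%N by rewrite -ltnS.
by rewrite (leq_ltn_trans kn nN) (leq_ltn_trans (leq_subr _ _) nN).
Qed.

Lemma cauchy_ext a a' b b' : a =1 a' -> b =1 b' -> cauchy a b =1 cauchy a' b'.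
Proof. by move=> E E' n; apply: eq_bigr => k _; rewrite E E'. Qed.

Lemma cauchyC a b : cauchy a b =1 cauchy b a.
Proof. by move=> n; rewrite !(@cauchy_poly _ _ n.+1) // mulrC. Qed.

Lemma cauchyA a b c : cauchy a (cauchy b c) =1 cauchy (cauchy a b) c.
Proof.
move=> n; have P (u : nat -> C) (p : {poly C}) : (forall k, (k <= n)%N -> u k = p`_k) ->
    forall v, cauchy u v n = (p * \poly_(k < n.+1) v k)`_n.
  move=> up v; rewrite coefM; apply: eq_bigr => k _; rewrite coef_poly ltnS leq_subr.
  by rewrite up // -ltnS.
rewrite cauchyC (P _ (\poly_(k < n.+1) b k * \poly_(k < n.+1) c k)); last first.
  by move=> k kn; rewrite (@cauchy_poly _ _ n.+1).
rewrite (P _ (\poly_(k < n.+1) a k * \poly_(k < n.+1) b k)); last first.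
  by move=> k kn; rewrite (@cauchy_poly _ _ n.+1).
by rewrite mulrC mulrA.
Qed.

Lemma cauchyDl a a' b n : cauchy (fun k => a k + a' k) b n = cauchy a b n + cauchy a' b n.
Proof. by rewrite -big_split; apply: eq_bigr => k _; rewrite mulrDl. Qed.

Lemma cauchyDr a b b' n : cauchy a (fun k => b k + b' k) n = cauchy a b n + cauchy a b' n.
Proof. by rewrite -big_split; apply: eq_bigr => k _; rewrite mulrDr. Qed.

Lemma cauchyZr (k : C) a b n : cauchy a (fun j => k * b j) n = k * cauchy a b n.
Proof. by rewrite mulr_sumr; apply: eq_bigr => j _; rewrite mulrCA. Qed.

Lemma cauchyX a n : cauchy X_seq a n.+1 = a n.
Proof.
rewrite /cauchy 2!big_ord_recl mul0r add0r mul1r subSS subn0 big1 ?addr0 // => k _.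
by rewrite mul0r.
Qed.

Lemma euler_cauchy a b n : euler (cauchy a b) n = cauchy (euler a) b n + cauchy a (euler b) n.
Proof.
rewrite /euler mulr_sumr -big_split; apply: eq_bigr => k _ /=.
have kn : (k <= n)%N by rewrite -ltnS.
by rewrite -{1}(subnKC kn) natrD; ring.
Qed.

Fixpoint pow_seq a m : nat -> C := if m is m'.+1 then cauchy a (pow_seq a m') else one_seq.

Lemma euler_pow a m : euler (pow_seq a m.+1) =1 (fun k => m.+1%:R * cauchy (euler a) (pow_seq a m) k).
Proof.
elim: m => [|m IH] n.
  rewrite mul1r [pow_seq a 1%N]/= euler_cauchy [X in _ + X](_ : _ = 0) ?addr0 //.
  apply: big1 => k _; rewrite /euler /one_seq; case: (n - k)%N => [|j]; rewrite ?mul0r ?mulr0 //.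
rewrite [pow_seq a m.+2]/= -/(pow_seq a m.+1) euler_cauchy.
rewrite (cauchy_ext (b' := fun k => m.+1%:R * cauchy (euler a) (pow_seq a m) k) (fun=> erefl) IH).
rewrite cauchyZr cauchyA (cauchy_ext (b' := pow_seq a m) (cauchyC _ _) (fun=> erefl)) -cauchyA.
by rewrite -[cauchy a (pow_seq a m)]/(pow_seq a m.+1) -[in RHS]nat1r mulrDl mul1r.
Qed.

Lemma has_series_unique f a b : has_series f a -> has_series f b -> a =1 b.
Proof.
move=> [_ [e e0 fa]] [_ [e' e0' fb]] k; apply/eqP; rewrite -subr_eq0; apply/eqP.
apply: (@power_series_eq0 R (fun k => a k - b k) (Num.min e e')); first by rewrite lt_min e0.
move=> t t0; rewrite lt_min => /andP[te te'].
have tn0 : t%:C != 0 :> C by rewrite -cabs_gt0 cabs_real normr_gt0 gt_eqF.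
have tc : cabs t%:C = t by rewrite cabs_real gtr0_norm.
have := cvgSD (fa t%:C tn0 _) (cvgSZ (-1) (fb t%:C tn0 _)); rewrite tc => /(_ te te').
rewrite mulN1r subrr; apply: cvgC_ext => n; apply: eq_bigr => j _.
by rewrite mulN1r -mulrBl rmorphXn.
Qed.

Lemma has_series_seq_ext f a b : a =1 b -> has_series f a -> has_series f b.
Proof. by move=> /funext ->. Qed.

Lemma has_series_eq f g a : (forall y, y != 0 -> f y = g y) -> has_series f a -> has_series g a.
Proof. by move=> E; apply: has_series_ext; exists 1 => // y y0 _; apply: E. Qed.

Lemma has_seriesX : has_series id X_seq.
Proof.
split.
  exists 1, 1; split=> // k; rewrite expr1n mulr1 /X_seq.
  by case: eqP; rewrite ?cabs1 ?cabs0.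
exists 1 => // y y0 _; apply/cvgCP => e e0; exists 2%N => -[//|[//|n]] _.
rewrite 2!big_ord_recl /X_seq /= mul0r add0r mul1r expr1 big1 => [|k _]; last by rewrite mul0r.
by rewrite addr0 subrr cabs0.
Qed.

Lemma has_seriesXm f a m : has_series f a -> has_series (fun y => f y ^+ m) (pow_seq a m).
Proof.
move=> fa; elim: m => [|m IH]; first exact: has_series1.
by apply: has_series_ext (has_seriesM fa IH); exists 1 => // y _ _; rewrite exprS.
Qed.

Lemma has_seriesD f g a b : has_series f a -> has_series g b ->
  has_series (fun y => f y + g y) (fun k => a k + b k).
Proof.
move=> [[A [rho [A0 r0 aA]]] [e e0 fa]] [[B [rho' [B0 r0' bB]]] [e' e0' gb]]; split.
  exists (A + B), (rho + rho'); split; rewrite ?addr_ge0 ?addr_gt0 // => k.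
  apply: le_trans (cabsD _ _) _; rewrite mulrDl; apply: lerD.
    by apply: geometric_boundW aA _ => //; rewrite ?(ltW r0) // lerDl ltW.
  by apply: geometric_boundW bB _ => //; rewrite ?(ltW r0') // lerDr ltW.
exists (Num.min e e'); first by rewrite lt_min e0.
move=> y y0; rewrite lt_min => /andP[ye ye'].
apply: cvgC_ext (cvgSD (fa y y0 ye) (gb y y0 ye')) => n.
by apply: eq_bigr => k _; rewrite mulrDl.
Qed.

Definition exp_seq (t : C) : nat -> C := fun k => t ^+ k / k`!%:R.

Lemma has_series_exp (t : C) : has_series (fun y => cexp (t * y)) (exp_seq t).
Proof.
have [->|t0] := eqVneq t 0; last exact: has_series_scale (has_series_cexp R).
apply: has_series_seq_ext (_ : one_seq =1 _) (has_series_eq _ (has_series1 R)).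
  by case=> [|k]; rewrite /exp_seq /one_seq ?expr0n /= ?fact0 ?divr1 ?mul0r.
by move=> y _; rewrite mul0r cexp0.
Qed.

Definition expm1_seq : nat -> C := fun k => one_seq k - exp_seq (-1) k.

Lemma has_series_expm1 : has_series (fun y => 1 - cexp (- y)) expm1_seq.
Proof.
apply: has_series_eq (has_seriesB1 (has_series_exp (-1))) => y _.
by rewrite mulN1r.
Qed.

Definition todd : nat -> C := inv_seq (fun k => expm1_seq k.+1).

Lemma expm1_seq0 : expm1_seq 0%N = 0.
Proof. by rewrite /expm1_seq /one_seq /exp_seq expr0 fact0 divr1 subrr. Qed.

Lemma expm1_seq1 : expm1_seq 1%N = 1.
Proof. by rewrite /expm1_seq /one_seq /exp_seq expr1 factS fact0 muln1 divr1 sub0r opprK. Qed.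

Lemma has_series_todd : has_series (fun y => y / (1 - cexp (- y))) todd.
Proof.
have := has_seriesV (has_series_shift expm1_seq0 has_series_expm1).
rewrite expm1_seq1 oner_eq0 => /(_ isT); apply: has_series_eq => y _.
by rewrite invf_div.
Qed.

Lemma todd0 : todd 0%N = 1.
Proof. by rewrite /todd inv_seq0 expm1_seq1 invr1. Qed.

Lemma expm1_neq0 : exists2 e : R, 0 < e & forall y : C, y != 0 -> cabs y < e -> 1 - cexp (- y) != 0.
Proof.
have H := has_series_shift expm1_seq0 has_series_expm1.
have [|e e0 low] := series_lower H; first by rewrite expm1_seq1 oner_eq0.
exists e => // y y0 ye; apply/eqP => E; have := low y y0 ye.
by rewrite E mul0r cabs0 expm1_seq1 cabs1 leNgt divr_gt0.
Qed.

Lemma cauchy_expm1_todd : cauchy expm1_seq todd =1 X_seq.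
Proof.
apply: has_series_unique (has_seriesM has_series_expm1 has_series_todd) _.
have [e e0 H] := expm1_neq0.
apply: has_series_ext has_seriesX; exists e => // y y0 ye.
by rewrite mulrC divfK // H.
Qed.

Lemma euler_expm1 n : euler expm1_seq n = cauchy X_seq (exp_seq (-1)) n.
Proof.
case: n => [|n]; first by rewrite /euler mul0r /cauchy big_ord1 mul0r.
rewrite cauchyX /euler /expm1_seq /one_seq /exp_seq sub0r factS natrM invfM exprS.
by field; rewrite fact_neq0 /= addrC natr1 pnatr_eq0.
Qed.

(** With [T = y / (1 - e^(-y))], apply [y d/dy] to [(1 - e^(-y)) T = y], multiply by [T] and cancel
    one factor [y]. *)
Lemma exp_todd2 : cauchy (exp_seq (-1)) (cauchy todd todd) =1 (fun k => todd k - euler todd k).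
Proof.
move=> n; have E k : euler X_seq k = X_seq k.
  by rewrite /euler /X_seq; case: k => [|[|k]]; rewrite ?mul0r ?mulr0 ?mul1r.
have H : cauchy todd X_seq n.+1 = cauchy todd (fun k =>
    cauchy (cauchy X_seq (exp_seq (-1))) todd k + cauchy expm1_seq (euler todd) k) n.+1.
  apply: cauchy_ext => // k; rewrite -E -(_ : euler (cauchy expm1_seq todd) k = euler X_seq k).
    rewrite euler_cauchy; congr (_ + _); apply: cauchy_ext => // j; exact: euler_expm1.
  by rewrite /euler cauchy_expm1_todd.
move: H; rewrite cauchyC cauchyX cauchyDr.
have -> : cauchy todd (cauchy expm1_seq (euler todd)) n.+1 = euler todd n.
  rewrite cauchyA (cauchy_ext (a' := X_seq) (b' := euler todd)) ?cauchyX // => k.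
  by rewrite cauchyC cauchy_expm1_todd.
have -> : cauchy todd (cauchy (cauchy X_seq (exp_seq (-1))) todd) n.+1 =
    cauchy (exp_seq (-1)) (cauchy todd todd) n.
  by rewrite cauchyC -2!cauchyA cauchyX.
by move=> ->; rewrite addrK.
Qed.

(* Coefficient of [y ^ (m - 1)] in [e ^ (nu y) (y / (1 - e ^ (- y))) ^ m], that
   is, the residue of [e ^ (nu y) / (1 - e ^ (- y)) ^ m]. *)
Definition exp_residue (nu : C) m : C :=
  if m is m'.+1 then cauchy (exp_seq nu) (pow_seq todd m) m' else 0.

(** The factor [1 - e^(-y)] cancels one power of the denominator. In terms of the powers of
    [y / (1 - e^(-y))] this costs a factor [y], that is, a shift of the index. *)
Lemma exp_residue_step (nu : C) m :
  exp_residue nu m.+2 - exp_residue (nu - 1) m.+2 = exp_residue nu m.+1.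
Proof.
rewrite /exp_residue.
have F (t : C) k := has_seriesM (has_series_exp t) (has_seriesXm k has_series_todd).
have [e e0 H] := expm1_neq0.
have L := has_seriesD (F nu m.+2) (has_seriesZ (-1) (F (nu - 1) m.+2)).
have Rr := has_seriesM has_seriesX (F nu m.+1).
have ext : exists2 e : R, 0 < e & forall y : C, y != 0 -> cabs y < e ->
    y * (cexp (nu * y) * (y / (1 - cexp (- y))) ^+ m.+1) =
    cexp (nu * y) * (y / (1 - cexp (- y))) ^+ m.+2 +
    -1 * (cexp ((nu - 1) * y) * (y / (1 - cexp (- y))) ^+ m.+2).
  exists e => // y y0 ye; have d0 := H y y0 ye.
  rewrite mulrBl mul1r cexpD [_ ^+ m.+2]exprS; move: (_ ^+ m.+1) (cexp (nu * y)) => P a.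
  by move: (cexp (- y)) d0 => b d0; field.
have := has_series_unique L (has_series_ext ext Rr) m.+1.
by rewrite cauchyX mulN1r.
Qed.

Lemma exp_residue1 (nu : C) : exp_residue nu 1%N = 1.
Proof.
rewrite /exp_residue /cauchy big_ord1 /= /cauchy big_ord1 todd0 /one_seq !mulr1.
by rewrite /exp_seq expr0 fact0 divr1.
Qed.

(** The form [e^(-y) dy / (1 - e^(-y))^(m+2)] is exact. In coefficients, [exp_todd2] gives [e^(-y)
    T^(m+2) = T^(m+1) - (y d/dy) T^(m+1) / (m+1)], and [y d/dy] multiplies the coefficient of
    [y^(m+1)] by [m + 1]. *)
Lemma exp_residueN1 m : exp_residue (-1) m.+2 = 0.
Proof.
rewrite /exp_residue [pow_seq todd m.+2]/= -/(pow_seq todd m).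
have -> : cauchy (exp_seq (-1)) (cauchy todd (cauchy todd (pow_seq todd m))) m.+1 =
    cauchy (fun k => todd k + -1 * euler todd k) (pow_seq todd m) m.+1.
  rewrite (cauchy_ext (b' := cauchy (cauchy todd todd) (pow_seq todd m)) (fun=> erefl)); last first.
    by move=> k; rewrite cauchyA.
  by rewrite cauchyA; apply: cauchy_ext => // k; rewrite exp_todd2 mulN1r.
rewrite cauchyDl -/(pow_seq todd m.+1 m.+1).
have -> : cauchy (fun k => -1 * euler todd k) (pow_seq todd m) m.+1 =
    - cauchy (euler todd) (pow_seq todd m) m.+1.
  by rewrite cauchyC cauchyZr mulN1r cauchyC.
have := euler_pow todd m m.+1; rewrite /euler -/(euler todd) => /(mulfI _) <-.
  by rewrite subrr.
by rewrite pnatr_eq0.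
Qed.

(* Coefficient of [X ^ nu] in [1 / (1 - X) ^ m]. *)
Definition neg_binomial (m : nat) (nu : int) : nat :=
  if nu is Posz n then (if m is m'.+1 then 'C(n + m', m') else (n == 0)%N) else 0%N.

Lemma neg_binomial_step m (nu : int) :
  neg_binomial m.+1 nu = (neg_binomial m.+1 (nu - 1) + neg_binomial m nu)%N.
Proof.
case: nu => [[|n]|n] //; first by case: m => [|m] //=; rewrite !add0n !binn.
have -> : n.+1%:Z - 1 = n by rewrite -addn1 PoszD addrK.
case: m => [|m] /=; first by rewrite !addn0 !bin0.
by rewrite addSn binS addSnnS.
Qed.

(** Both sides satisfy the same Pascal recursion and vanish at [nu = -1] for exponents at least 2.
    From there one goes up through all larger [nu], and down as long as the values for the smaller
    exponent vanish, which stops exactly at the stated bound. *)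
Lemma exp_residueE m (nu : int) : - (m.+1)%:Z < nu ->
  exp_residue nu%:~R m.+1 = (neg_binomial m.+1 nu)%:R.
Proof.
elim: m nu => [|m IH] nu nm.
  rewrite exp_residue1; case: nu nm => [n _|n] //=; rewrite ?addn0 ?bin0 //.
have step (k : int) : exp_residue k%:~R m.+2 - exp_residue (k - 1)%:~R m.+2 = exp_residue k%:~R m.+1.
  by rewrite -[RHS]exp_residue_step intrB mulr1z.
have pos (n : nat) : exp_residue (n%:Z - 1)%:~R m.+2 = (neg_binomial m.+2 (n%:Z - 1))%:R.
  elim: n => [|n IHn]; first by rewrite sub0r exp_residueN1.
  have := step n%:Z; rewrite IHn IH // => /eqP; rewrite subr_eq => /eqP E.
  have -> : n.+1%:Z - 1 = n%:Z by rewrite -addn1 PoszD addrK.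
  by rewrite E -natrD addnC -neg_binomial_step.
have neg (n : nat) : (n <= m)%N -> exp_residue (- n%:Z - 1)%:~R m.+2 = 0.
  elim: n => [|n IHn] nm'; first by rewrite oppr0 sub0r exp_residueN1.
  have := step (- n%:Z - 1); rewrite (IHn (ltnW nm')) IH; last by lia.
  have -> : neg_binomial m.+1 (- n%:Z - 1) = 0%N by rewrite -opprD -PoszD addn1.
  rewrite sub0r => /eqP; rewrite oppr_eq0 => /eqP <-.
  by congr (exp_residue _%:~R _); lia.
case: nu nm => [n|n] nm; first by have := pos n.+1; rewrite -addn1 PoszD addrK.
have -> : Negz n = - n%:Z - 1 by lia.
rewrite neg; last by lia.
by rewrite -opprD -PoszD addn1.
Qed.

End FormalSeriesRing.

(** * Residues of germs *)

Section GermResidues.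
Variables (R : realType) (r : nat) (Phip : {fset 'rV[R]_r}).
Local Notation C := R[i].
Variable chi_c : {fraction (mpoly r R[i])} -> C.
Hypothesis Phip0 : 0 \notin Phip.
Hypothesis chi_comb : forall k f g, SH Phip f -> SH Phip g -> chi_c (scal k f + g) = k * chi_c f + chi_c g.
Hypothesis chi_dRH : forall f, SH Phip f -> dRH Phip f -> chi_c f = 0.
Implicit Types (F G : 'cV[C]_r -> C) (z p : 'cV[C]_r) (P : nat -> polyVC R r) (b : seq 'rV[R]_r).

(** A relational form of [chi_c (Tres_germ Phip F) = v]. The germ and its part in S_H are exhibited
    instead of being chosen by [xget], which makes the notion stable under linear combinations. *)
Definition has_residue F (v : C) := exists P b s,
  [/\ germ_at0 Phip F P b, SH Phip s, dRH Phip (germ_residue P b - s) & chi_c s = v].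

Lemma chi_unique s s' : SH Phip s -> SH Phip s' -> dRH Phip (s - s') -> chi_c s = chi_c s'.
Proof.
move=> sS sS' d; have := @chi_comb (-1) s' s sS' sS.
rewrite scalN1 addrC chi_dRH ?mulN1r //; last exact: SHB.
by move/eqP; rewrite addrC eq_sym subr_eq0 => /eqP.
Qed.

Lemma has_residue_Tres F v : has_residue F v -> chi_c (Tres_germ Phip F) = v.
Proof.
move=> [P [b [s [G sS sd <-]]]]; rewrite /Tres_germ; case: xgetP => [s' _ [P' [b' [G' ->]]]|/(_ (Tres Phip (germ_residue P b)))].
  rewrite -/(germ_residue P' b') -(germ_residue_unique Phip0 G G').
  rewrite /Tres; case: xgetP => [s2 _ [s2S s2d]|/(_ s) []]; last by split.
  apply: chi_unique => //; have := dRHB sd s2d.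
  by rewrite opprB addrC addrA subrK -opprB => d; have := dRH_scal (-1) d; rewrite scalN1 opprK.
by case; exists P, b.
Qed.

Definition near_regular (Q : 'cV[C]_r -> Prop) := exists2 e : R, 0 < e &
  forall z, (forall i, cabs (z i 0) < e) -> (forall a, a \in Phip -> evalC a z != 0) -> Q z.

Lemma near_regularI Q Q' : near_regular Q -> near_regular Q' -> near_regular (fun z => Q z /\ Q' z).
Proof.
move=> [e e0 H] [e' e0' H']; exists (Num.min e e'); first by rewrite lt_min e0.
move=> z ze zP; split; [apply: H => // k|apply: H' => // k].
  by have := ze k; rewrite lt_min => /andP[].
by have := ze k; rewrite lt_min => /andP[].
Qed.

Lemma near_regularW (Q Q' : 'cV[C]_r -> Prop) : (forall z, Q z -> Q' z) -> near_regular Q -> near_regular Q'.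
Proof. by move=> QQ [e e0 H]; exists e => // z ze zP; apply/QQ/H. Qed.

Lemma germ_near F P b : germ_at0 Phip F P b <->
  [/\ forall m, P m \is ishomog1 m mdeg, {subset b <= Phip} &
    near_regular (fun z => cvgS (fun m => ev z (P m)) (F z * \prod_(a <- b) evalC a z))].
Proof. by []. Qed.

Lemma germ_ext F G P b : near_regular (fun z => F z = G z) ->
  germ_at0 Phip F P b -> germ_at0 Phip G P b.
Proof.
move=> E /germ_near[hP bP nF]; apply/germ_near; split=> //.
by apply: near_regularW (near_regularI E nF) => z [<-].
Qed.

Lemma has_residue_ext F G v : near_regular (fun z => F z = G z) -> has_residue F v -> has_residue G v.
Proof.
by move=> E [P [b [s [gF sS sd sv]]]]; exists P, b, s; split=> //; apply: germ_ext gF.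
Qed.

Lemma germ0 : germ_at0 Phip (fun=> 0) (fun=> 0) [::].
Proof.
apply/germ_near; split=> //; first by move=> m; apply: dhomog0.
exists 1 => // z _ _; rewrite mul0r; apply: cvgC_ext (cvgC_const 0) => n.
by rewrite big1 // => k _; rewrite ev0.
Qed.

Lemma germ_residue0 b : germ_residue (fun=> 0 : polyVC R r) b = 0.
Proof.
by rewrite /germ_residue /ratfrac; case: (r <= size b)%N; rewrite rmorph0 mul0r.
Qed.

Lemma has_residue0 : has_residue (fun=> 0) 0.
Proof.
exists (fun=> 0), [::], 0; rewrite germ_residue0 subrr.
split; [exact: germ0|exact: SH0|exact: dRH0|].
by apply: chi_dRH; [exact: SH0|exact: dRH0].
Qed.

Lemma germ_scale k F P b : germ_at0 Phip F P b ->
  germ_at0 Phip (fun z => k * F z) (fun m => k *: P m) b.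
Proof.
move=> /germ_near[hP bP nF]; apply/germ_near; split=> //; first by move=> m; apply: rpredZ.
apply: near_regularW nF => z /(cvgSZ k); rewrite mulrA; apply: cvgC_ext => n.
by apply: eq_bigr => m _; rewrite evZ.
Qed.

Lemma tofracZ_scal (k : C) (p : polyVC R r) : tofrac (k *: p) = scal k (tofrac p).
Proof. by rewrite /scal -rmorphM /= mpoly.mul_mpolyC. Qed.

Lemma germ_residueZ k P b : germ_residue (fun m => k *: P m) b = scal k (germ_residue P b).
Proof.
rewrite /germ_residue /ratfrac; case: (r <= size b)%N; first by rewrite tofracZ_scal scalM.
by rewrite !rmorph0 !mul0r /scal mulr0.
Qed.

Lemma has_residueZ k F v : has_residue F v -> has_residue (fun z => k * F z) (k * v).
Proof.
move=> [P [b [s [gF sS sd sv]]]]; exists (fun m => k *: P m), b, (scal k s); split.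
- exact: germ_scale.
- exact: SH_scal.
- by rewrite germ_residueZ -scalN1 scal_scal mulN1r -[- k]mulr1 mulNr -mulrN -scal_scal scalN1 -scalD; apply: dRH_scal.
have := @chi_comb k s 0 sS (@SH0 R r Phip); rewrite addr0 => ->.
rewrite sv chi_dRH ?addr0 //; [exact: SH0|exact: dRH0].
Qed.

(* [P / prod b] rewritten over the larger denominator [b ++ b']. *)
Definition raise_germ P b' (m : nat) : polyVC R r :=
  if (m < size b')%N then 0 else P (m - size b')%N * \prod_(a <- b') linform a.

Lemma germ_raise F P b b' : {subset b' <= Phip} -> germ_at0 Phip F P b ->
  germ_at0 Phip F (raise_germ P b') (b ++ b').
Proof.
move=> bP' /germ_near[hP bP nF]; apply/germ_near; split.
- move=> m; rewrite /raise_germ; case: ltnP => mb; first exact: dhomog0.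
  by apply: homog_cast (subnK mb) _; apply: dhomogM => //; apply: homog_prod_linform.
- by move=> a; rewrite mem_cat => /orP[/bP|/bP'].
apply: near_regularW nF => z /(cvgSZ (\prod_(a <- b') evalC a z)) /(cvgS_delay (size b')).
rewrite big_cat /=; set B := \prod_(a <- b) _; set B' := \prod_(a <- b') _.
have -> : F z * (B * B') = B' * (F z * B) by ring.
apply: cvgC_ext => n; apply: eq_bigr => m _.
rewrite /raise_germ; case: ltnP => mb; first by rewrite ev0.
by rewrite evM ev_prod_linform mulrC.
Qed.

Lemma germD F G P P' b : germ_at0 Phip F P b -> germ_at0 Phip G P' b ->
  germ_at0 Phip (fun z => F z + G z) (fun m => P m + P' m) b.
Proof.
move=> /germ_near[hP bP nF] /germ_near[hP' _ nG]; apply/germ_near; split=> //.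
  by move=> m; apply: rpredD.
apply: near_regularW (near_regularI nF nG) => z [cF cG]; rewrite mulrDl.
by apply: cvgC_ext (cvgSD cF cG) => n; apply: eq_bigr => m _; rewrite evD.
Qed.

Lemma germ_residueD P P' b : germ_residue (fun m => P m + P' m) b = germ_residue P b + germ_residue P' b.
Proof.
rewrite /germ_residue /ratfrac; case: (r <= size b)%N; first by rewrite rmorphD mulrDl.
by rewrite !rmorph0 !mul0r addr0.
Qed.

(** Both germs are rewritten over the common denominator [b ++ b'], which does not change their
    residues by [germ_residue_unique]. *)
Lemma has_residueD F G v w : has_residue F v -> has_residue G w -> has_residue (fun z => F z + G z) (v + w).
Proof.
move=> [P [b [s [gF sS sd <-]]]] [P' [b' [s' [gG sS' sd' <-]]]].
have bP : {subset b <= Phip} by case: gF.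
have bP' : {subset b' <= Phip} by case: gG.
have gF2 := germ_raise bP' gF; have gG2 := germ_raise bP gG.
have gG3 : germ_at0 Phip G (raise_germ P' b) (b ++ b').
  have /germ_near[h1 h2 h3] := gG2; apply/germ_near; split=> //.
    by move=> a ab; apply: h2; rewrite mem_cat orbC -mem_cat.
  by apply: near_regularW h3 => z; rewrite !big_cat /= [_ b' _ * _]mulrC.
exists (fun m => raise_germ P b' m + raise_germ P' b m), (b ++ b'), (s + s'); split.
- exact: germD.
- exact: SHD.
- rewrite germ_residueD (germ_residue_unique Phip0 gF2 gF) (germ_residue_unique Phip0 gG3 gG).
  by rewrite opprD addrACA; apply: dRHD.
by have := @chi_comb 1 s s' sS sS'; rewrite scal1 mul1r.
Qed.

Section GoodPairs.
Variables (Phi : {fset 'rV[R]_r}) (cor : 'rV[R]_r -> 'cV[R]_r).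
Local Notation pairs := (C^o * ('cV[C]_r -> C^o))%type.

Definition all_classes : set (set 'cV[C]_r) := [set K | exists p, K = class_mod Phi cor p]%classic.

Definition class_residue F (K : set 'cV[C]_r) : C :=
  chi_c (Tres_germ Phip (fun z => F (xget 0 K - z))).

(** The pairs (number, function) for which the number is the sum of the residues of the function
    over all classes. Existence of the residue at every point is demanded because additivity would
    fail for default values; the finite set [S] contains the support of the residues. *)
Definition good (x : pairs) :=
  (forall p, exists v, has_residue (fun z => x.2 (p - z)) v) /\
  exists S : set (set 'cV[C]_r), [/\ finite_set S, (S `<=` all_classes)%classic,
    (forall K, all_classes K -> ~ S K -> class_residue x.2 K = 0) &
    x.1 = \sum_(K \in S) class_residue x.2 K].

Lemma class_residueE F K v : has_residue (fun z => F (xget 0 K - z)) v -> class_residue F K = v.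
Proof. exact: has_residue_Tres. Qed.

Lemma good_null F : (forall p, near_regular (fun z => F (p - z) = 0)) -> good (0, F).
Proof.
move=> F0; have H p : has_residue (fun z => F (p - z)) 0.
  by apply: has_residue_ext has_residue0; apply: near_regularW (F0 p) => z ->.
split=> [p|]; first by exists 0; apply: H.
exists set0; split=> //; first by move=> K _ _; apply: class_residueE (H _).
by rewrite fsbig_set0.
Qed.

Lemma goodZ (k : C) x : good x -> good (k *: x).
Proof.
move=> [H [S [Sf SA S0 xE]]]; have HK K : exists v, has_residue (fun z => x.2 (xget 0 K - z)) v by [].
have E K : class_residue (k *: x).2 K = k * class_residue x.2 K.
  have [v Hv] := HK K; rewrite (class_residueE Hv); apply: class_residueE.
  exact: has_residueZ Hv.
split=> [p|].
  by have [v Hv] := H p; exists (k * v); apply: has_residueZ Hv.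
exists S; split=> //; first by move=> K AK SK; rewrite E S0 // mulr0.
change (k * x.1 = \sum_(K \in S) class_residue (k *: x).2 K).
by rewrite xE !fsbig_finite // mulr_sumr; apply: eq_bigr => K _; rewrite E.
Qed.

Lemma goodD x y : good x -> good y -> good (x + y).
Proof.
move=> [H [S [Sf SA S0 xE]]] [H' [S' [Sf' SA' S0' yE]]].
have E K : class_residue (x + y).2 K = class_residue x.2 K + class_residue y.2 K.
  have [v Hv] := H (xget 0 K); have [v' Hv'] := H' (xget 0 K).
  by rewrite (class_residueE Hv) (class_residueE Hv'); apply: class_residueE; apply: has_residueD Hv Hv'.
split=> [p|].
  by have [v Hv] := H p; have [v' Hv'] := H' p; exists (v + v'); apply: has_residueD Hv Hv'.
exists (S `|` S')%classic; split.
- by rewrite finite_setU.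
- by move=> K [/SA|/SA'].
- move=> K AK SK; rewrite E S0 ?S0' ?addr0 // => SK'; apply: SK; [by right|by left].
rewrite /= xE yE (fsbig_widen S (S `|` S')%classic); last 2 first.
- by move=> K; left.
- by move=> K [[//|SK'] nSK]; apply: S0 (SA' _ SK') nSK.
rewrite (fsbig_widen S' (S `|` S')%classic); last 2 first.
- by move=> K; right.
- by move=> K [[SK|//] nSK]; apply: S0' (SA _ SK) nSK.
by rewrite -fsbig_split ?finite_setU //=; apply: eq_fsbigr => K _; rewrite E.
Qed.

End GoodPairs.

End GermResidues.

(** * Formal expansions *)

Section FormalExpansions.
Variables (R : realType) (r : nat) (height : 'rV[R]_r -> R).
Hypothesis heightD : {morph height : x y / x + y}.
Hypothesis heightZ : forall k x, height (k *: x) = k * height x.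
Local Notation block := ('rV[R]_r * R)%type.
Implicit Types (d : block) (L : seq block) (h f g : 'rV[R]_r -> R) (a x : 'rV[R]_r).

Lemma height_mulrn x n : height (x *+ n) = n%:R * height x.
Proof. by rewrite -scaler_nat heightZ. Qed.

Lemma heightN x : height (- x) = - height x.
Proof. by rewrite -scaleN1r heightZ mulN1r. Qed.

Lemma heightBn x a n : height (x - a *+ n) = height x - n%:R * height a.
Proof. by rewrite heightD heightN height_mulrn. Qed.

Definition nneg_support h := forall x, height x < 0 -> h x = 0.

(** After this many steps along a direction of height at least 1 the height has become negative; it
    bounds the sums over a ray. *)
Definition degree x := (Num.truncn (height x)).+1.

Lemma degreeP x a k : 1 <= height a -> (degree x <= k)%N -> height (x - a *+ k) < 0.
Proof.
move=> a1 xk; rewrite heightBn subr_lt0; have := truncnS_gt (height x).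
move/lt_le_trans; apply; apply: (@le_trans _ _ k%:R); first by rewrite ler_nat.
by rewrite ler_peMr.
Qed.

Lemma ray_sum_stable (w : nat -> R) h a x n : nneg_support h -> 1 <= height a -> (degree x <= n)%N ->
  \sum_(k < n) w k * h (x - a *+ k) = \sum_(k < degree x) w k * h (x - a *+ k) :> R.
Proof.
move=> h0 a1 xn; rewrite -!(big_mkord xpredT (fun k => w k * h (x - a *+ k))).
rewrite (big_cat_nat (leq0n _) xn) /= [X in _ + X]big_nat_cond [X in _ + X]big1 ?addr0 //.
by move=> k; rewrite andbT => /andP[xk _]; rewrite h0 ?mulr0 // degreeP.
Qed.

Definition ray_mul a (w : nat -> R) h : 'rV[R]_r -> R :=
  fun x => \sum_(k < degree x) w k * h (x - a *+ k).

Lemma ray_mul_nneg a w h : 1 <= height a -> nneg_support h -> nneg_support (ray_mul a w h).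
Proof.
move=> a1 h0 x x0; apply: big1 => k _; rewrite h0 ?mulr0 // heightBn subr_lt0.
by apply: lt_le_trans x0 _; rewrite mulr_ge0 // (le_trans ler01).
Qed.

Definition geom_mul d := ray_mul d.1 (fun k => d.2 ^+ k).

Lemma geom_mul_step d h x : 1 <= height d.1 -> nneg_support h ->
  geom_mul d h x - d.2 * geom_mul d h (x - d.1) = h x.
Proof.
move=> d1 h0; rewrite /geom_mul /ray_mul.
set n := maxn (degree x) (degree (x - d.1)).+1.
have nx : (degree x <= n.+1)%N by rewrite ltnW // ltnS leq_maxl.
have nx' : (degree (x - d.1) <= n)%N by rewrite ltnW // leq_maxr.
rewrite -(ray_sum_stable _ h0 d1 nx) -(ray_sum_stable _ h0 d1 nx') big_ord_recl.
rewrite expr0 mul1r mulr0n subr0 mulr_sumr -addrA -sumrB big1 ?addr0 // => k _.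
by rewrite lift0 exprS mulrA mulrS opprD addrA subrr.
Qed.

(** The difference at [x] equals a power of [d.2] times the difference at [x - d.1 *+ k] for every
    [k], and both functions vanish there once the height is negative. *)
Lemma geom_mul_unique d f g : 1 <= height d.1 -> nneg_support f -> nneg_support g ->
  (forall x, f x - d.2 * f (x - d.1) = g x - d.2 * g (x - d.1)) -> f =1 g.
Proof.
move=> d1 f0 g0 E x; have D k : f x - g x = d.2 ^+ k * (f (x - d.1 *+ k) - g (x - d.1 *+ k)).
  elim: k => [|k ->]; first by rewrite expr0 mul1r mulr0n subr0.
  rewrite exprSr -mulrA mulrSr opprD addrA; congr (_ * _).
  move: (E (x - d.1 *+ k)); set u := f (_ - _ *+ k); set v := g (_ - _ *+ k) => E'.
  by rewrite mulrBr; apply/eqP; rewrite -subr_eq0; move/eqP: E'; rewrite -subr_eq0; apply: etrans; congr (_ == _); ring.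
apply/eqP; rewrite -subr_eq0 (D (degree x)) f0 ?g0 ?subrr ?mulr0 //; exact: degreeP.
Qed.

Fixpoint tseries L : 'rV[R]_r -> R :=
  if L is d :: L' then geom_mul d (tseries L') else fun x => (x == 0)%:R.

Definition high L := all (fun d => 1 <= height d.1) L.

Lemma tseries_nneg L : high L -> nneg_support (tseries L).
Proof.
elim: L => [_ x|d L IH /= /andP[d1 hL]]; last by apply: ray_mul_nneg => //; apply: IH.
by rewrite /=; case: eqP => // ->; rewrite -(scale0r (0 : 'rV[R]_r)) heightZ mul0r ltxx.
Qed.

Lemma tseries_step d L x : high (d :: L) ->
  tseries (d :: L) x - d.2 * tseries (d :: L) (x - d.1) = tseries L x.
Proof. by move=> /andP[d1 hL]; apply: geom_mul_step => //; apply: tseries_nneg. Qed.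

Lemma tseries_cons_ext d L L' : tseries L =1 tseries L' -> tseries (d :: L) =1 tseries (d :: L').
Proof. by move=> E x; apply: eq_bigr => k _; congr (_ * _); apply: E. Qed.

Lemma tseries_swap d d' L : high (d :: d' :: L) -> tseries (d :: d' :: L) =1 tseries (d' :: d :: L).
Proof.
move=> hL; have /and3P[d1 d1' hL0] := hL.
have hL' : high (d' :: d :: L) by apply/and3P.
have hdL : high (d :: L) by apply/andP.
have hdL' : high (d' :: L) by apply/andP.
apply: (@geom_mul_unique d) => //; [exact: tseries_nneg|exact: tseries_nneg|].
pose f x := tseries (d' :: d :: L) x - d.2 * tseries (d' :: d :: L) (x - d.1).
have f0 : nneg_support f.
  move=> x x0; rewrite /f !tseries_nneg ?mulr0 ?subr0 // -[d.1]mulr1n heightBn mul1r subr_lt0.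
  by apply: lt_le_trans x0 _; rewrite (le_trans ler01).
move=> x; rewrite tseries_step // -/(f x); apply: (@geom_mul_unique d' (tseries (d' :: L)) f) => // [|y].
  exact: tseries_nneg.
rewrite tseries_step // /f [y - d'.1 - d.1]addrAC.
have E1 := tseries_step y hL'; have E2 := tseries_step (y - d.1) hL'.
have E3 := tseries_step y hdL.
rewrite -E3 -E1 -E2; ring.
Qed.

Lemma tseries_perm L L' : high L -> perm_eq L L' -> tseries L =1 tseries L'.
Proof.
have front d L1 L2 : high (L1 ++ d :: L2) -> tseries (L1 ++ d :: L2) =1 tseries (d :: L1 ++ L2).
  elim: L1 => // d1 L1 IH /andP[h1 hL] x.
  rewrite !cat_cons (tseries_cons_ext d1 (IH hL)).
  have : all (fun d => 1 <= height d.1) (L1 ++ d :: L2) := hL.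
  rewrite all_cat => /andP[a1 /andP[a2 a3]].
  have a12 : all (fun d => 1 <= height d.1) (L1 ++ L2) by rewrite all_cat a1.
  by apply: tseries_swap; apply/and3P; split.
elim: L L' => [|d L IH] L' hL; first by rewrite perm_sym => /perm_nilP ->.
move=> p x; have dL' : d \in L' by rewrite -(perm_mem p) mem_head.
move: p; case/splitPr: dL' => L1 L2 p.
have hL' : high (L1 ++ d :: L2) by rewrite /high -(perm_all _ p).
rewrite front //; apply: tseries_cons_ext; apply: IH; first by case/andP: hL.
rewrite -(perm_cons d); apply: perm_trans p _.
by rewrite -cat1s perm_catCA.
Qed.

Definition ray a (w : nat -> R) : 'rV[R]_r -> R :=
  fun x => \sum_(k \in [set k : nat | x = a *+ k]%classic) w k.

Lemma mulrn_inj a : 1 <= height a -> injective (fun k => a *+ k).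
Proof.
move=> a1 k k' /(congr1 height); rewrite !height_mulrn => /mulIf.
have a0 : height a != 0 by rewrite gt_eqF // (lt_le_trans ltr01).
by move=> /(_ a0)/eqP; rewrite eqr_nat => /eqP.
Qed.

Lemma rayE a w k : 1 <= height a -> ray a w (a *+ k) = w k.
Proof.
move=> a1; rewrite /ray (_ : [set _ | _] = [set k])%classic ?fsbig_set1 //.
by apply/seteqP; split=> j /= => [/(mulrn_inj a1)|->].
Qed.

Lemma ray_out a w x : (forall k, x <> a *+ k) -> ray a w x = 0.
Proof. by move=> H; rewrite /ray fsbig1 // => k /= /H. Qed.

Lemma ray_nneg a w : 1 <= height a -> nneg_support (ray a w).
Proof.
move=> a1 x x0; apply: ray_out => k xE; move: x0; rewrite xE height_mulrn ltNge mulr_ge0 //.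
exact: le_trans ler01 a1.
Qed.

Lemma fsmul_ray a w h : 1 <= height a -> nneg_support h -> fsmul (ray a w) h =1 ray_mul a w h.
Proof.
move=> a1 h0 x; rewrite /fsmul (fsbigE [seq a *+ k | k <- iota 0 (degree x)]).
- rewrite big_map -[iota 0 _]/(index_iota 0 (degree x)) (eq_bigl xpredT) => [|k]; last by apply: mem_set.
  by rewrite big_mkord; apply: eq_bigr => k _; rewrite rayE.
- by rewrite map_inj_uniq ?iota_uniq //; apply: mulrn_inj.
- by [].
move=> nu _ nuN; have [[k nuE]|H] := pselect (exists k, nu = a *+ k); last first.
  by rewrite ray_out ?mul0r // => k nuE; apply: H; exists k.
rewrite nuE h0 ?mulr0 //; apply: degreeP => //; rewrite leqNgt; apply: contra nuN => kx.
by rewrite nuE; apply: map_f; rewrite mem_iota.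
Qed.

Definition conv (w w' : nat -> R) n := \sum_(k < n.+1) w k * w' (n - k)%N.

Lemma fsmul_ray_ray a w w' : 1 <= height a -> fsmul (ray a w) (ray a w') =1 ray a (conv w w').
Proof.
move=> a1 x; rewrite fsmul_ray //; last exact: ray_nneg.
have [[n ->]|H] := pselect (exists n, x = a *+ n); last first.
  rewrite ray_out => [|k xE]; last by apply: H; exists k.
  apply: big1 => k _; rewrite ray_out ?mulr0 // => j /eqP; rewrite subr_eq => /eqP xE.
  by apply: H; exists (j + k)%N; rewrite mulrnDr.
rewrite rayE // /ray_mul.
have dn : (degree (a *+ n) <= (degree (a *+ n)) + n.+1)%N by rewrite leq_addr.
rewrite -(ray_sum_stable _ (ray_nneg _ a1) a1 dn) addnC big_split_ord /= [X in _ + X]big1 ?addr0.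
  apply: eq_bigr => k _; have kn : (k <= n)%N by rewrite -ltnS.
  by rewrite -mulrnBr // rayE.
move=> k _; rewrite ray_nneg ?mulr0 // -{1}[a *+ n]subr0 -{1}(mulr0n a).
rewrite subr0 heightBn height_mulrn -mulrBl nmulr_rlt0 ?(lt_le_trans ltr01) //.
by rewrite subr_lt0 ltr_nat addSn ltnS leq_addr.
Qed.

Definition one_minus : nat -> R := fun k => (k == 0%N)%:R - (k == 1%N)%:R.

Lemma fsexpB a : 1 <= height a -> (fsexp 0 \- fsexp a)%R = ray a one_minus.
Proof.
move=> a1; apply/funext => x; rewrite /fsexp /=.
have [[n ->]|H] := pselect (exists n, x = a *+ n).
  rewrite rayE // /one_minus; have i0 := inj_eq (mulrn_inj a1) n 0%N.
  by have := inj_eq (mulrn_inj a1) n 1%N; rewrite mulr1n mulr0n in i0 * => ->; rewrite i0.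
rewrite ray_out => [|k xE]; last by apply: H; exists k.
case: eqP => [x0|_]; first by case: H; exists 0%N.
case: eqP => [x1|_]; first by case: H; exists 1%N.
by rewrite subrr.
Qed.

Lemma conv_one_minus w n : conv one_minus w n = w n - (if n is n'.+1 then w n' else 0).
Proof.
rewrite /conv /one_minus big_ord_recl subr0 mul1r subn0; case: n => [|n].
  by rewrite big_ord0 addr0 subr0.
rewrite big_ord_recl sub0r mulN1r subSS subn0 big1 ?addr0 // => k _.
by rewrite subrr mul0r.
Qed.

Lemma conv_geom (u v : R) n : (v - u) * conv (fun k => u ^+ k) (fun k => v ^+ k) n = v ^+ n.+1 - u ^+ n.+1.
Proof.
rewrite -[RHS]opprB subrXX -mulNr opprB; congr (_ * _); rewrite /conv.
rewrite (reindex_inj rev_ord_inj) /=; apply: eq_bigr => k _.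
have kn : (k <= n)%N by rewrite -ltnS.
by rewrite subSS subKn.
Qed.

Variable q : R.
Hypothesis q1 : 1 < q.

Definition eta_coef : R := (q - 1) / (q + 1).

Definition eta_seq := conv (conv one_minus one_minus) (conv (fun k => q^-1 ^+ k) (fun k => q ^+ k)).

Lemma conv_poly (w w' : nat -> R) N n : (n < N)%N ->
  conv w w' n = (\poly_(k < N) w k * \poly_(k < N) w' k)`_n.
Proof.
move=> nN; rewrite coefM; apply: eq_bigr => k _; rewrite !coef_poly.
have kn : (k <= n)%N by rewrite -ltnS.
by rewrite (leq_ltn_trans kn nN) (leq_ltn_trans (leq_subr _ _) nN).
Qed.

Lemma convA w w' w'' n : conv (conv w w') w'' n = conv w (conv w' w'') n.
Proof.
have P (u v v' : nat -> R) : conv u (conv v v') n =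
    (\poly_(k < n.+1) u k * (\poly_(k < n.+1) v k * \poly_(k < n.+1) v' k))`_n.
  rewrite coefM; apply: eq_bigr => k _; have kn : (k <= n)%N by rewrite -ltnS.
  by rewrite coef_poly ltnS kn (@conv_poly _ _ n.+1) // ltnS leq_subr.
have C (u v : nat -> R) k : conv u v k = conv v u k.
  by rewrite !(@conv_poly _ _ k.+1) // mulrC.
by rewrite P C P mulrC mulrA.
Qed.

(* [(1 - X)^2 / ((1 - X / q) (1 - q X)) = 1 - c / (1 - X / q) + c / (1 - q X)]
   with [c = (q - 1) / (q + 1)]. *)
Lemma eta_seqE n : eta_seq n = (n == 0%N)%:R + (- eta_coef) * q^-1 ^+ n + eta_coef * q ^+ n.
Proof.
have q0 : q != 0 by rewrite gt_eqF // (lt_trans ltr01).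
have qp : q + 1 != 0 by rewrite gt_eqF // ltr_wpDl // ltW // (lt_trans ltr01).
have qm : q - 1 != 0 by rewrite gt_eqF // subr_gt0.
have qq : q - q^-1 != 0.
  have -> : q - q^-1 = (q - 1) * (q + 1) / q by field.
  by rewrite !mulf_neq0 // invr_eq0.
rewrite /eta_seq convA conv_one_minus; set g := conv (fun k => q^-1 ^+ k) _.
have gE k : g k = (q ^+ k.+1 - q^-1 ^+ k.+1) / (q - q^-1).
  by rewrite -conv_geom -/g mulrC mulKf.
rewrite conv_one_minus; case: n => [|n]; rewrite ?conv_one_minus.
  by rewrite gE !expr1 divff // !subr0 !expr0 !mulr1 subrK.
have qq' : q * q - 1 != 0.
  have -> : q * q - 1 = (q - 1) * (q + 1) by ring.
  by rewrite mulf_neq0.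
case: n => [|n]; rewrite /= !gE /eta_coef !exprVn !exprS ?expr0.
  by field; rewrite q0 qp qq'.
have qn : q ^+ n != 0 by rewrite expf_neq0.
by field; rewrite q0 qp qq' qn.
Qed.

Lemma eta_factor a h : 1 <= height a -> nneg_support h ->
  fsmul (fsmul (fsmul (fsexp 0 \- fsexp a) (fsexp 0 \- fsexp a))
    (fsmul (fsgeom q^-1 a) (fsgeom q a))) h =1
  (fun x => h x + (- eta_coef) * geom_mul (a, q^-1) h x + eta_coef * geom_mul (a, q) h x).
Proof.
move=> a1 h0 x; rewrite fsexpB //.
have -> : fsmul (ray a one_minus) (ray a one_minus) = ray a (conv one_minus one_minus).
  by apply/funext; apply: fsmul_ray_ray.
have -> : fsmul (fsgeom q^-1 a) (fsgeom q a) = ray a (conv (fun k => q^-1 ^+ k) (fun k => q ^+ k)).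
  by apply/funext; apply: fsmul_ray_ray.
have -> : fsmul (ray a (conv one_minus one_minus)) (ray a (conv (fun k => q^-1 ^+ k) (fun k => q ^+ k))) =
    ray a eta_seq by apply/funext; apply: fsmul_ray_ray.
rewrite fsmul_ray // /geom_mul /ray_mul /=.
have hE : h x = \sum_(k < degree x) (k == 0%N :> nat)%:R * h (x - a *+ k).
  rewrite big_ord_recl eqxx mul1r mulr0n subr0 big1 ?addr0 // => k _.
  by rewrite mul0r.
rewrite [in RHS]hE !mulr_sumr -!big_split /=; apply: eq_bigr => k _.
by rewrite eta_seqE; ring.
Qed.

(** Each root contributes one of the three terms of the partial fraction of its factor. An entry
    records the resulting scalar and the list of the geometric factors chosen. *)
Definition eta_blocks (s : seq 'rV[R]_r) : seq (R * seq block) :=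
  foldr (fun a cs => [seq (c.1, c.2) | c <- cs] ++
    [seq (- eta_coef * c.1, (a, q^-1) :: c.2) | c <- cs] ++
    [seq (eta_coef * c.1, (a, q) :: c.2) | c <- cs]) [:: (1, [::])] s.

Lemma eta_blocks_mem s c d : c \in eta_blocks s -> d \in c.2 -> d.1 \in s /\ (d.2 = q \/ d.2 = q^-1).
Proof.
elim: s c => [|a s IH] c /=; first by rewrite inE => /eqP ->.
rewrite !mem_cat => /or3P[] /mapP[c' c's ->] /=.
- by move=> /(IH _ c's)[ds dq]; rewrite inE ds orbT.
- rewrite inE => /orP[/eqP ->|/(IH _ c's)[ds dq]]; first by rewrite mem_head; split=> //; right.
  by rewrite inE ds orbT.
- rewrite inE => /orP[/eqP ->|/(IH _ c's)[ds dq]]; first by rewrite mem_head; split=> //; left.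
  by rewrite inE ds orbT.
Qed.

Lemma rplus_eta_blocks (s : seq 'rV[R]_r) : all (fun a => 1 <= height a) s ->
  \big[@fsmul R r/fsexp 0]_(a <- s) fsmul (fsmul (fsexp 0 \- fsexp a) (fsexp 0 \- fsexp a))
          (fsmul (fsgeom q^-1 a) (fsgeom q a)) =1
  (fun x => \sum_(c <- eta_blocks s) c.1 * tseries c.2 x).
Proof.
elim: s => [_ x|a s IH /= /andP[a1 hs] x].
  by rewrite big_nil big_seq1 /= mul1r /fsexp.
rewrite big_cons; set h := \big[_/_]_(_ <- s) _.
have hE : h = (fun x => \sum_(c <- eta_blocks s) c.1 * tseries c.2 x) by apply/funext; apply: IH.
have cs_high c : c \in eta_blocks s -> high c.2.
  by move=> cs; apply/allP => d dc; have [ds _] := eta_blocks_mem cs dc; apply: (allP hs).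
have h0 : nneg_support h.
  move=> y y0; rewrite hE big_seq big1 // => c cs.
  by rewrite tseries_nneg ?mulr0 //; apply: cs_high.
rewrite eta_factor // !big_cat !big_map /= addrA.
have G u : geom_mul (a, u) h x = \sum_(c <- eta_blocks s) c.1 * tseries ((a, u) :: c.2) x.
  rewrite hE /= /geom_mul /ray_mul /=; under eq_bigr do rewrite mulr_sumr.
  rewrite exchange_big; apply: eq_bigr => c _; rewrite mulr_sumr; apply: eq_bigr => k _.
  by rewrite mulrCA.
rewrite !G hE !mulr_sumr; congr (_ + _ + _); apply: eq_bigr => c _; by rewrite mulrA.
Qed.

End FormalExpansions.

(** * Reduction along circuits *)

Section Circuits.
Variables (R : realType) (r : nat).
Local Notation C := R[i].
Local Notation block := ('rV[R]_r * R)%type.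
Implicit Types (d : block) (L : seq block) (mu : 'rV[R]_r) (s : seq (R * block)).

Definition unit_coef s := all (fun x : R * block => 0 <= x.1 <= 1) s.
Definition zsum s := \sum_(x <- s) x.1 *: x.2.1.

(** A repeated block counts as often as it occurs in [L], hence the comparison up to permutation and
    not by membership. *)
Definition zonotope L mu := exists s, [/\ perm_eq [seq x.2 | x <- s] L, unit_coef s & mu = zsum s].

Lemma perm_map_lift (T : eqType) (T' : eqType) (f : T -> T') (s : seq T) (L : seq T') :
  perm_eq [seq f x | x <- s] L -> exists2 s', perm_eq s s' & [seq f x | x <- s'] = L.
Proof.
elim: L s => [|y L IH] s sL.
  by exists s => //; apply/nilP; rewrite /nilp (perm_size sL).
have : y \in [seq f x | x <- s] by rewrite (perm_mem sL) mem_head.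
case/mapP=> x xs yx; have ps := perm_to_rem xs.
have [|s' ps' fs'] := IH (rem x s).
  by rewrite -(perm_cons y) {1}yx -map_cons (perm_trans _ sL) // perm_map // perm_sym.
exists (x :: s'); last by rewrite /= fs' yx.
by rewrite (perm_trans ps) // perm_cons.
Qed.

Lemma zonotopeP L mu : zonotope L mu <->
  exists s, [/\ [seq x.2 | x <- s] = L, unit_coef s & mu = zsum s].
Proof.
split=> [[s [pL u ->]]|[s [sL u ->]]]; last by exists s; rewrite sL perm_refl.
have [s' ps sL] := perm_map_lift pL; exists s'; split=> //.
  by rewrite /unit_coef -(perm_all _ ps).
by apply: perm_big.
Qed.

Lemma zonotope_perm L L' mu : perm_eq L L' -> zonotope L mu -> zonotope L' mu.
Proof. by move=> p [s [ps u E]]; exists s; split=> //; apply: perm_trans p. Qed.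

Lemma zonotope_cons d L mu (t : R) : 0 <= t <= 1 -> zonotope L mu ->
  zonotope (d :: L) (t *: d.1 + mu).
Proof.
move=> t01 [s [ps u ->]]; exists ((t, d) :: s); split; rewrite /= ?perm_cons //.
  by rewrite t01.
by rewrite /zsum big_cons.
Qed.

Lemma zonotope_consP d L mu : zonotope (d :: L) mu ->
  exists2 t : R, 0 <= t <= 1 & zonotope L (mu - t *: d.1).
Proof.
case/zonotopeP=> -[|[t d'] s] [] // [dE sL] /andP[t01 u] ->; exists t => //.
rewrite -{}dE -{}sL.
by apply/zonotopeP; exists s; rewrite /zsum big_cons addrAC subrr add0r.
Qed.

Lemma uniq_sub_perm (T : eqType) (K L : seq T) : uniq K -> {subset K <= L} ->
  exists L' : seq T, perm_eq L (K ++ L').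
Proof.
elim: K L => [|k K IH] L; first by exists L.
move=> /= /andP[kK uK] KL; have kL : k \in L by apply: KL; rewrite mem_head.
have pL := perm_to_rem kL.
have [|L' pL'] := IH (rem k L) uK.
  move=> x xK; have : x \in L by apply: KL; rewrite inE xK orbT.
  rewrite (perm_mem pL) inE => /orP[/eqP xk|//].
  by rewrite -xk xK in kK.
by exists L'; rewrite (perm_trans pL) // perm_cons.
Qed.

Variables (V : lmodType C) (Good : V -> Prop).
Hypothesis Good0 : Good 0.
Hypothesis GoodD : forall x y, Good x -> Good y -> Good (x + y).
Hypothesis GoodZ : forall (k : C) x, Good x -> Good (k *: x).

Lemma GoodN x : Good x -> Good (- x).
Proof. by rewrite -scaleN1r; apply: GoodZ. Qed.

Lemma GoodB x y : Good x -> Good y -> Good (x - y).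
Proof. by move=> gx gy; apply: GoodD => //; apply: GoodN. Qed.

Lemma GoodZ_inv (k : C) x : k != 0 -> Good (k *: x) -> Good x.
Proof. by move=> k0 /(GoodZ k^-1); rewrite scalerA mulVf // scale1r. Qed.

Lemma Good_diff x y : Good x -> Good (y - x) -> Good y.
Proof. by move=> gx /(GoodD gx); rewrite addrC subrK. Qed.

(** Abstract form of the terms: [E mu L] stands for [e^(mu - lambda) / prod_d (1 - u_d
    e^(gamma_d))], and [Erel] is the identity [1 / (1 - X) - X / (1 - X) = 1] modulo the subspace
    [Good]. The reduction along circuits uses nothing else about residues. *)
Variables (E : 'rV[R]_r -> seq block -> V) (valid : block -> Prop) (lat : 'rV[R]_r -> Prop).
Definition valids L := forall d, d \in L -> valid d.
Hypothesis Eperm : forall mu L L', perm_eq L L' -> E mu L = E mu L'.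
Hypothesis Erel : forall mu d L, valid d -> valids L ->
  Good (E mu (d :: L) - d.2%:C *: E (mu + d.1) (d :: L) - E mu L).
Hypothesis valid_unit : forall d, valid d -> 0 < d.2.
Hypothesis latD : forall mu d, valid d -> lat mu -> lat (mu + d.1).
Hypothesis latB : forall mu d, valid d -> lat mu -> lat (mu - d.1).

Lemma valids_perm L L' : perm_eq L L' -> valids L -> valids L'.
Proof. by move=> p vL d; rewrite -(perm_mem p); apply: vL. Qed.

Lemma valids_cons d L : valid d -> valids L -> valids (d :: L).
Proof. by move=> vd vL x; rewrite inE => /orP[/eqP -> //|]; apply: vL. Qed.

Lemma valids_cat L L' : valids (L ++ L') <-> valids L /\ valids L'.
Proof.
split=> [v|[v v'] d]; last by rewrite mem_cat => /orP[/v|/v'].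
by split=> d dL; apply: v; rewrite mem_cat dL ?orbT.
Qed.

Definition allGood L := forall mu, lat mu -> zonotope L mu -> Good (E mu L).

Lemma allGood_perm L L' : perm_eq L L' -> allGood L -> allGood L'.
Proof.
by move=> p gL mu lm z; rewrite -(Eperm mu p); apply: gL => //; apply: zonotope_perm z; rewrite perm_sym.
Qed.

Section Walk.
Variables (eps : block -> bool) (w : seq (R * block)) (L' : seq block) (mu' : 'rV[R]_r).

Definition sg (x : R * block) : R := if eps x.2 then 1 else -1.
(** Let every coordinate of the circuit move at unit speed, up or down according to [eps]. By
    [w_rel] the point itself does not move; [tau x] is the time at which the coordinate of [x]
    reaches 1 or 0. *)
Definition tau (x : R * block) : R := if eps x.2 then 1 - x.1 else x.1.

Hypothesis w_unit : unit_coef w.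
Hypothesis w_sorted : pairwise (fun x y => tau x <= tau y) w.
Hypothesis w_rel : \sum_(x <- w) sg x *: x.2.1 = 0.
Hypothesis zL' : zonotope L' mu'.
Hypothesis vw : valids [seq x.2 | x <- w].
Hypothesis vL' : valids L'.
Hypothesis lat0 : lat (zsum w + mu').

(** The point after the coordinates in [w1] have reached the boundary and jumped to its other side:
    a coordinate that arrives at 1 restarts at 0, and conversely. *)
Definition walk_at (w1 : seq (R * block)) := zsum w + mu' - \sum_(x <- w1) sg x *: x.2.1.
Definition walk_low w1 (x : R * block) := walk_at w1 - (if eps x.2 then x.2.1 else 0).
Definition blocks (w1 : seq (R * block)) := [seq x.2 | x <- w1] ++ L'.

Lemma tau_unit x : x \in w -> 0 <= tau x <= 1.
Proof.
move=> xw; have := allP w_unit x xw; rewrite /tau.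
by case: (eps _) => /andP[h1 h2]; apply/andP; split; lra.
Qed.

(** Read the coordinates at the time [tau x]. Those of [w1] have already jumped, those of [w2] have
    not yet reached the boundary, so all are in [0, 1] by the order of the times; that of [x] is 0
    after the correction in [walk_low], so [x] can be left out. *)
Lemma walk_zonotope w1 x w2 : w = w1 ++ x :: w2 -> zonotope (blocks (w1 ++ w2)) (walk_low w1 x).
Proof.
move=> wE; pose th (y : R * block) := if eps y.2 then tau x - tau y else tau y - tau x.
pose o (y : R * block) : R := if eps y.2 then 0 else 1; pose o' (y : R * block) : R := if eps y.2 then 1 else 0.
have -> : walk_low w1 x =
    zsum [seq (th y + o y, y.2) | y <- w1] + zsum [seq (th y + o' y, y.2) | y <- w2] + mu'.
  have Z : zsum w = zsum w + tau x *: (\sum_(y <- w) sg y *: y.2.1) by rewrite w_rel scaler0 addr0.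
  rewrite /walk_low /walk_at Z.
  rewrite /zsum wE !big_cat !big_cons /= !big_map.
  have Ex : x.1 *: x.2.1 + tau x *: (sg x *: x.2.1) = (if eps x.2 then x.2.1 else 0).
    rewrite scalerA -scalerDl /tau /sg; case: (eps _); last by rewrite mulrN1 subrr scale0r.
    by rewrite mulr1 addrC subrK scale1r.
  have E1 : \sum_(y <- w1) (th y + o y) *: y.2.1 = \sum_(y <- w1) y.1 *: y.2.1 +
      tau x *: (\sum_(y <- w1) sg y *: y.2.1) - \sum_(y <- w1) sg y *: y.2.1.
    rewrite scaler_sumr -big_split -sumrB /=; apply: eq_bigr => y _.
    rewrite scalerA -scalerDl -scalerBl; congr (_ *: _); rewrite /th /o /tau /sg.
    by case: (eps y.2); ring.
  have E2 : \sum_(y <- w2) (th y + o' y) *: y.2.1 = \sum_(y <- w2) y.1 *: y.2.1 +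
      tau x *: (\sum_(y <- w2) sg y *: y.2.1).
    rewrite scaler_sumr -big_split /=; apply: eq_bigr => y _.
    rewrite scalerA -scalerDl; congr (_ *: _); rewrite /th /o' /tau /sg.
    by case: (eps y.2); ring.
  rewrite E1 E2 !scalerDr -Ex.
  set A := \sum_(y <- w1) y.1 *: _; set A' := \sum_(y <- w2) y.1 *: _.
  set B := \sum_(y <- w1) sg y *: _; set B' := \sum_(y <- w2) sg y *: _.
  set X := x.1 *: _; set X' := tau x *: (sg x *: _).
  move: (tau x *: B) (tau x *: B') => {E1 E2 Ex} TB TB'; clearbody A A' B B' X X'.
  apply/eqP; rewrite -subr_eq0; apply/eqP/rowP => k; rewrite !mxE; ring.
have [s [ps us E']] := zL'.
exists ([seq (th y + o y, y.2) | y <- w1] ++ [seq (th y + o' y, y.2) | y <- w2] ++ s); split.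
- rewrite !map_cat -!map_comp /blocks map_cat -catA.
  rewrite (eq_map (g := fun x => x.2)) // (eq_map (g := fun x => x.2)) //.
  by rewrite !perm_cat2l.
- move: w_sorted; rewrite wE pairwise_cat /= => /and3P[/allrelP a12 _ /andP[/allP a2 _]].
  have xw : x \in w by rewrite wE mem_cat mem_head orbT.
  have tx := tau_unit xw; move: us; rewrite /unit_coef => us; rewrite !all_cat us andbT !all_map; apply/andP; split.
    apply/allP => y yw /=; have ty : 0 <= tau y <= 1 by apply: tau_unit; rewrite wE mem_cat yw.
    have := a12 y x yw (mem_head _ _); move: tx ty; rewrite /th /o.
    by case: (eps _) => /andP[? ?] /andP[? ?] ?; apply/andP; split; lra.
  apply/allP => y yw /=; have ty : 0 <= tau y <= 1.
    by apply: tau_unit; rewrite wE mem_cat inE yw !orbT.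
  have := a2 y yw; move: tx ty; rewrite /th /o'.
  by case: (eps _) => /andP[? ?] /andP[? ?] ?; apply/andP; split; lra.
by rewrite E' /zsum !big_cat /= addrA.
Qed.

Lemma lat_walk w1 w2 : w = w1 ++ w2 -> lat (walk_at w1).
Proof.
elim/last_ind: w1 w2 => [|w1 x IH] w2 wE; first by rewrite /walk_at big_nil subr0.
have := IH (x :: w2); rewrite -cat_rcons => /(_ wE) l1.
have vx : valid x.2 by apply/vw/map_f; rewrite wE mem_cat mem_rcons mem_head.
have -> : walk_at (rcons w1 x) = walk_at w1 - sg x *: x.2.1.
  by rewrite /walk_at -cats1 big_cat big_seq1 opprD addrA.
rewrite /sg; case: (eps _); first by rewrite scale1r; apply: latB.
by rewrite scaleN1r opprK; apply: latD.
Qed.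

Lemma lat_walk_low w1 x w2 : w = w1 ++ x :: w2 -> lat (walk_low w1 x).
Proof.
move=> wE; have l1 := lat_walk wE; rewrite /walk_low; case: (eps _); last by rewrite subr0.
by apply: latB => //; apply/vw/map_f; rewrite wE mem_cat mem_head orbT.
Qed.

Definition kap (w1 : seq (R * block)) : R := \prod_(x <- w1) (if eps x.2 then x.2.2 else x.2.2^-1).

Definition low_coef (x : R * block) : C := if eps x.2 then 1 else - x.2.2%:C^-1.

(** [Erel] at the point [walk_low w1 x]. It is used as it stands when the coordinate jumps down, and
    divided by [- x.2.2] when it jumps up. *)
Lemma walk_step w1 x w2 : w = w1 ++ x :: w2 ->
  Good (E (walk_at (rcons w1 x)) (blocks w) -
    (if eps x.2 then x.2.2 else x.2.2^-1)%:C *: E (walk_at w1) (blocks w) -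
    low_coef x *: E (walk_low w1 x) (blocks (w1 ++ w2))).
Proof.
move=> wE; have vx : valid x.2 by apply/vw/map_f; rewrite wE mem_cat mem_head orbT.
have pw : perm_eq (blocks w) (x.2 :: blocks (w1 ++ w2)).
  by rewrite /blocks wE !map_cat /= -!catA perm_sym -cat1s perm_catCA.
have vr : valids (blocks (w1 ++ w2)).
  apply/valids_cat; split=> // d; rewrite map_cat mem_cat => dw; apply: vw.
  by rewrite wE map_cat mem_cat inE; case/orP: dw => ->; rewrite ?orbT.
have wat : walk_at (rcons w1 x) = walk_at w1 - sg x *: x.2.1.
  by rewrite /walk_at -cats1 big_cat big_seq1 opprD addrA.
have u0 : x.2.2%:C != 0 :> C.
  by rewrite -(rmorph0 (real_complex R)) (inj_eq (@complexI R)) gt_eqF ?valid_unit.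
have := Erel (walk_low w1 x) vx vr.
rewrite !(Eperm _ pw) wat /walk_low /low_coef /sg; case: (eps x.2).
  by rewrite scale1r subrK scale1r.
move/(GoodZ (- x.2.2%:C^-1)); rewrite subr0 scaleN1r opprK.
rewrite !scalerBr !scaleNr scalerA mulVf // scale1r opprK addrC [in X in _ -> X]addrC.
by rewrite fmorphV [E (walk_at w1 + x.2.1) _ - _]addrC.
Qed.

Lemma walk w2 w1 : w = w1 ++ w2 ->
  (forall a x b, w2 = a ++ x :: b ->
    Good (E (walk_low (w1 ++ a) x) (blocks ((w1 ++ a) ++ b)))) ->
  Good (E (walk_at w) (blocks w) - (kap w2)%:C *: E (walk_at w1) (blocks w)).
Proof.
elim: w2 w1 => [|x w2 IH] w1 wE H.
  by rewrite cats0 in wE; rewrite -wE /kap big_nil scale1r subrr.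
have wE' : w = rcons w1 x ++ w2 by rewrite cat_rcons.
have H0 := H [::] x w2 erefl; rewrite cats0 in H0.
have H1 := Good_diff (GoodZ (low_coef x) H0) (walk_step wE).
have {}IH := IH (rcons w1 x) wE' _.
have /IH {}IH : forall a y b, w2 = a ++ y :: b ->
    Good (E (walk_low (rcons w1 x ++ a) y) (blocks ((rcons w1 x ++ a) ++ b))).
  by move=> a y b E2; rewrite cat_rcons; apply: H; rewrite E2.
have := GoodD IH (GoodZ (kap w2)%:C H1).
by rewrite scalerBr scalerA -rmorphM /= addrA subrK /kap big_cons [X in _ -> Good (_ - X%:C *: _)]mulrC.
Qed.

Lemma walk_end : walk_at w = zsum w + mu'.
Proof. by rewrite /walk_at w_rel subr0. Qed.

End Walk.

(* The circuit [w] is cut where a coordinate of the moving point reaches the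
   boundary; sorting by these times keeps all the points in the zonotope. *)
Lemma walk_pair (eps : block -> bool) (w : seq (R * block)) L' mu' :
  unit_coef w -> pairwise (fun x y => tau eps x <= tau eps y) w ->
  \sum_(x <- w) sg eps x *: x.2.1 = 0 -> zonotope L' mu' ->
  valids [seq x.2 | x <- w] -> valids L' -> lat (zsum w + mu') ->
  kap eps w != 1 ->
  (forall a x b, w = a ++ x :: b -> allGood ([seq y.2 | y <- a ++ b] ++ L')) ->
  Good (E (zsum w + mu') ([seq x.2 | x <- w] ++ L')).
Proof.
move=> w_unit w_sorted w_rel zL' vw vL' lat0 k1 H.
have low a x b : w = a ++ x :: b ->
    Good (E (walk_low eps w mu' ([::] ++ a) x) (blocks L' (([::] ++ a) ++ b))).
  move=> wE; apply: (H a x b wE); first exact: (lat_walk_low eps vw lat0 wE).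
  exact: (walk_zonotope w_unit w_sorted w_rel zL' wE).
have := @walk eps w L' mu' vw vL' w [::] erefl low.
rewrite (walk_end mu' w_rel) /walk_at big_nil subr0 -{1}[E _ _]scale1r -scalerBl.
by apply: GoodZ_inv; rewrite subr_eq0 eq_sym -(rmorph1 (real_complex R)) (inj_eq (@complexI R)).
Qed.

(** When the factor of the circuit is 1, the walk only shows that the terms cut off along it combine
    to a good element. The block [k], added with coordinate 0 and moving down, is cut first; the
    term cut off there is the wanted one, and all the others contain [k] and lack another block. *)
Lemma walk_first (eps : block -> bool) (k : block) (w : seq (R * block)) L' mu' :
  eps k = false ->
  unit_coef w -> pairwise (fun x y => tau eps x <= tau eps y) w ->
  \sum_(x <- (0, k) :: w) sg eps x *: x.2.1 = 0 -> zonotope L' mu' -> valid k ->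
  valids [seq x.2 | x <- w] -> valids L' -> lat (zsum w + mu') ->
  kap eps ((0, k) :: w) = 1 ->
  (forall a x b, w = a ++ x :: b -> allGood (k :: [seq y.2 | y <- a ++ b] ++ L')) ->
  Good (E (zsum w + mu') ([seq x.2 | x <- w] ++ L')).
Proof.
move=> ek w_unit w_sorted w_rel zL' vk vw vL' lat0 k1 H; set W := (0, k) :: w.
have W_unit : unit_coef W by rewrite /unit_coef /= lexx ler01.
have W_sorted : pairwise (fun x y => tau eps x <= tau eps y) W.
  rewrite /= w_sorted andbT; apply/allP => x xw.
  by rewrite {1}/tau ek; have /andP[] := tau_unit eps w_unit xw.
have zW : zsum W = zsum w by rewrite /zsum big_cons scale0r add0r.
have vW : valids [seq x.2 | x <- W] by apply: valids_cons.
have latW : lat (zsum W + mu') by rewrite zW.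
have step := @walk_step eps W L' mu' vW vL' [::] (0, k) w erefl.
have low0 : walk_low eps W mu' [::] (0, k) = zsum w + mu'.
  by rewrite /walk_low /walk_at ek big_nil zW !subr0.
rewrite low0 in step.
have low a x b : w = a ++ x :: b ->
    Good (E (walk_low eps W mu' ([:: (0, k)] ++ a) x) (blocks L' (([:: (0, k)] ++ a) ++ b))).
  move=> wE; have WE : W = ((0, k) :: a) ++ x :: b by rewrite /W wE.
  apply: (H a x b wE); first exact: (lat_walk_low eps vW latW WE).
  exact: (walk_zonotope W_unit W_sorted w_rel zL' WE).
have := @walk eps W L' mu' vW vL' w [:: (0, k)] erefl low.
rewrite (walk_end mu' w_rel) => G1.
have at0 : walk_at eps W mu' [::] = zsum W + mu' by rewrite /walk_at big_nil subr0.
rewrite at0 /= in step.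
have := GoodD G1 (GoodZ (kap eps w)%:C step).
rewrite !scalerBr !scalerA -rmorphM /=.
have -> : kap eps w * (if eps k then k.2 else k.2^-1) = 1 by rewrite mulrC -k1 /kap big_cons.
have alg (X Y Z : V) : X - Y + (Y - X - Z) = - Z.
  by rewrite addrA -[X - Y]opprB addNr add0r.
rewrite scale1r alg => /GoodN; rewrite opprK; apply: GoodZ_inv.
rewrite /low_coef ek mulf_neq0 // ?oppr_eq0 ?invr_eq0 -(rmorph0 (real_complex R)) (inj_eq (@complexI R)).
  apply/eqP => k0; move/eqP: k1; rewrite /kap big_cons -/(kap eps w) k0 mulr0 eq_sym.
  by rewrite oner_eq0.
by rewrite gt_eqF // valid_unit.
Qed.

Definition scale_block (n : nat) (d : block) : block := (d.1 *+ n, d.2 ^+ n).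

Hypothesis valid_scale : forall n d, (0 < n)%N -> valid d -> valid (scale_block n d).

(* [1 / (1 - X) = (1 + X + ... + X ^ (n - 1)) / (1 - X ^ n)] *)
Lemma allGood_scale n d L : (0 < n)%N -> valid d -> valids L ->
  allGood (scale_block n d :: L) -> allGood (d :: L).
Proof.
move=> n0 vd vL G mu lmu /zonotope_consP[t /andP[t0 t1] z].
have vnd : valid (scale_block n d) by apply: valid_scale.
have latn k : lat (mu + d.1 *+ k).
  by elim: k => [|k IH]; rewrite ?mulr0n ?addr0 // mulrSr addrA; apply: latD.
pose A k := E (mu + d.1 *+ k) (d :: scale_block n d :: L).
have nR : 0 < n%:R :> R by rewrite ltr0n.
have step k : (k < n)%N -> Good (A k - d.2%:C *: A k.+1).
  move=> kn; have := Erel (mu + d.1 *+ k) vd (valids_cons vnd vL).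
  rewrite -[mu + _ + d.1]addrA -mulrSr -/(A k) -/(A k.+1) => Gr.
  apply: Good_diff _ (_ : Good (A k - d.2%:C *: A k.+1 - E (mu + d.1 *+ k) (scale_block n d :: L))) => //.
  apply: G; first exact: latn.
  (* In units of the long block the coordinate is [(t + k) / n], which stays in [0, 1] because
     [k < n]. *)
  have -> : mu + d.1 *+ k = ((t + k%:R) / n%:R) *: (scale_block n d).1 + (mu - t *: d.1).
    rewrite /= -[d.1 *+ n]scaler_nat scalerA mulfVK ?gt_eqF // scalerDl scaler_nat.
    by rewrite [t *: _ + _]addrC -addrA [t *: _ + _]addrC subrK addrC.
  apply: zonotope_cons => //; apply/andP; split.
    by rewrite divr_ge0 ?addr_ge0 ?ler0n.
  rewrite ler_pdivrMr // mul1r; apply: le_trans (_ : 1 + k%:R <= _); first by rewrite lerD2r.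
  by rewrite nat1r ler_nat.
have tele k : (k <= n)%N -> Good (A 0%N - (d.2 ^+ k)%:C *: A k).
  elim: k => [|k IH] kn; first by rewrite expr0 scale1r subrr.
  have := GoodD (IH (ltnW kn)) (GoodZ (d.2 ^+ k)%:C (step k kn)).
  by rewrite scalerBr scalerA -rmorphM /= -exprSr addrA subrK.
have := Erel mu vnd (valids_cons vd vL).
have sw nu : E nu (scale_block n d :: d :: L) = E nu (d :: scale_block n d :: L).
  by apply: Eperm; rewrite -cat1s -[d :: scale_block n d :: L]cat1s (perm_catCA [:: _] [:: _]).
rewrite !sw /= -[mu in E mu (d :: _)]addr0 -(mulr0n d.1) -/(A 0%N) -/(A n) => Gr.
by have := GoodB (tele n (leqnn n)) Gr; rewrite opprB addrC subrK.
Qed.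

Lemma allGood_rescale (h : block -> nat) L L' : (forall d, 0 < h d)%N -> valids L -> valids L' ->
  allGood ([seq scale_block (h d) d | d <- L] ++ L') -> allGood (L ++ L').
Proof.
move=> h0; elim: L L' => // d L IH L' vL vL' G.
have vd : valid d by apply: vL; rewrite mem_head.
have {}vL : valids L by move=> x xL; apply: vL; rewrite inE xL orbT.
apply: (@allGood_scale (h d) d (L ++ L')) => //; first by apply/valids_cat.
have pm (X Y : seq block) (x : block) : perm_eq (X ++ x :: Y) (x :: X ++ Y).
  by rewrite -cat1s perm_catCA.
apply: allGood_perm (pm _ _ _) _; apply: IH => //; first exact: valids_cons (valid_scale (h0 d) vd) vL'.
by apply: allGood_perm G; rewrite perm_sym pm.
Qed.

Section Circuit.
Variables (D K : seq block).
Hypothesis vD : valids D.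
Hypothesis KD : {subset K <= D}.
Hypothesis K_uniq : uniq K.
Hypothesis Hlow : forall L, {subset L <= D} -> ~~ all (mem L) K -> allGood L.

Definition sgb (eps : block -> bool) (k : block) : R := if eps k then 1 else -1.
Definition kapb (eps : block -> bool) (ks : seq block) : R :=
  \prod_(k <- ks) (if eps k then k.2 else k.2^-1).

Lemma valids_sub L : {subset L <= D} -> valids L.
Proof. by move=> LD d /LD; apply: vD. Qed.

Lemma zonotope_cat (ks ks' : seq block) mu : zonotope (ks ++ ks') mu ->
  exists s s', [/\ [seq x.2 | x <- s] = ks, [seq x.2 | x <- s'] = ks',
    unit_coef s, unit_coef s' & mu = zsum s + zsum s'].
Proof.
case/zonotopeP=> s [sE us ->]; exists (take (size ks) s), (drop (size ks) s).
move: us; rewrite /unit_coef -{1}(cat_take_drop (size ks) s) all_cat => /andP[u u'].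
split=> //.
- by rewrite map_take sE take_size_cat.
- by rewrite map_drop sE drop_size_cat.
by rewrite /zsum -big_cat cat_take_drop.
Qed.

Definition by_time (eps : block -> bool) (s : seq (R * block)) :=
  sort (fun x y => tau eps x <= tau eps y) s.

Lemma by_time_sorted eps s : pairwise (fun x y => tau eps x <= tau eps y) (by_time eps s).
Proof.
rewrite -sorted_pairwise; first by apply: sort_sorted => x y; apply: le_total.
by move=> y x z; apply: le_trans.
Qed.

Lemma by_time_perm eps s : perm_eq (by_time eps s) s.
Proof. exact: permEl (perm_sort _ _). Qed.

Lemma sum_map_snd (F : block -> 'rV[R]_r) (s : seq (R * block)) :
  \sum_(x <- s) F x.2 = \sum_(k <- [seq x.2 | x <- s]) F k.
Proof. by rewrite big_map. Qed.

(* Going around the circuit multiplies the term by [kapb eps K], up to terms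
   with fewer blocks. *)
Lemma circuit_neq1 eps : \sum_(k <- K) sgb eps k *: k.1 = 0 -> kapb eps K != 1 ->
  forall L, {subset L <= D} -> allGood L.
Proof.
move=> rel k1 L; have [n] := ubnP (size L); elim: n L => // n IH L Ln LD.
have [/allP KL|nKL] := boolP (all (mem L) K); last exact: Hlow.
have [L' pL] := uniq_sub_perm K_uniq KL.
move=> mu lmu /(zonotope_perm pL) /zonotope_cat[s [s' [sK sL' us us' muE]]].
rewrite (Eperm _ pL) muE; set w := by_time eps s; have pw : perm_eq w s := by_time_perm eps s.
have pwK : perm_eq [seq x.2 | x <- w] K by rewrite -sK perm_map.
have zw : zsum s = zsum w by apply: perm_big; rewrite perm_sym.
have pp : perm_eq (K ++ L') ([seq x.2 | x <- w] ++ L') by rewrite perm_cat2r perm_sym.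
rewrite (Eperm _ pp).
rewrite zw; have vK : valids K := valids_sub KD.
have vL' : valids L'.
  by apply: valids_sub => x xL'; apply: LD; rewrite (perm_mem pL) mem_cat xL' orbT.
apply: (@walk_pair eps w L' (zsum s')) => //.
- by rewrite /unit_coef (perm_all _ pw).
- exact: by_time_sorted.
- by rewrite (perm_big _ pw) /= /sg (sum_map_snd (fun k => sgb eps k *: k.1)) sK.
- by apply/zonotopeP; exists s'.
- by apply: valids_perm vK; rewrite perm_sym.
- by rewrite -zw -muE.
- move: k1; rewrite /kapb /kap -(perm_big _ pwK) /= big_map.
  by [].
move=> a x b wE; apply: IH.
  have sizeK : size K = (size a + size b).+1.
    by rewrite -(perm_size pwK) size_map wE size_cat /= addnS.
  by move: Ln; rewrite (perm_size pL) !size_cat size_map size_cat sizeK addSn ltnS.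
move=> y; rewrite mem_cat => /orP[yab|yL'].
  apply: KD; rewrite -(perm_mem pwK) wE map_cat /= mem_cat inE.
  by move: yab; rewrite map_cat mem_cat => /orP[] ->; rewrite ?orbT.
by apply: LD; rewrite (perm_mem pL) mem_cat yL' orbT.
Qed.

(* With one more block [k0], the circuit expresses a term through those where a
   block of the circuit other than [k0] was replaced by [k0]. *)
Lemma circuit_eq1 eps k0 K' : K = k0 :: K' -> eps k0 = false ->
  \sum_(k <- K) sgb eps k *: k.1 = 0 -> kapb eps K = 1 ->
  forall L, {subset L <= D} -> allGood L.
Proof.
move=> KE e0 rel k1 L; have [n] := ubnP (count (predC1 k0) L); elim: n L => // n IH L Ln LD.
have [/allP KL|nKL] := boolP (all (mem L) K); last exact: Hlow.
have [L' pL] := uniq_sub_perm K_uniq KL.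
have pL2 : perm_eq L (K' ++ k0 :: L').
  by rewrite (perm_trans pL) // KE cat_cons perm_sym -cat1s perm_catCA.
move=> mu lmu /(zonotope_perm pL2) /zonotope_cat[s [s' [sK sL' us us' muE]]].
rewrite (Eperm _ pL2) muE; set w := by_time eps s; have pw : perm_eq w s := by_time_perm eps s.
have pwK : perm_eq [seq x.2 | x <- w] K' by rewrite -sK perm_map.
have zw : zsum s = zsum w by apply: perm_big; rewrite perm_sym.
have pp : perm_eq (K' ++ k0 :: L') ([seq x.2 | x <- w] ++ k0 :: L') by rewrite perm_cat2r perm_sym.
rewrite (Eperm _ pp).
have vK : valids K := valids_sub KD; move: (vK); rewrite KE => vK0.
have vk0 : valid k0 by apply: vK0; rewrite mem_head.
have vK' : valids K' by move=> x xK'; apply: vK0; rewrite inE xK' orbT.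
have vL' : valids (k0 :: L').
  apply: valids_cons => //.
  by apply: valids_sub => x xL'; apply: LD; rewrite (perm_mem pL) mem_cat xL' orbT.
rewrite zw; apply: (@walk_first eps k0 w (k0 :: L') (zsum s')) => //.
- by rewrite /unit_coef (perm_all _ pw).
- exact: by_time_sorted.
- rewrite (sum_map_snd (fun k => sgb eps k *: k.1)) /=.
  transitivity (\sum_(k <- K) sgb eps k *: k.1); last exact: rel.
  by rewrite KE; apply: perm_big; rewrite perm_cons.
- by apply/zonotopeP; exists s'.
- by apply: valids_perm vK'; rewrite perm_sym.
- by rewrite -zw -muE.
- by rewrite -k1 /kapb KE /kap !big_cons -(perm_big _ pwK) big_map.
move=> a x b wE; have xK' : x.2 \in K'.
  by rewrite -(perm_mem pwK) wE map_cat mem_cat mem_head orbT.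
have xk0 : x.2 != k0 by apply: contraTneq xK' => ->; move: K_uniq; rewrite KE => /andP[].
apply: IH.
  have countK : count (predC1 k0) K' = (count (predC1 k0) [seq y.2 | y <- a ++ b]).+1.
    have /seq.permP/(_ (predC1 k0)) <- := pwK; by rewrite wE !map_cat /= !count_cat /= xk0 add1n addnS.
  by move: Ln; have /seq.permP/(_ (predC1 k0)) -> := pL2; rewrite count_cat countK /= eqxx count_cat /= eqxx !add0n addSn ltnS.
move=> y; rewrite inE mem_cat => /orP[/eqP ->|/orP[yab|]].
- by apply: KD; rewrite KE mem_head.
- apply: KD; rewrite KE inE -(perm_mem pwK) wE map_cat /= mem_cat inE.
  by move: yab; rewrite map_cat mem_cat => /orP[] ->; rewrite ?orbT.
by move=> yL'; apply: LD; rewrite (perm_mem pL2) mem_cat yL' orbT.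
Qed.

(** In the case of factor 1 the first block has to move down. If it does not, the opposite
    orientation is taken; the relation remains true and the factor, being inverted, is still 1. *)
Lemma circuit_reduce eps : K != [::] -> \sum_(k <- K) sgb eps k *: k.1 = 0 ->
  forall L, {subset L <= D} -> allGood L.
Proof.
move=> K0 rel; have [k1|] := eqVneq (kapb eps K) 1; last exact: circuit_neq1.
case KE : K K0 => [//|k0 K'] _.
case e0 : (eps k0); last exact: (@circuit_eq1 eps k0 K').
apply: (@circuit_eq1 (fun k => ~~ eps k) k0 K'); rewrite ?e0 //.
  transitivity (- \sum_(k <- K) sgb eps k *: k.1); last by rewrite rel oppr0.
  rewrite -sumrN; apply: eq_bigr => k _; rewrite /sgb -scaleNr.
  by case: (eps k); rewrite ?opprK.
rewrite -[RHS]invr1 -k1 /kapb -prodfV; apply: eq_bigr => k _.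
by case: (eps k); rewrite ?invrK.
Qed.

End Circuit.

Hypothesis base : forall L, valids L -> free [seq d.1 | d <- undup L] -> allGood L.
Hypothesis dependent : forall D, valids D -> uniq D -> ~~ free [seq d.1 | d <- D] ->
  exists2 a : block -> int, has (fun d => a d != 0) D & \sum_(d <- D) (a d)%:~R *: d.1 = 0.

Lemma uniq_map_injP (T T' : eqType) (f : T -> T') (s : seq T) : uniq [seq f x | x <- s] ->
  {in s &, injective f}.
Proof.
elim: s => // x s IH /= /andP[fx us] y z; rewrite !inE => /orP[/eqP ->|ys] /orP[/eqP ->|zs] // fyz.
- by case/negP: fx; rewrite fyz map_f.
- by case/negP: fx; rewrite -fyz map_f.
exact: IH.
Qed.

(** Induction on the number of distinct blocks. An integer relation between dependent directions
    gets coefficients 1 and -1 after each block is replaced by its multiple; lists that lack a block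
    of the resulting circuit have fewer distinct blocks. *)
Lemma all_good L : valids L -> allGood L.
Proof.
have [n] := ubnP (size (undup L)); elim: n L => // n IH L Ln vL.
pose D := undup L; have vD : valids D by move=> d; rewrite mem_undup; apply: vL.
have [fD|nfD] := boolP (free [seq d.1 | d <- D]); first exact: base.
have [a aD rel] := dependent vD (undup_uniq L) nfD.
(* Blocks outside the relation are scaled by 1, so that every multiple is positive. *)
pose h d := if a d == 0 then 1%N else `|a d|%N.
have h0 d : (0 < h d)%N by rewrite /h; case: eqP => // /eqP; rewrite absz_gt0.
pose H d := scale_block (h d) d.
rewrite -[L]cats0; apply: (@allGood_rescale h) => //; rewrite cats0 -/H.
set L1 := [seq H d | d <- L].
have L1D : L1 =i [seq H d | d <- D].
  by move=> x; apply/mapP/mapP => -[d dL ->]; exists d => //; move: dL; rewrite mem_undup.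
have vL1 : valids L1 by move=> _ /mapP[d dL ->]; apply: valid_scale (h0 d) (vL d dL).
have size1 : (size (undup L1) <= size D)%N.
  have -> : size D = size [seq H d | d <- D] by rewrite size_map.
  by apply: uniq_leq_size (undup_uniq _) _ => x; rewrite mem_undup L1D.
(* If the scaling merges distinct blocks, the induction hypothesis applies at once; otherwise the
   scaling is injective and the signs of the relation carry over. *)
have [lt1|] := ltnP (size (undup L1)) (size D); first by apply: IH vL1; apply: leq_trans lt1 _.
move=> ge1; have uH : uniq [seq H d | d <- D].
  rewrite -[uniq _]negbK -ltn_size_undup -leqNgt size_map.
  apply: leq_trans ge1 (uniq_leq_size (undup_uniq _) _) => x.
  by rewrite !mem_undup L1D.
have injH := uniq_map_injP uH.
pose K0 := [seq d <- D | a d != 0].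
pose eps k := has (fun d => (H d == k) && (0 < a d)) K0.
have epsE d : d \in K0 -> eps (H d) = (0 < a d).
  move=> dK; apply/hasP/idP => [[d' d'K /andP[/eqP dd' a0]]|a0]; last by exists d; rewrite ?eqxx.
  by move: dK d'K; rewrite !mem_filter => /andP[_ dD] /andP[_ d'D]; rewrite -(injH _ _ d'D dD dd').
have sub1 : {subset [seq H d | d <- K0] <= undup L1}.
  move=> _ /mapP[d dK ->]; rewrite mem_undup L1D; apply: map_f.
  by move: dK; rewrite mem_filter => /andP[].
apply: (@circuit_reduce (undup L1) [seq H d | d <- K0] _ sub1 _ _ eps) => //.
- by move=> d; rewrite mem_undup; apply: vL1.
- exact: subseq_uniq (map_subseq _ (filter_subseq _ _)) uH.
- move=> M MD /allPn[k kK kM]; apply: IH; last by move=> d /MD; rewrite mem_undup; apply: vL1.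
  have lt1 : (size (undup M) < size (undup L1))%N.
    rewrite -(ltn_predK (m := 0) (n := size (undup L1))) ?ltnS; last first.
      by have := sub1 k kK; case: (undup L1).
    rewrite -(size_rem (sub1 k kK)); apply: uniq_leq_size (undup_uniq _) _ => x.
    rewrite mem_undup => xM; rewrite mem_rem_uniq ?undup_uniq // inE MD // andbT.
    by apply: contraNneq kM => <-.
  by apply: leq_trans lt1 _; apply: leq_trans size1 _.
- by rewrite -size_eq0 size_map size_filter -lt0n -has_count.
- rewrite big_map -[RHS]rel [RHS](bigID (fun d => a d != 0)) /= [X in _ = _ + X]big1 ?addr0; last first.
    by move=> d; rewrite negbK => /eqP ->; rewrite scale0r.
  rewrite -[RHS]big_filter -/K0 big_seq [RHS]big_seq; apply: eq_bigr => d dK.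
  rewrite /sgb epsE // /H /= -scaler_nat scalerA; congr (_ *: _).
  move: dK; rewrite mem_filter => /andP[ad _]; rewrite /h (negbTE ad).
  have := ltrgt0P (a d); case: ltrgt0P ad => // a0 _ _.
    by rewrite mul1r natr_absz gtr0_norm.
  by rewrite mulN1r natr_absz ltr0_norm // rmorphN opprK.
by move=> x xL; rewrite mem_undup.
Qed.

End Circuits.

(** * Character sums *)

Section LatticeQuotient.
Variables (R : realType) (r : nat).
Local Notation C := R[i].
Local Notation toR := (map_mx (intr : int -> R)).

Definition int_vec (v : 'cV[R]_r) := exists x : 'cV[int]_r, v = toR x.

Lemma int_vecM (A : 'M[int]_r) v : int_vec v -> int_vec (toR A *m v).
Proof. by move=> [x ->]; exists (A *m x); rewrite map_mxM. Qed.

Lemma geometric_root_sum (z : C) n : z ^+ n = 1 ->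
  \sum_(k < n) z ^+ k = if z == 1 then n%:R else 0.
Proof.
move=> zn; have [->|z1] := eqVneq z 1.
  by rewrite (eq_bigr (fun=> 1)) ?sumr_const ?card_ord // => k _; rewrite expr1n.
apply: (mulfI (x := z - 1)); first by rewrite subr_eq0.
by rewrite -subrX1 zn subrr mulr0.
Qed.

Definition cis (t : R) : C := cexp (0 +i* (2 * pi * t)).

Lemma cisD s t : cis (s + t) = cis s * cis t.
Proof.
by rewrite /cis -cexpD; congr cexp; apply/eqP; rewrite eq_complex /= addr0 mulrDr !eqxx.
Qed.

Lemma cis0 : cis 0 = 1.
Proof. by rewrite /cis mulr0 cexp0. Qed.

Lemma cis_sum (I : Type) (s : seq I) (F : I -> R) : cis (\sum_(x <- s) F x) = \prod_(x <- s) cis (F x).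
Proof. exact: (big_morph _ cisD cis0). Qed.

Lemma cis_natM n t : cis (n%:R * t) = cis t ^+ n.
Proof.
by elim: n => [|n IH]; rewrite ?mul0r ?cis0 // mulrS mulrDl mul1r cisD IH exprS.
Qed.

Lemma cis_eq1 t : cis t = 1 <-> t \is a Num.int.
Proof.
have p0 : 2 * pi != 0 :> R by rewrite mulf_neq0 ?pnatr_eq0 // gt_eqF ?pi_gt0.
split=> [/cexp_eq1[k /(congr1 (@complex.Im R)) /= /(mulfI p0) ->]|/intrP[k ->]]; first exact: intr_int.
exact: cexp_2pi_int.
Qed.

Lemma absz_sub_lt m n k : (m < k)%N -> (n < k)%N -> (absz (m%:Z - n%:Z) < k)%N.
Proof. by lia. Qed.

Lemma absz_mod_lt (y d : int) : d != 0 -> (absz (y %% d)%Z < absz d)%N.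
Proof. by move=> d0; have := ltz_mod y d0; have := modz_ge0 y d0; lia. Qed.

Lemma det_unit_int (A : 'M[int]_r) : A \in unitmx -> (absz (\det A)) = 1%N.
Proof. by rewrite unitmxE => /unitzPl/(congr1 absz) || rewrite unitmxE => /orP[] /eqP ->. Qed.

(** [S] represents the quotient of [N^-1 Z^r] by [Z^r]. With the Smith normal form [N = L D Q],
    representatives are [Q^-1] applied to the vectors of fractions [f_i / d_i] with
    [0 <= f_i < |d_i|], and the character sum becomes a product of geometric sums over roots of
    unity. *)
Lemma lattice_quotient (N : 'M[int]_r) : \det N != 0 -> exists S : seq 'cV[R]_r,
  [/\ uniq S, {in S, forall w, int_vec (toR N *m w)},
    forall w, int_vec (toR N *m w) -> exists2 w', w' \in S & int_vec (w - w'),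
    {in S &, forall w w', int_vec (w - w') -> w = w'} &
    forall rho : 'rV[int]_r, \sum_(w <- S) cis ((toR rho *m w) 0 0) =
      if `[< exists sigma : 'rV[int]_r, rho = sigma *m N >] then (absz (\det N))%:R else 0].
Proof.
move=> N0; have [L Lu [Q Qu [d _ NE]]] := int_Smith_normal_form N.
pose D : 'M[int]_r := \matrix_(i, j) (d`_i *+ (i == j :> nat)).
have DE : D = diag_mx (\row_i d`_i).
  apply/matrixP => i j; rewrite !mxE; case: (i =P j) => [->|/eqP ij]; first by rewrite eqxx.
  by rewrite (negbTE (ij : i != j :> nat)) // ?mulr0n.
have detN : (absz (\det N)) = (absz (\prod_(i < r) d`_i)).
  rewrite NE !det_mulmx !abszM (det_unit_int Lu) (det_unit_int Qu) mul1n muln1 -/D DE det_diag; congr absz.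
  by apply: eq_bigr => i _; rewrite mxE.
have d0 (k : 'I_r) : d`_k != 0.
  have : \prod_(i < r) d`_i != 0 by rewrite -absz_eq0 -detN absz_eq0.
  by move/prodf_neq0; apply.
have dR0 (k : 'I_r) : (d`_k)%:~R != 0 :> R by rewrite intr_eq0.
(* A common bound for all the digits, so that they live in a single finite type and the sum of
   products can be distributed. *)
pose M := (\max_(i < r) absz (d`_i)%R).+1.
have dM (k : 'I_r) : (absz (d`_k)%R < M)%N by rewrite ltnS (leq_bigmax k).
pose fam := family (fun (i : 'I_r) (j : 'I_M) => (j < absz (d`_i)%R)%N).
have famP (f : {ffun 'I_r -> 'I_M}) : reflect (forall k, (f k < absz (d`_k)%R)%N) (f \in fam) by apply: (iffP finfun.familyP) => H k; apply: (H k).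
pose frac (f : {ffun 'I_r -> 'I_M}) : 'cV[R]_r := \col_i ((f i)%:R / (d`_i)%:~R).
pose w f := toR (invmx Q) *m frac f.
have QK v : toR Q *m (toR (invmx Q) *m v) = v.
  by rewrite mulmxA -map_mxM mulmxV // map_mx1 mul1mx.
have KQ v : toR (invmx Q) *m (toR Q *m v) = v.
  by rewrite mulmxA -map_mxM mulVmx // map_mx1 mul1mx.
have LK v : toR (invmx L) *m (toR L *m v) = v.
  by rewrite mulmxA -map_mxM mulVmx // map_mx1 mul1mx.
have DR v k : (toR D *m v) k 0 = (d`_k)%:~R * v k 0.
  rewrite DE mxE (bigD1 k) //= big1 ?addr0 => [|j jk]; first by rewrite !mxE eqxx.
  by rewrite !mxE eq_sym (negbTE jk) mul0r.
have NR v : toR N *m v = toR L *m (toR D *m (toR Q *m v)) by rewrite NE !map_mxM -!mulmxA.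
have winj f g : f \in fam -> g \in fam -> int_vec (w f - w g) -> f = g.
  move=> /famP ff /famP gf /(int_vecM Q); rewrite -mulmxBr QK => -[x xE].
  apply/ffunP => k; apply/val_inj => /=.
  have := congr1 (fun v : 'cV[R]_r => v k 0) xE; rewrite !mxE -mulrBl => /eqP.
  rewrite -(inj_eq (mulIf (dR0 k))) divfK // -intrM [(f k)%:R]pmulrn [(g k)%:R]pmulrn -intrB eqr_int => /eqP E.
  have dv : (d`_k %| (f k)%:Z - (g k)%:Z)%Z by apply/dvdzP; exists (x k 0).
  have f1 := ff k; have g1 := gf k.
  apply/eqP; apply: contraT => fg; have : (absz (d`_k)%R <= absz ((f k)%:Z - (g k)%:Z)%R)%N.
    by apply: dvdn_leq; rewrite ?absz_gt0 ?subr_eq0 //; move: dv; rewrite dvdzE.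
  by rewrite leqNgt absz_sub_lt.
exists [seq w f | f <- enum fam]; split.
- rewrite map_inj_in_uniq ?enum_uniq // => f g; rewrite !mem_enum => ff gf fg.
  by apply: winj => //; rewrite fg subrr; exists 0; rewrite map_mx0.
- move=> _ /mapP[f _ ->]; rewrite NR QK; apply: int_vecM; exists (\col_i (f i)%:Z).
  by apply/matrixP => k j; rewrite ord1 DR !mxE mulrCA divff // mulr1 -pmulrn.
- move=> v [x xE]; pose y := invmx L *m x.
  pose yv k : int := y k 0.
  have yE k : (yv k)%:~R = (d`_k)%:~R * (toR Q *m v) k 0.
    by rewrite -DR -[toR D *m _]LK -NR xE -map_mxM [RHS]mxE.
  have fP k : (absz (yv k %% d`_k)%Z < M)%N.
    by apply: ltn_trans (dM k); apply: absz_mod_lt.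
  pose f : {ffun 'I_r -> 'I_M} := [ffun k => Ordinal (fP k)].
  have ff : f \in fam.
    apply/famP => k; rewrite ffunE /=.
    exact: absz_mod_lt.
  exists (w f); first by apply: map_f; rewrite mem_enum.
  rewrite -[v - w f]KQ mulmxBr QK; apply: int_vecM; exists (\col_k (yv k %/ d`_k)%Z).
  apply/matrixP => k j; rewrite ord1 !mxE ffunE /=.
  apply: (mulfI (dR0 k)); rewrite mulrBr -[_ * \sum_i _](_ : (d`_k)%:~R * (toR Q *m v) k 0 = _); last by rewrite mxE.
  rewrite -yE mulrCA divff // mulr1 {1}(divz_eq (yv k) d`_k) intrD intrM.
  rewrite [_%:R]pmulrn gez0_abs ?modz_ge0 // addrK mulrC.
  by [].
- move=> _ _ /mapP[f ff ->] /mapP[g gf ->]; move: ff gf; rewrite !mem_enum => ff gf fg.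
  by rewrite (winj f g ff gf fg).
move=> rho; pose sigma := rho *m invmx Q.
have rw f : (toR rho *m w f) 0 0 = \sum_(k < r) (f k)%:R * ((sigma 0 k)%:~R / (d`_k)%:~R).
  rewrite /w mulmxA -map_mxM -/sigma mxE; apply: eq_bigr => k _.
  by rewrite !mxE mulrCA.
rewrite big_map big_enum /=.
transitivity (\sum_(f in fam) \prod_(k < r) cis ((sigma 0 k)%:~R / (d`_k)%:~R) ^+ f k).
  by apply: eq_bigr => f _; rewrite rw cis_sum; apply: eq_bigr => k _; rewrite cis_natM.
rewrite -(bigA_distr_big_dep (fun (i : 'I_r) (j : 'I_M) => (j < absz (d`_i)%R)%N)
  (fun (i : 'I_r) (j : 'I_M) => cis ((sigma 0 i)%:~R / (d`_i)%:~R) ^+ j)).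
pose sg (k : 'I_r) : int := sigma 0 k.
have root (k : 'I_r) : \sum_(j < M | (j < absz (d`_k)%R)%N) cis ((sg k)%:~R / (d`_k)%:~R) ^+ j =
    if (d`_k %| sg k)%Z then (absz (d`_k))%:R else 0.
  rewrite -(big_ord_widen_cond _ xpredT (fun j => cis ((sg k)%:~R / (d`_k)%:~R) ^+ j)) ?(ltnW (dM k)) //.
  rewrite geometric_root_sum; last first.
    rewrite -cis_natM; apply/cis_eq1; rewrite mulrCA pmulrn abszE intr_norm normrEsign.
    by rewrite -mulrA divff // mulr1 rpredM ?intr_int // rpred_sign.
  congr (if _ then _ else _); apply/eqP/idP => [/cis_eq1/intrP[x]|/dvdzP[x ->]].
    move/(congr1 ( *%R^~ (d`_k)%:~R)); rewrite divfK // -intrM => /eqP; rewrite eqr_int => /eqP ->.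
    exact: dvdz_mull.
  by apply/cis_eq1; rewrite intrM mulfK // intr_int.
rewrite (eq_bigr _ (fun k _ => root k)).
have [dv|ndv] := pselect (forall k, (d`_k %| sg k)%Z).
  rewrite (eq_bigr (fun k : 'I_r => (absz (d`_k))%:R)) => [|k _]; last by rewrite dv.
  case: asboolP => [_|[]]; first by rewrite detN (big_morph absz abszM absz1) natr_prod.
  exists (\row_k (sg k %/ d`_k)%Z *m invmx L).
  rewrite NE !mulmxA mulmxKV // -/D DE -[LHS](mulmxKV Qu) -/sigma; congr (_ *m _).
  by apply/rowP => k; rewrite mul_mx_diag [RHS]mxE [X in X * _]mxE [X in _ * X]mxE divzK.
case: asboolP => [[tau tE]|_].
  case: ndv => k; apply/dvdzP; exists ((tau *m L) 0 k).
  by rewrite /sg /sigma tE NE !mulmxA mulmxK // -/D DE mul_mx_diag [LHS]mxE [X in _ * X]mxE.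
have [k kn] : exists k, ~~ (d`_k %| sg k)%Z.
  by apply: contrapT => H; apply: ndv => k; apply: contrapT => /negP nk; apply: H; exists k.
by rewrite (bigD1 k) //= (negbTE kn) mul0r.
Qed.

End LatticeQuotient.

(** * Residues for independent directions *)

Section Monomials.
Variables (T : eqType) (K : fieldType) (C : Type) (io : C -> K) (x : T -> K) (D : K -> Prop).
Variables (s : seq T) (c : T -> nat -> C).
Hypotheses (us : uniq s) (x0 : {in s, forall a, x a != 0}).
Hypothesis D0 : D 0.
Hypothesis DD : forall f g, D f -> D g -> D (f + g).
Hypothesis DZ : forall k f, D f -> D (io k * f).

(** Laurent monomials in the forms of a basis. [D] stands for the derivatives: modulo [D] only the
    monomial with all exponents equal to -1 survives. *)
Definition monomial (e : T -> int) : K := \prod_(a <- s) x a ^ e a.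
Hypothesis Dmono : forall e a, a \in s -> e a != -1 -> D (monomial e).

Fixpoint expand (l : seq T) (m : nat) : K :=
  if l is a :: l' then \sum_(j < m.+1) io (c a j) * (x a ^+ j * expand l' (m - j))
  else (m == 0%N)%:R.

Definition bump_at (e : T -> int) a (j : nat) : T -> int := fun b => if b == a then e b + j else e b.

Lemma monomial_bump e a j : a \in s -> x a ^+ j * monomial e = monomial (bump_at e a j).
Proof.
move=> aS; rewrite /monomial !(bigD1_seq a) //= mulrA {1}/bump_at eqxx addrC expfzDr ?x0 //.
rewrite exprnP; congr (_ * _); apply: eq_bigr => b ba.
by rewrite /bump_at (negbTE ba).
Qed.

Lemma expand_bump a l m e : a \in s -> expand (a :: l) m * monomial e =
  \sum_(j < m.+1) io (c a j) * (expand l (m - j) * monomial (bump_at e a j)).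
Proof.
move=> aS; rewrite mulr_suml; apply: eq_bigr => j _.
by rewrite -monomial_bump // -!mulrA [X in _ = _ * X]mulrCA.
Qed.

Lemma Dsum (I : Type) (r : seq I) (p : pred I) (F : I -> K) :
  (forall j, p j -> D (F j)) -> D (\sum_(j <- r | p j) F j).
Proof. by move=> H; elim/big_ind: _. Qed.

(** The expansion can only raise exponents, and only those of the elements of [l]. An exponent that
    is nonnegative, or different from -1 and no longer subject to change, never becomes -1. *)
Lemma expand_dead (l : seq T) m (e : T -> int) a : {subset l <= s} -> a \in s ->
  (0 <= e a) || ((a \notin l) && (e a != -1)) -> D (expand l m * monomial e).
Proof.
elim: l m e => [|b l IH] m e ls aS He.
  case: m => [|m]; rewrite /= ?mul0r // mul1r; apply: (Dmono aS).
  by case/orP: He => [|/andP[]//]; case: (e a).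
have bs : b \in s by apply: ls; rewrite mem_head.
have ls' : {subset l <= s} by move=> y yl; apply: ls; rewrite inE yl orbT.
rewrite expand_bump //; apply: Dsum => j _; apply: DZ; apply: IH => //.
rewrite /bump_at; case/orP: He => [e0|].
  by case: eqP => _; rewrite ?e0 // addr_ge0.
by rewrite inE negb_or => /andP[/andP[ab al] ea]; rewrite (negbTE ab) al ea orbT.
Qed.

Variable k : T -> nat.

(** To end at -1, the exponent of each [a] has to be raised by exactly [(k a).-1]; these amounts sum
    to the available degree [m]. Every other choice at [a] leaves a derivative by [expand_dead]. *)
Lemma expand_live l e m : uniq l -> {subset l <= s} ->
  {in s, forall a, a \notin l -> e a = -1} -> {in l, forall a, e a = - (k a)%:Z} ->
  {in l, forall a, (0 < k a)%N} -> m = (\sum_(a <- l) (k a).-1)%N ->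
  D (expand l m * monomial e - \prod_(a <- l) io (c a (k a).-1) * monomial (fun=> -1)).
Proof.
elim: l e m => [|a l IH] e m.
  move=> _ _ eN _ _ ->; rewrite !big_nil /= !mul1r [X in X - _](_ : _ = monomial (fun=> -1)) ?subrr //.
  by rewrite /monomial big_seq [RHS]big_seq; apply: eq_bigr => b bs; rewrite eN.
move=> /andP[al ul] ls eN ek k0 mE.
have aS : a \in s by apply: ls; rewrite mem_head.
have ls' : {subset l <= s} by move=> y yl; apply: ls; rewrite inE yl orbT.
have ka : (0 < k a)%N by apply: k0; rewrite mem_head.
rewrite expand_bump //.
have jm : ((k a).-1 < m.+1)%N by rewrite mE big_cons ltnS leq_addr.
rewrite (bigD1 (Ordinal jm)) //= big_cons -mulrA addrAC -mulrBr; apply: DD.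
  apply: DZ; apply: IH => //.
  - move=> b bs bl; rewrite /bump_at; case: eqP => [->|/eqP ba].
      by rewrite ek ?mem_head // -{1}(prednK ka) -addn1 PoszD opprD addrAC addNr add0r.
    by apply: eN => //; rewrite inE negb_or ba.
  - move=> b bl; rewrite /bump_at; case: eqP => [ba|_]; last by rewrite ek // inE bl orbT.
    by rewrite -ba bl in al.
  - by move=> b bl; apply: k0; rewrite inE bl orbT.
  - by rewrite mE big_cons addKn.
apply: Dsum => j ja; apply: DZ; apply: (expand_dead _ (a := a)) => //.
apply/orP; right; rewrite al /bump_at eqxx ek ?mem_head //=.
apply: contra ja => /eqP E; apply/eqP/val_inj => /=; move: E ka; case: (k a) => // n.
by move=> E _ /=; lia.
Qed.

End Monomials.

Lemma sum_pred_size (T : eqType) (l : seq T) (k : T -> nat) : {in l, forall a, (0 < k a)%N} ->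
  (\sum_(a <- l) k a = \sum_(a <- l) (k a).-1 + size l)%N.
Proof.
elim: l => [|a l IH] k0; first by rewrite !big_nil.
rewrite !big_cons IH => [|b bl]; last by apply: k0; rewrite inE bl orbT.
by rewrite -{1}(prednK (k0 a (mem_head _ _))) /= addSn addnS addnA.
Qed.

Section BasisResidue.
Variables (R : realType) (r : nat) (Phip : {fset 'rV[R]_r}).
Local Notation C := R[i].
Local Notation K := {fraction (mpoly r C)}.
Variable chi_c : K -> C.
Hypothesis Phip0 : 0 \notin Phip.
Hypothesis chi_comb : forall k f g, SH Phip f -> SH Phip g -> chi_c (scal k f + g) = k * chi_c f + chi_c g.
Hypothesis chi_dRH : forall f, SH Phip f -> dRH Phip f -> chi_c f = 0.
Variable s : {fset 'rV[R]_r}.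
Hypotheses (sP : (s `<=` Phip)%fset) (sb : basis_of fullv s).

Lemma dual_vector (a : 'rV[R]_r) : a \in s ->
  exists v : 'cV[C]_r, {in s, forall b, evalC b v = (b == a)%:R}.
Proof.
move=> aS; have [sr su] := basis_seq_mx sb.
have ai : (index a s < r)%N by rewrite -[X in (_ < X)%N]sr index_mem.
pose j := Ordinal ai; pose v := col j (invmx (seq_mx s)).
exists (map_mx (real_complex R) v) => b bs.
have bi : (index b s < r)%N by rewrite -[X in (_ < X)%N]sr index_mem.
have bE : b = row (Ordinal bi) (seq_mx s) by rewrite row_seq_mx /= nth_index.
rewrite /evalC -map_mxM mxE.
have -> : b *m v = row (Ordinal bi) 1%:M *m delta_mx j 0.
  by rewrite /v colE mulmxA {1}bE -row_mul mulmxV.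
rewrite -row_mul mul1mx !mxE eqxx andbT rmorph_nat; congr ((_ : bool)%:R).
apply/eqP/eqP => [/(congr1 val) /= E|ba]; last by apply/val_inj; rewrite /= ba.
by rewrite -(nth_index 0 bs) E nth_index.
Qed.

Lemma fderiv1 (v : 'cV[C]_r) : fderiv v (1 : K) = 0.
Proof. by rewrite -(rmorph1 (@FracField.tofrac _)) fderiv_tofrac pderiv1 rmorph0. Qed.

Lemma fderiv_prod0 (v : 'cV[C]_r) (l : seq 'rV[R]_r) (F : 'rV[R]_r -> K) :
  (forall a, a \in l -> fderiv v (F a) = 0) -> fderiv v (\prod_(a <- l) F a) = 0.
Proof.
elim: l => [|a l IH] H; first by rewrite big_nil fderiv1.
rewrite big_cons fderivM H ?mem_head // mul0r add0r IH ?mulr0 // => b bl.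
by apply: H; rewrite inE bl orbT.
Qed.

Lemma RH_prod (l : seq 'rV[R]_r) (F : 'rV[R]_r -> K) :
  (forall a, a \in l -> RH Phip (F a)) -> RH Phip (\prod_(a <- l) F a).
Proof.
elim: l => [|a l IH] H.
  by rewrite big_nil -(rmorph1 (@FracField.tofrac _)); apply: RH_tofrac.
rewrite big_cons; apply: RHM; first by apply: H; rewrite mem_head.
by apply: IH => b bl; apply: H; rewrite inE bl orbT.
Qed.

Local Notation lin a := (tofrac (linform a) : K).

Lemma lin_neq0 a : a \in s -> lin a != 0.
Proof.
move=> aS; rewrite tofrac_eq0 linform_eq0; apply: contraNneq Phip0 => <-.
exact: (fsubsetP sP).
Qed.

(** Integrate along the vector dual to [a]: the other forms are constant in that direction, and
    [e a + 1] can be inverted. *)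
Lemma monomial_dRH (e : 'rV[R]_r -> int) a : a \in s -> e a != -1 ->
  dRH Phip (monomial (fun a => lin a) s e).
Proof.
move=> aS ea; have [v vP] := dual_vector aS.
have ea0 : (e a + 1)%:~R != 0 :> C by rewrite intr_eq0 addr_eq0.
pose rest := \prod_(b <- s | b != a) lin b ^ e b.
have -> : monomial (fun a => lin a) s e = scal ((e a + 1)%:~R)^-1 (fderiv v (lin a ^ (e a + 1) * rest)).
  rewrite fderivM; have -> : fderiv v rest = 0.
    rewrite /rest -big_filter; apply: fderiv_prod0 => b; rewrite mem_filter => /andP[ba bs].
    rewrite fderivXz ?lin_neq0 // fderiv_tofrac pderiv_linform vP // (negbTE ba).
    by rewrite mpolyC0 rmorph0 mulr0.
  rewrite mulr0 addr0 fderivXz ?lin_neq0 // addrK fderiv_tofrac pderiv_linform vP // eqxx.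
  rewrite mpolyC1 rmorph1 mulr1 /monomial (bigD1_seq a) ?fset_uniq //=.
  rewrite -mulrA -[in RHS](_ : tofrac (mpolyC r ((e a + 1)%:~R)) = (e a + 1)%:~R); last by rewrite !rmorph_int.
  by rewrite -/(scal _ _) scal_scal mulVf // scal1.
apply: dRH_scal; apply: dRH_fderiv; apply: RHM.
  by apply: RH_linformXz; apply: (fsubsetP sP).
rewrite /rest -big_filter; apply: RH_prod => b; rewrite mem_filter => /andP[_ bs].
by apply: RH_linformXz; apply: (fsubsetP sP).
Qed.

Variables (g : 'rV[R]_r -> C -> C) (c : 'rV[R]_r -> nat -> C) (k : 'rV[R]_r -> nat).
Hypothesis gc : forall a, a \in s -> has_series (g a) (c a).

Lemma tofrac_prod_poly (l : seq 'rV[R]_r) m :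
  tofrac (prod_poly id c l m) = expand (fun k : C => tofrac (mpolyC r k) : K) (fun a => lin a) c l m.
Proof.
elim: l m => [|a l IH] m; first by rewrite /= rmorph_nat.
rewrite /= rmorph_sum; apply: eq_bigr => j _.
by rewrite -mpoly.mul_mpolyC !rmorphM rmorphXn /= IH.
Qed.

Definition poles (l : seq 'rV[R]_r) : seq 'rV[R]_r := flatten [seq nseq (k a) a | a <- l].

Lemma poles_sub l : {subset poles l <= l}.
Proof. by move=> a /flattenP[_ /mapP[b bl ->]] /nseqP[-> _]. Qed.

Lemma prod_poles (A : comNzRingType) (F : 'rV[R]_r -> A) l :
  \prod_(a <- poles l) F a = \prod_(a <- l) F a ^+ k a.
Proof.
elim: l => [|a l IH]; first by rewrite !big_nil.
rewrite /poles /= big_cat /= -/(poles l) IH big_cons; congr (_ * _).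
by elim: (k a) => [|n IHn]; rewrite ?big_nil ?expr0 //= big_cons IHn exprS.
Qed.

Lemma size_poles l : size (poles l) = (\sum_(a <- l) k a)%N.
Proof.
elim: l => [|a l IH]; first by rewrite big_nil.
by rewrite /poles /= size_cat size_nseq -/(poles l) IH big_cons.
Qed.

Definition basis_value : C := if all (fun a => 0 < k a)%N s then
  \prod_(a <- s) c a (k a).-1 * chi_c (fsigma s) else 0.

Lemma has_residue_basis F : (forall z, (forall a, a \in Phip -> evalC a z != 0) ->
    F z = \prod_(a <- s) (g a (evalC a z) / evalC a z ^+ k a)) ->
  has_residue Phip chi_c F basis_value.
Proof.
move=> FE; have sP' a : a \in s -> a \in Phip by apply: (fsubsetP sP).
have G : germ_at0 Phip F (prod_poly id c s) (poles s).
  apply: (germ_prod (f := g)) => //; first by move=> a /poles_sub /sP'.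
  move=> z zP; rewrite FE // prod_poles -big_split /= big_seq [RHS]big_seq; apply: eq_bigr => a aS.
  by rewrite divfK // expf_neq0 // zP // sP'.
have sr : size s = r by case: (basis_seq_mx sb).
have resE m : tofrac (prod_poly id c s m) / tofrac (\prod_(a <- poles s) linform a) =
    expand (fun k : C => tofrac (mpolyC r k) : K) (fun a => lin a) c s m *
    monomial (fun a => lin a) s (fun a => - (k a)%:Z).
  rewrite tofrac_prod_poly; congr (_ * _); rewrite prod_poles rmorph_prod -prodfV /monomial.
  by apply: eq_bigr => a _; rewrite rmorphXn /= -exprnN exprnP.
have D0 := @dRH0 R r Phip; have DD := @dRHD R r Phip; have DZ := @dRH_scal R r Phip.
have us := fset_uniq s.
rewrite /basis_value; case: (boolP (all _ s)) => [/allP k0|/allPn[a aS]]; last first.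
  rewrite -eqn0Ngt => /eqP ka; exists (prod_poly id c s), (poles s), 0; split=> //.
  - exact: SH0.
  - rewrite subr0 /germ_residue /ratfrac; case: ifP => _; last by rewrite rmorph0 mul0r.
    rewrite resE; have H := @expand_dead _ _ _ (fun k : C => tofrac (mpolyC r k) : K) (fun a => lin a)
      (dRH Phip) s c us lin_neq0 D0 DD DZ monomial_dRH s (size (poles s) - r)%N.
    by apply: (H _ a) => //; rewrite ka.
  - by apply: chi_dRH; [exact: SH0|].
have E := sum_pred_size k0; rewrite sr in E.
have rk : (\sum_(a <- s) k a - r = \sum_(a <- s) (k a).-1)%N by rewrite E addnK.
have rk' : (r <= \sum_(a <- s) k a)%N by rewrite E leq_addl.
exists (prod_poly id c s), (poles s), (scal (\prod_(a <- s) c a (k a).-1) (fsigma s)); split=> //.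
- by apply: SH_scal; apply: SH_fsigma.
- rewrite /germ_residue size_poles rk' /ratfrac resE rk.
  have := @expand_live _ _ _ (fun k : C => tofrac (mpolyC r k) : K) (fun a => lin a) (dRH Phip)
    s c us lin_neq0 D0 DD DZ monomial_dRH k s (fun a => - (k a)%:Z) _ us _ _ _ k0 erefl.
  rewrite -[X in _ - X]/(_ * _) => H.
  have -> : scal (\prod_(a <- s) c a (k a).-1) (fsigma s) =
      \prod_(a <- s) tofrac (mpolyC r (c a (k a).-1)) * monomial (fun a => lin a) s (fun=> -1).
    have A : tofrac (mpolyC r (\prod_(a <- s) c a (k a).-1)) =
        \prod_(a <- s) tofrac (mpolyC r (c a (k a).-1)) :> K by rewrite !rmorph_prod.
    have B : (tofrac (\prod_(a <- s) linform a))^-1 = monomial (fun a => lin a) s (fun=> -1).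
      by rewrite rmorph_prod -prodfV.
    by rewrite /scal /fsigma /ratfrac A rmorph1 mul1r B.
  by apply: H => // a aS; rewrite aS.
have := @chi_comb (\prod_(a <- s) c a (k a).-1) (fsigma s) 0 (SH_fsigma sP sb) (@SH0 R r Phip).
rewrite addr0 => ->; rewrite [chi_c 0]chi_dRH ?addr0 //; exact: SH0.
Qed.

End BasisResidue.

(** * Formal coefficients along independent directions *)

Section IndependentBlocks.
Variables (R : realType) (r : nat) (height : 'rV[R]_r -> R).
Hypothesis heightD : {morph height : x y / x + y}.
Hypothesis heightZ : forall k x, height (k *: x) = k * height x.
Local Notation block := ('rV[R]_r * R)%type.
Variables (s : seq 'rV[R]_r) (dd : 'rV[R]_r -> block) (crd : 'rV[R]_r -> 'rV[R]_r -> R).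
Hypothesis us : uniq s.
Hypothesis crdD : forall a x y, crd a (x + y) = crd a x + crd a y.
Hypothesis crdZ : forall a k x, crd a (k *: x) = k * crd a x.
Hypothesis crd_dd : {in s &, forall a b, crd a (dd b).1 = (a == b)%:R}.
Hypothesis crdE : forall x, x = \sum_(a <- s) crd a x *: (dd a).1.
Hypothesis dd_high : {in s, forall a, 1 <= height (dd a).1}.
Hypothesis dd_pos : {in s, forall a, 0 < (dd a).2}.
Implicit Types (B : seq 'rV[R]_r) (x mu : 'rV[R]_r) (m : nat) (u t : R).

Lemma crdN a x : crd a (- x) = - crd a x.
Proof. by rewrite -scaleN1r crdZ mulN1r. Qed.

Lemma crd0 a : crd a 0 = 0.
Proof. by rewrite -(scale0r 0) crdZ mul0r. Qed.

(** Coefficient of [X ^ t] in [1 / (1 - u X) ^ m], extended by 0 to real [t] that are not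
    integers. *)
Definition block_coef m u t : R :=
  if t \is a Num.int then u ^ Num.floor t * (neg_binomial m (Num.floor t))%:R else 0.

Lemma block_coef_int m u (k : int) : block_coef m u k%:~R = u ^ k * (neg_binomial m k)%:R.
Proof. by rewrite /block_coef intr_int intrKfloor. Qed.

Lemma block_coef_nint m u t : t \isn't a Num.int -> block_coef m u t = 0.
Proof. by rewrite /block_coef => /negbTE ->. Qed.

Lemma block_coef_step m u t : u != 0 ->
  block_coef m.+1 u t - u * block_coef m.+1 u (t - 1) = block_coef m u t.
Proof.
move=> u0; have [/intrP[k ->]|tn] := boolP (t \is a Num.int).
  rewrite -[k%:~R - 1](rmorphB _ k 1) !block_coef_int neg_binomial_step natrD mulrA.
  by rewrite -{2}(expr1z u) -expfzDr // [1 + _]addrC subrK; ring.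
rewrite !block_coef_nint ?mulr0 ?subr0 //; apply: contra tn => H.
by have := rpredD H (rpred1 _); rewrite subrK.
Qed.

Lemma block_coef_neg m u t : t < 0 -> block_coef m u t = 0.
Proof.
move=> t0; have [/intrP[k tk]|/block_coef_nint -> //] := boolP (t \is a Num.int).
by rewrite tk block_coef_int; move: t0; rewrite tk ltrz0; case: k {tk} => //= n _; rewrite mulr0.
Qed.

Lemma block_coef0 u t : block_coef 0 u t = (t == 0)%:R.
Proof.
have [/intrP[k ->]|tn] := boolP (t \is a Num.int).
  rewrite block_coef_int intr_eq0; case: k => [[|n]|n]; rewrite /= ?mulr0 //.
  by rewrite mulr1.
by rewrite block_coef_nint //; case: eqP tn => // ->; rewrite rpred0.
Qed.

Definition block_series B x : R := \prod_(a <- s) block_coef (count_mem a B) (dd a).2 (crd a x).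

Lemma height_crd x : height x = \sum_(a <- s) crd a x * height (dd a).1.
Proof.
have h0 : height 0 = 0 by rewrite -(scale0r 0) heightZ mul0r.
by rewrite {1}[x]crdE (big_morph _ heightD h0); apply: eq_bigr => a _; rewrite heightZ.
Qed.

Lemma block_series_nneg B : nneg_support height (block_series B).
Proof.
move=> x; rewrite height_crd => x0.
have [/hasP[a aS ca]|/hasPn H] := boolP (has (fun a => crd a x < 0) s).
  by rewrite /block_series (bigD1_seq a) //= block_coef_neg ?mul0r.
move: x0; rewrite ltNge big_seq sumr_ge0 // => a aS.
by rewrite mulr_ge0 // ?(le_trans ler01 (dd_high aS)) // leNgt H.
Qed.

(** Multiplication by [1 - u e^gamma] removes one block on both sides, by Pascal's rule on the
    right; [geom_mul_unique] concludes. *)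
Lemma tseries_independent B : {subset B <= s} ->
  tseries height [seq dd a | a <- B] =1 block_series B.
Proof.
elim: B => [_ x|b B IH BS].
  rewrite /= /block_series; have [->|x0] := eqVneq x 0.
    by rewrite big1 // => a _; rewrite crd0 block_coef0 eqxx.
  have /hasP[a aS ca] : has (fun a => crd a x != 0) s.
    apply: contraR x0 => /hasPn H; rewrite [x]crdE big_seq big1 // => a aS.
    by have := H a aS; rewrite negbK => /eqP ->; rewrite scale0r.
  by rewrite (bigD1_seq a) //= block_coef0 (negbTE ca) mul0r.
have bS : b \in s by apply: BS; rewrite mem_head.
have BS' : {subset B <= s} by move=> y yB; apply: BS; rewrite inE yB orbT.
have hB : high height [seq dd a | a <- b :: B].
  by apply/allP => _ /mapP[a aB ->]; apply/dd_high/BS.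
apply: (geom_mul_unique heightD heightZ (d := dd b)) => [||x|x].
- exact: dd_high.
- exact: (tseries_nneg heightD heightZ hB).
- exact: block_series_nneg.
rewrite (tseries_step heightD heightZ _ hB) IH // /block_series.
rewrite !(bigD1_seq b bS us) /= eqxx add1n mulrA crdD crdN crd_dd // eqxx.
rewrite -(block_coef_step (count_mem b B) (crd b x)) ?gt_eqF ?dd_pos // mulrBl.
congr (_ - _); first congr (_ * _).
  by rewrite big_seq_cond [RHS]big_seq_cond; apply: eq_bigr => a /andP[_ ab]; rewrite eq_sym (negbTE ab).
congr (_ * _ * _); rewrite big_seq_cond [RHS]big_seq_cond; apply: eq_bigr => a /andP[aS ab].
by rewrite eq_sym (negbTE ab) crdD crdN crd_dd // (negbTE ab) subr0.
Qed.

Lemma zonotope_crd B mu a : {subset B <= s} -> a \in s ->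
  zonotope [seq dd a | a <- B] mu -> 0 <= crd a mu <= (count_mem a B)%:R.
Proof.
move=> BS aS; elim: B mu BS => [|b B IH] mu BS.
  by case/zonotopeP=> -[|x s'] [] // _ _ ->; rewrite /zsum big_nil crd0 lexx.
have bS : b \in s by apply: BS; rewrite mem_head.
have BS' : {subset B <= s} by move=> y yB; apply: BS; rewrite inE yB orbT.
case/zonotope_consP=> t /andP[t0 t1] /(IH _ BS').
rewrite crdD crdN crdZ crd_dd //= natrD eq_sym; case: eqP => _ /=.
  by rewrite mulr1 => /andP[h1 h2]; apply/andP; split; lra.
by rewrite mulr0 subr0 add0r.
Qed.

End IndependentBlocks.

(** * Integer relations between lattice vectors *)

Section IntegerRelations.
Variable R : realType.

Lemma clear_denominators k (x : 'rV[rat]_k) : exists2 D : int, D != 0 &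
  exists y : 'rV[int]_k, map_mx intr y = D%:~R *: x.
Proof.
pose D := \prod_j denq (x 0 j); exists D.
  by apply/prodf_neq0 => j _; apply: denq_neq0.
exists (\row_j (numq (x 0 j) * \prod_(i | i != j) denq (x 0 i))).
apply/rowP => j; rewrite !mxE /D [in RHS](bigD1 j) //=.
rewrite !(rmorphM intr) /= -[X in _ = _ * X](divq_num_den (x 0 j)).
have d0 : (denq (x 0 j))%:~R != 0 :> rat by rewrite intr_eq0 denq_neq0.
by field.
Qed.

Lemma integer_kernel k n (A : 'M[int]_(k, n)) : ~~ row_free (map_mx (intr : int -> R) A) ->
  exists2 x : 'rV[int]_k, x != 0 & x *m A = 0.
Proof.
pose AQ : 'M[rat]_(k, n) := map_mx intr A.
have -> : map_mx (intr : int -> R) A = map_mx (ratr : rat -> R) AQ.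
  by apply/matrixP => i j; rewrite !mxE ratr_int.
rewrite row_free_map -kermx_eq0 => /rowV0Pn[v /sub_kermxP vA v0].
have [D D0 [y yE]] := clear_denominators v; exists y.
  apply: contraNneq v0 => y0; move: yE; rewrite y0 map_mx0 => /esym/eqP.
  by rewrite scaler_eq0 intr_eq0 (negbTE D0).
have : map_mx (intr : int -> rat) (y *m A) = 0.
  by rewrite map_mxM yE -scalemxAl -/AQ vA scaler0.
move/matrixP=> E; apply/matrixP => i j; have := E i j.
move: (y *m A) => W; rewrite !mxE => /eqP; rewrite intr_eq0 => /eqP //.
Qed.

(** The matrix [M] takes the vectors to integral ones. Their rank is the same over the reals as over
    the rationals, so a rational relation exists, and its denominators can be cleared. *)
Lemma integer_relation (T : eqType) n (f : T -> 'rV[R]_n) (M : 'M[R]_n) (D : seq T) :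
  M \in unitmx -> uniq D -> (forall d, d \in D -> exists y : 'rV[int]_n, f d *m M = map_mx intr y) ->
  ~~ free [seq f d | d <- D] ->
  exists2 c : T -> int, has (fun d => c d != 0) D & \sum_(d <- D) (c d)%:~R *: f d = 0.
Proof.
move=> Mu uD fM nf; have [d0|D0] := pselect (exists d0, d0 \in D); last first.
  by move: nf; case: D D0 {uD fM} => [|d D] H; rewrite ?nil_free //; case: H; exists d; rewrite mem_head.
have {d0} [d0 _] := d0.
pose k := size D; have /choice[y yP] : forall i : 'I_k, exists z : 'rV[int]_n, f (nth d0 D i) *m M = map_mx intr z.
  by move=> i; apply: fM; rewrite mem_nth.
pose A : 'M[int]_(k, n) := \matrix_i y i.
pose F : 'M[R]_(k, n) := \matrix_i f (nth d0 D i).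
have FA : F *m M = map_mx intr A.
  by apply/row_matrixP => i; rewrite row_mul rowK yP -map_row rowK.
have nF : ~~ row_free (map_mx (intr : int -> R) A).
  rewrite -FA; apply: contra nf => /row_freeP[W FW].
  have szD : size [seq f d | d <- D] = k by rewrite size_map.
  rewrite -[[seq f d | d <- D]]/(tval (in_tuple _)); apply/freeP => c c0.
  pose cr : 'rV[R]_k := \row_j c (cast_ord (esym szD) j).
  have crF : cr *m F = 0.
    rewrite mulmx_sum_row -[RHS]c0 (reindex (cast_ord szD)) /=; last first.
      by exists (cast_ord (esym szD)) => j _; rewrite ?cast_ordK ?cast_ordKV.
    apply: eq_bigr => j _; rewrite rowK mxE cast_ordK.
    by rewrite /= (nth_map d0) // -/k -[X in (_ < X)%N]szD.
  have : cr = 0 by rewrite -[cr]mulmx1 -FW !mulmxA crF !mul0mx.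
  move=> E j; have /rowP/(_ (cast_ord szD j)) := E.
  by rewrite !mxE cast_ordK.
have [x x0 xA] := integer_kernel nF.
have xF : map_mx intr x *m F = 0.
  by rewrite -[F](mulmxK Mu) FA mulmxA -map_mxM xA map_mx0 mul0mx.
pose c d := if insub (index d D) is Some i then x 0 (i : 'I_k) else 0.
have cE (i : 'I_k) : c (nth d0 D i) = x 0 i.
  by rewrite /c index_uniq ?ltn_ord // valK.
exists c.
  apply/hasP; have [i xi] : exists i, x 0 i != 0.
    apply: contrapT => H; case/negP: x0; apply/eqP/rowP => i; rewrite mxE; apply/eqP.
    by apply: contrapT => xi; apply: H; exists i; apply/negP.
  by exists (nth d0 D i); [rewrite mem_nth|rewrite cE].
rewrite (big_nth d0) big_mkord -[RHS]xF mulmx_sum_row; apply: eq_bigr => i _.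
by rewrite cE rowK mxE.
Qed.

End IntegerRelations.

Lemma addr_through (V : zmodType) (a b c : V) : a + c = a + b + (c - b).
Proof. by rewrite -addrA [b + _]addrC subrK. Qed.

(** * Points modulo the coroot lattice *)

Section ClassPoints.
Variables (R : realType) (r : nat) (Phi Delta : {fset 'rV[R]_r}) (cor : 'rV[R]_r -> 'cV[R]_r).
Hypotheses (rootsP : irreducible_root_system Phi cor) (baseP : root_base Phi Delta).
Local Notation C := R[i].
Local Notation C0 := (coroot_matrix Delta cor).
Local Notation toR := (map_mx (intr : int -> R)).
Local Notation toC := (map_mx (real_complex R)).
Local Notation twopi := (0 +i* (2 * pi) : C).

Lemma twopi_neq0 : twopi != 0.
Proof. by rewrite eq_complex /= eqxx /= mulf_neq0 ?pnatr_eq0 // gt_eqF ?pi_gt0. Qed.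

Lemma evalC_real (a : 'rV[R]_r) (v : 'cV[R]_r) : evalC a (toC v) = (pairing a v)%:C.
Proof. by rewrite /evalC /pairing -map_mxM mxE. Qed.

Lemma evalC_imag (a : 'rV[R]_r) (v : 'cV[R]_r) : evalC a (twopi *: toC v) = 0 +i* (2 * pi * pairing a v).
Proof. by rewrite evalCZ evalC_real; simpc. Qed.

Lemma evalCDr (a : 'rV[R]_r) (x y : 'cV[C]_r) : evalC a (x + y) = evalC a x + evalC a y.
Proof. by rewrite /evalC mulmxDr mxE. Qed.

Lemma evalCNr (a : 'rV[R]_r) (x : 'cV[C]_r) : evalC a (- x) = - evalC a x.
Proof. by rewrite /evalC mulmxN mxE. Qed.

Lemma evalCDl (a b : 'rV[R]_r) (x : 'cV[C]_r) : evalC (a + b) x = evalC a x + evalC b x.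
Proof. by rewrite /evalC map_mxD mulmxDl mxE. Qed.

Lemma evalCZl k (a : 'rV[R]_r) (x : 'cV[C]_r) : evalC (k *: a) x = k%:C * evalC a x.
Proof. by rewrite /evalC map_mxZ -scalemxAl mxE. Qed.

Lemma evalC0l (x : 'cV[C]_r) : evalC 0 x = 0.
Proof. by rewrite -(scale0r 0) evalCZl rmorph0 mul0r. Qed.

Lemma evalCNl (a : 'rV[R]_r) (x : 'cV[C]_r) : evalC (- a) x = - evalC a x.
Proof. by rewrite -scaleN1r evalCZl rmorphN1 mulN1r. Qed.

Lemma evalC_suml (I : Type) (s : seq I) (k : I -> R) (F : I -> 'rV[R]_r) (x : 'cV[C]_r) :
  evalC (\sum_(j <- s) k j *: F j) x = \sum_(j <- s) (k j)%:C * evalC (F j) x.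
Proof.
elim: s => [|a s IH]; first by rewrite !big_nil evalC0l.
by rewrite !big_cons evalCDl evalCZl IH.
Qed.

Lemma cexp_period (a : 'rV[R]_r) (v : 'cV[R]_r) (p : 'cV[C]_r) : pairing a v \is a Num.int ->
  cexp (evalC a (p + twopi *: toC v)) = cexp (evalC a p).
Proof. by move=> /intrP[k ak]; rewrite evalCDr cexpD evalC_imag ak cexp_2pi_int mulr1. Qed.

(** [w] gives the coordinates on the simple coroots, so that classes modulo [2 pi i] times the
    coroot lattice become classes of [w] modulo integral vectors. *)
Definition lattice_point (p0 : 'cV[C]_r) (w : 'cV[R]_r) : 'cV[C]_r := p0 + twopi *: toC (C0 *m w).

Lemma lattice_pointD p0 w w' : lattice_point p0 (w + w') = lattice_point p0 w + twopi *: toC (C0 *m w').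
Proof. by rewrite /lattice_point mulmxDr map_mxD scalerDr addrA. Qed.

Lemma lattice_point_inj p0 : injective (lattice_point p0).
Proof.
move=> w w' /addrI /(scalerI twopi_neq0) E.
have : C0 *m w = C0 *m w'.
  apply/matrixP => k l; have := congr1 (fun M : 'cV_r => M k l) E.
  by rewrite !mxE => /complexI.
by move/(congr1 (mulmx (invmx C0))); rewrite !mulKmx ?(coroot_matrix_unit rootsP baseP).
Qed.

Lemma class_mod_point p0 w p :
  class_mod Phi cor (lattice_point p0 w) p <-> exists2 w', int_vec (w' - w) & p = lattice_point p0 w'.
Proof.
split=> [[v /(coroot_latticeP rootsP baseP)[x vE] ->]|[w' [x xE] ->]].
  exists (w + toR x); first by exists x; rewrite addrAC subrr add0r.
  by rewrite lattice_pointD vE.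
exists (C0 *m toR x); first by apply/(coroot_latticeP rootsP baseP); exists x.
by rewrite -lattice_pointD -xE addrC subrK.
Qed.

Lemma class_mod_refl p : class_mod Phi cor p p.
Proof.
have := class_mod_point p 0 p; rewrite /lattice_point mulmx0 map_mx0 scaler0 addr0 => ->.
exists 0; last by rewrite mulmx0 map_mx0 scaler0 addr0.
by exists 0; rewrite subrr map_mx0.
Qed.

Lemma class_mod_inj p0 w w' :
  class_mod Phi cor (lattice_point p0 w) = class_mod Phi cor (lattice_point p0 w') -> int_vec (w - w').
Proof.
move=> E; have := class_mod_refl (lattice_point p0 w); rewrite E => /class_mod_point[w2 H].
by move/lattice_point_inj ->.
Qed.

Variables (Phip : {fset 'rV[R]_r}) (chi_c : {fraction (mpoly r C)} -> C).
Hypothesis Phip0 : 0 \notin Phip.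
Hypothesis chi_comb : forall k f g, SH Phip f -> SH Phip g -> chi_c (scal k f + g) = k * chi_c f + chi_c g.
Hypothesis chi_dRH : forall f, SH Phip f -> dRH Phip f -> chi_c f = 0.

Definition periodic (F : 'cV[C]_r -> C) :=
  forall v p, coroot_lattice Phi cor v -> F (p + twopi *: toC v) = F p.

Lemma class_residue_periodic F p v : periodic F -> has_residue Phip chi_c (fun z => F (p - z)) v ->
  class_residue Phip chi_c F (class_mod Phi cor p) = v.
Proof.
move=> Fp H; apply: (class_residueE Phip0 chi_comb chi_dRH).
case: xgetP => [p' _ [u uQ ->]|/(_ p) []]; last exact: class_mod_refl.
by apply: has_residue_ext H; exists 1 => // z _ _; rewrite addrAC Fp.
Qed.

Lemma good_periodic F p0 (S : seq 'cV[R]_r) V : periodic F ->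
  uniq S -> {in S &, forall w w', int_vec (w - w') -> w = w'} ->
  {in S, forall w, has_residue Phip chi_c (fun z => F (lattice_point p0 w - z)) (V w)} ->
  (forall p, (forall w, w \in S -> ~ class_mod Phi cor (lattice_point p0 w) p) ->
    has_residue Phip chi_c (fun z => F (p - z)) 0) ->
  good Phip chi_c Phi cor (\sum_(w <- S) V w, F).
Proof.
move=> Fp uS Sinj HV H0; split=> [p|].
  have [[w wS [v vQ pE]]|H] := pselect (exists2 w, w \in S & class_mod Phi cor (lattice_point p0 w) p).
    exists (V w); apply: has_residue_ext (HV w wS); exists 1 => // z _ _.
    by rewrite -(Fp v _ vQ) addrAC -pE.
  by exists 0; apply: H0 => w wS wp; apply: H; exists w.
pose cl w := class_mod Phi cor (lattice_point p0 w).
have clP w : w \in S -> class_residue Phip chi_c F (cl w) = V w.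
  by move=> wS; apply: class_residue_periodic => //; apply: HV.
have uc : uniq [seq cl w | w <- S].
  by rewrite map_inj_in_uniq // => w w' wS wS' /class_mod_inj; apply: Sinj.
exists [set` [seq cl w | w <- S]]%classic; split.
- exact: finite_seq.
- by move=> K /= /mapP[w _ ->]; exists (lattice_point p0 w).
- move=> _ [p ->] pS; apply: class_residue_periodic => //; apply: H0 => w wS wp; apply: pS.
  apply/mapP; exists w => //; case: wp => v vQ pE.
  apply/seteqP; split=> y [u uQ ->].
    exists (v + u); last by rewrite pE map_mxD scalerDr addrA.
    case: vQ uQ => n -> [m ->]; exists (fun a => n a + m a).
    by rewrite -big_split; apply: eq_bigr => a _; rewrite mulrzDr.
  exists (u - v); last first.
    by rewrite pE map_mxB scalerBr -addr_through.
  case: vQ uQ => n -> [m ->]; exists (fun a => m a - n a).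
  by rewrite -sumrB; apply: eq_bigr => a _; rewrite mulrzBr.
rewrite -fsbig_seq // big_map big_seq [RHS]big_seq; apply: eq_bigr => w wS /=.
by rewrite clP.
Qed.

End ClassPoints.

Lemma prod_count_mem (A : comNzRingType) (T : eqType) (s B : seq T) (f : T -> A) : uniq s -> {subset B <= s} ->
  \prod_(b <- B) f b = \prod_(a <- s) f a ^+ count_mem a B.
Proof.
move=> us; elim: B => [|b B IH] BS; first by rewrite big_nil big1.
have bS : b \in s by apply: BS; rewrite mem_head.
rewrite big_cons IH => [|y yB]; last by apply: BS; rewrite inE yB orbT.
rewrite !(bigD1_seq b bS us) /= eqxx add1n exprS mulrA; congr (_ * _).
by apply: eq_bigr => a ab; rewrite eq_sym (negbTE ab).
Qed.

Lemma natr_neq0 (F : numDomainType) n : (0 < n)%N -> n%:R != 0 :> F.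
Proof. by move=> n0; rewrite pnatr_eq0 -lt0n. Qed.

Lemma cancel_scale (F : fieldType) (A W N Y : F) : N != 0 -> Y != 0 -> A * W = N^-1 * (A * (N * Y * W)) / Y.
Proof. by move=> N0 Y0; field; rewrite N0 Y0. Qed.

Lemma geometric_factorE (F : fieldType) (u v w : F) m : (1 - u * (v * w))^-1 ^+ m = (1 - u * v * w) ^- m.
Proof. by rewrite mulrA exprVn. Qed.

Section LocalFactors.
Variable R : realType.
Local Notation C := R[i].

Definition local_factor (n m : nat) (nu x y : C) : C :=
  cexp (nu * (n%:R * y)) * (1 - x * cexp (- (n%:R * y))) ^- m.

(** If [x != 1] the factor is regular at 0. If [x = 1] it has a pole of order [m], cleared by a
    power of the Todd series in the variable [n y]; this change of variable is the origin of [n^-1]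
    in the residue. *)
Lemma local_factor_series n m (nu x : C) : (0 < n)%N -> exists gc : (C -> C) * (nat -> C),
  [/\ has_series gc.1 gc.2,
    forall y, y != 0 -> local_factor n m nu x y = gc.1 y / y ^+ (if x == 1 then m else 0) &
    x = 1 -> (0 < m)%N -> gc.2 m.-1 = n%:R^-1 * exp_residue nu m].
Proof.
move=> n0; have nC : n%:R != 0 :> C by apply: natr_neq0.
have [->|x1] := eqVneq x 1; last first.
  have H1 := has_series_scale nC (has_seriesB1 (has_seriesZ x (has_series_exp (-1 : C)))).
  have H2 := has_seriesXm m (has_seriesV H1 _).
  have H3 := has_seriesM (has_series_scale nC (has_series_exp nu)) (H2 _).
  eexists (_, _); split; [apply: H3| |by move/eqP; rewrite (negbTE x1)].
    by rewrite /exp_seq !expr0 fact0 divr1 !mul1r mulr1 subr_eq0 eq_sym.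
  by move=> y _; rewrite expr0 divr1 /= mulN1r exprVn.
have H1 := has_seriesM (has_series_exp nu) (has_seriesXm m (has_series_todd R)).
have H2 := has_seriesZ (n%:R ^- m) (has_series_scale nC H1).
eexists (_, _); split; first exact: H2.
  move=> y y0; rewrite /local_factor /= mul1r !expr_div_n exprMn.
  have nm : (n%:R : C) ^+ m != 0 by rewrite expf_neq0.
  have ym : y ^+ m != 0 by rewrite expf_neq0.
  exact: cancel_scale.
case: m {H1 H2} => // m _ _ /=; rewrite mulrA; congr (_ * _).
by rewrite exprS invfM -mulrA mulVf ?mulr1 // expf_neq0.
Qed.

End LocalFactors.

(** * Terms whose directions are multiples of roots *)

Section RootBlocks.
Variables (R : realType) (r : nat) (Phi Delta : {fset 'rV[R]_r}) (cor : 'rV[R]_r -> 'cV[R]_r).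
Hypotheses (rootsP : irreducible_root_system Phi cor) (baseP : root_base Phi Delta).
Variables (chamber : set 'rV[R]_r) (lambda : 'rV[R]_r).
Hypotheses (chamberP : big_chamber (posroots Phi Delta) chamber) (chamber_lambda : chamber lambda).
Local Notation C := R[i].
Local Notation block := ('rV[R]_r * R)%type.
Local Notation Phip := (posroots Phi Delta).
Local Notation ht := (height Delta).
Local Notation chi_c := (chi Phip (vol_box Delta cor) chamber).
Local Notation toR := (map_mx (intr : int -> R)).
Local Notation toC := (map_mx (real_complex R)).

Lemma posroots0 : 0 \notin Phip.
Proof. by apply/negP => /posroots_sub /(root_neq0 rootsP); rewrite eqxx. Qed.

Lemma posroot_height a : a \in Phip -> 1 <= ht a.
Proof.
by move=> aP; have /posrootsP[aPhi Qa] := aP; apply: (height_ge1 baseP Qa (root_neq0 rootsP aPhi)).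
Qed.

Lemma posroot_height_gt0 : {in Phip, forall a, 0 < ht a}.
Proof. by move=> a aP; apply: lt_le_trans (posroot_height aP). Qed.

Lemma lambda_nonsingular : ~ singular Phip lambda.
Proof. by have [] := chamber_nonsingular chamberP chamber_lambda. Qed.

Lemma fund_weights_unit : fund_weights Delta cor \in unitmx.
Proof. by rewrite unitmx_inv; apply: coroot_matrix_unit rootsP baseP. Qed.

Lemma chamber_coneE (s : {fset 'rV[R]_r}) : (s `<=` Phip)%fset -> basis_of fullv s ->
  (chamber `<=` cone s)%classic <-> cone s lambda.
Proof. exact: chamber_in_cone chamberP chamber_lambda. Qed.

Lemma chiD k f g : SH Phip f -> SH Phip g -> chi_c (scal k f + g) = k * chi_c f + chi_c g.
Proof.
exact: (chi_comb posroots0 (heightD Delta) (heightZ Delta) posroot_height_gt0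
  lambda_nonsingular fund_weights_unit chamber_coneE).
Qed.

Lemma chi_derivation f : SH Phip f -> dRH Phip f -> chi_c f = 0.
Proof.
exact: (chi_dRH posroots0 (heightD Delta) (heightZ Delta) posroot_height_gt0
  lambda_nonsingular fund_weights_unit chamber_coneE).
Qed.

Lemma chi_basis (s : {fset 'rV[R]_r}) : (s `<=` Phip)%fset -> basis_of fullv s ->
  chi_c (fsigma s) = if `[< cone s lambda >] then (vol_box Delta cor s)^-1%:C else 0.
Proof.
exact: (chi_fsigma posroots0 (heightD Delta) (heightZ Delta) posroot_height_gt0
  lambda_nonsingular fund_weights_unit chamber_coneE).
Qed.

Lemma vol_boxE (s : {fset 'rV[R]_r}) :
  vol_box Delta cor s = `|\det (seq_mx s)| * `|\det (coroot_matrix Delta cor)|.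
Proof.
rewrite /vol_box -/(coroot_matrix Delta cor) /fund_weights -/(coroot_matrix Delta cor) -/(seq_mx s).
by rewrite det_inv normfV invrK.
Qed.

Definition root_block (d : block) := exists a n, [/\ a \in Phip, (0 < n)%N, d.1 = a *+ n & 0 < d.2].

Definition integral_weight (mu : 'rV[R]_r) :=
  forall v, coroot_lattice Phi cor v -> pairing mu v \is a Num.int.

Definition block_fun mu (L : seq block) (p : 'cV[C]_r) : C :=
  cexp (evalC (mu - lambda) p) * \prod_(d <- L) (1 - d.2%:C * cexp (evalC d.1 p))^-1.

(** The first component is the coefficient at [lambda] of the expansion of
    [e^mu / prod_d (1 - u_d e^(gamma_d))]. The guard [high] holds for all lists of root blocks; with
    it the pair is invariant under permutation of arbitrary lists, as the reduction requires. *)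
Definition block_pair mu (L : seq block) : (C^o * ('cV[C]_r -> C^o))%type :=
  ((if high ht L then tseries ht L (lambda - mu) else 0)%:C, block_fun mu L).

Lemma root_block_high d : root_block d -> 1 <= ht d.1.
Proof.
move=> [a [n [aP n0 -> _]]]; rewrite (height_mulrn (heightZ Delta)).
by have := posroot_height aP; have : 1 <= n%:R :> R by [rewrite ler1n]; nra.
Qed.

Section Independent.
Variables (s : {fset 'rV[R]_r}) (dd : 'rV[R]_r -> block) (n : 'rV[R]_r -> nat) (B : seq 'rV[R]_r).
Hypotheses (sP : (s `<=` Phip)%fset) (sb : basis_of fullv s).
Hypothesis n_gt0 : forall a, (0 < n a)%N.
Hypothesis ddE : {in s, forall a, (dd a).1 = a *+ n a}.
Hypothesis dd_gt0 : {in s, forall a, 0 < (dd a).2}.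
Hypothesis BS : {subset B <= s}.
Variable mu : 'rV[R]_r.
Hypothesis mu_int : integral_weight mu.
Hypothesis lambda_int : integral_weight lambda.
Hypothesis mu_zono : zonotope [seq dd a | a <- B] mu.
Local Notation L := [seq dd a | a <- B].

Definition dual_basis a : 'cV[R]_r := xget 0 [set v | {in s, forall b, pairing b v = (b == a)%:R}]%classic.

Lemma dual_basisP a : a \in s -> {in s, forall b, pairing b (dual_basis a) = (b == a)%:R}.
Proof.
move=> aS; rewrite /dual_basis; case: xgetP => [v _ //|].
have [v vP] := dual_vector sb aS => /(_ (map_mx (@complex.Re R) v)) [] b bS /=.
have := vP b bS; rewrite /pairing /evalC !mxE => /(congr1 (@complex.Re R)).
rewrite raddf_sum /= => H; transitivity (complex.Re ((b == a)%:R : C)); last by case: (b == a).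
rewrite -H; apply: eq_bigr => j _; rewrite !mxE; case: (v j 0) => x y /=.
by rewrite mul0r subr0.
Qed.

Definition crd a (x : 'rV[R]_r) : R := pairing x (dual_basis a) / (n a)%:R.

Lemma crdD a x y : crd a (x + y) = crd a x + crd a y.
Proof. by rewrite /crd pairingDl mulrDl. Qed.

Lemma crdZ a k x : crd a (k *: x) = k * crd a x.
Proof. by rewrite /crd pairingZl mulrA. Qed.

Lemma nR a : (n a)%:R != 0 :> R. Proof. exact: natr_neq0. Qed.

Lemma crd_dd : {in s &, forall a b, crd a (dd b).1 = (a == b)%:R}.
Proof.
move=> a b aS bS; rewrite ddE // /crd -scaler_nat pairingZl dual_basisP // eq_sym.
by case: eqP => [->|_]; rewrite ?mulr0 ?mul0r // mulr1 divff ?nR.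
Qed.

Lemma crdE x : x = \sum_(a <- s) crd a x *: (dd a).1.
Proof.
have [l lE] := basis_coords x sb; rewrite {1}lE big_seq [RHS]big_seq; apply: eq_bigr => a aS.
rewrite ddE // -scaler_nat scalerA /crd mulfVK ?nR //; congr (_ *: _).
rewrite lE pairing_suml (bigD1_seq a) ?fset_uniq //= pairingZl dual_basisP // eqxx mulr1.
rewrite big_seq_cond big1 ?addr0 // => b /andP[bS ba].
by rewrite pairingZl dual_basisP // (negbTE ba) mulr0.
Qed.

Lemma dd_high : {in s, forall a, 1 <= ht (dd a).1}.
Proof.
move=> a aS; apply: root_block_high; exists a, (n a); split; rewrite ?ddE ?dd_gt0 //.
exact: (fsubsetP sP).
Qed.

Definition nu a := crd a (lambda - mu).
Definition mult a := count_mem a B.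

Definition base_val (p : 'cV[C]_r) a : C := (dd a).2%:C * cexp (evalC (dd a).1 p).

(** Writing [lambda - mu] in the directions of the basis distributes the exponential over the
    one-variable factors, so [block_fun] splits into a constant and one factor for each element of
    [s]. *)
Lemma block_fun_local p z : block_fun mu L (p - z) =
  cexp (evalC (mu - lambda) p) *
  \prod_(a <- s) local_factor (n a) (mult a) (nu a)%:C (base_val p a) (evalC a z).
Proof.
rewrite /block_fun evalCDr cexpD -mulrA evalCNr -evalCNl opprB; congr (_ * _).
rewrite {1}[lambda - mu]crdE evalC_suml cexp_sum big_map (prod_count_mem _ (fset_uniq s) BS).
rewrite -big_split /= big_seq [RHS]big_seq; apply: eq_bigr => a aS.
rewrite /local_factor /base_val ddE // -[a *+ n a]scaler_nat.
have E w : evalC ((n a)%:R *: a) w = (n a)%:R * evalC a w by rewrite evalCZl rmorph_nat.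
have -> : cexp (evalC ((n a)%:R *: a) (p - z)) =
    cexp (evalC ((n a)%:R *: a) p) * cexp (- ((n a)%:R * evalC a z)).
  by rewrite -cexpD; congr cexp; rewrite evalCDr evalCNr (E z).
by rewrite (E z); congr (_ * _); apply: geometric_factorE.
Qed.

Definition local_gc_spec p a (gc : (C -> C) * (nat -> C)) := [/\ has_series gc.1 gc.2,
    forall y, y != 0 -> local_factor (n a) (mult a) (nu a)%:C (base_val p a) y =
      gc.1 y / y ^+ (if base_val p a == 1 then mult a else 0) &
    base_val p a = 1 -> (0 < mult a)%N -> gc.2 (mult a).-1 = (n a)%:R^-1 * exp_residue (nu a)%:C (mult a)].

Definition residue_const : C :=
  \prod_(a <- s) ((n a)%:R^-1 * exp_residue (nu a)%:C (mult a)) * chi_c (fsigma s).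

Lemma block_residue p : has_residue Phip chi_c (fun z => block_fun mu L (p - z))
  (cexp (evalC (mu - lambda) p) *
   (if all (fun a => (base_val p a == 1) && (0 < mult a)%N) s then residue_const else 0)).
Proof.
have /choice[gc gcP] a : exists gc, local_gc_spec p a gc by apply: local_factor_series.
have H := has_residue_basis posroots0 chiD chi_derivation sP sb (g := fun a => (gc a).1)
  (c := fun a => (gc a).2) (k := fun a => if base_val p a == 1 then mult a else 0%N)
  (fun a _ => let: And3 h _ _ := gcP a in h)
  (F := fun z => \prod_(a <- s) local_factor (n a) (mult a) (nu a)%:C (base_val p a) (evalC a z)).
have {}H := has_residueZ chiD chi_derivation (cexp (evalC (mu - lambda) p)) (H _).
apply: (has_residue_ext (F := fun z => cexp (evalC (mu - lambda) p) *
  \prod_(a <- s) local_factor (n a) (mult a) (nu a)%:C (base_val p a) (evalC a z))).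
  by exists 1 => // z _ _; rewrite block_fun_local.
rewrite -[X in _ * X](_ : basis_value chi_c s (fun a => (gc a).2)
    (fun a => if base_val p a == 1 then mult a else 0%N) = _); last first.
  rewrite /basis_value; have -> : all (fun a => (base_val p a == 1) && (0 < mult a)%N) s =
      all (fun a => (0 < (if (base_val p a == 1)%R then mult a else 0))%N) s.
    by apply: eq_all => a /=; case: eqP.
  case: (boolP (all _ s)) => // /allP H1; rewrite /residue_const; congr (_ * _).
  rewrite big_seq [RHS]big_seq; apply: eq_bigr => a aS; have := H1 a aS.
  by case: eqP => // x1 m0; have [_ _ ->] := gcP a.
apply: H => z zP; rewrite big_seq [RHS]big_seq; apply: eq_bigr => a aS.
by have [_ H2 _] := gcP a; apply: H2; apply: zP; apply: (fsubsetP sP).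
Qed.

Lemma block_fun_periodic : periodic Phi cor (block_fun mu L).
Proof.
move=> v p vQ; rewrite /block_fun cexp_period; last first.
  by rewrite pairingDl pairingNl rpredD ?rpredN //; [apply: mu_int|apply: lambda_int].
congr (_ * _); rewrite !big_map big_seq [RHS]big_seq; apply: eq_bigr => a aB.
rewrite cexp_period // ddE ?BS // -scaler_nat pairingZl rpredM ?rpred_nat //.
by apply: (pairing_coroot_int rootsP _ vQ); apply/posroots_sub/(fsubsetP sP)/BS.
Qed.

Lemma block_pairE : block_pair mu L = ((block_series s dd crd B (lambda - mu))%:C, block_fun mu L).
Proof.
rewrite /block_pair ifT; last by apply/allP => _ /mapP[a aB ->]; apply: dd_high; apply: BS.
by rewrite (tseries_independent (heightD Delta) (heightZ Delta) (fset_uniq s) crdD crdZ crd_dd crdE dd_high dd_gt0 BS).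
Qed.

Lemma crd_lambda_gt0 : cone s lambda -> {in s, forall a, 0 < crd a lambda}.
Proof.
move=> cl a aS; have E : lambda = \sum_(b <- s) (crd b lambda * (n b)%:R) *: b.
  rewrite {1}[lambda]crdE big_seq [RHS]big_seq; apply: eq_bigr => b bS.
  by rewrite ddE // -scaler_nat scalerA.
have /(cone_basisE (basis_free sb) E) H := cl.
have := cone_strict lambda_nonsingular sP sb E H aS.
by rewrite pmulr_lgt0 // ltr0n.
Qed.

Lemma crd_lambda_lt0 : ~ cone s lambda -> exists2 a, a \in s & crd a lambda < 0.
Proof.
move=> ncl; have E : lambda = \sum_(b <- s) (crd b lambda * (n b)%:R) *: b.
  rewrite {1}[lambda]crdE big_seq [RHS]big_seq; apply: eq_bigr => b bS.
  by rewrite ddE // -scaler_nat scalerA.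
apply: contrapT => H; apply: ncl; apply/(cone_basisE (basis_free sb) E)/allP => a aS.
rewrite mulr_ge0 // leNgt; apply/negP => ca; apply: H; by exists a.
Qed.

Lemma crd_mu a : a \in s -> 0 <= crd a mu <= (mult a)%:R.
Proof. by move=> aS; apply: (zonotope_crd crdD crdZ crd_dd BS aS mu_zono). Qed.

Lemma nuE a : nu a = crd a lambda - crd a mu.
Proof. by rewrite /nu crdD -scaleN1r crdZ mulN1r. Qed.

Lemma good_no_residue : (forall p, has_residue Phip chi_c (fun z => block_fun mu L (p - z)) 0) ->
  block_series s dd crd B (lambda - mu) = 0 -> good Phip chi_c Phi cor (block_pair mu L).
Proof.
move=> H T0; rewrite block_pairE T0.
have := good_periodic rootsP baseP posroots0 chiD chi_derivation (p0 := 0) (S := [::]) (V := fun=> 0)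
  block_fun_periodic isT.
by rewrite big_nil; apply=> // p _.
Qed.

(** Both sides vanish: [chi] is 0 on the function of the basis, and some coordinate of [lambda] is
    negative while those of [mu] are nonnegative, so the exponent wanted in that direction is
    negative. *)
Lemma good_outside_cone : ~ cone s lambda -> good Phip chi_c Phi cor (block_pair mu L).
Proof.
move=> ncl; apply: good_no_residue => [p|].
  have := block_residue p; rewrite /residue_const chi_basis //; case: asboolP => // _.
  by rewrite mulr0 if_same mulr0.
have [a aS al] := crd_lambda_lt0 ncl; rewrite /block_series (bigD1_seq a) ?fset_uniq //=.
rewrite block_coef_neg ?mul0r // -/(nu a) nuE; have := crd_mu aS => /andP[m0 _]; lra.
Qed.

(** Both sides vanish: in a direction without blocks there is no pole, and the expansion contains
    only the exponent 0, whereas [mu] has coordinate 0 and [lambda] a positive one. *)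
Lemma good_missing a : cone s lambda -> a \in s -> mult a = 0%N ->
  good Phip chi_c Phi cor (block_pair mu L).
Proof.
move=> cl aS ma; apply: good_no_residue => [p|].
  have := block_residue p; rewrite ifF ?mulr0 //; apply/negP => /allP /(_ a aS).
  by rewrite ma andbF.
rewrite /block_series (bigD1_seq a) ?fset_uniq //= -/(mult a) ma block_coef0 -/(nu a) nuE.
have := crd_mu aS; rewrite ma => /andP[m0 m1]; have := crd_lambda_gt0 cl aS => l0.
by rewrite gt_eqF ?mul0r //; lra.
Qed.

End Independent.

End RootBlocks.

Lemma expR_intmul (R : realType) (k : int) (u : R) : 0 < u -> expR (k%:~R * ln u) = u ^ k.
Proof.
move=> u0; case: k => k; first by rewrite -pmulrn expRM_natl lnK.
by rewrite NegzE mulrNz mulNr expRN -pmulrn expRM_natl lnK // -exprnN.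
Qed.

Lemma int_mx (R : archiRealDomainType) m n (A : 'M[R]_(m, n)) : (forall i j, A i j \is a Num.int) ->
  exists N : 'M[int]_(m, n), A = map_mx intr N.
Proof.
move=> AZ; exists (map_mx Num.floor A); apply/matrixP => i j; rewrite !mxE.
by apply/esym/eqP; rewrite -intrEfloor.
Qed.

Lemma intr_mx_inj (R : numDomainType) m n : injective (fun A : 'M[int]_(m, n) => map_mx (intr : int -> R) A).
Proof.
move=> A B /matrixP E; apply/matrixP => i j; have := E i j.
by rewrite !mxE => /eqP; rewrite eqr_int => /eqP.
Qed.

Lemma cancel_index (F : fieldType) (P E n v : F) : n != 0 -> v != 0 ->
  P * (n^-1 * E * v^-1) * (n * v) = P * E.
Proof. by move=> n0 v0; field; rewrite n0 v0. Qed.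

(** * The poles of a term as a finite quotient of lattices *)

Section LatticeSum.
Variables (R : realType) (r : nat) (Phi Delta : {fset 'rV[R]_r}) (cor : 'rV[R]_r -> 'cV[R]_r).
Hypotheses (rootsP : irreducible_root_system Phi cor) (baseP : root_base Phi Delta).
Variables (chamber : set 'rV[R]_r) (lambda : 'rV[R]_r).
Hypotheses (chamberP : big_chamber (posroots Phi Delta) chamber) (chamber_lambda : chamber lambda).
Local Notation C := R[i].
Local Notation block := ('rV[R]_r * R)%type.
Local Notation Phip := (posroots Phi Delta).
Local Notation C0 := (coroot_matrix Delta cor).
Local Notation chi_c := (chi Phip (vol_box Delta cor) chamber).
Local Notation toR := (map_mx (intr : int -> R)).
Local Notation toC := (map_mx (real_complex R)).
Local Notation twopi := (0 +i* (2 * pi) : C).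
Variables (s : {fset 'rV[R]_r}) (dd : 'rV[R]_r -> block) (n : 'rV[R]_r -> nat) (B : seq 'rV[R]_r).
Hypotheses (sP : (s `<=` Phip)%fset) (sb : basis_of fullv s).
Hypothesis n_gt0 : forall a, (0 < n a)%N.
Hypothesis ddE : {in s, forall a, (dd a).1 = a *+ n a}.
Hypothesis dd_gt0 : {in s, forall a, 0 < (dd a).2}.
Hypothesis BS : {subset B <= s}.
Variable mu : 'rV[R]_r.
Hypothesis mu_int : integral_weight Phi cor mu.
Hypothesis lambda_int : integral_weight Phi cor lambda.
Hypothesis mu_zono : zonotope [seq dd a | a <- B] mu.
Local Notation L := [seq dd a | a <- B].
Local Notation nu := (nu lambda s n mu).
Local Notation mult := (mult B).
Local Notation crd := (crd s n).

Definition dir_mx : 'M[R]_r := \matrix_(i < r) (dd (enum_fset s)`_i).1.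

Lemma size_basis : size s = r. Proof. by have [] := basis_seq_mx sb. Qed.

Lemma nth_basis (i : 'I_r) : (enum_fset s)`_i \in s.
Proof. by apply: mem_nth; rewrite -[X in (_ < X)%N]/(size s) size_basis. Qed.

Lemma basis_nth a : a \in s -> exists i : 'I_r, (enum_fset s)`_i = a.
Proof.
move=> /(nthP 0) [j jr ja]; have jr' : (j < r)%N by rewrite -size_basis.
by exists (Ordinal jr').
Qed.

Lemma dir_mxE : dir_mx = diag_mx (\row_i (n (enum_fset s)`_i)%:R) *m seq_mx s.
Proof.
apply/row_matrixP => i; rewrite rowK ddE ?nth_basis // row_mul row_diag_mx -scalemxAl -rowE.
by rewrite row_seq_mx mxE scaler_nat.
Qed.

Lemma det_dir_mx : \det dir_mx = (\prod_(a <- s) (n a)%:R) * \det (seq_mx s).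
Proof.
rewrite dir_mxE det_mulmx det_diag; congr (_ * _).
rewrite (big_nth 0) big_mkord [in RHS]size_basis.
by apply: eq_bigr => i _; rewrite mxE.
Qed.

Lemma dir_mx_unit : dir_mx \in unitmx.
Proof.
have [_ su] := basis_seq_mx sb; rewrite unitmxE det_dir_mx unitrM -unitmxE su andbT unitfE.
by rewrite prodf_seq_neq0; apply/allP => a _; rewrite natr_neq0.
Qed.

Lemma dir_coroot_int : exists N : 'M[int]_r, dir_mx *m C0 = toR N.
Proof.
apply: int_mx => i j; have -> : (dir_mx *m C0) i j = (row i dir_mx *m C0) 0 j.
  by rewrite -row_mul [RHS]mxE.
rewrite mul_coroot_matrix rowK ddE ?nth_basis // -scaler_nat pairingZl rpredM ?rpred_nat //.
apply: (roots_int rootsP); last by apply/posroots_sub/(fsubsetP sP)/nth_basis.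
by apply: (base_root baseP); rewrite mem_nth // -[X in (_ < X)%N]/(size Delta) (size_base baseP).
Qed.

(** The real solution of [u e^gamma = 1] for all the directions of the basis simultaneously, that
    is, [gamma = - ln u] on each. *)
Definition real_point : 'cV[R]_r := \sum_(a <- s) (- ln (dd a).2 / (n a)%:R) *: dual_basis s a.

Lemma pairing_real_point b : b \in s -> pairing (dd b).1 real_point = - ln (dd b).2.
Proof.
move=> bS; rewrite pairing_sumr (bigD1_seq b) ?fset_uniq //= big_seq_cond big1 ?addr0 => [|a /andP[aS ab]].
  by rewrite pairingZr ddE // -[b *+ n b]scaler_nat pairingZl dual_basisP // eqxx mulr1 divfK ?natr_neq0 //.
by rewrite pairingZr ddE // -[b *+ n b]scaler_nat pairingZl dual_basisP // eq_sym (negbTE ab) !mulr0.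
Qed.

Local Notation p0 := (toC real_point).

Lemma base_val_p0 b : b \in s -> base_val dd p0 b = 1.
Proof.
move=> bS; rewrite /base_val evalC_real pairing_real_point // cexp_real expRN lnK ?posrE ?dd_gt0 //.
by rewrite -rmorphM /= divff // gt_eqF // dd_gt0.
Qed.

Lemma dd2_neq0 b : b \in s -> (dd b).2%:C != 0 :> C.
Proof. by move=> bS; rewrite -(rmorph0 (real_complex R)) (inj_eq (@complexI R)) gt_eqF ?dd_gt0. Qed.

Section Quotient.
Variable N : 'M[int]_r.
Hypothesis NE : dir_mx *m C0 = toR N.

Lemma pairing_lattice w (i : 'I_r) : pairing (dd (enum_fset s)`_i).1 (C0 *m w) = (toR N *m w) i 0.
Proof. rewrite -NE -mulmxA; have -> : (dir_mx *m (C0 *m w)) i 0 = (row i dir_mx *m (C0 *m w)) 0 0.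
  by rewrite -row_mul [RHS]mxE.
by rewrite rowK. Qed.

Lemma base_val_point w b : b \in s -> int_vec (toR N *m w) ->
  base_val dd (lattice_point Delta cor p0 w) b = 1.
Proof.
move=> bS [x xE]; rewrite -(base_val_p0 bS) /base_val; congr (_ * _).
have [i <-] := basis_nth bS; rewrite evalCDr cexpD evalC_imag pairing_lattice xE mxE.
by rewrite cexp_2pi_int mulr1.
Qed.

(** Relative to [p0], every direction takes a value in [2 pi i Z]. Hence the common poles are the
    translates of [p0] by [2 pi i] times the lattice dual to the directions, which is [N^-1 Z^r] in
    coroot coordinates. *)
Lemma base_val_all p : {in s, forall b, base_val dd p b = 1} ->
  exists2 w, int_vec (toR N *m w) & p = lattice_point Delta cor p0 w.
Proof.
move=> H; have Cu := coroot_matrix_unit rootsP baseP; have Gu := dir_mx_unit.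
have /choice[k kE] (i : 'I_r) : exists k : int, evalC (dd (enum_fset s)`_i).1 (p - p0) = 0 +i* (2 * pi * k%:~R).
  apply/cexp_eq1; rewrite evalCDr evalCNr cexpD cexpN.
  have iS := nth_basis i.
  have /(mulfI (dd2_neq0 iS)) -> : (dd (enum_fset s)`_i).2%:C * cexp (evalC (dd (enum_fset s)`_i).1 p) =
      (dd (enum_fset s)`_i).2%:C * cexp (evalC (dd (enum_fset s)`_i).1 p0).
    exact: etrans (H _ iS) (esym (base_val_p0 iS)).
  by rewrite mulfV // cexp_neq0.
pose x : 'cV[int]_r := \col_i k i; pose w := invmx C0 *m (invmx dir_mx *m toR x).
exists w; first by exists x; rewrite -NE /w -mulmxA mulKVmx // mulKVmx.
have GC : toC dir_mx *m (p - p0) = twopi *: toC (toR x).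
  apply/colP => i; have -> : (toC dir_mx *m (p - p0)) i 0 = evalC (row i dir_mx) (p - p0).
    by rewrite /evalC map_row -row_mul [RHS]mxE.
  by rewrite rowK kE !mxE; simpc.
have -> : p = p0 + (p - p0) by rewrite addrC subrK.
rewrite /lattice_point /w mulKVmx //; congr (_ + _).
rewrite map_mxM scalemxAr -GC mulmxA -map_mxM mulVmx // map_mx1 mul1mx //.
Qed.

Lemma dir_combination (x : 'rV[R]_r) : x = (\row_i crd (enum_fset s)`_i x) *m dir_mx.
Proof.
rewrite {1}(crdE sb n_gt0 ddE x) mulmx_sum_row (big_nth 0) big_mkord [in LHS]size_basis.
by apply: eq_bigr => i _; rewrite mxE rowK.
Qed.

(** Condition for the character of the poles defined by [mu - lambda] to be trivial: [lambda - mu]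
    is an integral combination of the directions, and this is also when the formal coefficient can
    be nonzero. *)
Lemma dir_lattice (rho : 'rV[int]_r) : (mu - lambda) *m C0 = toR rho ->
  (exists sigma, rho = sigma *m N) <-> {in s, forall a, nu a \is a Num.int}.
Proof.
move=> rhoE; have Cu := coroot_matrix_unit rootsP baseP; have Gu := dir_mx_unit.
have nuN a : nu a = - crd a (mu - lambda).
  by rewrite /nu -opprB -scaleN1r crdZ mulN1r.
split=> [[sigma E] a aS|H].
  have : (mu - lambda) *m C0 = toR sigma *m dir_mx *m C0.
    by rewrite -mulmxA NE -map_mxM -E.
  move/(congr1 (mulmx^~ (invmx C0))); rewrite /= !mulmxK // => {}E.
  have [i <-] := basis_nth aS; rewrite nuN rpredN.
  have := congr1 (mulmx^~ (invmx dir_mx)) E; rewrite {1}[mu - lambda]dir_combination /= !mulmxK //.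
  by move/rowP/(_ i); rewrite !mxE => ->; apply: intr_int.
have [sigma sE] : exists sigma : 'rV[int]_r, \row_i crd (enum_fset s)`_i (mu - lambda) = toR sigma.
  apply: int_mx => i j; rewrite mxE -rpredN -nuN; apply: H; exact: nth_basis.
exists sigma; apply: (@intr_mx_inj R); rewrite map_mxM -rhoE -NE -sE mulmxA.
by rewrite -dir_combination.
Qed.

(** The number of poles modulo the coroot lattice. It cancels the factors [n^-1] of the one-variable
    residues and the inverse volume in [chi]. *)
Lemma absz_detE : (absz (\det N))%:R = (\prod_(a <- s) (n a)%:R * vol_box Delta cor s)%:C :> C.
Proof.
have : (absz (\det N))%:R = \prod_(a <- s) (n a)%:R * vol_box Delta cor s :> R.
  rewrite pmulrn abszE intr_norm -det_map_mx -NE det_mulmx normrM det_dir_mx normrM vol_boxE //.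
  by rewrite mulrA ger0_norm // prodr_ge0.
by move=> <-; rewrite rmorph_nat.
Qed.

Lemma vol_box_neq0 : vol_box Delta cor s != 0.
Proof.
have [_ su] := basis_seq_mx sb; have Cu := coroot_matrix_unit rootsP baseP.
by rewrite vol_boxE // mulf_neq0 // normr_eq0 -unitfE -unitmxE.
Qed.

End Quotient.

Lemma cexp_p0 (k : 'rV[R]_r -> int) : {in s, forall a, nu a = (k a)%:~R} ->
  cexp (evalC (mu - lambda) p0) = (\prod_(a <- s) (dd a).2 ^ k a)%:C.
Proof.
move=> kE; have -> : evalC (mu - lambda) p0 = (\sum_(a <- s) nu a * ln (dd a).2)%:C.
  rewrite evalC_real; congr (_%:C).
  rewrite -opprB pairingNl {1}(crdE sb n_gt0 ddE (lambda - mu)) pairing_suml -sumrN.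
  rewrite big_seq [RHS]big_seq; apply: eq_bigr => a aS.
  by rewrite pairingZl pairing_real_point // mulrN opprK.
rewrite cexp_real expR_sum; congr (_%:C); rewrite big_seq [RHS]big_seq; apply: eq_bigr => a aS.
by rewrite kE // expR_intmul ?dd_gt0.
Qed.

(** The residues at the common poles differ only by a character of the finite quotient, so their sum
    is the index times the residue at [p0], or 0. The exponential at [p0] supplies the powers of
    [u], and [exp_residueE] the binomial coefficients of the expansion. *)
Lemma good_all_poles : cone s lambda -> {in s, forall a, (0 < mult a)%N} ->
  good Phip chi_c Phi cor (block_pair Delta lambda mu L).
Proof.
move=> cl m0; have [N NE] := dir_coroot_int.
have Cu := coroot_matrix_unit rootsP baseP; have Gu := dir_mx_unit.
have N0 : \det N != 0.
  rewrite -(intr_eq0 R) -det_map_mx -NE det_mulmx mulf_neq0 // -unitfE -unitmxE //.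
have [rho rhoE] : exists rho : 'rV[int]_r, (mu - lambda) *m C0 = toR rho.
  apply: int_mx => i j; rewrite !ord1 mul_coroot_matrix pairingDl pairingNl.
  have jD : (enum_fset Delta)`_j \in Delta.
    by rewrite mem_nth // -[X in (_ < X)%N]/(size Delta) (size_base baseP).
  have cj : coroot_lattice Phi cor (cor (enum_fset Delta)`_j).
    by apply/(coroot_latticeE rootsP baseP)/simple_coroot_span_base.
  by rewrite rpredD ?rpredN; [|apply: mu_int|apply: lambda_int].
have [S [uS SN Sex Sinj Ssum]] := lattice_quotient R N0.
pose rc := residue_const Phi Delta cor chamber lambda s n B mu.
rewrite (block_pairE rootsP baseP lambda sP sb n_gt0 ddE dd_gt0 BS).
pose V w := cexp (evalC (mu - lambda) (lattice_point Delta cor p0 w)) * rc.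
have := good_periodic rootsP baseP (posroots0 Delta rootsP) (chiD rootsP baseP chamberP chamber_lambda)
  (chi_derivation rootsP baseP chamberP chamber_lambda) (p0 := p0) (S := S) (V := V)
  (block_fun_periodic rootsP sP ddE BS mu_int lambda_int) uS Sinj.
have -> : \sum_(w <- S) V w = (block_series s dd crd B (lambda - mu))%:C.
  have Vw w : V w = cexp (evalC (mu - lambda) p0) * rc * cis ((toR rho *m w) 0 0).
    rewrite /V /lattice_point evalCDr cexpD evalC_imag /cis -rhoE -mulmxA -/(pairing _ _).
    by rewrite mulrAC.
  rewrite (eq_bigr _ (fun w _ => Vw w)) -mulr_sumr Ssum.
  case: asboolP => [/(dir_lattice NE rhoE) H|nH].
    have kE : {in s, forall a, nu a = (Num.floor (nu a))%:~R}.
      by move=> a aS; apply/esym/eqP; rewrite -intrEfloor; apply: H.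
    rewrite (cexp_p0 kE) /rc /residue_const (chi_basis rootsP baseP chamberP chamber_lambda sP sb).
    rewrite asboolT // (absz_detE NE).
    have eE : \prod_(a <- s) ((n a)%:R^-1 * exp_residue (nu a)%:C (mult a)) =
        ((\prod_(a <- s) (n a)%:R)^-1 * \prod_(a <- s) (neg_binomial (mult a) (Num.floor (nu a)))%:R)%:C :> C.
      rewrite -prodfV -big_split rmorph_prod /= big_seq [RHS]big_seq; apply: eq_bigr => a aS.
      have -> : (nu a)%:C = (Num.floor (nu a))%:~R :> C.
        by rewrite {1}(kE a aS); apply: (rmorph_int (real_complex R)).
      rewrite rmorphM /= fmorphV !rmorph_nat; congr (_ * _).
      have := m0 a aS; case mE: (mult a) => [//|m] _; apply: exp_residueE.
      (* The bound required by [exp_residueE]: the coordinate of [lambda] is strictly positive since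
         it is nonsingular, and that of [mu] is at most the multiplicity by the zonotope
         condition. *)
      rewrite -(ltr_int R) -(kE a aS) nuE.
      have := crd_lambda_gt0 chamberP chamber_lambda sP sb n_gt0 ddE cl aS.
      have /andP[_] := crd_mu sb n_gt0 ddE BS mu_zono aS; rewrite mE rmorphN /=; lra.
    have bE : block_series s dd crd B (lambda - mu) = \prod_(a <- s) (dd a).2 ^ Num.floor (nu a) *
        \prod_(a <- s) (neg_binomial (mult a) (Num.floor (nu a)))%:R.
      rewrite -big_split /block_series big_seq [RHS]big_seq; apply: eq_bigr => a aS /=.
      by rewrite -/(nu a) {1}(kE a aS) block_coef_int.
    rewrite eE bE -!rmorphM; congr (_%:C).
    have v0 := vol_box_neq0; have n0 : \prod_(a <- s) (n a)%:R != 0 :> R.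
      by rewrite prodf_seq_neq0; apply/allP => a _; rewrite natr_neq0.
    exact: cancel_index.
  have [a aS na] : exists2 a, a \in s & nu a \isn't a Num.int.
    apply: contrapT => H; apply: nH; apply/(dir_lattice NE rhoE) => a aS.
    by apply: contrapT => /negP na; apply: H; exists a.
  by rewrite mulr0 /block_series (bigD1_seq a) ?fset_uniq //= block_coef_nint // mul0r.
apply.
- move=> w wS; have := block_residue rootsP baseP chamberP chamber_lambda sP sb n_gt0 ddE BS mu (lattice_point Delta cor p0 w).
  rewrite ifT //; apply/allP => a aS.
  by rewrite (base_val_point NE aS (SN w wS)) eqxx m0.
move=> p Hp; have := block_residue rootsP baseP chamberP chamber_lambda sP sb n_gt0 ddE BS mu p.
rewrite ifF ?mulr0 //; apply/negP => /allP H.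
have [w wN pE] := base_val_all NE (p := p) (fun b bS => eqP (proj1 (andP (H b bS)))).
have [w' wS' ww] := Sex w wN; apply: (Hp w' wS').
by apply/(class_mod_point rootsP baseP); exists w.
Qed.

End LatticeSum.

Lemma mem_fset_seq (T : choiceType) (s : seq T) x : (x \in [fset y in s]%fset) = (x \in s).
Proof. by rewrite inE. Qed.

Section FreeExtension.
Variables (K : fieldType) (vT : vectType K).
Implicit Types X Y Z : seq vT.

Lemma free_extend X Y : free X -> exists Z, [/\ {subset Z <= Y}, free (X ++ Z) & <<X ++ Z>>%VS = <<X ++ Y>>%VS].
Proof.
move=> fX; elim: Y => [|y Y [Z [ZY fZ sZ]]]; first by exists [::]; rewrite cats0.
have px W : perm_eq (X ++ y :: W) (y :: X ++ W) by rewrite -cat1s perm_catCA.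
have sp W : <<X ++ y :: W>>%VS = (<[y]> + <<X ++ W>>)%VS.
  by rewrite -span_cons; apply: eq_span; apply: perm_mem.
have [yZ|yZ] := boolP (y \in <<X ++ Z>>%VS).
  exists Z; split=> //; first by move=> z /ZY zY; rewrite inE zY orbT.
  by rewrite sp -sZ; apply/esym/addv_idPr; rewrite -memvE.
exists (y :: Z); split; last by rewrite !sp sZ.
  by move=> z; rewrite !inE => /orP[->//|/ZY ->]; rewrite orbT.
by rewrite (perm_free (px Z)) free_cons yZ.
Qed.

Lemma free_unscale (T : Type) (U : seq T) (k : T -> K) (f g : T -> vT) :
  (forall x, f x = k x *: g x) -> free [seq f x | x <- U] -> free [seq g x | x <- U].
Proof.
move=> fE; rewrite /free size_map => /eqP sU; rewrite size_map eqn_leq.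
have := dim_span [seq g x | x <- U]; rewrite size_map => -> /=.
rewrite -sU dimvS //; apply/span_subvP => v.
elim: U {sU} => //= x U IH; rewrite inE span_cons => /orP[/eqP ->|/IH vU].
  by rewrite fE memvZ // (subvP (addvSl _ _)) // memv_line.
by rewrite (subvP (addvSr _ _)).
Qed.

End FreeExtension.

Section NonVanishing.
Variable R : realType.
Local Notation C := R[i].

Lemma factor_neq0_near n (x : C) : (0 < n)%N -> exists2 e : R, 0 < e &
  forall y : C, y != 0 -> cabs y < e -> 1 - x * cexp (- (n%:R * y)) != 0.
Proof.
move=> n0; have nC : n%:R != 0 :> C by apply: natr_neq0.
have nR : 0 < n%:R :> R by rewrite ltr0n.
have [->|x1] := eqVneq x 1.
  have [e e0 H] := @expm1_neq0 R; exists (e / n%:R); first by rewrite divr_gt0.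
  move=> y y0 ye; rewrite mul1r; apply: H; first by rewrite mulf_neq0.
  by rewrite cabsM cabs_nat mulrC -ltr_pdivlMr.
have H := has_series_scale nC (has_seriesB1 (has_seriesZ x (has_series_exp (-1 : C)))).
have a0 : (fun k => n%:R ^+ k * ((k == 0%N)%:R - x * exp_seq (-1) k)) 0%N != 0 :> C.
  by rewrite /exp_seq !expr0 fact0 divr1 !mul1r mulr1 subr_eq0 eq_sym.
have [e e0 He] := series_lower H a0; exists e => // y y0 ye.
have := He y y0 ye; rewrite mulN1r => Hy; apply: contraTneq Hy => ->.
by rewrite cabs0 -ltNge divr_gt0 // lt0r cabs_ge0 cabs_eq0 andbT.
Qed.

Lemma near_regular_root r (Phip : {fset 'rV[R]_r}) a (Q : C -> Prop) : a \in Phip ->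
  (exists2 e : R, 0 < e & forall y : C, y != 0 -> cabs y < e -> Q y) ->
  near_regular Phip (fun z => Q (evalC a z)).
Proof.
move=> aP [e e0 H]; pose k := \sum_i `|a 0 i| + 1.
have k0 : 0 < k by rewrite ltr_wpDl // sumr_ge0.
exists (e / k); first by rewrite divr_gt0.
move=> z ze zP; apply: H; first exact: zP.
rewrite /evalC mxE; apply: le_lt_trans (cabs_sum _ _ _) _.
apply: (@le_lt_trans _ _ (\sum_i `|a 0 i| * (e / k))).
  by apply: ler_sum => i _; rewrite mxE cabsM cabs_real ler_wpM2l // (ltW (ze i)).
rewrite -mulr_suml; apply: (@lt_le_trans _ _ (k * (e / k))).
  by rewrite ltr_pM2r ?divr_gt0 // /k ltrDl.
by rewrite mulrC mulfVK // gt_eqF.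
Qed.

End NonVanishing.

Lemma geometric_relation (F : fieldType) (A P u e : F) : 1 - u * e != 0 ->
  A * ((1 - u * e)^-1 * P) - u * (e * A * ((1 - u * e)^-1 * P)) - A * P = 0.
Proof. by move=> x0; field. Qed.

(** * Assembling the residue formula *)

Section BlockReduction.
Variables (R : realType) (r : nat) (Phi Delta : {fset 'rV[R]_r}) (cor : 'rV[R]_r -> 'cV[R]_r).
Hypotheses (rootsP : irreducible_root_system Phi cor) (baseP : root_base Phi Delta).
Variables (chamber : set 'rV[R]_r) (lambda : 'rV[R]_r).
Hypotheses (chamberP : big_chamber (posroots Phi Delta) chamber) (chamber_lambda : chamber lambda).
Hypothesis lambda_int : integral_weight Phi cor lambda.
Local Notation C := R[i].
Local Notation block := ('rV[R]_r * R)%type.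
Local Notation Phip := (posroots Phi Delta).
Local Notation ht := (height Delta).
Local Notation chi_c := (chi Phip (vol_box Delta cor) chamber).
Local Notation block_pair := (block_pair Delta lambda).
Local Notation block_fun := (block_fun lambda).
Local Notation root_block := (root_block Phi Delta).
Local Notation good := (good Phip chi_c Phi cor).

(** The roots of the distinct blocks are independent and are completed to a basis by positive roots,
    which span. The added roots occur in [s] but not in [B], so no factor of the term belongs to
    them. *)
Lemma blocks_basis L : valids root_block L -> free [seq d.1 | d <- undup L] ->
  exists (s : {fset 'rV[R]_r}) (dd : 'rV[R]_r -> block) (n : 'rV[R]_r -> nat) (B : seq 'rV[R]_r),
  [/\ (s `<=` Phip)%fset /\ basis_of fullv s, forall a, (0 < n a)%N,
    {in s, forall a, (dd a).1 = a *+ n a} /\ {in s, forall a, 0 < (dd a).2},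
    {subset B <= s} & L = [seq dd a | a <- B]].
Proof.
move=> vL fL; have /choice[f fP] (d : block) : exists x : 'rV[R]_r * nat, root_block d ->
    [/\ x.1 \in Phip, (0 < x.2)%N, d.1 = x.1 *+ x.2 & 0 < d.2].
  have [[a [n H]]|nd] := pselect (root_block d); last by exists (0, 0%N).
  by exists (a, n).
have vf d : d \in L -> [/\ (f d).1 \in Phip, (0 < (f d).2)%N, d.1 = (f d).1 *+ (f d).2 & 0 < d.2].
  by move=> dL; apply/fP/vL.
pose X := [seq (f d).1 | d <- undup L].
have fX : free X.
  apply: (free_unscale (f := fun d => (f d).2%:R *: (f d).1)) => //.
  rewrite (_ : [seq _ | _ <- _] = [seq d.1 | d <- undup L]) //.
  by apply/eq_in_map => d; rewrite mem_undup => /vf[_ _ -> _]; rewrite scaler_nat.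
have [Z [ZP fXZ sXZ]] := free_extend Phip fX.
have uX := free_uniq fX.
have XP a : a \in X -> a \in Phip by case/mapP=> d; rewrite mem_undup => /vf[h _ _ _] ->.
(* The block of [L] that lies over [a]; an added root falls outside the list and gets the default
   block [(a, 1)]. *)
pose dd a := nth (a, 1) (undup L) (index a X).
have ddX a : a \in X -> dd a \in L /\ (f (dd a)).1 = a.
  move=> aX; have iX : (index a X < size (undup L))%N.
    by rewrite -(size_map (fun d => (f d).1)) index_mem.
  rewrite -mem_undup mem_nth //; split=> //.
  by rewrite -[RHS](nth_index 0 aX) (nth_map (a, 1)).
have ddN a : a \notin X -> dd a = (a, 1).
  by move=> aX; rewrite /dd memNindex // nth_default // size_map.
pose n a := if a \in X then (f (dd a)).2 else 1%N.
have psXZ : perm_eq [fset x in X ++ Z]%fset (X ++ Z).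
  apply: uniq_perm => [||x]; [exact: fset_uniq|exact: free_uniq|].
  exact: mem_fset_seq.
exists [fset x in X ++ Z]%fset, dd, n, [seq (f d).1 | d <- L]; split.
- split; first by apply/fsubsetP => a; rewrite mem_fset_seq mem_cat => /orP[/XP|/ZP].
  rewrite (perm_basis _ psXZ) /basis_of fXZ andbT sXZ span_cat.
  by rewrite eqEsubv subvf /= -(posroots_span rootsP baseP) addvSr.
- move=> a; rewrite /n; case: ifP => // /ddX[dL _].
  by have [] := vf _ dL.
- split=> a _; have [aX|aX] := boolP (a \in X).
  + have [dL fa] := ddX _ aX; have [_ _ -> _] := vf _ dL.
    by rewrite /n aX fa.
  + by rewrite ddN // /n (negbTE aX).
  + by have [dL _] := ddX _ aX; have [] := vf _ dL.
  + by rewrite ddN //= ltr01.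
- move=> _ /mapP[d dL ->]; rewrite mem_fset_seq mem_cat; apply/orP; left.
  by apply: map_f; rewrite mem_undup.
rewrite -map_comp -[LHS]map_id; apply/eq_in_map => d dL /=.
have dU : d \in undup L by rewrite mem_undup.
have iU : (index d (undup L) < size (undup L))%N by rewrite index_mem.
have E : (f d).1 = nth 0 X (index d (undup L)) by rewrite (nth_map d) // nth_index.
by rewrite /dd {2}E index_uniq ?size_map // nth_index.
Qed.

Lemma good_free L mu : valids root_block L -> free [seq d.1 | d <- undup L] ->
  integral_weight Phi cor mu -> zonotope L mu -> good (block_pair mu L).
Proof.
move=> vL fL mi; have [s [dd [n [B [[sP sb] n0 [ddE dd0] BS ->]]]]] := blocks_basis vL fL => mz.
have [cl|ncl] := pselect (cone s lambda); last first.
  exact: (good_outside_cone rootsP baseP chamberP chamber_lambda sP sb n0 ddE dd0 BS mi lambda_int mz).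
have [/hasP[a aS /eqP ma]|/hasPn H] := boolP (has (fun a => mult B a == 0%N) s).
  exact: (good_missing rootsP baseP chamberP chamber_lambda sP sb n0 ddE dd0 BS mi lambda_int mz cl aS ma).
apply: (good_all_poles rootsP baseP chamberP chamber_lambda sP sb n0 ddE dd0 BS mi lambda_int mz cl).
by move=> a /H; rewrite lt0n.
Qed.

Lemma block_pair_perm mu L L' : perm_eq L L' -> block_pair mu L = block_pair mu L'.
Proof.
move=> p; rewrite /block_pair /high -(perm_all _ p); congr (_%:C, _).
  by case: ifP => // hL; apply: (tseries_perm (heightD Delta) (heightZ Delta)).
by apply/funext => z; rewrite /block_fun (perm_big _ p).
Qed.

(** The relation is exact for the formal coefficients. For the functions it holds wherever
    [1 - u e^gamma] is nonzero, hence at the regular points near any point, so the combination has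
    all residues 0. *)
Lemma block_pair_relation mu d L : root_block d -> valids root_block L ->
  good (block_pair mu (d :: L) - d.2%:C *: block_pair (mu + d.1) (d :: L) - block_pair mu L).
Proof.
move=> dv vL; have hL : high ht L by apply/allP => x /vL; apply: root_block_high rootsP baseP _.
have hdL : high ht (d :: L) by rewrite /high /= (root_block_high rootsP baseP dv).
set x := _ - _; have -> : x = (0, x.2).
  rewrite [LHS]surjective_pairing; congr (_, _).
  have -> : x.1 = (tseries ht (d :: L) (lambda - mu))%:C -
      d.2%:C * (tseries ht (d :: L) (lambda - (mu + d.1)))%:C - (tseries ht L (lambda - mu))%:C.
    by rewrite /x /block_pair hL hdL.
  rewrite -rmorphM -!rmorphB /= opprD addrA.
  by rewrite (tseries_step (heightD Delta) (heightZ Delta) _ hdL) subrr.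
apply: (good_null (posroots0 Delta rootsP) (chiD rootsP baseP chamberP chamber_lambda)
  (chi_derivation rootsP baseP chamberP chamber_lambda)) => p.
have [a [n [aP n0 dE _]]] := dv.
pose X := d.2%:C * cexp (evalC d.1 p).
have := near_regular_root aP (factor_neq0_near X n0); apply: near_regularW => z Hz.
change (block_fun mu (d :: L) (p - z) - d.2%:C * block_fun (mu + d.1) (d :: L) (p - z) -
  block_fun mu L (p - z) = 0).
have {Hz} : 1 - d.2%:C * cexp (evalC d.1 (p - z)) != 0.
  rewrite evalCDr evalCNr cexpD mulrA -/X dE -[a *+ n]scaler_nat [evalC (_ *: a) z]evalCZl.
  by rewrite rmorph_nat.
rewrite /block_fun !big_cons; have -> : cexp (evalC (mu + d.1 - lambda) (p - z)) =
    cexp (evalC d.1 (p - z)) * cexp (evalC (mu - lambda) (p - z)).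
  by rewrite -cexpD -evalCDl addrA [d.1 + mu]addrC.
exact: geometric_relation.
Qed.

Lemma blocks_dependent D : valids root_block D -> uniq D -> ~~ free [seq d.1 | d <- D] ->
  exists2 c : block -> int, has (fun d => c d != 0) D & \sum_(d <- D) (c d)%:~R *: d.1 = 0.
Proof.
move=> vD uD; apply: (integer_relation (coroot_matrix_unit rootsP baseP) uD) => d dD.
have [a [n [aP n0 -> _]]] := vD d dD; apply: int_mx => i j; rewrite ord1 mul_coroot_matrix.
rewrite -[a *+ n]scaler_nat pairingZl rpredM ?rpred_nat //.
apply: (roots_int rootsP); last by apply: posroots_sub aP.
by apply: (base_root baseP); rewrite mem_nth // -[X in (_ < X)%N]/(size Delta) (size_base baseP).
Qed.

Lemma good_blocks L mu : valids root_block L -> integral_weight Phi cor mu -> zonotope L mu ->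
  good (block_pair mu L).
Proof.
move=> vL mi mz; have P0 := posroots0 Delta rootsP; have cD := chiD rootsP baseP chamberP chamber_lambda.
have cd := chi_derivation rootsP baseP chamberP chamber_lambda.
have dint d v : root_block d -> coroot_lattice Phi cor v -> pairing d.1 v \is a Num.int.
  move=> [a [n [aP _ -> _]]] vQ; rewrite -[a *+ n]scaler_nat pairingZl rpredM ?rpred_nat //.
  exact: (pairing_coroot_int rootsP (posroots_sub aP) vQ).
apply: (@all_good R r _ good _ _ _ block_pair root_block (integral_weight Phi cor)) vL mu mi mz.
- by apply: (good_null P0 cD cd Phi cor (F := fun=> 0)) => p; exists 1.
- exact: goodD.
- exact: goodZ.
- exact: block_pair_perm.
- exact: block_pair_relation.
- by move=> d [a [n []]].
- by move=> nu d dv ni v vQ; rewrite pairingDl rpredD ?dint //; apply: ni.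
- by move=> nu d dv ni v vQ; rewrite pairingDl pairingNl rpredD ?rpredN ?dint //; apply: ni.
- move=> m d m0 [a [n [aP n0 dE d2]]]; exists a, (n * m)%N; split=> //=.
  + by rewrite muln_gt0 n0.
  + by rewrite dE mulrnA.
  + by rewrite exprn_gt0.
- by move=> M vM fM nu ni nz; apply: good_free.
- exact: blocks_dependent.
Qed.

End BlockReduction.

(** * Orders of the zeros and poles of eta *)

Section Parity.
Variables (R : realType) (r : nat) (Phi Delta : {fset 'rV[R]_r}) (cor : 'rV[R]_r -> 'cV[R]_r).
Hypotheses (rootsP : irreducible_root_system Phi cor) (baseP : root_base Phi Delta).
Local Notation Phip := (posroots Phi Delta).

Lemma posroots_perm : perm_eq Phi ((Phip : seq _) ++ [seq - a | a <- Phip]).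
Proof.
have inP a : a \in Phip <-> a \in Phi /\ Qplus Delta a by apply: posrootsP.
apply: uniq_perm => [||a]; first exact: fset_uniq.
  rewrite cat_uniq fset_uniq (map_inj_uniq oppr_inj) fset_uniq andbT /=.
  apply/hasPn => _ /mapP[a /inP[aP Qa] ->]; apply/negP => /inP[_ Qa'].
  by have := root_neq0 rootsP aP; rewrite (Qplus_opp baseP Qa Qa') eqxx.
rewrite mem_cat; apply/idP/orP => [aP|[/inP[]//|/mapP[b /inP[bP _] ->]]]; last exact: rootN rootsP _ bP.
case: (base_sign baseP aP) => Qa; [left; exact/inP|right].
apply/mapP; exists (- a); last by rewrite opprK.
by apply/inP; split=> //; apply: rootN rootsP _ aP.
Qed.

(** Residual points are defined by counting over all roots, whereas [eta_fun] runs over the positive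
    ones; the negative root accounts for the second pole factor, and for the second order of the
    zero. *)
Lemma card_roots (f : pred 'rV[R]_r) :
  #|` [fset a in Phi | f a]%fset| = (\sum_(a <- Phip) (f a + f (- a)))%N.
Proof.
have -> : #|` [fset a in Phi | f a]%fset| = count f Phi.
  rewrite -size_filter; apply: perm_size; apply: uniq_perm => [||a]; first exact: fset_uniq.
    by rewrite filter_uniq ?fset_uniq.
  by rewrite mem_filter !inE /= andbC.
rewrite (seq.permP posroots_perm) count_cat count_map -!sum1_count big_split /=.
by congr (_ + _)%N; rewrite big_mkcond; apply: eq_bigr => a _; case: (f _).
Qed.

End Parity.

Section EtaLocal.
Variable R : realType.
Local Notation C := R[i].
Implicit Types (a b : nat -> C).

Lemma cauchy_low o a b k : (forall j, (j < o)%N -> a j = 0) -> (k < o)%N -> cauchy a b k = 0.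
Proof.
move=> a0 ko; apply: big1 => j _; rewrite a0 ?mul0r //.
by apply: leq_ltn_trans ko; rewrite -ltnS.
Qed.

Lemma cauchy_square_low a k : a 0%N = 0 -> (k < 2)%N -> cauchy a a k = 0.
Proof.
move=> a0; case: k => [|[|//]] _; first by rewrite /cauchy big_ord1 a0 mul0r.
by rewrite /cauchy big_ord_recl big_ord1 /= a0 mul0r mulr0 addr0.
Qed.

Definition eta_local (u nu x y : C) : C := cexp (nu * y) *
  ((1 - x * cexp (- y)) ^+ 2 / ((1 - u^-1 * (x * cexp (- y))) * (1 - u * (x * cexp (- y))))).

(** The factor of one root near a point where its exponential is [x]: simple poles at [u x = 1] and
    [u^-1 x = 1], cleared by the power of [y], and a double zero at [x = 1]. *)
Lemma eta_local_series (u nu x : C) : exists gc : (C -> C) * (nat -> C),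
  [/\ has_series gc.1 gc.2,
    forall y, y != 0 -> eta_local u nu x y * y ^+ ((u^-1 * x == 1)%R + (u * x == 1)%R)%N = gc.1 y &
    x = 1 -> forall k, (k < 2)%N -> gc.2 k = 0].
Proof.
have [[g1 c1] [/= H1 E1 _]] := local_factor_series 1 0 (u^-1 * x) (ltn0Sn 0).
have [[g2 c2] [/= H2 E2 _]] := local_factor_series 1 0 (u * x) (ltn0Sn 0).
have H0 := has_seriesB1 (has_seriesZ x (has_series_exp (-1 : C))).
have H := has_seriesM (has_seriesM H0 H0) (has_seriesM H1 (has_seriesM H2 (has_series_exp nu))).
eexists (_, _); split; [exact: H| |].
  move=> y y0 /=; have := E1 y y0; have := E2 y y0; rewrite /local_factor !mul0r cexp0 !mul1r !expr1.
  rewrite /eta_local mulN1r -!mulrA => e2 e1; rewrite exprD invfM.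
  have [k1 k1E] : exists k, k = (u^-1 * x == 1) :> nat by eexists.
  have [k2 k2E] : exists k, k = (u * x == 1) :> nat by eexists.
  have ifE (t : bool) : (if t then 1%N else 0%N) = t by case: t.
  move: e1 e2; rewrite !ifE -k1E -k2E => -> ->.
  have y1 : y ^+ k1 != 0 by rewrite expf_neq0.
  have y2 : y ^+ k2 != 0 by rewrite expf_neq0.
  move: (cexp (nu * y)) (1 - x * cexp (- y)) (g1 y) (g2 y) (y ^+ k1) (y ^+ k2) y1 y2 => A B a b c d c0 d0.
  by field; rewrite c0 d0.
move=> x1 k k2; apply: cauchy_low k2 => j j2; apply: cauchy_square_low j2.
by rewrite /exp_seq expr0 fact0 divr1 x1 mulr1 eqxx subrr.
Qed.

End EtaLocal.

Lemma eta_partial_fractions (F : numFieldType) (u x : F) : u != 0 -> u + 1 != 0 ->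
  1 - u^-1 * x != 0 -> 1 - u * x != 0 ->
  (1 - x) ^+ 2 / ((1 - u^-1 * x) * (1 - u * x)) =
  1 - (u - 1) / (u + 1) * (1 - u^-1 * x)^-1 + (u - 1) / (u + 1) * (1 - u * x)^-1.
Proof.
move=> u0 u1 x1 x2.
have x1' : u - x != 0 by apply: contraNneq x1 => /eqP; rewrite subr_eq0 => /eqP <-; rewrite mulVf // subrr.
by field; rewrite u0 u1 x2 x1'.
Qed.

Lemma sum_pairs (K : comNzRingType) (T I : Type) (cs : seq I) (k : I -> K) (x : I -> (K^o * (T -> K^o))%type) :
  \sum_(c <- cs) k c *: x c = (\sum_(c <- cs) k c * (x c).1, fun p => \sum_(c <- cs) k c * (x c).2 p).
Proof.
elim: cs => [|c cs IH].
  by rewrite !big_nil; congr (_, _); apply/funext => p; rewrite big_nil.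
rewrite !big_cons IH; congr (_, _); apply/funext => p.
by rewrite big_cons.
Qed.

Section EtaExpansion.
Variables (R : realType) (r : nat) (q : R).
Local Notation C := R[i].
Local Notation block := ('rV[R]_r * R)%type.

Lemma eta_blocks_prod (s : seq 'rV[R]_r) (f : block -> C) :
  \sum_(c <- eta_blocks q s) c.1%:C * \prod_(d <- c.2) f d =
  \prod_(a <- s) (1 - (eta_coef q)%:C * f (a, q^-1) + (eta_coef q)%:C * f (a, q)).
Proof.
elim: s => [|a s IH]; first by rewrite /= big_seq1 !big_nil mulr1.
rewrite big_cons -IH /= !big_cat !big_map /= !mulrDl mul1r addrA !mulr_sumr; congr (_ + _ + _).
  apply: eq_bigr => c _; rewrite big_cons rmorphM rmorphN /=; ring.
by apply: eq_bigr => c _; rewrite big_cons rmorphM /=; ring.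
Qed.

Lemma zonotope0 (L : seq block) : zonotope L 0.
Proof.
apply/zonotopeP; exists [seq (0, d) | d <- L]; split.
- by rewrite -map_comp map_id.
- by apply/allP => _ /mapP[d _ ->]; rewrite lexx ler01.
by rewrite /zsum big_map big1 // => d _; rewrite scale0r.
Qed.

End EtaExpansion.

Section Residues.
Variables (R : realType) (r : nat) (Phi Delta : {fset 'rV[R]_r}) (cor : 'rV[R]_r -> 'cV[R]_r) (q : R).
Hypotheses (rootsP : irreducible_root_system Phi cor) (baseP : root_base Phi Delta).
Hypothesis q_gt1 : 1 < q.
Variables (chamber : set 'rV[R]_r) (lambda : 'rV[R]_r).
Hypotheses (chamberP : big_chamber (posroots Phi Delta) chamber) (chamber_lambda : chamber lambda).
Hypothesis lambda_Q : Qplus Delta lambda.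
Local Notation C := R[i].
Local Notation Phip := (posroots Phi Delta).
Local Notation ht := (height Delta).
Local Notation chi_c := (chi Phip (vol_box Delta cor) chamber).
Local Notation good := (good Phip chi_c Phi cor).

Definition integrand (p : 'cV[C]_r) : C := cexp (- evalC lambda p) * eta_fun Phip q p.

Let P0 := posroots0 Delta rootsP.
Let cD := chiD rootsP baseP chamberP chamber_lambda.
Let cd := chi_derivation rootsP baseP chamberP chamber_lambda.

Lemma lambda_integral : integral_weight Phi cor lambda.
Proof. by move=> v; apply: (pairing_coroot_Qplus_int rootsP baseP lambda_Q). Qed.

Lemma integrand_periodic : periodic Phi cor integrand.
Proof.
move=> v p vQ; rewrite /integrand -!evalCNl cexp_period; last first.
  by rewrite pairingNl rpredN; apply: lambda_integral.
congr (_ * _); rewrite /eta_fun big_seq [RHS]big_seq; apply: eq_bigr => a aP.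
by rewrite cexp_period // (pairing_coroot_int rootsP (posroots_sub aP) vQ).
Qed.

Lemma q_neq0 : q != 0. Proof. by rewrite gt_eqF // (lt_trans ltr01). Qed.

(** The same partial fractions as for the formal series, now for functions. They hold where no
    denominator vanishes, which is the case at the regular points near [p]. *)
Lemma integrand_blocks p : near_regular Phip (fun z => integrand (p - z) =
  \sum_(c <- eta_blocks q Phip) c.1%:C * block_fun lambda 0 c.2 (p - z)).
Proof.
have H (a : 'rV[R]_r) u : a \in Phip -> near_regular Phip (fun z => 1 - u%:C * cexp (evalC a (p - z)) != 0).
  move=> aP; have := near_regular_root aP (factor_neq0_near (u%:C * cexp (evalC a p)) (ltn0Sn 0)).
  by apply: near_regularW => z; rewrite mul1r evalCDr evalCNr cexpD mulrA.
have {}H : near_regular Phip (fun z => {in Phip, forall a, 1 - q^-1%:C * cexp (evalC a (p - z)) != 0 /\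
    1 - q%:C * cexp (evalC a (p - z)) != 0}).
  have := @fset_uniq _ Phip; have : {subset (Phip : seq _) <= Phip} by [].
  suff Q (s : seq 'rV[R]_r) : {subset s <= Phip} ->
    near_regular Phip (fun z => forall a, a \in s -> 1 - q^-1%:C * cexp (evalC a (p - z)) != 0 /\
      1 - q%:C * cexp (evalC a (p - z)) != 0) by move=> sP _; apply: Q.
  elim: s => [_|a s IH sP]; first by exists 1.
  have aP : a \in Phip by apply: sP; rewrite mem_head.
  have sP' : {subset s <= Phip} by move=> b bs; apply: sP; rewrite inE bs orbT.
  have := near_regularI (near_regularI (H a q^-1 aP) (H a q aP)) (IH sP').
  by apply: near_regularW => z [[h1 h2] h3] b; rewrite inE => /orP[/eqP ->|/h3].
apply: near_regularW H => z Hz.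
rewrite (eq_bigr (fun c : R * seq ('rV[R]_r * R) => cexp (- evalC lambda (p - z)) *
  (c.1%:C * \prod_(d <- c.2) (1 - d.2%:C * cexp (evalC d.1 (p - z)))^-1))); last first.
  by move=> c _; rewrite /block_fun sub0r evalCNl mulrCA.
rewrite -mulr_sumr (eta_blocks_prod q Phip (fun d => (1 - d.2%:C * cexp (evalC d.1 (p - z)))^-1)) /=.
rewrite /integrand /eta_fun; congr (_ * _); rewrite big_seq [RHS]big_seq; apply: eq_bigr => a aP.
have [h1 h2] := Hz a aP; have qV : q^-1%:C = q%:C^-1 :> C by rewrite fmorphV.
have q0 : q%:C != 0 :> C by rewrite -(rmorph0 (real_complex R)) (inj_eq (@complexI R)) q_neq0.
have q1 : q%:C + 1 != 0 :> C.
  rewrite -(rmorph1 (real_complex R)) -rmorphD -(rmorph0 (real_complex R)) (inj_eq (@complexI R)).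
  by rewrite gt_eqF // addr_gt0 // (lt_trans ltr01).
have cE : (eta_coef q)%:C = (q%:C - 1) / (q%:C + 1) :> C.
  by rewrite /eta_coef rmorphM fmorphV rmorphB rmorphD rmorph1.
by rewrite cE qV; apply: eta_partial_fractions; rewrite -?qV.
Qed.

(** All terms of the expansion start from [mu = 0], which lies in every zonotope, so [good_blocks]
    applies to each of them; the difference between the integrand and the sum of the terms vanishes
    at regular points. *)
Lemma good_integrand : good ((rplus_eta Phip q lambda)%:C, integrand).
Proof.
have vB c : c \in eta_blocks q Phip -> valids (root_block Phi Delta) c.2.
  move=> cB d /(eta_blocks_mem cB)[dP dq]; exists d.1, 1%N; split=> //.
  have q0 : 0 < q by apply: lt_trans ltr01 _.
  by case: dq => ->; rewrite ?invr_gt0.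
have z_int : integral_weight Phi cor 0 by move=> v _; rewrite pairing0l rpred0.
have gB c : c \in eta_blocks q Phip -> good (block_pair Delta lambda 0 c.2).
  by move=> cB; apply: (good_blocks rootsP baseP chamberP chamber_lambda lambda_integral (vB c cB) z_int); apply: zonotope0.
pose G p := \sum_(c <- eta_blocks q Phip) c.1%:C * block_fun lambda 0 c.2 p.
have gG : good ((rplus_eta Phip q lambda)%:C, G).
  have -> : ((rplus_eta Phip q lambda)%:C, G) =
      \sum_(c <- eta_blocks q Phip) c.1%:C *: block_pair Delta lambda 0 c.2.
    rewrite sum_pairs; congr (_, _).
    have hP : all (fun a => 1 <= ht a) Phip.
      by apply/allP => a; apply: (posroot_height rootsP baseP).
    rewrite /rplus_eta (rplus_eta_blocks (heightD Delta) (heightZ Delta) q_gt1 hP) rmorph_sum /=.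
    rewrite big_seq [RHS]big_seq; apply: eq_bigr => c cB; rewrite rmorphM /= subr0 ifT //.
    by apply/allP => d /(vB c cB); apply: (root_block_high rootsP baseP).
  rewrite big_seq; apply: (big_ind good).
  - by apply: (good_null P0 cD cd Phi cor (F := fun=> 0)) => p; exists 1.
  - by move=> x y; apply: goodD.
  - by move=> c cB; apply: (goodZ P0 cD cd); apply: gB.
have gD : good (0, fun p => integrand p - G p).
  apply: (good_null P0 cD cd) => p; apply: near_regularW (integrand_blocks p) => z ->.
  by rewrite subrr.
have := goodD P0 cD cd gG gD; congr good.
congr (_, _); first by rewrite addr0.
by apply/funext => p; rewrite /= addrC subrK.
Qed.

Lemma torus_point_exp p : torus_point Phi cor (tpoint p).
Proof.
by split=> [mu _|mu mu' _ _]; [apply: cexp_neq0|rewrite /tpoint evalCDl cexpD].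
Qed.

(** The total residue involves only the part of degree (poles minus [r]) of the cleared numerator.
    At a point that is not residual this degree is smaller than the total order of the zeros, so
    that part is 0. *)
Lemma residue_nonresidual p : ~ residual Phi cor q (tpoint p) ->
  has_residue Phip chi_c (fun z => integrand (p - z)) 0.
Proof.
move=> nres.
(* Writing [lambda] as a combination of positive roots distributes its exponential over the factors
   of eta, which makes the integrand a product of one-variable functions. *)
have lS : lambda \in <<Phip>>%VS by rewrite (posroots_span rootsP baseP) memvf.
have [l lE] := span_coords (fset_uniq _) lS.
pose X a := cexp (evalC a p).
have /choice[gc gcP] a := eta_local_series q%:C (l a)%:C (X a).
pose k a := ((q%:C^-1 * X a == 1)%R + (q%:C * X a == 1)%R)%N.
pose o a := if X a == 1 then 2%N else 0%N.
have q0 : q%:C != 0 :> C by rewrite -(rmorph0 (real_complex R)) (inj_eq (@complexI R)) q_neq0.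
pose F z := \prod_(a <- Phip) eta_local q%:C (l a)%:C (X a) (evalC a z).
suff H : has_residue Phip chi_c F 0.
  have := has_residueZ cD cd (cexp (- evalC lambda p)) H; rewrite mulr0.
  apply: has_residue_ext; exists 1 => // z _ _; rewrite /integrand evalCDr evalCNr opprB addrC cexpD.
  rewrite -mulrA; congr (_ * _); rewrite lE evalC_suml cexp_sum /eta_fun -big_split /F.
  apply: eq_bigr => a _; rewrite /eta_local /X /= evalCDr evalCNr cexpD.
  by rewrite fmorphV.
have cnt : (\sum_(a <- Phip) k a < r + \sum_(a <- Phip) o a)%N.
  have X0 a : X a != 0 by apply: cexp_neq0.
  have XN a : cexp (evalC (- a) p) = (X a)^-1 by rewrite evalCNl cexpN.
  have kE : (\sum_(a <- Phip) k a)%N = #|` [fset a in Phi | tpoint p a == q%:C]%fset|.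
    rewrite (card_roots rootsP baseP); apply: eq_bigr => a _; rewrite /k /tpoint XN -/(X a).
    congr ((_ : bool) + (_ : bool))%N; first by rewrite -(inj_eq (mulfI q0)) mulrA mulfV // mul1r mulr1.
    by rewrite -[RHS](inj_eq (mulIf (X0 a))) mulVf // eq_sym.
  have oE : (\sum_(a <- Phip) o a)%N = #|` [fset a in Phi | tpoint p a == 1%:C]%fset|.
    rewrite (card_roots rootsP baseP); apply: eq_bigr => a _; rewrite /o /tpoint XN -/(X a).
    by rewrite invr_eq1; case: (X a == 1).
  rewrite kE oE ltnNge; apply/negP => le; apply: nres; split; first exact: torus_point_exp.
  by rewrite lerBrDr -PoszD lez_nat.
exists (prod_poly id (fun a => (gc a).2) Phip), (poles k Phip), 0; split.
- apply: (germ_prod (f := fun a => (gc a).1)) => //.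
  + by move=> a _; have [] := gcP a.
  + exact: poles_sub.
  move=> z zP; rewrite prod_poles -big_split /= big_seq [RHS]big_seq; apply: eq_bigr => a aP.
  by have [_ H _] := gcP a; apply: H; apply: zP.
- exact: SH0.
- rewrite subr0 /germ_residue size_poles; case: leqP => rk; last first.
    by rewrite /ratfrac rmorph0 mul0r; apply: dRH0.
  rewrite (@prod_poly_low _ _ _ P0 _ id _ o); first by rewrite /ratfrac rmorph0 mul0r; apply: dRH0.
    move=> a j aP; rewrite /o; case: eqP => // x1 j2.
    by have [_ _ H] := gcP a; apply: H.
  by rewrite ltn_subLR.
by apply: cd; [exact: SH0|exact: dRH0].
Qed.

(** The finite set provided by [good] and the set of residual classes are compared on their union:
    outside the first the residues vanish by goodness, outside the second by
    [residue_nonresidual]. *)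
Lemma residue_sum : (rplus_eta Phip q lambda)%:C =
  \sum_(K \in residual_classes Phi cor q) class_residue Phip chi_c integrand K.
Proof.
have [_ [S [_ SA S0 /= ->]]] := good_integrand.
have AR : (residual_classes Phi cor q `<=` all_classes Phi cor)%classic.
  by move=> K [p _ ->]; exists p.
rewrite (fsbig_widen S (S `|` residual_classes Phi cor q)%classic); last 2 first.
- by move=> K; left.
- by move=> K [[//|rK] nSK]; apply: S0 (AR _ rK) nSK.
rewrite [RHS](fsbig_widen _ (S `|` residual_classes Phi cor q)%classic) //.
move=> K [[SK|//] nK]; have [p KE] := SA K SK; rewrite KE.
apply: (class_residue_periodic rootsP baseP P0 cD cd integrand_periodic).
by apply: residue_nonresidual => res; apply: nK; exists p.
Qed.

End Residues.

Theorem theorem3p1 (R : realType) (r : nat)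
    (Phi Delta : {fset 'rV[R]_r}) (cor : 'rV[R]_r -> 'cV[R]_r) (q : R)
    (c : set 'rV[R]_r) (lambda : 'rV[R]_r) :
  irreducible_root_system Phi cor ->
  root_base Phi Delta ->
  1 < q ->
  big_chamber (posroots Phi Delta) c ->
  c lambda -> Qplus Delta lambda ->
  (rplus_eta (posroots Phi Delta) q lambda)%:C =
  \sum_(K \in residual_classes Phi cor q)
    let p := xget 0 K in
    chi (posroots Phi Delta) (vol_box Delta cor) c
      (Tres_germ (posroots Phi Delta)
         (fun z => cexp (- evalC lambda (p - z)) *
                   eta_fun (posroots Phi Delta) q (p - z))).
Proof.
move=> rootsP baseP q_gt1 chamberP c_lambda lambda_Q.
exact: (residue_sum rootsP baseP q_gt1 chamberP c_lambda lambda_Q).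
Qed.
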